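(* Let $(u,v,P)$ solve the linearized system (with right-hand sides $f,g$ and boundary conditions) given in the context. Then for $\delta\in[0,1]$, $$\|v\|_B^2+\int_{\omega=\theta_0}\varepsilon u_\omega^2r^{\delta-1}\,dR\lesssim\|u\|_A^2+(\theta_0+\sqrt\varepsilon)\|v\|_B^2+(1-\delta)^2\|P\|_{L^2_{*,\delta}}^2+\|f\|_{L^2_{*,2+\delta}}^2+\varepsilon\|g\|_{L^2_{*,2+\delta}}^2,$$ with an implicit constant independent of $\varepsilon$, of small $\theta_0$, and of $(u,v,P,f,g)$.
   Context: Geometry. $R_0>0$, $\theta_0>0$ small, $0<\varepsilon\le1$ small relative to $\theta_0$, $\Omega=(0,\theta_0)\times(R_0,\infty)\ni(\omega,R)$; $r=r(R)=R_0+\sqrt\varepsilon(R-R_0)$; $\iint=\int_0^{\theta_0}\int_{R_0}^\infty\cdot\,dR\,d\omega$. Functions with subscript $e$ are functions of $(\omega,r)$, all others of $(\omega,R)$. Norms. $\|h\|_{L^2_{*,\kappa}}^2=\iint h^2r^\kappa$; $\|u\|_A^2=\iint(u_R^2r^{1+\delta}+\varepsilon u_\omega^2r^{-1+\delta}+\varepsilon u^2r^{-1+\delta})$; $\|v\|_B^2=\iint(r^\delta|\partial_R(rv)|^2+\varepsilon v_\omega^2r^\delta+\varepsilon v^2r^\delta)$. Linearized system: $\frac1ru_su_\omega+\frac1ru_{s\omega}u+u_{sR}v+v_su_R+\frac{\sqrt\varepsilon}rv_su+\frac{\sqrt\varepsilon}ru_sv+\frac1rP_\omega-u_{RR}-\frac{\sqrt\varepsilon}ru_R-\frac\varepsilon{r^2}u_{\omega\omega}+\frac\varepsilon{r^2}u-\frac{2\varepsilon^{3/2}}{r^2}v_\omega=f$,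 $\frac1ru_sv_\omega+\frac1rv_{s\omega}u+v_sv_R+v_{sR}v-\frac2r\frac1{\sqrt\varepsilon}u_su+\frac1\varepsilon P_R-v_{RR}-\frac{\sqrt\varepsilon}rv_R-\frac\varepsilon{r^2}v_{\omega\omega}+\frac{2\sqrt\varepsilon}{r^2}u_\omega+\frac\varepsilon{r^2}v=g$, $\frac1ru_\omega+\frac{\sqrt\varepsilon}rv+v_R=0$ (i.e. $u_\omega+\partial_R(rv)=0$), with $u=v=0$ on $\{\omega=0\}$ and $\{R=R_0\}$, and $\varepsilon v_\omega+ru_R=0$, $Pr=2\varepsilon u_\omega$ on $\{\omega=\theta_0\}$. Solutions are regular and decay as $R\to\infty$ so that the norms involved make sense. Profiles. $u_s=u_e^0+u_p^0+\sqrt\varepsilon u_e^1$, $v_s=v_p^0+v_e^1$, constructed from the following data. $u_b>0$ constant; $u_e^0=u_e^0(r)$ smooth, bounded below by a positive constant, with $\partial_r^ku_e^0$ ($k\ge1$) exponentially decaying; $u_e:=u_e^0(R_0)$; $\bar u_0(R),u_b^1(r),V_{b0}(r),V_{b1}(r)$ smooth with exponential decay (with derivatives); $\min\{u_b,\inf_R(u_e+\bar u_0)\}>0$; $|V_{b0}-V_{b1}|+|\partial_r(V_{b0}-V_{b1})|\lesssim\theta_0$; $V_{b0}(R_0)=-v_p^0(0,R_0)$, $V_{b1}(R_0)=-v_p^0(\theta_0,R_0)$. Prandtl-0: $(u_e+u_p^0)u^0_{p\omega}+(rv_p^0-R_0v_p^0(\omega,R_0))u^0_{pR}=R_0u^0_{pRR}$,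 $rv_p^0=\int_R^\infty u^0_{p\omega}$, $u_p^0(\omega,R_0)=u_b-u_e$, $u_p^0(0,R)=\bar u_0(R)$, $u_p^0\to0$ as $R\to\infty$. Euler-1: $Lv=-r\Delta v+(\frac{ru^0_{err}}{u_e^0}+\frac{u^0_{er}}{u_e^0})v-2v_r-\frac2rv$, $\Delta=\partial_r^2+\frac1r\partial_r+\frac1{r^2}\partial_\omega^2$; $\mathcal B=(1-\frac\omega{\theta_0})\frac{v_p^0(\omega,R_0)}{v_p^0(0,R_0)}V_{b0}(r)+\frac\omega{\theta_0}\frac{v_p^0(\omega,R_0)}{v_p^0(\theta_0,R_0)}V_{b1}(r)$; $F=L\mathcal B$; $E_b=\chi_0(\frac\omega\varepsilon)F(0,r)+\chi_0(\frac{\theta_0-\omega}\varepsilon)F(\theta_0,r)$, $\chi_0$ a smooth cutoff supported in $[0,1]$, equal to $1$ near $0$. $Lv_e^1=E_b$, $v_e^1(\omega,R_0)=-v_p^0(\omega,R_0)$, $v_e^1(0,r)=V_{b0}$, $v_e^1(\theta_0,r)=V_{b1}$, $v_e^1\to0$ as $r\to\infty$; $u_e^1=u_b^1(r)-\int_0^\omega\partial_r(rv_e^1)d\omega'$. *)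

(* Defs.v *)
From HB Require Import structures.
From mathcomp Require Import all_boot all_order all_algebra.
From mathcomp Require Import all_classical all_reals all_analysis.
Import Order.TTheory GRing.Theory Num.Theory.
Import numFieldNormedType.Exports.

Set Implicit Arguments.
Unset Strict Implicit.
Unset Printing Implicit Defensive.

Local Open Scope classical_set_scope.
Local Open Scope ring_scope.

(** Conventions.  The angle is written [w], the stretched radius [y] (so that
    [y > R0]) and the unstretched radius [r = R0 + sqrt eps * (y - R0)].
    A function "regular up to the boundary" of a half-line or of a half-strip is
    represented by a regular extension to the whole line or plane; equations,
    norms and decay only refer to the half-line or half-strip itself, unless
    said otherwise. *)

Section Calculus.
Context {R : realType}.
Implicit Types (f : R -> R -> R) (h : R -> R).

Definition dw f (w y : R) : R := derive1 (fun t => f t y) w.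
Definition dy f (w y : R) : R := derive1 (fun t => f w t) y.

Fixpoint Ck (k : nat) f : Prop :=
  continuous (fun z : R * R => f z.1 z.2) /\
  if k is k'.+1 then
    [/\ forall w y, derivable (fun t => f t y) w 1,
        forall w y, derivable (fun t => f w t) y 1,
        Ck k' (dw f) & Ck k' (dy f)]
  else True.

Definition smooth2 f : Prop := forall k, Ck k f.

Definition smooth1 h : Prop := forall (k : nat) (x : R), derivable (derive1n k h) x 1.

Definition exp_decay (a : R) h : Prop :=
  exists M c : R, 0 < c /\ forall x, a <= x -> `|h x| <= M * expR (- (c * x)).

Definition smooth_exp_decay (a : R) h : Prop :=
  smooth1 h /\ forall k : nat, exp_decay a (derive1n k h).

Definition vanishes_at_infty (theta0 : R) f : Prop :=
  forall e : R, 0 < e -> exists M : R,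
    forall w y, 0 <= w <= theta0 -> M <= y -> `|f w y| < e.

End Calculus.

Section Profiles.
Context {R : realType}.

Record profile_data := ProfileData {
  R0 : R;
  u_b : R;
  u_e0 : R -> R;
  ubar0 : R -> R;
  u_b1 : R -> R;
  V_b0 : R -> R;
  V_b1 : R -> R -> R; (* [V_b1 theta0]: its value at [R0] depends on [theta0] *)
  chi0 : R -> R
}.

Variable D : profile_data.
Let R0 := R0 D.

Definition rad (eps y : R) : R := R0 + Num.sqrt eps * (y - R0).

Definition u_e : R := u_e0 D R0.

Definition outer_data : Prop :=
  [/\ 0 < R0, 0 < u_b D,
      smooth1 (u_e0 D),
      exists2 c : R, 0 < c & forall r, R0 <= r -> c <= u_e0 D r &
      forall k : nat, (0 < k)%N -> exp_decay R0 (derive1n k (u_e0 D))] /\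
  [/\ smooth_exp_decay R0 (ubar0 D),
      exists2 c : R, 0 < c & forall y, R0 <= y -> c <= u_e + ubar0 D y,
      smooth_exp_decay R0 (u_b1 D) &
      [/\ smooth1 (chi0 D),
          exists2 a : R, 0 < a & forall x, 0 <= x <= a -> chi0 D x = 1 &
          forall x, 1 <= x -> chi0 D x = 0]].

(** [rvp up] is [r v_p^0]; it does not depend on [eps], although [v_p^0] does
    through [r]. *)
Definition rvp (up : R -> R -> R) (w y : R) : R :=
  \int[lebesgue_measure]_(t in `[y, +oo[) dw up w t.

Definition v_p0 (up : R -> R -> R) (eps w y : R) : R := rvp up w y / rad eps y.

(** At [y = R0] one has [r = R0], whatever [eps]. *)
Definition vp_wall (up : R -> R -> R) (w : R) : R := rvp up w R0 / R0.

(** The Prandtl-0 profile on [(0, Theta) * (R0, oo)].  The extension to the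
    plane is taken rapidly decreasing for all [w], not only in [[0, Theta]]:
    the ratios of [v_p^0(w, R0)] entering [euler_B] are differentiated in [w]
    at [w = 0], where the integral defining [rvp] has to be that of a
    neighbourhood of [0]. *)
Definition prandtl0 (Theta : R) (up : R -> R -> R) : Prop :=
  [/\ smooth2 up,
      forall k l m : nat, exists M : R, forall w y, R0 <= y ->
        y ^+ m * `|iter k dw (iter l dy up) w y| <= M,
      forall w y, 0 < w < Theta -> R0 < y ->
        (u_e + up w y) * dw up w y + (rvp up w y - R0 * vp_wall up w) * dy up w y
        = R0 * dy (dy up) w y,
      forall w, 0 <= w <= Theta -> up w R0 = u_b D - u_e &
      forall y, R0 <= y -> up 0 y = ubar0 D y].

(** Lateral data of the Euler-1 problem, with bounds uniform in [theta0].
    [vp_wall up 0 != 0] is what gives sense to [euler_B] for small [theta0]. *)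
Definition lateral_data (Theta : R) (up : R -> R -> R) : Prop :=
  [/\ vp_wall up 0 != 0,
      smooth_exp_decay R0 (V_b0 D),
      V_b0 D R0 = - vp_wall up 0 &
  [/\ forall theta0, 0 < theta0 < Theta ->
        smooth1 (V_b1 D theta0) /\ V_b1 D theta0 R0 = - vp_wall up theta0,
      forall k : nat, exists M c : R, 0 < c /\
        forall theta0 r, 0 < theta0 < Theta -> R0 <= r ->
          `|derive1n k (V_b1 D theta0) r| <= M * expR (- (c * r)) &
      exists M : R, forall theta0 r, 0 < theta0 < Theta -> R0 <= r ->
        `|V_b0 D r - V_b1 D theta0 r|
        + `|derive1 (fun s => V_b0 D s - V_b1 D theta0 s) r| <= M * theta0]].

(** In the Euler part the second variable of a function is [r], so that [dy]
    is [d/dr]. *)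
Definition laplace (v : R -> R -> R) (w r : R) : R :=
  dy (dy v) w r + r^-1 * dy v w r + (r ^+ 2)^-1 * dw (dw v) w r.

Definition euler_L (v : R -> R -> R) (w r : R) : R :=
  - r * laplace v w r
  + (r * derive1n 2 (u_e0 D) r / u_e0 D r + derive1 (u_e0 D) r / u_e0 D r) * v w r
  - 2 * dy v w r - 2 / r * v w r.

Definition euler_B (up : R -> R -> R) (theta0 w r : R) : R :=
  (1 - w / theta0) * (vp_wall up w / vp_wall up 0) * V_b0 D r
  + w / theta0 * (vp_wall up w / vp_wall up theta0) * V_b1 D theta0 r.

Definition euler_F (up : R -> R -> R) (theta0 : R) : R -> R -> R :=
  euler_L (euler_B up theta0).

Definition euler_E (up : R -> R -> R) (theta0 eps w r : R) : R :=
  chi0 D (w / eps) * euler_F up theta0 0 r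
  + chi0 D ((theta0 - w) / eps) * euler_F up theta0 theta0 r.

Definition euler1 (up : R -> R -> R) (theta0 eps : R) (ve : R -> R -> R) : Prop :=
  [/\ Ck 2 ve,
      forall w r, 0 < w < theta0 -> R0 < r ->
        euler_L ve w r = euler_E up theta0 eps w r,
      forall w, 0 <= w <= theta0 -> ve w R0 = - vp_wall up w,
      forall r, R0 <= r -> ve 0 r = V_b0 D r /\ ve theta0 r = V_b1 D theta0 r &
      vanishes_at_infty theta0 ve].

Definition u_e1 (ve : R -> R -> R) (w r : R) : R :=
  u_b1 D r
  - \int[lebesgue_measure]_(t in `[0, w]) dy (fun t' r' => r' * ve t' r') t r.

Definition u_s (up ve : R -> R -> R) (eps w y : R) : R :=
  u_e0 D (rad eps y) + up w y + Num.sqrt eps * u_e1 ve w (rad eps y).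

Definition v_s (up ve : R -> R -> R) (eps w y : R) : R :=
  v_p0 up eps w y + ve w (rad eps y).

Definition momentum_w (us vs : R -> R -> R) (eps : R) (u v P : R -> R -> R)
    (w y : R) : R :=
  let r := rad eps y in let se := Num.sqrt eps in
  r^-1 * us w y * dw u w y + r^-1 * dw us w y * u w y
  + dy us w y * v w y + vs w y * dy u w y
  + se / r * vs w y * u w y + se / r * us w y * v w y
  + r^-1 * dw P w y
  - dy (dy u) w y - se / r * dy u w y - eps / r ^+ 2 * dw (dw u) w y
  + eps / r ^+ 2 * u w y - 2 * (eps * se) / r ^+ 2 * dw v w y.

Definition momentum_r (us vs : R -> R -> R) (eps : R) (u v P : R -> R -> R)
    (w y : R) : R :=
  let r := rad eps y in let se := Num.sqrt eps in
  r^-1 * us w y * dw v w y + r^-1 * dw vs w y * u w y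
  + vs w y * dy v w y + dy vs w y * v w y
  - 2 / r * se^-1 * us w y * u w y
  + eps^-1 * dy P w y
  - dy (dy v) w y - se / r * dy v w y - eps / r ^+ 2 * dw (dw v) w y
  + 2 * se / r ^+ 2 * dw u w y + eps / r ^+ 2 * v w y.

Definition divergence (eps : R) (u v : R -> R -> R) (w y : R) : R :=
  let r := rad eps y in
  r^-1 * dw u w y + Num.sqrt eps / r * v w y + dy v w y.

Definition linearized (us vs : R -> R -> R) (theta0 eps : R)
    (u v P f g : R -> R -> R) : Prop :=
  [/\ [/\ Ck 2 u, Ck 2 v & Ck 1 P],
      [/\ vanishes_at_infty theta0 u, vanishes_at_infty theta0 v &
          vanishes_at_infty theta0 P],
      forall w y, 0 < w < theta0 -> R0 < y ->
        [/\ momentum_w us vs eps u v P w y = f w y,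
            momentum_r us vs eps u v P w y = g w y &
            divergence eps u v w y = 0],
      (forall y, R0 <= y -> u 0 y = 0 /\ v 0 y = 0) /\
      (forall w, 0 <= w <= theta0 -> u w R0 = 0 /\ v w R0 = 0) &
      forall y, R0 <= y ->
        eps * dw v theta0 y + rad eps y * dy u theta0 y = 0 /\
        P theta0 y * rad eps y = 2 * eps * dw u theta0 y].

(** Squared norms, with values in [[0, +oo]]. *)
Definition iint (theta0 : R) (h : R -> R -> R) : \bar R :=
  (\int[lebesgue_measure]_(w in `]0%R, theta0[)
     \int[lebesgue_measure]_(y in `]R0, +oo[) (h w y)%:E)%E.

Definition normL2 (theta0 eps kappa : R) (h : R -> R -> R) : \bar R :=
  iint theta0 (fun w y => h w y ^+ 2 * rad eps y `^ kappa).

Definition normA2 (theta0 eps delta : R) (u : R -> R -> R) : \bar R :=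
  iint theta0 (fun w y =>
    dy u w y ^+ 2 * rad eps y `^ (1 + delta)
    + eps * dw u w y ^+ 2 * rad eps y `^ (- 1 + delta)
    + eps * u w y ^+ 2 * rad eps y `^ (- 1 + delta)).

Definition normB2 (theta0 eps delta : R) (v : R -> R -> R) : \bar R :=
  iint theta0 (fun w y =>
    rad eps y `^ delta * dy (fun w' y' => rad eps y' * v w' y') w y ^+ 2
    + eps * dw v w y ^+ 2 * rad eps y `^ delta
    + eps * v w y ^+ 2 * rad eps y `^ delta).

Definition outflow_trace (theta0 eps delta : R) (u : R -> R -> R) : \bar R :=
  (\int[lebesgue_measure]_(y in `]R0, +oo[)
     (eps * dw u theta0 y ^+ 2 * rad eps y `^ (delta - 1))%:E)%E.

Definition finite_norms (theta0 eps delta : R) (u v P f g : R -> R -> R) : Prop :=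
  [/\ (normA2 theta0 eps delta u < +oo)%E, (normB2 theta0 eps delta v < +oo)%E,
      (normL2 theta0 eps delta P < +oo)%E,
      (normL2 theta0 eps (2 + delta) f < +oo)%E &
      (normL2 theta0 eps (2 + delta) g < +oo)%E].

End Profiles.
Arguments profile_data R : clear implicits.

(* Main.v *)
(** Write r = rad y, phi = r v, s = sqrt eps and let U(y) = u_e0(r) + up(0, y)
    be the shear flow at the inlet.  With Psi = r^delta phi / U one tests the
    first equation against - r d_y Psi and the second one, multiplied by eps,
    against d_w Psi.  The pressure and the term u_s u_w + (u_s)_y v combine: the
    pressure survives on the boundary only, and the transport terms give the
    coercive quantity r^delta ((U d_y (phi / U))^2 + eps v_w^2).  A Hardy
    inequality recovers phi / y^2 and phi_y from it, Poincare inequalities in w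
    (with constant theta0) absorb u and v, and the outflow condition on P and
    u_y turns the boundary term at w = theta0 into eps u_w^2.  Everything is
    first integrated against a logarithmic cutoff in r and then passed to the
    limit.

    This requires u_s - U = O(theta0) and bounds on u_s, v_s that are uniform in
    theta0 and eps, that is, |v_e^1| <= C / r uniformly and first derivatives of
    v_e^1 bounded in terms of theta0 (they are paid for by sqrt eps).  They come
    from the maximum principle for the Euler operator on a narrow strip, applied
    to v_e^1 - B, to its differences in w and to its dilation differences in r,
    with explicit barriers. *)
Require Import Defs.
From HB Require Import structures.
From mathcomp Require Import all_boot all_order all_algebra.
From mathcomp Require Import all_classical all_reals all_analysis.
Import Order.TTheory GRing.Theory Num.Theory.
Import numFieldNormedType.Exports.
From mathcomp Require Import measurable_realfun ring lra.
Set Implicit Arguments.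
Unset Strict Implicit.
Unset Printing Implicit Defensive.
Local Open Scope classical_set_scope.
Local Open Scope ring_scope.

(** * Calculus in one and two variables *)

Section RealDerivatives.
Context {R : realType}.
Implicit Types (f g : R -> R) (x : R).

(** Incompressibility turns [us u_w + us_y phi] into [- (us phi_y - us_y phi) = - us^2 (phi /
    us)_y], which dictates a multiplier built on [phi / us]. Dividing by the inlet profile [U(y)]
    instead costs [us - U = O(th)] but gives a weight that commutes with [d_w]; then
    [Psi_yw = Psi_wy] makes the pressure work an exact divergence. Hardy, Poincare and trace
    inequalities are kept in differential form, as exact derivatives added with constant weights, so
    the estimate is one algebraic inequality at each point, integrated once. The fluxes carry a
    factor [r] that the norms do not control; a logarithmic cutoff repays it, its derivative being
    of size [kap s / r]. The obstacle is the factor [1 / th] that the lateral interpolation puts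
    into the Euler source: a bound on [v_s] containing it would destroy every absorption by small
    [th]. It disappears because the barrier [w (th - w) / r] is of size [th^2]. Hence the order of
    the constants: the one of the theorem before [th], the bounds on derivatives of [v_e^1] after
    [th], and [eps] last. *)

Lemma dvC (c x : R) : is_derive x 1 (fun=> c) 0.
Proof. exact: is_derive_cst. Qed.

Lemma dvI x : is_derive x 1 (fun t : R => t) 1.
Proof. exact: is_derive_id. Qed.

Lemma dvD f g x (a b : R) : is_derive x 1 f a -> is_derive x 1 g b ->
  is_derive x 1 (fun t => f t + g t) (a + b).
Proof. by move=> fa gb; exact: is_deriveD. Qed.

Lemma dvN f x (a : R) : is_derive x 1 f a -> is_derive x 1 (fun t => - f t) (- a).
Proof. by move=> fa; exact: is_deriveN. Qed.

Lemma dvB f g x (a b : R) : is_derive x 1 f a -> is_derive x 1 g b ->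
  is_derive x 1 (fun t => f t - g t) (a - b).
Proof. by move=> fa gb; exact: is_deriveB. Qed.

Lemma dvM f g x (a b : R) : is_derive x 1 f a -> is_derive x 1 g b ->
  is_derive x 1 (fun t => f t * g t) (a * g x + f x * b).
Proof.
move=> fa gb; have h : is_derive x 1 (f * g) (f x *: b + g x *: a) by exact: is_deriveM.
by apply: (is_derive_eq h); rewrite /GRing.scale/= addrC [g x * a]mulrC.
Qed.

Lemma dvX f x (a : R) n : is_derive x 1 f a ->
  is_derive x 1 (fun t => f t ^+ n) (n%:R * f x ^+ n.-1 * a).
Proof. move=> fa; have h : is_derive x 1 (f ^+ n) ((n%:R * f x ^+ n.-1) *: a).
  exact: is_deriveX.
by rewrite (_ : (fun t => f t ^+ n) = f ^+ n)//; apply/funext => t; rewrite exprfctE. Qed.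

Lemma dvV f x (a : R) : f x != 0 -> is_derive x 1 f a ->
  is_derive x 1 (fun t => (f t)^-1) (- a / f x ^+ 2).
Proof.
move=> fx0 fa; have h := is_deriveV fx0 fa; apply: (is_derive_eq h).
by rewrite /GRing.scale/= !mulNr mulrC.
Qed.

Lemma dv_comp f g x (a b : R) : is_derive (g x) 1 f a -> is_derive x 1 g b ->
  is_derive x 1 (fun t => f (g t)) (a * b).
Proof. by move=> fa gb; exact: (@is_derive1_comp _ f g). Qed.

Lemma dv_cont f x (a : R) : is_derive x 1 f a -> {for x, continuous f}.
Proof.
by move=> [fa _]; apply/differentiable_continuous; rewrite -derivable1_diffP.
Qed.

Lemma derivable_dv f x : derivable f x 1 -> is_derive x 1 f (derive1 f x).
Proof. by move=> df; apply: DeriveDef => //; rewrite derive1E. Qed.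

Lemma dv_derive1 f x (a : R) : is_derive x 1 f a -> derive1 f x = a.
Proof. by move=> [_ <-]; rewrite derive1E. Qed.

Lemma dv_eq_near f g x (a : R) : (\forall t \near x, f t = g t) ->
  is_derive x 1 f a -> is_derive x 1 g a.
Proof.
by move=> fg fa; apply: near_eq_is_derive fa; rewrite ?oner_eq0.
Qed.

Lemma dv_unique f x (a b : R) : is_derive x 1 f a -> is_derive x 1 f b -> a = b.
Proof. by move=> [_ <-] [_ <-]. Qed.

(* One-sided agreement suffices since both derivatives are known to exist. *)
Lemma dv_right_eq f g x (a b e : R) : 0 < e -> is_derive x 1 f a -> is_derive x 1 g b ->
  (forall t, x <= t < x + e -> f t = g t) -> a = b.
Proof.
move=> e0 fa gb fg.
have h := dvB fa gb.
suff : a - b = 0 by move/eqP; rewrite subr_eq0 => /eqP.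
have [hd hv] := h.
have c : (fun t : R => t^-1 *: ((f (t *: 1 + x) - g (t *: 1 + x)) - (f x - g x)))
    @ 0^'+ --> a - b.
  rewrite -hv; apply: cvg_trans hd.
  by apply: cvg_app; apply: within_subset => // t /=; rewrite lt_def => /andP[].
apply: (cvg_unique _ c) => //.
apply: (@cvg_trans _ ((fun=> 0 : R) @ 0^'+)); last exact: cvg_cst.
apply: near_eq_cvg; near=> t.
have t0 : 0 < t by near: t; exact: nbhs_right_gt.
have te : t < e by near: t; exact: nbhs_right_lt.
have r1 : x <= t *: 1 + x < x + e.
  by rewrite /GRing.scale/= mulr1 [t + x]addrC lerDl (ltW t0) ltrD2l te.
have r2 : x <= x < x + e by rewrite lexx ltrDl.
by rewrite (fg _ r1) (fg _ r2) !subrr scaler0.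
Unshelve. all: by end_near. Qed.
End RealDerivatives.

(** * Joint continuity at a point *)

Section PointContinuity.
Context {R : realType}.
Implicit Types (h k : R -> R -> R) (w y : R).

(** Curried form of continuity at a pair, so that closure under arithmetic can be applied directly
    to integrands written as functions of two arguments. *)
Definition ptc h w y := {for (w, y), continuous (fun z : R * R => h z.1 z.2)}.

Lemma ptcC (c : R) w y : ptc (fun _ _ => c) w y.
Proof. exact: cvg_cst. Qed.

Lemma ptcD h k w y : ptc h w y -> ptc k w y -> ptc (fun w y => h w y + k w y) w y.
Proof. by move=> ch ck; exact: (@continuousD _ _ _ (fun z => h z.1 z.2) (fun z => k z.1 z.2)). Qed.

Lemma ptcN h w y : ptc h w y -> ptc (fun w y => - h w y) w y.
Proof. by move=> ch; exact: (@continuousN _ _ _ (fun z => h z.1 z.2)). Qed.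

Lemma ptcM h k w y : ptc h w y -> ptc k w y -> ptc (fun w y => h w y * k w y) w y.
Proof. by move=> ch ck; exact: (@continuousM _ _ (fun z => h z.1 z.2) (fun z => k z.1 z.2)). Qed.

Lemma ptcX h n w y : ptc h w y -> ptc (fun w y => h w y ^+ n) w y.
Proof.
move=> ch; elim: n => [|n IH]; first exact: ptcC.
have -> : (fun w y => h w y ^+ n.+1) = (fun w y => h w y * h w y ^+ n).
  by apply/funext => a; apply/funext => b; rewrite exprS.
exact: ptcM.
Qed.

Lemma ptcV h w y : h w y != 0 -> ptc h w y -> ptc (fun w y => (h w y)^-1) w y.
Proof. by move=> h0 ch; exact: (@continuousV _ _ (fun z => h z.1 z.2)). Qed.

Lemma ptc_y (f : R -> R) w y : {for y, continuous f} -> ptc (fun _ y => f y) w y.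
Proof. move=> cf; have pc : {for (w, y), continuous (@snd R R)} by exact: cvg_snd.
exact: (continuous_comp pc cf). Qed.

Lemma ptc_w (f : R -> R) w y : {for w, continuous f} -> ptc (fun w _ => f w) w y.
Proof. move=> cf; have pc : {for (w, y), continuous (@fst R R)} by exact: cvg_fst.
exact: (continuous_comp pc cf). Qed.

Lemma ptc_comp_y h (f : R -> R) w y : {for y, continuous f} -> ptc h w (f y) ->
  ptc (fun w y => h w (f y)) w y.
Proof.
move=> cf ch.
have cs := @ptc_y f w y cf.
have pc : {for (w, y), continuous (fun z : R * R => (z.1, f z.2))}.
  by apply: (@cvg_pair _ _ _ _ (nbhs w) (nbhs (f y))); [exact: cvg_fst|exact: cs].
exact: (continuous_comp pc ch).
Qed.
End PointContinuity.

Section CkFacts.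
Context {R : realType}.
Implicit Types (f : R -> R -> R) (w y : R).

Lemma Ck_ptc k f w y : Ck k f -> ptc f w y.
Proof. by case: k => [|k] [cf _]; exact: cf. Qed.

Lemma Ck_dw k f : Ck k.+1 f -> Ck k (dw f).
Proof. by move=> [_ []]. Qed.

Lemma Ck_dy k f : Ck k.+1 f -> Ck k (dy f).
Proof. by move=> [_ []]. Qed.

Lemma Ck_dvw k f w y : Ck k.+1 f -> is_derive w 1 (f^~ y) (dw f w y).
Proof. by move=> [_ [h _ _ _]]; exact: derivable_dv. Qed.

Lemma Ck_dvy k f w y : Ck k.+1 f -> is_derive y 1 (f w) (dy f w y).
Proof. by move=> [_ [_ h _ _]]; apply: derivable_dv. Qed.
End CkFacts.

(** * Integrals over segments and rectangles, and their divergence identities *)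

Section RectangleIntegrals.
Context {R : realType}.
Notation mu := (@lebesgue_measure R).
Implicit Types (a b c d : R) (f : R -> R) (h : R -> R -> R).

Definition segint a b f : R := \int[mu]_(x in `[a, b]) f x.

Definition cont_seg a b f := {within `[a, b], continuous f}.

Definition cont_rect a b c d h := forall w y, a <= w <= b -> c <= y <= d ->
  {for (w, y), continuous (fun z : R * R => h z.1 z.2)}.

Lemma cont_seg_integrable a b f : cont_seg a b f ->
  mu.-integrable `[a, b] (EFin \o f).
Proof.
by move=> cf; apply: continuous_compact_integrable => //; exact: segment_compact.
Qed.

Lemma cont_seg_pt a b f : (forall x, a <= x <= b -> {for x, continuous f}) ->
  cont_seg a b f.
Proof.
move=> cf; apply: continuous_in_subspaceT => x /set_mem /=.
by rewrite in_itv/=; exact: cf.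
Qed.

(** The endpoints are negligible, so the comparison is asked only in the open segment, where the
    differential equations hold. *)
Lemma segint_le a b f g : cont_seg a b f -> cont_seg a b g ->
  (forall x, a < x < b -> f x <= g x) -> segint a b f <= segint a b g.
Proof.
move=> cf cg fg; rewrite /segint.
have fi := cont_seg_integrable cf; have gi := cont_seg_integrable cg.
have sub1 : (`]a, b[ : set R) `<=` `[a, b] by exact: subset_itv_oo_cc.
have sub2 : (`]a, b] : set R) `<=` `[a, b] by exact: subset_itv_oc_cc.
have E k : mu.-integrable `[a, b] (EFin \o k) ->
    \int[mu]_(x in `[a, b]) k x = \int[mu]_(x in `]a, b[) k x.
  move=> ki; rewrite -Rintegral_itv_obnd_cbnd ?Rintegral_itv_bndo_bndc//.
  - exact: integrableS ki.
  - exact: integrableS ki.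
rewrite !E//; apply: le_Rintegral => //.
- exact: integrableS fi.
- exact: integrableS gi.
Qed.

Lemma segintD a b f g : cont_seg a b f -> cont_seg a b g ->
  segint a b (fun x => f x + g x) = segint a b f + segint a b g.
Proof. by move=> cf cg; apply: RintegralD => //; exact: cont_seg_integrable. Qed.

Lemma segintZ a b k f : cont_seg a b f ->
  segint a b (fun x => k * f x) = k * segint a b f.
Proof. by move=> cf; apply: RintegralZl => //; exact: cont_seg_integrable. Qed.

Lemma segint_ge0 a b f : (forall x, a <= x <= b -> 0 <= f x) -> 0 <= segint a b f.
Proof. by move=> f0; apply: Rintegral_ge0 => x /=; rewrite in_itv/=; exact: f0. Qed.

Lemma segint_FTC a b F f : a < b -> cont_seg a b f -> cont_seg a b F ->
  (forall x, a < x < b -> is_derive x 1 F (f x)) ->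
  segint a b f = F b - F a.
Proof.
move=> ab cf cF dF; rewrite /segint /Rintegral (continuous_FTC2 ab cf (F := F))//.
  have /(continuous_within_itvP _ ab) [_ cFa cFb] := cF.
  by split => //; move=> x; rewrite in_itv/= => /dF -[].
by move=> x; rewrite in_itv/= => /dF dFx; rewrite derive1E; apply: derive_val.
Qed.

Lemma cont_rect_slice a b c d h w : a <= w <= b -> cont_rect a b c d h ->
  cont_seg c d (h w).
Proof.
move=> wab ch; apply: cont_seg_pt => y ycd.
have hc := ch w y wab ycd.
have pc : {for y, continuous (fun y : R => (w, y))}.
  by apply: (@cvg_pair _ _ _ _ (nbhs w) (nbhs y)); [exact: cvg_cst|exact: cvg_id].
exact: (continuous_comp pc hc).
Qed.

Lemma cont_rect_bounded a b c d h : cont_rect a b c d h ->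
  exists M : R, forall w y, a <= w <= b -> c <= y <= d -> `|h w y| <= M.
Proof.
move=> ch.
pose A : set (R * R) := `[a, b] `*` `[c, d].
have cA : compact A by apply: compact_setX; exact: segment_compact.
have cf : {within A, continuous (fun z : R * R => h z.1 z.2)}.
  apply: continuous_in_subspaceT => -[w y] /set_mem [] /=.
  by rewrite !in_itv/= => ? ?; exact: ch.
have /compact_bounded := continuous_compact cf cA.
move=> [M [_ hM]]; exists (M + 1) => w y wab ycd.
apply: (hM (M + 1)); first by rewrite ltrDl.
by exists (w, y) => //; split; rewrite /= in_itv.
Qed.

Lemma clamp_itv a b w : a <= b -> a <= Num.max a (Num.min w b) <= b.
Proof. by move=> ab; rewrite le_max lexx/= ge_max ab ge_min lexx orbT. Qed.

Lemma clamp_id a b w : a <= w <= b -> Num.max a (Num.min w b) = w.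
Proof. by move=> /andP[aw wb]; rewrite (min_idPl wb) (max_idPr aw). Qed.

Lemma clamp_continuous a b : continuous (fun w : R => Num.max a (Num.min w b)).
Proof.
move=> w; apply: (@continuous_max _ _ (cst a) (Num.min^~ b)).
  exact: cvg_cst.
by apply: (@continuous_min _ _ id (cst b)) => //; exact: cvg_cst.
Qed.

Lemma segint_param_continuous a b c d h : a <= b -> cont_rect a b c d h ->
  cont_seg a b (fun w => segint c d (h w)).
Proof.
move=> ab ch.
(* Clamping the parameter extends the integrand continuously to all [w], so that continuity under
   the integral, stated on open intervals, also covers the endpoints [a] and [b]. *)
pose cl w := Num.max a (Num.min w b).
pose k w y := h (cl w) y.
have clab w : a <= cl w <= b by exact: clamp_itv.
have [M hM] := cont_rect_bounded ch.
have ik w : mu.-integrable `[c, d] (EFin \o k w).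
  by apply: cont_seg_integrable; exact: cont_rect_slice ch.
have kc : continuous (fun w => segint c d (k w)).
  move=> w.
  have wI : w \in [set` `]w - 1, w + 1[].
    by rewrite inE/= in_itv/= ltrBlDr ltrDl ltr01.
  apply: (@continuity_under_integral _ _ _ mu k `[c, d] _ (w - 1) (w + 1) _ _
    (cst M)) wI => //.
  - apply: aeW => y /=; rewrite in_itv/= => ycd x _.
    have hc := ch (cl x) y (clab x) ycd.
    have pc : {for x, continuous (fun x : R => (cl x, y))}.
      apply: (@cvg_pair _ _ _ _ (nbhs (cl x)) (nbhs y)); last exact: cvg_cst.
      exact: clamp_continuous.
    exact: (continuous_comp pc hc).
  - by apply: cont_seg_integrable; apply: cont_seg_pt => ? _; exact: cvg_cst.
  - move=> x _; apply: aeW => y /=; rewrite in_itv/= => ycd.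
    exact: hM.
rewrite /cont_seg.
apply: (@subspace_eq_continuous _ _ _ (fun w => segint c d (k w))).
  by move=> w; rewrite inE/= in_itv/= => wab; rewrite /k /cl clamp_id.
exact: continuous_subspaceT.
Qed.

Lemma segint_param_derive a b c d h h' : a <= b ->
  cont_rect a b c d h -> cont_rect a b c d h' ->
  (forall w y, a < w < b -> c <= y <= d -> is_derive w 1 (h^~ y) (h' w y)) ->
  forall w, a < w < b ->
  is_derive w 1 (fun w => segint c d (h w)) (segint c d (h' w)).
Proof.
move=> ab ch ch' dh w wab.
have [M hM] := cont_rect_bounded ch'.
have wI : [set` `]a, b[] w by rewrite /= in_itv.
have itvW x : a < x < b -> a <= x <= b by move=> /andP[/ltW -> /ltW ->].
have i x : [set` `]a, b[] x -> mu.-integrable `[c, d] (EFin \o h x).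
  rewrite /= in_itv/= => xab.
  by apply: cont_seg_integrable; apply: cont_rect_slice ch; exact: itvW.
have M0 : 0 <= `|M| by [].
have iM : mu.-integrable `[c, d] (EFin \o (fun _ : R => `|M|)).
  by apply: cont_seg_integrable; apply: cont_seg_pt => ? _; exact: cvg_cst.
have dh1 x y : [set` `]a, b[] x -> [set` `[c, d]] y ->
    derivable (h^~ y) x 1.
  by rewrite /= !in_itv/= => xab ycd; have [] := dh x y xab ycd.
have dhE x y : [set` `]a, b[] x -> [set` `[c, d]] y ->
    partial1of2 h x y = h' x y.
  rewrite /= !in_itv/= => xab ycd; rewrite partial1of2E.
  by have dhx := dh x y xab ycd; rewrite derive_val.
have Mub x y : [set` `]a, b[] x -> [set` `[c, d]] y ->
    `|partial1of2 h x y| <= `|M|.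
  move=> xI yI; rewrite dhE//; apply: le_trans (ler_norm _).
  by move: xI yI; rewrite /= !in_itv/= => /itvW xab ycd; exact: hM.
have mcd := measurable_itv `[c, d].
apply: DeriveDef.
  exact: (@derivable_under_integral _ _ _ mu h [set` `[c, d]] mcd w a b wI i dh1
    (fun=> `|M|) (fun=> M0) iM Mub).
rewrite -derive1E (@differentiation_under_integral _ _ _ mu h [set` `[c, d]] mcd w a b wI i dh1
    (fun=> `|M|) (fun=> M0) iM Mub).
by apply: eq_Rintegral => y /set_mem yI; rewrite dhE.
Qed.

Definition rectint a b c d h := segint a b (fun w => segint c d (h w)).

Section Rectint.
Variables a b c d : R.
Hypotheses (ab : a < b) (cd : c < d).

(** Differentiation under the inner integral followed by the fundamental theorem in [w]; the order
    of integration is never exchanged. *)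
Lemma rectint_div_w h h' : cont_rect a b c d h -> cont_rect a b c d h' ->
  (forall w y, a < w < b -> c <= y <= d -> is_derive w 1 (h^~ y) (h' w y)) ->
  rectint a b c d h' = segint c d (h b) - segint c d (h a).
Proof.
move=> ch ch' dh.
apply: (@segint_FTC _ _ (fun w => segint c d (h w))) => //.
- exact: segint_param_continuous (ltW ab) ch'.
- exact: segint_param_continuous (ltW ab) ch.
- by move=> x xab; apply: segint_param_derive (ltW ab) ch ch' dh _ xab.
Qed.

Lemma cont_rect_cst_y h y : cont_rect a b c d h -> c <= y <= d ->
  cont_seg a b (h^~ y).
Proof.
move=> ch ycd; apply: cont_seg_pt => w wab.
have hc := ch w y wab ycd.
have pc : {for w, continuous (fun w : R => (w, y))}.
  by apply: (@cvg_pair _ _ _ _ (nbhs w) (nbhs y)); [exact: cvg_id|exact: cvg_cst].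
exact: (continuous_comp pc hc).
Qed.

Lemma rectint_div_y h h' : cont_rect a b c d h -> cont_rect a b c d h' ->
  (forall w y, a <= w <= b -> c < y < d -> is_derive y 1 (h w) (h' w y)) ->
  rectint a b c d h' = segint a b (h^~ d) - segint a b (h^~ c).
Proof.
move=> ch ch' dh.
have cd1 : c <= d <= d by rewrite (ltW cd) lexx.
have cc1 : c <= c <= d by rewrite (ltW cd) lexx.
transitivity (segint a b (fun w => h w d - h w c)); last first.
  rewrite /segint RintegralB//; apply: cont_seg_integrable; exact: cont_rect_cst_y.
apply: eq_Rintegral => w /set_mem; rewrite /= in_itv/= => wab.
apply: (@segint_FTC _ _ (h w)) => //.
- exact: cont_rect_slice ch'.
- exact: cont_rect_slice ch.
- by move=> y ycd; exact: dh.
Qed.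

Lemma rectint_le h k : cont_rect a b c d h -> cont_rect a b c d k ->
  (forall w y, a < w < b -> c < y < d -> h w y <= k w y) ->
  rectint a b c d h <= rectint a b c d k.
Proof.
move=> ch ck hk; apply: segint_le.
- exact: segint_param_continuous (ltW ab) ch.
- exact: segint_param_continuous (ltW ab) ck.
- move=> w wab; have wab' : a <= w <= b by case/andP: wab => /ltW -> /ltW ->.
  apply: segint_le => [||y ycd]; [exact: cont_rect_slice ch|exact: cont_rect_slice ck|].
  exact: hk.
Qed.

Lemma rectintD h k : cont_rect a b c d h -> cont_rect a b c d k ->
  rectint a b c d (fun w y => h w y + k w y) =
  rectint a b c d h + rectint a b c d k.
Proof.
move=> ch ck; rewrite /rectint -segintD.
- apply: eq_Rintegral => w /set_mem; rewrite /= in_itv/= => wab.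
  by rewrite segintD//; [exact: cont_rect_slice ch|exact: cont_rect_slice ck].
- exact: segint_param_continuous (ltW ab) ch.
- exact: segint_param_continuous (ltW ab) ck.
Qed.

Lemma rectintZ k h : cont_rect a b c d h ->
  rectint a b c d (fun w y => k * h w y) = k * rectint a b c d h.
Proof.
move=> ch; rewrite /rectint -segintZ.
- apply: eq_Rintegral => w /set_mem; rewrite /= in_itv/= => wab.
  by rewrite segintZ//; exact: cont_rect_slice ch.
- exact: segint_param_continuous (ltW ab) ch.
Qed.

Lemma rectint_ge0 h :
  (forall w y, a <= w <= b -> c <= y <= d -> 0 <= h w y) ->
  0 <= rectint a b c d h.
Proof. by move=> h0; apply: segint_ge0 => w wab; apply: segint_ge0 => y; exact: h0. Qed.

End Rectint.
End RectangleIntegrals.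

(** * Extended integrals over the half-strip and their exhaustion by compact sets *)

Section StripIntegrals.
Context {R : realType}.
Notation mu := (@lebesgue_measure R).
Implicit Types (a b c d : R) (f : R -> R) (h : R -> R -> R).

Definition cont_strip a b c h := forall w y, a < w < b -> c < y ->
  {for (w, y), continuous (fun z : R * R => h z.1 z.2)}.

Definition stripint a b c h : \bar R :=
  (\int[mu]_(w in `]a, b[) \int[mu]_(y in `]c, +oo[) (h w y)%:E)%E.

(** The segments keep a distance from the wall [c], since strip integrands are assumed continuous
    only in the open strip. *)
Definition exh c (n : nat) : set R := `[c + n.+1%:R^-1, c + n.+1%:R].

Lemma exh_nd c : nondecreasing_seq (exh c).
Proof.
apply/nondecreasing_seqP => n; rewrite subsetEset => y.
rewrite /exh /= !in_itv/= => /andP[h1 h2]; apply/andP; split.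
  by apply: le_trans h1; rewrite lerD2l lef_pV2 ?posrE// ler_nat.
by apply: (le_trans h2); rewrite lerD2l ler_nat.
Qed.

Lemma exh_bigcup c : \bigcup_n exh c n = [set` `]c, +oo[].
Proof.
apply/seteqP; split => [y [n _]|y].
  rewrite /exh /= !in_itv/= andbT => /andP[h1 _].
  by apply: lt_le_trans h1; rewrite ltrDl invr_gt0.
rewrite /= in_itv/= andbT => cy.
have yc : 0 < y - c by rewrite subr_gt0.
have [m hm] : exists m : nat, (y - c)^-1 < m%:R /\ y - c < m%:R.
  exists (Num.bound (y - c)^-1 + Num.bound (y - c))%N; split.
    apply: (lt_le_trans (archi_boundP (ltW _))); first by rewrite invr_gt0.
    by rewrite ler_nat leq_addr.
  apply: (lt_le_trans (archi_boundP (ltW yc))).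
  by rewrite ler_nat leq_addl.
have [h1 h2] := hm.
have m0 : 0 < m%:R :> R by exact: lt_trans h2.
have mS : m%:R <= m.+1%:R :> R by rewrite ler_nat.
exists m => //; rewrite /exh /= in_itv/=; apply/andP; split; last first.
  by rewrite -lerBlDl (le_trans (ltW h2)).
rewrite -lerBrDl -[X in _ <= X]invrK lef_pV2 ?posrE ?invr_gt0//.
by rewrite (le_trans (ltW h1)).
Qed.

Lemma exh_measurable c n : measurable (exh c n).
Proof. exact: measurable_itv. Qed.

Lemma exh_sub c n y : exh c n y -> c < y.
Proof.
rewrite /exh /= in_itv/= => /andP[h1 _].
by apply: lt_le_trans h1; rewrite ltrDl invr_gt0.
Qed.

Lemma strip_slice_meas a b c h w : a < w < b -> cont_strip a b c h ->
  measurable_fun `]c, +oo[ (fun y => (h w y)%:E).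
Proof.
move=> wab ch; apply/measurable_EFinP.
apply: open_continuous_measurable_fun; first exact: rray_open.
move=> y; rewrite inE/= in_itv/= andbT => cy.
have hc := ch w y wab cy.
have pc : {for y, continuous (fun y : R => (w, y))}.
  by apply: (@cvg_pair _ _ _ _ (nbhs w) (nbhs y)); [exact: cvg_cst|exact: cvg_id].
exact: (continuous_comp pc hc).
Qed.

Lemma strip_exh_cvg a b c h w : a < w < b -> cont_strip a b c h ->
  (forall y, c < y -> 0 <= h w y) ->
  (\int[mu]_(y in exh c n) (h w y)%:E @[n --> \oo] -->
   \int[mu]_(y in `]c, +oo[) (h w y)%:E)%E.
Proof.
move=> wab ch h0; rewrite -exh_bigcup.
apply: ge0_nondecreasing_set_cvg_integral.
- exact: exh_nd.
- exact: exh_measurable.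
- move=> n; apply: (measurable_funS (E := [set` `]c, +oo[])) => //.
    by move=> y /exh_sub cy; rewrite /= in_itv/= cy.
  exact: strip_slice_meas ch.
- by move=> n y /exh_sub cy; rewrite lee_fin h0.
Qed.

Lemma cont_strip_seg a b c h w n : a < w < b -> cont_strip a b c h ->
  cont_seg (c + n.+1%:R^-1) (c + n.+1%:R) (h w).
Proof.
move=> wab ch; apply: cont_seg_pt => y /andP[hy _].
have cy : c < y by apply: lt_le_trans hy; rewrite ltrDl invr_gt0.
have hc := ch w y wab cy.
have pc : {for y, continuous (fun y : R => (w, y))}.
  by apply: (@cvg_pair _ _ _ _ (nbhs w) (nbhs y)); [exact: cvg_cst|exact: cvg_id].
exact: (continuous_comp pc hc).
Qed.

Lemma segint_fine a b f : cont_seg a b f ->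
  (\int[mu]_(x in `[a, b]) (f x)%:E)%E = (segint a b f)%:E.
Proof.
move=> /cont_seg_integrable fi.
by rewrite /segint /Rintegral fineK//; exact: integrable_fin_num.
Qed.

(** Over a compact segment the inner integral depends continuously on the angle in the open
    interval; measurability on the whole half-line then follows by a limit. *)
Lemma strip_exh_meas a b c h n : cont_strip a b c h ->
  measurable_fun `]a, b[ (fun w => \int[mu]_(y in exh c n) (h w y)%:E)%E.
Proof.
move=> ch.
apply: (eq_measurable_fun
  (fun w => (segint (c + n.+1%:R^-1) (c + n.+1%:R) (h w))%:E)).
  move=> w; rewrite inE/= in_itv/= => wab.
  by rewrite -segint_fine//; exact: cont_strip_seg ch.
apply/measurable_EFinP.
apply: open_continuous_measurable_fun; first exact: interval_open.
move=> w; rewrite inE/= in_itv/= => wab.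
have /andP[aw wb] := wab.
pose a' := (a + w) / 2; pose b' := (w + b) / 2.
have aa' : a < a' by rewrite /a'; lra.
have a'w : a' < w by rewrite /a'; lra.
have wb' : w < b' by rewrite /b'; lra.
have bb' : b' < b by rewrite /b'; lra.
have ch' : cont_rect a' b' (c + n.+1%:R^-1) (c + n.+1%:R) h.
  move=> x y /andP[h1 h2] /andP[h3 _]; apply: ch.
    by rewrite (lt_le_trans aa' h1) (le_lt_trans h2 bb').
  by apply: lt_le_trans h3; rewrite ltrDl invr_gt0.
have := segint_param_continuous (ltW (lt_trans a'w wb')) ch'.
move=> /(continuous_within_itvP _ (lt_trans a'w wb')) [+ _ _]; apply.
by rewrite in_itv/= a'w.
Qed.

Lemma strip_outer_meas a b c h : cont_strip a b c h ->
  (forall w y, a < w < b -> c < y -> 0 <= h w y) ->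
  measurable_fun `]a, b[ (fun w => \int[mu]_(y in `]c, +oo[) (h w y)%:E)%E.
Proof.
move=> ch h0.
apply: (emeasurable_fun_cvg (fun n w => \int[mu]_(y in exh c n) (h w y)%:E)%E).
  by move=> n; exact: strip_exh_meas.
move=> w /=; rewrite in_itv/= => wab; apply: strip_exh_cvg ch _ => // y; exact: h0.
Qed.

Lemma strip_inner_ge0 a b c h w : a < w < b ->
  (forall w y, a < w < b -> c < y -> 0 <= h w y) ->
  (0 <= \int[mu]_(y in `]c, +oo[) (h w y)%:E)%E.
Proof.
move=> wab h0; apply: integral_ge0 => y /=; rewrite in_itv/= andbT => cy.
by rewrite lee_fin h0.
Qed.

Lemma stripint_ge0 a b c h :
  (forall w y, a < w < b -> c < y -> 0 <= h w y) -> (0 <= stripint a b c h)%E.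
Proof.
move=> h0; apply: integral_ge0 => w /=; rewrite in_itv/= => wab.
exact: strip_inner_ge0 h0.
Qed.

Lemma stripint_le a b c h k : cont_strip a b c h -> cont_strip a b c k ->
  (forall w y, a < w < b -> c < y -> 0 <= h w y <= k w y) ->
  (stripint a b c h <= stripint a b c k)%E.
Proof.
move=> ch ck hk.
have h0 w y : a < w < b -> c < y -> 0 <= h w y by move=> wab cy; have /andP[] := hk w y wab cy.
have k0 w y : a < w < b -> c < y -> 0 <= k w y.
  by move=> wab cy; have /andP[] := hk w y wab cy; exact: le_trans.
apply: ge0_le_integral => //.
- by move=> w /=; rewrite in_itv/= => wab; exact: strip_inner_ge0 h0.
- exact: strip_outer_meas.
- exact: strip_outer_meas.
- move=> w /=; rewrite in_itv/= => wab; apply: ge0_le_integral => //.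
  + by move=> y /=; rewrite in_itv/= andbT => cy; rewrite lee_fin h0.
  + exact: strip_slice_meas ch.
  + exact: strip_slice_meas ck.
  + by move=> y /=; rewrite in_itv/= andbT => cy; rewrite lee_fin; have /andP[] := hk w y wab cy.
Qed.

Lemma stripintD a b c h k : cont_strip a b c h -> cont_strip a b c k ->
  (forall w y, a < w < b -> c < y -> 0 <= h w y) ->
  (forall w y, a < w < b -> c < y -> 0 <= k w y) ->
  (stripint a b c (fun w y => (h w y + k w y)%R) = stripint a b c h + stripint a b c k)%E.
Proof.
move=> ch ck h0 k0; rewrite /stripint -ge0_integralD//.
- apply: eq_integral => w; rewrite inE/= in_itv/= => wab.
  rewrite -ge0_integralD//.
  + by move=> y /=; rewrite in_itv/= andbT => cy; rewrite lee_fin h0.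
  + exact: strip_slice_meas ch.
  + by move=> y /=; rewrite in_itv/= andbT => cy; rewrite lee_fin k0.
  + exact: strip_slice_meas ck.
- by move=> w /=; rewrite in_itv/= => wab; exact: strip_inner_ge0 h0.
- exact: strip_outer_meas.
- by move=> w /=; rewrite in_itv/= => wab; exact: strip_inner_ge0 k0.
- exact: strip_outer_meas.
Qed.

Lemma stripintZ a b c h (k : R) : cont_strip a b c h -> 0 <= k ->
  (forall w y, a < w < b -> c < y -> 0 <= h w y) ->
  (stripint a b c (fun w y => (k * h w y)%R) = k%:E * stripint a b c h)%E.
Proof.
move=> ch k0 h0; rewrite /stripint -ge0_integralZl_EFin//.
- apply: eq_integral => w; rewrite inE/= in_itv/= => wab.
  rewrite -ge0_integralZl_EFin//.
  + by move=> y /=; rewrite in_itv/= andbT => cy; rewrite lee_fin h0.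
  + exact: strip_slice_meas ch.
- by move=> w /=; rewrite in_itv/= => wab; exact: strip_inner_ge0 h0.
- exact: strip_outer_meas.
Qed.

(** Bridge from real to extended integrals. [L] has no sign, so it is first replaced by its positive
    part, which still lies below the nonnegative [F] and can be compared by monotonicity of
    nonnegative integrals. *)
Lemma rectint_le_strip a b c d L F : a < b ->
  cont_rect a b c d L -> cont_strip a b c F ->
  (forall w y, a < w < b -> c < y -> 0 <= F w y) ->
  (forall w y, a < w < b -> c < y < d -> L w y <= F w y) ->
  ((rectint a b c d L)%:E <= stripint a b c F)%E.
Proof.
move=> ab cL cF F0 LF.
pose L' w y := Num.max (L w y) 0.
have cL' : cont_rect a b c d L'.
  move=> w y wab ycd; apply: (@continuous_max _ _ (fun z : R * R => L z.1 z.2) (cst 0)).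
    exact: cL.
  exact: cvg_cst.
have itvW x : a < x < b -> a <= x <= b by move=> /andP[/ltW -> /ltW ->].
have cs : cont_seg a b (fun w => segint c d (L' w)).
  exact: segint_param_continuous (ltW ab) cL'.
apply: (@le_trans _ _ (rectint a b c d L')%:E).
  rewrite lee_fin; apply: segint_le => // [|w wab].
    exact: segint_param_continuous (ltW ab) cL.
  apply: segint_le => [||y ycd]; last by rewrite /L' le_max lexx.
    exact: cont_rect_slice (itvW _ wab) cL.
  exact: cont_rect_slice (itvW _ wab) cL'.
rewrite /rectint -segint_fine//.
have sub1 : [set` `]a, b[] `<=` [set` `[a, b]] by exact: subset_itv_oo_cc.
have mseg : measurable_fun `]a, b[ (fun w => (segint c d (L' w))%:E).
  apply: (measurable_funS _ sub1) => //.
  by have /integrableP[] := cont_seg_integrable cs.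
rewrite integral_itv_bndoo//.
apply: ge0_le_integral => //.
- move=> w _; rewrite lee_fin; apply: segint_ge0 => y _.
  by rewrite /L' le_max lexx orbT.
- exact: strip_outer_meas.
- move=> w /=; rewrite in_itv/= => wab.
  have cLw : cont_seg c d (L' w) by exact: cont_rect_slice (itvW _ wab) cL'.
  rewrite -segint_fine//.
  have mLw : measurable_fun `]c, d[ (fun y => (L' w y)%:E).
    apply: (measurable_funS (E := [set` `[c, d]])) => //; first exact: subset_itv_oo_cc.
    by have /integrableP[] := cont_seg_integrable cLw.
  rewrite integral_itv_bndoo//.
  have subd : [set` `]c, d[] `<=` [set` `]c, +oo[] by exact: subset_itvl.
  apply: (@le_trans _ _ (\int[mu]_(y in `]c, d[) (F w y)%:E)%E); last first.
    apply: ge0_subset_integral => //; first exact: strip_slice_meas cF.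
    by move=> y /=; rewrite in_itv/= andbT => cy; rewrite lee_fin F0.
  apply: ge0_le_integral => //.
  + by move=> y _; rewrite lee_fin /L' le_max lexx orbT.
  + by apply: (measurable_funS _ subd) => //; exact: strip_slice_meas cF.
  + move=> y /=; rewrite in_itv/= => ycd; rewrite lee_fin /L' ge_max LF//= F0//.
    by case/andP: ycd.
Qed.

(** Monotone convergence: bounds on all bounded rectangles that do not depend on the rectangle give
    finiteness of the integral over the strip, which therefore need not be known beforehand. *)
Lemma stripint_le_rect a b c h (K : R) : a < b ->
  (forall d, c < d -> cont_rect a b c d h) ->
  (forall w y, a <= w <= b -> c <= y -> 0 <= h w y) ->
  (forall d, c < d -> rectint a b c d h <= K) ->
  (stripint a b c h <= K%:E)%E.
Proof.
move=> ab ch h0 hK.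
have itvW x : a < x < b -> a <= x <= b by move=> /andP[/ltW -> /ltW ->].
have cs : cont_strip a b c h.
  move=> w y wab cy; apply: (ch (y + 1)).
  - by rewrite (lt_trans cy)// ltrDl.
  - exact: itvW.
  - by rewrite (ltW cy) lerDl ler01.
have h0' w y : a < w < b -> c < y -> 0 <= h w y.
  by move=> wab cy; apply: h0; [exact: itvW|exact: ltW].
rewrite /stripint.
have -> : (\int[mu]_(w in `]a, b[) \int[mu]_(y in `]c, +oo[) (h w y)%:E)%E =
    (\int[mu]_(w in `]a, b[) limn (fun n => \int[mu]_(y in exh c n) (h w y)%:E))%E.
  apply: eq_integral => w; rewrite inE/= in_itv/= => wab.
  apply/esym/cvg_lim => //; apply: strip_exh_cvg cs _ => // y; exact: h0'.
rewrite monotone_convergence//; last 3 first.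
- by move=> n; exact: strip_exh_meas.
- move=> n w /=; rewrite in_itv/= => wab; apply: integral_ge0 => y /exh_sub cy.
  by rewrite lee_fin h0'.
- move=> w /=; rewrite in_itv/= => wab.
  apply: ge0_nondecreasing_set_nondecreasing_integral.
  + exact: exh_nd.
  + exact: exh_measurable.
  + move=> n; apply: (measurable_funS (E := [set` `]c, +oo[])) => //.
      by move=> y /exh_sub cy; rewrite /= in_itv/= cy.
    exact: strip_slice_meas cs.
  + by move=> n y /exh_sub cy; rewrite lee_fin h0'.
apply: lime_le.
  apply: ereal_nondecreasing_is_cvgn; apply/nondecreasing_seqP => n.
  apply: ge0_le_integral => //.
  - move=> w /=; rewrite in_itv/= => wab; apply: integral_ge0 => y /exh_sub cy.
    by rewrite lee_fin h0'.
  - exact: strip_exh_meas.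
  - exact: strip_exh_meas.
  - move=> w /=; rewrite in_itv/= => wab.
    apply: ge0_subset_integral; [exact: exh_measurable|exact: exh_measurable| | |].
    + apply: (measurable_funS (E := [set` `]c, +oo[])) => //.
        by move=> y /exh_sub cy; rewrite /= in_itv/= cy.
      exact: strip_slice_meas cs.
    + by move=> y /exh_sub cy; rewrite lee_fin h0'.
    + by rewrite -subsetEset; exact: exh_nd.
apply: nearW => n.
have cd : c < c + n.+1%:R by rewrite ltrDl.
have sub1 : [set` `]a, b[] `<=` [set` `[a, b]] by exact: subset_itv_oo_cc.
apply: (@le_trans _ _ (rectint a b c (c + n.+1%:R) h)%:E); last by rewrite lee_fin hK.
have csg : cont_seg a b (fun w => segint c (c + n.+1%:R) (h w)).
  exact: segint_param_continuous (ltW ab) (ch _ cd).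
rewrite /rectint -segint_fine// integral_itv_bndoo; last first.
  apply: (measurable_funS _ sub1) => //.
  by have /integrableP[] := cont_seg_integrable csg.
apply: ge0_le_integral => //.
- move=> w /=; rewrite in_itv/= => wab; apply: integral_ge0 => y /exh_sub cy.
  by rewrite lee_fin h0'.
- exact: strip_exh_meas.
- apply: (measurable_funS _ sub1) => //.
  by have /integrableP[] := cont_seg_integrable csg.
- move=> w /=; rewrite in_itv/= => wab.
  have cw : cont_seg c (c + n.+1%:R) (h w) by exact: cont_rect_slice (itvW _ wab) (ch _ cd).
  rewrite -segint_fine//; apply: ge0_subset_integral => //.
  + exact: exh_measurable.
  + by have /integrableP[] := cont_seg_integrable cw.
  + by move=> y /=; rewrite in_itv/= => /andP[cy _]; rewrite lee_fin h0// itvW.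
  + by apply: subset_itvr; rewrite bnd_simp lerDl invr_ge0.
Qed.

Lemma ray_le_seg c f (K : R) : {in `[c, +oo[, continuous f} ->
  (forall y, c <= y -> 0 <= f y) ->
  (forall d, c < d -> segint c d f <= K) ->
  (\int[mu]_(y in `]c, +oo[) (f y)%:E <= K%:E)%E.
Proof.
move=> cf f0 hK.
(* The half-line is treated as the slice of a strip whose integrand is constant in the angle, in
   order to reuse the exhaustion. *)
pose h (w y : R) := f y.
have cs : cont_strip 0 1 c h.
  move=> w y _ cy; rewrite /h.
  have hc : {for y, continuous f} by apply: cf; rewrite in_itv/= (ltW cy).
  by apply: (@continuous_comp _ _ _ snd f) => //; exact: cvg_snd.
have w01 : 0 < (2^-1 : R) < 1 by rewrite invr_gt0 ltr0n/= invf_lt1 ?ltr0n// ltr1n.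
have hge y : c < y -> 0 <= h 2^-1 y by move=> cy; exact: f0 (ltW cy).
have := strip_exh_cvg w01 cs hge => /cvg_lim <- //.
apply: lime_le.
  by apply/cvg_ex; eexists; exact: strip_exh_cvg w01 cs hge.
apply: nearW => n.
have cd : c < c + n.+1%:R by rewrite ltrDl.
have cw : cont_seg c (c + n.+1%:R) f.
  apply: cont_seg_pt => y /andP[cy _]; apply: cf; by rewrite in_itv/= cy.
apply: (@le_trans _ _ (segint c (c + n.+1%:R) f)%:E); last by rewrite lee_fin hK.
rewrite -segint_fine//; apply: ge0_subset_integral => //.
- exact: exh_measurable.
- by have /integrableP[] := cont_seg_integrable cw.
- by move=> y /=; rewrite in_itv/= => /andP[cy _]; rewrite lee_fin f0.
- by apply: subset_itvr; rewrite bnd_simp lerDl invr_ge0.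
Qed.
End StripIntegrals.

(** * The pointwise energy inequality *)

Section PointwiseIdentity.
Context {R : realFieldType}.
Variables (r s U U1 beta eta : R).
Variables (sp sp1 usw vs vsw vsy : R).
Variables (u uy uyy uww uyw v vw vy vyy vww vyw P Pw Py : R).

Let us := U + sp.
Let usy := U1 + sp1.
Let uw := - (r * vy + s * v).
Let phi := r * v.
Let phiy := r * vy + s * v.
Let alpha := s / U + r * beta.
Let p := phiy / U + beta * phi.
Let Qy := phiy - U1 / U * phi.

(* All quantities are divided by the weight [rho = r^delta] and [s] is [sqrt eps].
   The multipliers are [- r (a v)_y] and [(a v)_w] for [a = r rho / U]; with
   [b = (rho / U)_y], the parameters [beta] and [eta] are [b / rho] and
   [(r b)_y / rho].  [dens_Xw] and [dens_Yy] are exact derivatives in [w], [y]. *)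
Definition dens_Xw : R :=
  - (Pw * p + P * (r / U * vyw + alpha * vw)) + r / U * uy * uyw
  - s ^+ 2 / r ^+ 2 * (r / U) * uw * uww
  + s ^+ 2 * beta * (uww * v + uw * vw)
  + s ^+ 2 * (r / U) * vy * vyw
  - s ^+ 4 / r ^+ 2 * (r / U) * vw * vww.

Definition dens_Yy : R :=
  Py * (r / U * vw) + P * (r / U * vyw + alpha * vw)
  - (alpha * uy * uw + r / U * (uyy * uw + uy * uyw))
  + (eta * uy * phi + r * beta * (uyy * phi + uy * phiy))
  - s ^+ 2 * (alpha * vy * vw + r / U * (vyy * vw + vy * vyw)).

Definition dens_M : R := Qy ^+ 2 + (s * vw) ^+ 2.

(** What remains beside the square terms and the exact derivatives: the deviation of [us] from [U],
    the lower-order transport terms, and the terms left when viscosity is integrated by parts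
    against non-constant weights. *)
Definition dens_err : R :=
  Qy * ((U * beta + U1 / U) * phi) + (sp * phiy - sp1 * phi) * p
  + s ^+ 2 * (sp / U) * vw ^+ 2
  - usw * u * p - r * vs * uy * p - s * vs * u * p - s * us * v * p
  + alpha * uy * uw - uy * (r * beta * phiy + eta * phi) + s * uy * p
  - s ^+ 2 * beta * uw * vw - s ^+ 2 / r * u * p + 2 * s ^+ 3 / r * vw * p
  + s ^+ 2 * alpha * vy * vw - s ^+ 3 / U * vy * vw
  + 2 * s ^+ 3 / r * uw * vw / U + s ^+ 4 / r * v * vw / U
  + s ^+ 2 * vsw * u * vw / U + s ^+ 2 * r * vs * vy * vw / U
  + s ^+ 2 * r * vsy * v * vw / U - 2 * s * us * u * vw / U.

Definition dens_f : R :=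
  r^-1 * us * uw + r^-1 * usw * u + usy * v + vs * uy
  + s / r * vs * u + s / r * us * v + r^-1 * Pw
  - uyy - s / r * uy - s ^+ 2 / r ^+ 2 * uww
  + s ^+ 2 / r ^+ 2 * u - 2 * (s ^+ 2 * s) / r ^+ 2 * vw.

Definition dens_g : R :=
  r^-1 * us * vw + r^-1 * vsw * u + vs * vy + vsy * v
  - 2 / r * s^-1 * us * u + (s ^+ 2)^-1 * Py
  - vyy - s / r * vy - s ^+ 2 / r ^+ 2 * vww
  + 2 * s / r ^+ 2 * uw + s ^+ 2 / r ^+ 2 * v.

(** With [uw = - phiy] the transport part of the first equation is [us * phiy - usy * phi] against
    [p]; for [us = U] this is [Qy * (Qy + (U * beta + U1 / U) * phi)]. The mixed derivatives of the
    two multipliers agree, so the pressure occurs only inside [dens_Xw] and [dens_Yy]. *)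
Lemma energy_identity : r != 0 -> s != 0 -> U != 0 ->
  - r * p * dens_f + s ^+ 2 * (r / U * vw) * dens_g =
  dens_M + dens_Xw + dens_Yy + dens_err.
Proof.
move=> r0 s0 U0.
rewrite /dens_f /dens_g /dens_M /dens_Xw /dens_Yy /dens_err /Qy /p /alpha
  /phiy /phi /uw /us /usy.
by field; rewrite r0 s0 U0.
Qed.
End PointwiseIdentity.

(** * Size of the remainder in the energy identity *)

Section ErrorBound.
Context {R : realFieldType}.

Lemma normM_le (a b A B : R) : `|a| <= A -> `|b| <= B -> `|a * b| <= A * B.
Proof. by move=> aA bB; rewrite normrM ler_pM. Qed.

Lemma normD_le (a b A B : R) : `|a| <= A -> `|b| <= B -> `|a + b| <= A + B.
Proof. by move=> aA bB; apply: le_trans (ler_normD _ _) _; exact: lerD. Qed.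

Lemma normB_le (a b A B : R) : `|a| <= A -> `|b| <= B -> `|a - b| <= A + B.
Proof. by move=> aA bB; apply: le_trans (ler_normB _ _) _; exact: lerD. Qed.

Variables (r s U U1 beta eta : R).
Variables (sp sp1 usw vs vsw vsy : R).
Variables (u uy v vw vy : R).
Variables (K th S : R).

Let us := U + sp.
Let uw := - (r * vy + s * v).
Let phi := r * v.
Let phiy := r * vy + s * v.
Let alpha := s / U + r * beta.
Let p := phiy / U + beta * phi.
Let Qy := phiy - U1 / U * phi.

Hypotheses (K1 : 1 <= K) (s0 : 0 < s) (sth : s <= th) (th1 : th <= 1).
Hypotheses (r0 : 0 < r) (U0 : 0 < U).
Hypotheses (hr : r^-1 <= K) (hU : U^-1 <= K).
Hypotheses (hcom : `|(U * beta + U1 / U) * phi| <= K * (s * `|v|)).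
Hypotheses (hQ : `|Qy| <= K * S) (hp : `|p| <= K * S).
Hypotheses (halpha : `|alpha| <= K) (hbeta : `|beta| <= K) (hrbeta : `|r * beta| <= K).
Hypotheses (heta : `|eta * phi| <= K * S).
Hypotheses (hsp : `|sp| <= K * th) (hsp1 : `|sp1 * phi| <= K * (th * S)).
Hypotheses (husw : `|usw| <= K) (hrvs : `|r * vs| <= K) (hvs : `|vs| <= K).
Hypotheses (hus : `|us| <= K) (hvsw : `|s * vsw| <= K) (hvsy : `|r * vsy| <= K).
Hypotheses (hphiy : `|phiy| <= S) (hsv : `|s * v| <= S) (hsvw : `|s * vw| <= S).
Hypotheses (hrvy : `|r * vy| <= S) (hvy : `|vy| <= K * S).

(** Each term falls into one of two classes: quadratic in [S] with a factor [th], coming from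
    [s <= th] or from [sp], [sp1]; or [S] times [|uy|], [|u|] or [s |v|]. The numbers 12, 5, 6, 3
    count the terms of each kind with multiplicity. *)
Lemma dens_err_le :
  `|dens_err r s U U1 beta eta sp sp1 usw vs vsw vsy u uy v vw vy| <=
  K ^+ 2 * (12%:R * th * S ^+ 2 + S * (5%:R * `|uy| + 6%:R * `|u| + 3%:R * (s * `|v|))).
Proof.
have K1' := K1; have sth' := sth; have th1' := th1; have s0' := s0.
have K0 : 0 <= K by lra.
have S0 : 0 <= S by exact: le_trans hphiy.
have th0 : 0 <= th by lra.
have nu : `|u| <= `|u| by []. have nuy : `|uy| <= `|uy| by [].
have ns : `|s| <= th by rewrite gtr0_norm.
have ns2 : `|s ^+ 2| <= th.
  rewrite normrX gtr0_norm// expr2; apply: le_trans (_ : th * 1 <= _); last by rewrite mulr1.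
  by apply: ler_pM; lra.
have niU : `|U^-1| <= K by rewrite gtr0_norm ?invr_gt0.
have nir : `|r^-1| <= K by rewrite gtr0_norm ?invr_gt0.
have nuw : `|uw| <= S by rewrite normrN.
have n2 : `|2%:R : R| <= 2%:R by rewrite ger0_norm.
have nsv' : `|s * v| <= s * `|v| by rewrite normrM gtr0_norm.
have sv0 : 0 <= s * `|v| by rewrite mulr_ge0// ltW.
have aS : 0 <= `|u| * S by rewrite mulr_ge0. have bS : 0 <= `|uy| * S by rewrite mulr_ge0.
have cS : 0 <= (s * `|v|) * S by rewrite mulr_ge0.
have dS : 0 <= th * S ^+ 2 by rewrite mulr_ge0 ?sqr_ge0.
have K2 x : 0 <= x -> K * x <= K ^+ 2 * x.
  by move=> x0; rewrite expr2 -mulrA ler_peMl// mulr_ge0.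
have up x X : `|x| <= K * X -> 0 <= X -> `|x| <= K ^+ 2 * X.
  by move=> h X0; apply: (le_trans h); exact: K2.
set X1 := th * S ^+ 2 in dS *.
pose T1 := Qy * ((U * beta + U1 / U) * phi).
have b1 : `|T1| <= K ^+ 2 * ((s * `|v|) * S).
  by apply: le_trans (normM_le hQ hcom) _; rewrite le_eqVlt; apply/orP; left; apply/eqP; ring.
pose T2 := (sp * phiy - sp1 * phi) * p.
have b2 : `|T2| <= K ^+ 2 * (2%:R * X1).
  apply: le_trans (normM_le (normB_le (normM_le hsp hphiy) hsp1) hp) _.
  by rewrite /X1 le_eqVlt; apply/orP; left; apply/eqP; ring.
pose T3 := s ^+ 2 * (sp / U) * vw ^+ 2.
have b3 : `|T3| <= K ^+ 2 * X1.
  have -> : T3 = (sp * U^-1) * ((s * vw) * (s * vw)) by rewrite /T3; ring.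
  apply: le_trans (normM_le (normM_le hsp niU) (normM_le hsvw hsvw)) _.
  by rewrite /X1 le_eqVlt; apply/orP; left; apply/eqP; ring.
pose T4 := usw * u * p.
have b4 : `|T4| <= K ^+ 2 * (`|u| * S).
  apply: le_trans (normM_le (normM_le husw nu) hp) _.
  by rewrite le_eqVlt; apply/orP; left; apply/eqP; ring.
pose T5 := r * vs * uy * p.
have b5 : `|T5| <= K ^+ 2 * (`|uy| * S).
  apply: le_trans (normM_le (normM_le hrvs nuy) hp) _.
  by rewrite le_eqVlt; apply/orP; left; apply/eqP; ring.
have ns1 : `|s| <= 1 by rewrite gtr0_norm//; lra.
pose T6 := s * vs * u * p.
have b6 : `|T6| <= K ^+ 2 * (`|u| * S).
  apply: le_trans (normM_le (normM_le (normM_le ns1 hvs) nu) hp) _.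
  by rewrite le_eqVlt; apply/orP; left; apply/eqP; ring.
pose T7 := s * us * v * p.
have b7 : `|T7| <= K ^+ 2 * ((s * `|v|) * S).
  have -> : T7 = us * (s * v) * p by rewrite /T7; ring.
  apply: le_trans (normM_le (normM_le hus nsv') hp) _.
  by rewrite le_eqVlt; apply/orP; left; apply/eqP; ring.
pose T8 := alpha * uy * uw.
have b8 : `|T8| <= K ^+ 2 * (`|uy| * S).
  apply: up => //; apply: le_trans (normM_le (normM_le halpha nuy) nuw) _.
  by rewrite le_eqVlt; apply/orP; left; apply/eqP; ring.
pose T9 := uy * (r * beta * phiy + eta * phi).
have b9 : `|T9| <= K ^+ 2 * (2%:R * (`|uy| * S)).
  apply: up; last by lra.
  apply: le_trans (normM_le nuy (normD_le (normM_le hrbeta hphiy) heta)) _.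
  by rewrite le_eqVlt; apply/orP; left; apply/eqP; ring.
pose T10 := s * uy * p.
have b10 : `|T10| <= K ^+ 2 * (`|uy| * S).
  apply: up => //; apply: le_trans (normM_le (normM_le ns1 nuy) hp) _.
  by rewrite le_eqVlt; apply/orP; left; apply/eqP; ring.
pose T11 := s ^+ 2 * beta * uw * vw.
have b11 : `|T11| <= K ^+ 2 * X1.
  have -> : T11 = s * beta * uw * (s * vw) by rewrite /T11; ring.
  apply: up => //; apply: le_trans (normM_le (normM_le (normM_le ns hbeta) nuw) hsvw) _.
  by rewrite /X1 le_eqVlt; apply/orP; left; apply/eqP; ring.
pose T12 := s ^+ 2 / r * u * p.
have ns21 : `|s ^+ 2| <= 1 by apply: le_trans ns2 _.
have b12 : `|T12| <= K ^+ 2 * (`|u| * S).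
  apply: le_trans (normM_le (normM_le (normM_le ns21 nir) nu) hp) _.
  by rewrite le_eqVlt; apply/orP; left; apply/eqP; ring.
pose T13 := 2%:R * s ^+ 3 / r * vw * p.
have b13 : `|T13| <= K ^+ 2 * (2%:R * X1).
  have -> : T13 = 2%:R * s ^+ 2 * r^-1 * (s * vw) * p by rewrite /T13; ring.
  apply: le_trans (normM_le (normM_le (normM_le (normM_le n2 ns2) nir) hsvw) hp) _.
  by rewrite /X1 le_eqVlt; apply/orP; left; apply/eqP; ring.
pose T14 := s ^+ 2 * alpha * vy * vw.
have b14 : `|T14| <= K ^+ 2 * X1.
  have -> : T14 = s * alpha * vy * (s * vw) by rewrite /T14; ring.
  apply: le_trans (normM_le (normM_le (normM_le ns halpha) hvy) hsvw) _.
  by rewrite /X1 le_eqVlt; apply/orP; left; apply/eqP; ring.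
pose T15 := s ^+ 3 / U * vy * vw.
have b15 : `|T15| <= K ^+ 2 * X1.
  have -> : T15 = s ^+ 2 * U^-1 * vy * (s * vw) by rewrite /T15; ring.
  apply: le_trans (normM_le (normM_le (normM_le ns2 niU) hvy) hsvw) _.
  by rewrite /X1 le_eqVlt; apply/orP; left; apply/eqP; ring.
pose T16 := 2%:R * s ^+ 3 / r * uw * vw / U.
have b16 : `|T16| <= K ^+ 2 * (2%:R * X1).
  have -> : T16 = 2%:R * s ^+ 2 * r^-1 * U^-1 * (uw * (s * vw)) by rewrite /T16; ring.
  apply: le_trans (normM_le (normM_le (normM_le (normM_le n2 ns2) nir) niU) (normM_le nuw hsvw)) _.
  by rewrite /X1 le_eqVlt; apply/orP; left; apply/eqP; ring.
pose T17 := s ^+ 4 / r * v * vw / U.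
have b17 : `|T17| <= K ^+ 2 * X1.
  have -> : T17 = s ^+ 2 * r^-1 * U^-1 * ((s * v) * (s * vw)) by rewrite /T17; ring.
  apply: le_trans (normM_le (normM_le (normM_le ns2 nir) niU) (normM_le hsv hsvw)) _.
  by rewrite /X1 le_eqVlt; apply/orP; left; apply/eqP; ring.
pose T18 := s ^+ 2 * vsw * u * vw / U.
have b18 : `|T18| <= K ^+ 2 * (`|u| * S).
  have -> : T18 = (s * vsw) * u * (s * vw) * U^-1 by rewrite /T18; ring.
  apply: le_trans (normM_le (normM_le (normM_le hvsw nu) hsvw) niU) _.
  by rewrite le_eqVlt; apply/orP; left; apply/eqP; ring.
pose T19 := s ^+ 2 * r * vs * vy * vw / U.
have b19 : `|T19| <= K ^+ 2 * X1.
  have -> : T19 = s * vs * (r * vy) * (s * vw) * U^-1 by rewrite /T19; ring.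
  apply: le_trans (normM_le (normM_le (normM_le (normM_le ns hvs) hrvy) hsvw) niU) _.
  by rewrite /X1 le_eqVlt; apply/orP; left; apply/eqP; ring.
pose T20 := s ^+ 2 * r * vsy * v * vw / U.
have b20 : `|T20| <= K ^+ 2 * ((s * `|v|) * S).
  have -> : T20 = (r * vsy) * (s * v) * (s * vw) * U^-1 by rewrite /T20; ring.
  apply: le_trans (normM_le (normM_le (normM_le hvsy nsv') hsvw) niU) _.
  by rewrite le_eqVlt; apply/orP; left; apply/eqP; ring.
pose T21 := 2%:R * s * us * u * vw / U.
have b21 : `|T21| <= K ^+ 2 * (2%:R * (`|u| * S)).
  have -> : T21 = 2%:R * us * u * (s * vw) * U^-1 by rewrite /T21; ring.
  apply: le_trans (normM_le (normM_le (normM_le (normM_le n2 hus) nu) hsvw) niU) _.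
  by rewrite le_eqVlt; apply/orP; left; apply/eqP; ring.
have -> : dens_err r s U U1 beta eta sp sp1 usw vs vsw vsy u uy v vw vy =
  T1 + T2 + T3 - T4 - T5 - T6 - T7 + T8 - T9 + T10 - T11 - T12 + T13 + T14 - T15
  + T16 + T17 + T18 + T19 + T20 - T21 by [].
move: (normB_le (normD_le (normD_le (normD_le (normD_le (normD_le (normB_le (normD_le
  (normD_le (normB_le (normB_le (normD_le (normB_le (normD_le (normB_le (normB_le
  (normB_le (normB_le (normD_le (normD_le b1 b2) b3) b4) b5) b6) b7) b8) b9) b10)
  b11) b12) b13) b14) b15) b16) b17) b18) b19) b20) b21).
move/le_trans; apply.
by rewrite /X1 le_eqVlt; apply/orP; left; apply/eqP; ring.
Qed.
End ErrorBound.

(** * From bounds on the base flow to bounds on the coefficients *)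

Section PrimaryBounds.
Context {R : realFieldType}.

Lemma young (l x y : R) : 0 < l -> x * y <= l * x ^+ 2 + y ^+ 2 / (4%:R * l).
Proof.
move=> l0; rewrite -subr_ge0.
have -> : l * x ^+ 2 + y ^+ 2 / (4%:R * l) - x * y =
  (2%:R * l * x - y) ^+ 2 / (4%:R * l) by field; rewrite gt_eqF.
by rewrite divr_ge0 ?sqr_ge0// mulr_ge0// ltW.
Qed.

(* [U1], [U2] are the derivatives of the inlet shear flow [U]; [sp] is [u_s - U]
   and [sp1] its radial derivative. *)
Definition profile_bounds (k th s r y U U1 U2 sp sp1 usw vs vsw vsy : R) : Prop :=
  [/\ 1 <= k, [/\ 0 < s, s <= th & th <= 1], [/\ 0 < r, r <= y, r^-1 <= k & y^-1 <= k] &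
  [/\ [/\ 0 < U, U <= k & U^-1 <= k],
      `|U1| <= k * ((y ^+ 2)^-1 + s / r) /\ `|r * U2| <= k * ((y ^+ 2)^-1 + s / r),
      `|sp| <= k * th /\ `|sp1| <= k * (th * ((y ^+ 2)^-1 + s / r)) &
      [/\ `|usw| <= k, `|r * vs| <= k, `|s * vsw| <= k & `|r * vsy| <= k]]].

(** For [rho = r^delta] and [r_y = s] this is [(rho / U)_y / rho]; likewise [mult_eta] is
    [(r rho beta)_y / rho]. *)
Definition mult_beta (delta s r U U1 : R) := delta * s / (r * U) - U1 / U ^+ 2.

Definition mult_eta (delta s r U U1 U2 : R) :=
  (1 + delta) * s * mult_beta delta s r U U1 - delta * s ^+ 2 / (r * U)
  - delta * s * U1 / U ^+ 2 - r * U2 / U ^+ 2 + 2%:R * r * U1 ^+ 2 / U ^+ 3.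

Definition Ssum (s r y v vw vy : R) :=
  `|r * vy + s * v| + `|s * vw| + `|s * v| + `|r * v| / y ^+ 2.

(** A single constant for all coefficients; the factor 12 and the power 6 are those of the bound on
    [mult_eta]. *)
Definition bigK (k : R) := 12%:R * k ^+ 6.

Lemma bigK_ge (c n : nat) (k : R) : 1 <= k -> (c <= 12)%N -> (n <= 6)%N ->
  c%:R * k ^+ n <= bigK k.
Proof.
move=> k1 c12 n6; have k0 : 0 <= k by exact: le_trans ler01 _.
apply: ler_pM; rewrite ?ler0n ?exprn_ge0// ?ler_nat//.
exact: ler_weXn2l.
Qed.

Lemma Ssum_ge (s r y v vw vy : R) : 0 < y ->
  let S := Ssum s r y v vw vy in
  [/\ `|r * vy + s * v| <= S, `|s * vw| <= S, `|s * v| <= S, `|r * vy| <= S &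
     `|s * v| + `|r * v| / y ^+ 2 <= S].
Proof.
move=> y0; rewrite /Ssum /=.
have h1 : 0 <= `|r * v| / y ^+ 2 by rewrite mulr_ge0// invr_ge0 exprn_ge0 ?ltW.
have h2 := normr_ge0 (r * vy + s * v); have h3 := normr_ge0 (s * vw).
have h4 := normr_ge0 (s * v).
have h5 : `|r * vy| <= `|r * vy + s * v| + `|s * v|.
  by rewrite [X in `|X| <= _](_ : _ = (r * vy + s * v) - s * v) ?ler_normB//; ring.
by split; lra.
Qed.

Lemma profile_bounds_err k th s r y U U1 U2 sp sp1 usw vs vsw vsy delta
    u uy v vw vy : 0 <= delta <= 1 ->
  profile_bounds k th s r y U U1 U2 sp sp1 usw vs vsw vsy ->
  let beta := mult_beta delta s r U U1 in
  let eta := mult_eta delta s r U U1 U2 in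
  let K := bigK k in let S := Ssum s r y v vw vy in
  let p := (r * vy + s * v) / U + beta * (r * v) in
  [/\ `|dens_err r s U U1 beta eta sp sp1 usw vs vsw vsy u uy v vw vy| <=
  K ^+ 2 * (12%:R * th * S ^+ 2 + S * (5%:R * `|uy| + 6%:R * `|u| + 3%:R * (s * `|v|))),
  `|p| <= K * S, `|s * vw| <= S, `|beta| <= K /\ `|r * beta| <= K &
  [/\ 1 <= K, U <= K, U^-1 <= K, r^-1 <= K &
   `|U1 / U * (r * v)| <= K ^+ 2 * (`|r * v| / y ^+ 2 + s * `|v|)] /\ y^-1 <= K].
Proof.
move=> /andP[d0 d1] [k1 [s0 sth th1] [r0 ry rk yk]
  [[U0 Uk iUk] [hU1 hU2] [hsp hsp1] [husw hvs hvsw hvsy]]] beta eta K S p.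
(* Decay rate of [U1]: inverse square from the Prandtl layer, [s / r] from the slowly varying outer
   flow. The rate is adapted to [S], because [L * |r v| = |r v| / y^2 + s |v|] consists of two of
   its summands. *)
set L := (y ^+ 2)^-1 + s / r in hU1 hU2 hsp1.
have y0 : 0 < y by exact: lt_le_trans ry.
have k0 : 0 <= k by exact: le_trans k1.
have s1 : s <= 1 by exact: le_trans th1.
have th0 : 0 <= th by exact: le_trans (ltW s0) sth.
have ex (m n : nat) : (m <= n)%N -> k ^+ m <= k ^+ n by exact: ler_weXn2l.
have k_ge0 n : 0 <= k ^+ n by rewrite exprn_ge0.
have bK c n : (c <= 12)%N -> (n <= 6)%N -> c%:R * k ^+ n <= K by move=> ? ?; exact: bigK_ge.
have bK1 n : (n <= 6)%N -> k ^+ n <= K.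
  by move=> n6; rewrite -[k ^+ n]mul1r; exact: (bK 1%N).
have bk : k <= K by rewrite -[k]expr1; exact: bK1.
have k1K : 1 <= K by exact: le_trans bk.
have KE : K = 12%:R * k ^+ 6 by [].
have K0 : 0 <= K by exact: le_trans k1K.
have y20 : 0 < (y ^+ 2)^-1 by rewrite invr_gt0 exprn_gt0.
have sr0 : 0 < s / r by rewrite divr_gt0.
have L0 : 0 <= L by rewrite /L addr_ge0// ltW.
have srL : s / r <= L by rewrite /L lerDr ltW.
have rL : r * L <= 2%:R * k.
  have -> : r * L = r / y * y^-1 + s by rewrite /L; field; rewrite !gt_eqF.
  have h1 : r / y <= 1 by rewrite ler_pdivrMr// mul1r.
  have h2 : 0 <= r / y by rewrite ltW// divr_gt0.
  have : r / y * y^-1 <= 1 * k by apply: ler_pM => //; rewrite invr_ge0 ltW.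
  by rewrite mul1r; lra.
have L2 : L <= 2%:R * k ^+ 2.
  have -> : L = r^-1 * (r * L) by field; rewrite gt_eqF.
  apply: (le_trans (ler_pM _ _ rk rL)); rewrite ?invr_ge0 ?mulr_ge0 ?(ltW r0)//.
  by rewrite le_eqVlt; apply/orP; left; apply/eqP; ring.
have nr : `|r| = r by rewrite gtr0_norm.
have ns : `|s| = s by rewrite gtr0_norm.
have nU : `|U| <= k by rewrite gtr0_norm.
have niU : `|U^-1| <= k by rewrite gtr0_norm ?invr_gt0.
have nir : `|r^-1| <= k by rewrite gtr0_norm ?invr_gt0.
have nd : `|delta| <= 1 by rewrite ger0_norm.
have ns1 : `|s| <= 1 by rewrite ns.
have nsr : `|s / r| <= L by rewrite gtr0_norm.
have nU2 : `|U ^- 2| <= k ^+ 2.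
  by rewrite -exprVn normrX; apply: lerXn2r => //; rewrite nnegrE.
have nU3 : `|U ^- 3| <= k ^+ 3.
  by rewrite -exprVn normrX; apply: lerXn2r => //; rewrite nnegrE.
have hbL : `|beta| <= 2%:R * k ^+ 3 * L.
  have -> : beta = delta * (s / r) * U^-1 - U1 * U ^- 2.
    by rewrite /beta /mult_beta; field; rewrite !gt_eqF.
  apply: (le_trans (normB_le (normM_le (normM_le nd nsr) niU) (normM_le hU1 nU2))).
  have : k * L <= k ^+ 3 * L by rewrite ler_wpM2r// -{1}[k]expr1; exact: ex.
  by lra.
have hSphi : L * `|r * v| = `|r * v| / y ^+ 2 + s * `|v|.
  by rewrite /L normrM nr; field; rewrite !gt_eqF.
have [hphiy hsvw hsv hrvy hsum] := Ssum_ge s r v vw vy y0.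
rewrite -/S in hphiy hsvw hsv hrvy hsum.
have hLS : L * `|r * v| <= S.
  by rewrite hSphi -{1}ns -normrM addrC.
have S0 : 0 <= S by apply: le_trans hLS; rewrite mulr_ge0.
have up a x : 0 <= x -> a <= K -> a * x <= K * x.
  by move=> x0 ha; rewrite ler_wpM2r.
have hp : `|p| <= 3%:R * k ^+ 3 * S.
  have -> : p = U^-1 * (r * vy + s * v) + beta * (r * v) by rewrite /p; ring.
  have h2 : `|beta * (r * v)| <= 2%:R * k ^+ 3 * S.
    rewrite normrM; apply: (le_trans (ler_wpM2r (normr_ge0 _) hbL)).
    have -> : 2%:R * k ^+ 3 * L * `|r * v| = (2%:R * k ^+ 3) * (L * `|r * v|) by ring.
    by rewrite ler_wpM2l// mulr_ge0.
  apply: (le_trans (normD_le (normM_le niU hphiy) h2)).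
  have : k * S <= k ^+ 3 * S by rewrite ler_wpM2r// -{1}[k]expr1; exact: ex.
  by clear; lra.
have hrb : `|r * beta| <= 4%:R * k ^+ 4.
  rewrite normrM nr; apply: (le_trans (ler_wpM2l (ltW r0) hbL)).
  have := ler_wpM2l (_ : 0 <= 2%:R * k ^+ 3) rL.
  rewrite mulr_ge0// => /(_ isT) h; apply: le_trans (_ : 2%:R * k ^+ 3 * (r * L) <= _).
    by rewrite le_eqVlt; apply/orP; left; apply/eqP; ring.
  by apply: (le_trans h); rewrite le_eqVlt; apply/orP; left; apply/eqP; ring.
have hb : `|beta| <= 4%:R * k ^+ 5.
  apply: (le_trans hbL); have := ler_wpM2l (_ : 0 <= 2%:R * k ^+ 3) L2.
  rewrite mulr_ge0// => /(_ isT) h; apply: (le_trans h).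
  by rewrite le_eqVlt; apply/orP; left; apply/eqP; ring.
have heta : `|eta| <= 12%:R * k ^+ 6 * L.
  have -> : eta = (1 + delta) * s * beta - delta * s * (s / r) * U^-1
    - delta * s * U1 * U ^- 2 - r * U2 * U ^- 2 + 2%:R * (r * U1) * U1 * U ^- 3.
    by rewrite /eta /mult_eta -/beta; field; rewrite !gt_eqF.
  have nd2 : `|1 + delta| <= 2%:R by rewrite ger0_norm; lra.
  have n2 : `|2%:R : R| <= 2%:R by rewrite ger0_norm.
  have hrU1 : `|r * U1| <= 2%:R * k ^+ 2.
    rewrite normrM nr; apply: (le_trans (ler_wpM2l (ltW r0) hU1)).
    have := ler_wpM2l k0 rL => h; apply: le_trans (_ : k * (r * L) <= _).
      by rewrite le_eqVlt; apply/orP; left; apply/eqP; ring.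
    by apply: (le_trans h); rewrite le_eqVlt; apply/orP; left; apply/eqP; ring.
  apply: (le_trans (normD_le (normB_le (normB_le (normB_le
    (normM_le (normM_le nd2 ns1) hbL)
    (normM_le (normM_le (normM_le nd ns1) nsr) niU))
    (normM_le (normM_le (normM_le nd ns1) hU1) nU2))
    (normM_le hU2 nU2))
    (normM_le (normM_le (normM_le n2 hrU1) hU1) nU3))).
  have e3 : k * L <= k ^+ 6 * L by rewrite ler_wpM2r// -{1}[k]expr1; exact: ex.
  have e4 : k ^+ 3 * L <= k ^+ 6 * L by rewrite ler_wpM2r//; exact: ex.
  have -> : 2 * 1 * (2 * k ^+ 3 * L) + 1 * 1 * L * k + 1 * 1 * (k * L) * k ^+ 2 +
    k * L * k ^+ 2 + 2 * (2 * k ^+ 2) * (k * L) * k ^+ 3 =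
    4%:R * (k ^+ 3 * L) + k * L + k ^+ 3 * L + k ^+ 3 * L + 4%:R * (k ^+ 6 * L) by ring.
  have -> : 12%:R * k ^+ 6 * L = 12%:R * (k ^+ 6 * L) by ring.
  by move: (mulr_ge0 (k_ge0 6%N) L0) e3 e4; clear; lra.
split; last 2 first.
- by split; [apply: (le_trans hb)|apply: (le_trans hrb)]; exact: bK.
- split; last exact: le_trans bk.
  split => //; [exact: le_trans bk|exact: le_trans bk|exact: le_trans bk|].
  rewrite normrM; apply: (le_trans (ler_wpM2r (normr_ge0 _) (normM_le hU1 niU))).
  have -> : k * L * k * `|r * v| = k ^+ 2 * (L * `|r * v|) by ring.
  have Lv0 : 0 <= L * `|r * v| by rewrite mulr_ge0.
  rewrite -hSphi ler_wpM2r//; apply: lerXn2r; rewrite ?nnegrE//.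
- apply: dens_err_le => //.
  + exact: le_trans bk.
  + exact: le_trans bk.
  (* The part [- U1 / U^2] of [beta] cancels the shear; only the derivative of the weight [r^delta]
     is left. *)
  + have -> : (U * beta + U1 / U) * (r * v) = delta * (s * v).
      by rewrite /beta /mult_beta; field; rewrite !gt_eqF.
    rewrite normrM [`|s * v|]normrM ns; apply: ler_pM => //; first by rewrite mulr_ge0// ltW.
    exact: le_trans k1K.
  + have h : `|U1 * U^-1 * (r * v)| <= k ^+ 2 * S.
      rewrite normrM; apply: (le_trans (ler_wpM2r (normr_ge0 _) (normM_le hU1 niU))).
      have -> : k * L * k * `|r * v| = k ^+ 2 * (L * `|r * v|) by ring.
      by rewrite ler_wpM2l.
    apply: (le_trans (normB_le hphiy h)).
    have -> : S + k ^+ 2 * S = (1 + k ^+ 2) * S by ring.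
    apply: up => //; apply: (le_trans _ (bK 2%N 2%N isT isT)).
    by have := ex 0%N 2%N isT; rewrite expr0; clear; lra.
  + by apply: (le_trans hp); apply: up => //; exact: bK.
  + apply: (le_trans (normD_le (normM_le ns1 niU) hrb)).
    apply: (le_trans _ (bK 5%N 4%N isT isT)).
    by have := ex 1%N 4%N isT; rewrite expr1; clear; lra.
  + by apply: (le_trans hb); exact: bK.
  + by apply: (le_trans hrb); exact: bK.
  + rewrite normrM; apply: (le_trans (ler_wpM2r (normr_ge0 _) heta)).
    rewrite KE; have -> : 12%:R * k ^+ 6 * L * `|r * v| =
      (12%:R * k ^+ 6) * (L * `|r * v|) by ring.
    by rewrite ler_wpM2l// mulr_ge0.
  + by apply: (le_trans hsp); exact: up.
  + rewrite normrM; apply: (le_trans (ler_wpM2r (normr_ge0 _) hsp1)).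
    have -> : k * (th * L) * `|r * v| = k * (th * (L * `|r * v|)) by ring.
    have t0 : 0 <= th * (L * `|r * v|) by rewrite !mulr_ge0.
    apply: (@le_trans _ _ (K * (th * (L * `|r * v|)))); first exact: up.
    by rewrite ler_wpM2l// ler_wpM2l.
  + exact: le_trans bk.
  + exact: le_trans bk.
  + have -> : vs = r^-1 * (r * vs) by field; rewrite gt_eqF.
    apply: (le_trans (normM_le nir hvs)); rewrite -expr2; exact: bK1.
  + apply: (le_trans (normD_le nU hsp)).
    apply: (le_trans _ (bK 2%N 1%N isT isT)); rewrite expr1.
    have : k * th <= k * 1 by rewrite ler_wpM2l.
    by clear; lra.
  + exact: le_trans bk.
  + exact: le_trans bk.
  + have -> : vy = r^-1 * (r * vy) by field; rewrite gt_eqF.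
    by apply: (le_trans (normM_le nir hrvy)); exact: up.
- by apply: (le_trans hp); apply: up => //; exact: bK.
- exact: hsvw.
Qed.
End PrimaryBounds.

(** * Weighted sum of the energy, Hardy, Poincare and trace inequalities *)

Section FinalPointwise.
Context {R : realFieldType}.
Implicit Types K : R.

(* Weights with which the Hardy, energy, trace and Poincare inequalities are added
   up; the powers of [K] leave room for every absorption in [final_algebra]. *)
Definition k_hardy K := 10%:R * K ^+ 6.
Definition k_diss K := 4%:R + 10%:R * K ^+ 10.
Definition k_trace K := k_diss K * K ^+ 3.
Definition k_poinc K :=
  2%:R * (9%:R * k_diss K * K ^+ 4 + 10%:R * K ^+ 4 + 2%:R * k_trace K).
Definition th_max K :=
  3%:R / (4%:R * (k_diss K * (48%:R * K ^+ 2 + 8%:R) + 2%:R * k_poinc K + k_trace K)).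

Lemma k_diss_gt0 K : 1 <= K -> 4%:R <= k_diss K.
Proof. by move=> K1; rewrite /k_diss lerDl mulr_ge0// exprn_ge0// (le_trans ler01). Qed.

Lemma k_trace_gt0 K : 1 <= K -> 0 < k_trace K.
Proof.
move=> K1; have K0 : 0 < K by exact: lt_le_trans ltr01 _.
rewrite /k_trace mulr_gt0 ?exprn_gt0//; apply: lt_le_trans (k_diss_gt0 K1) => //.
Qed.

Lemma k_poinc_gt0 K : 1 <= K -> 0 < k_poinc K.
Proof.
move=> K1; have K0 : 0 < K by exact: lt_le_trans ltr01 _.
have d0 : 0 < k_diss K by apply: lt_le_trans (k_diss_gt0 K1).
by rewrite /k_poinc mulr_gt0// !addr_gt0// !mulr_gt0 ?exprn_gt0// k_trace_gt0.
Qed.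

Lemma th_max_den_gt0 K : 1 <= K ->
  0 < 4%:R * (k_diss K * (48%:R * K ^+ 2 + 8%:R) + 2%:R * k_poinc K + k_trace K).
Proof.
move=> K1; have K0 : 0 < K by exact: lt_le_trans ltr01 _.
have d0 : 0 < k_diss K by apply: lt_le_trans (k_diss_gt0 K1).
rewrite mulr_gt0//; apply: addr_gt0; last exact: k_trace_gt0.
apply: addr_gt0; last by rewrite mulr_gt0// k_poinc_gt0.
by rewrite mulr_gt0// addr_gt0// mulr_gt0// exprn_gt0.
Qed.

Lemma th_max_gt0 K : 1 <= K -> 0 < th_max K.
Proof. by move=> K1; rewrite /th_max divr_gt0// th_max_den_gt0. Qed.

Lemma le_sub_eq (a b a' b' : R) : a <= b -> b - a = b' - a' -> a' <= b'.
Proof. by move=> ab e; rewrite -subr_ge0 -e subr_ge0. Qed.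

Lemma sq_sum4 (a b c d : R) :
  (a + b + c + d) ^+ 2 <= 4%:R * (a ^+ 2 + b ^+ 2 + c ^+ 2 + d ^+ 2).
Proof.
rewrite -subr_ge0.
have -> : 4%:R * (a ^+ 2 + b ^+ 2 + c ^+ 2 + d ^+ 2) - (a + b + c + d) ^+ 2 =
  (a - b) ^+ 2 + (a - c) ^+ 2 + (a - d) ^+ 2 + (b - c) ^+ 2 + (b - d) ^+ 2
  + (c - d) ^+ 2 by ring.
by rewrite !addr_ge0 ?sqr_ge0.
Qed.

(** Differential form of the Poincare inequality: the left side is the derivative of [(th - w) u^2],
    which vanishes at [w = th] through its weight and at [w = 0] through the inflow condition. *)
Lemma poincare_pointwise (th w u uw : R) : 0 <= w <= th ->
  - u ^+ 2 + 2%:R * (th - w) * u * uw <= - (u ^+ 2) / 2%:R + 2%:R * th ^+ 2 * uw ^+ 2.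
Proof.
move=> /andP[w0 wth].
have h : (th - w) ^+ 2 * uw ^+ 2 <= th ^+ 2 * uw ^+ 2.
  rewrite ler_wpM2r ?sqr_ge0//; apply: lerXn2r; rewrite ?nnegrE ?subr_ge0//.
    exact: le_trans wth.
  by rewrite gerBl.
have : 0 <= (u - 2%:R * (th - w) * uw) ^+ 2 by exact: sqr_ge0.
have -> : (u - 2%:R * (th - w) * uw) ^+ 2 =
  u ^+ 2 - 4%:R * (th - w) * u * uw + 4%:R * ((th - w) ^+ 2 * uw ^+ 2) by ring.
by lra.
Qed.

(** The left side is the derivative of [w v^2], whose integral is [th] times the square of the trace
    at the outflow; it supplies the trace of [v] that the outflow boundary term consumes. *)
Lemma trace_pointwise (th w v vw : R) : 0 <= w <= th ->
  v ^+ 2 + 2%:R * w * v * vw <= 2%:R * v ^+ 2 + th ^+ 2 * vw ^+ 2.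
Proof.
move=> /andP[w0 wth].
have h : w ^+ 2 * vw ^+ 2 <= th ^+ 2 * vw ^+ 2.
  rewrite ler_wpM2r ?sqr_ge0//; apply: lerXn2r; rewrite ?nnegrE//.
  exact: le_trans wth.
have : 0 <= (v - w * vw) ^+ 2 by exact: sqr_ge0.
have -> : (v - w * vw) ^+ 2 = v ^+ 2 - 2%:R * w * v * vw + w ^+ 2 * vw ^+ 2 by ring.
by lra.
Qed.

(** Differential form of the Hardy inequality: the left side is [(rho q^2 / y^3)_y / rho]. Of the
    coefficient 3 one unit absorbs the derivative of the weight, since [s y <= r], and another the
    cross term. *)
Lemma hardy_pointwise (K delta s r y q qy : R) : 1 <= K -> 0 <= delta <= 1 ->
  0 < s -> 0 < r -> 0 < y -> s * y <= r -> y^-1 <= K ->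
  delta * s * q ^+ 2 / (r * y ^+ 3) + 2%:R * q * qy / y ^+ 3 - 3%:R * q ^+ 2 / y ^+ 4
  <= - (q ^+ 2 / y ^+ 4) + K ^+ 2 * qy ^+ 2.
Proof.
move=> K1 /andP[d0 d1] s0 r0 y0 sy yK.
have h1 : delta * s * q ^+ 2 / (r * y ^+ 3) <= q ^+ 2 / y ^+ 4.
  have -> : delta * s * q ^+ 2 / (r * y ^+ 3) = (delta * (s * y / r)) * (q ^+ 2 / y ^+ 4).
    by field; rewrite !gt_eqF.
  apply: ler_piMl; first by rewrite divr_ge0 ?sqr_ge0// exprn_ge0// ltW.
  by rewrite mulr_ile1// ?divr_ge0 ?mulr_ge0 ?(ltW s0) ?(ltW y0) ?(ltW r0)// ler_pdivrMr// mul1r.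
have h2 : 2%:R * q * qy / y ^+ 3 <= q ^+ 2 / y ^+ 4 + (y^-1) ^+ 2 * qy ^+ 2.
  rewrite -subr_ge0.
  have -> : q ^+ 2 / y ^+ 4 + y^-1 ^+ 2 * qy ^+ 2 - 2%:R * q * qy / y ^+ 3 =
    (q / y ^+ 2 - qy / y) ^+ 2 by field; rewrite gt_eqF.
  exact: sqr_ge0.
have h3 : (y^-1) ^+ 2 * qy ^+ 2 <= K ^+ 2 * qy ^+ 2.
  rewrite ler_wpM2r ?sqr_ge0//; apply: lerXn2r; rewrite ?nnegrE ?invr_ge0 ?(ltW y0)//.
  exact: le_trans ler01 _.
have -> : 3%:R * q ^+ 2 / y ^+ 4 = 3%:R * (q ^+ 2 / y ^+ 4) by rewrite mulrA.
by lra.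
Qed.

(* [x1, x2, x3, x4] are [|phi_y|, |s v_w|, |s v|, |phi| / y^2]. *)
Lemma final_algebra (K th S XY br x1 x2 x3 x4 au auy F G uu vv D h : R)
  (Au : R) :
  1 <= K -> 0 < th -> th <= 1 -> th <= th_max K ->
  S = x1 + x2 + x3 + x4 -> 0 <= S ->
  D + XY <= K * S * (F + G)
    + K ^+ 2 * (12%:R * th * S ^+ 2 + S * (5%:R * auy + 6%:R * au + 3%:R * x3)) ->
  2%:R * (x1 ^+ 2 + x2 ^+ 2 + x3 ^+ 2 + x4 ^+ 2) <=
    4%:R * D + 10%:R * K ^+ 4 * x3 ^+ 2 + k_hardy K * h ->
  br <= - h + K ^+ 4 * D ->
  uu <= - (au ^+ 2) / 2%:R + 2%:R * th ^+ 2 * x1 ^+ 2 ->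
  vv <= - (x3 ^+ 2) / 2%:R + 2%:R * th ^+ 2 * x2 ^+ 2 ->
  Au <= 2%:R * x3 ^+ 2 + th ^+ 2 * x2 ^+ 2 ->
  x1 ^+ 2 + x2 ^+ 2 + x3 ^+ 2 + x4 ^+ 2 + k_diss K * XY
   + k_poinc K / th * uu + k_poinc K / th * vv + k_trace K / th * Au + k_hardy K * br
  <= 12%:R * k_diss K ^+ 2 * (K ^+ 2 + 25%:R * K ^+ 4) * (auy ^+ 2 + F ^+ 2 + G ^+ 2).
Proof.
move=> K1 th0 th1 thm SE S0 hXY hm hbr huu hvv hAu.
have K0 : 0 < K by exact: lt_le_trans ltr01 _.
have kd4 := k_diss_gt0 K1.
have kd0 : 0 < k_diss K by apply: lt_le_trans kd4.
have kp0 := k_poinc_gt0 K1. have kt0 := k_trace_gt0 K1.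
set m := x1 ^+ 2 + x2 ^+ 2 + x3 ^+ 2 + x4 ^+ 2 in hm *.
set kd := k_diss K in kd4 kd0 *.
have m0 : 0 <= m by rewrite /m !addr_ge0 ?sqr_ge0.
have kp2 : 0 <= 2%:R * k_poinc K * th by rewrite ltW// mulr_gt0// mulr_gt0.
have kt2 : 0 <= k_trace K * th by rewrite ltW// mulr_gt0.
have S2 : S ^+ 2 <= 4%:R * m by rewrite SE; exact: sq_sum4.
(* With this parameter three Young terms, multiplied by [kd] and estimated by [S^2 <= 4 m], add up
   to [m / 4]. *)
pose l := (48%:R * kd)^-1.
have l0 : 0 < l by rewrite invr_gt0 mulr_gt0.
have y1 := young S (K * F) l0. have y2 := young S (K * G) l0.
have y3 := young S (5%:R * K ^+ 2 * auy) l0.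
(* For the terms in [u] and [s v] the Young parameter is [th]: the part in [S] becomes small, and
   the price [1 / th] on the other part is what the Poincare inequality, weighted by
   [k_poinc K / th], returns. *)
have y4 := young S (6%:R * K ^+ 2 * au) th0. have y5 := young S (3%:R * K ^+ 2 * x3) th0.
have lE z : z / (4%:R * l) = 12%:R * kd * z.
  by rewrite /l invfM invrK; field.
rewrite !lE in y1 y2 y3.
have tE z : z / (4%:R * th) = th^-1 * z / 4%:R by field; rewrite gt_eqF.
rewrite !tE in y4 y5.
have hD : D + XY <= 3%:R * l * S ^+ 2 + (12%:R * K ^+ 2 + 2%:R) * th * S ^+ 2
   + 12%:R * kd * (K ^+ 2 * (F ^+ 2 + G ^+ 2) + 25%:R * K ^+ 4 * auy ^+ 2)
   + th^-1 * (9%:R * K ^+ 4 * au ^+ 2 + 9%:R / 4%:R * K ^+ 4 * x3 ^+ 2).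
  apply: (le_trans hXY).
  have -> : K * S * (F + G)
    + K ^+ 2 * (12%:R * th * S ^+ 2 + S * (5%:R * auy + 6%:R * au + 3%:R * x3)) =
    S * (K * F) + S * (K * G) + S * (5%:R * K ^+ 2 * auy) + S * (6%:R * K ^+ 2 * au)
    + S * (3%:R * K ^+ 2 * x3) + 12%:R * K ^+ 2 * th * S ^+ 2 by ring.
  apply: (le_trans (lerD (lerD (lerD (lerD (lerD y1 y2) y3) y4) y5) (lexx _))).
  by rewrite le_eqVlt; apply/orP; left; apply/eqP; field; rewrite gt_eqF.
have hS1 : 3%:R * l * S ^+ 2 * kd <= m / 4%:R.
  have : 3%:R * l * kd * S ^+ 2 <= 3%:R * l * kd * (4%:R * m).
    by rewrite ler_wpM2l// !mulr_ge0// ltW.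
  have -> : 3%:R * l * kd * (4%:R * m) = m / 4%:R by rewrite /l; field; rewrite gt_eqF.
  by apply: le_trans; rewrite le_eqVlt; apply/orP; left; apply/eqP; ring.
have hS2 : kd * ((12%:R * K ^+ 2 + 2%:R) * th * S ^+ 2) <= kd * (48%:R * K ^+ 2 + 8%:R) * th * m.
  have c0 : 0 <= kd * (12%:R * K ^+ 2 + 2%:R) * th.
    by rewrite !mulr_ge0 ?addr_ge0 ?mulr_ge0 ?exprn_ge0 ?ltW.
  by apply: (le_sub_eq (ler_wpM2l c0 S2)); ring.
(* [hm] provides [2 m]: one [m] is the left side of the conclusion, [m / 4] went into Young, and the
   remaining [3 m / 4] is what [th_max] reserves for the terms with a factor [th]. *)
have hth : kd * (48%:R * K ^+ 2 + 8%:R) * th + 2%:R * k_poinc K * th + k_trace K * th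
    <= 3%:R / 4%:R.
  move: thm; rewrite /th_max ler_pdivlMr ?th_max_den_gt0// => thm.
  rewrite ler_pdivlMr//; apply: (le_sub_eq thm); rewrite -/kd; ring.
have x120 : 0 <= x1 ^+ 2 + x2 ^+ 2 <= m.
  rewrite addr_ge0 ?sqr_ge0//= /m -[X in _ <= X]addrA lerDl.
  by rewrite addr_ge0 ?sqr_ge0.
have ith0 : 0 < th^-1 by rewrite invr_gt0.
have e1 : k_poinc K / th * uu <= th^-1 * (- (k_poinc K / 2%:R * au ^+ 2))
    + 2%:R * k_poinc K * th * x1 ^+ 2.
  have c0 : 0 <= k_poinc K / th by rewrite divr_ge0// ltW.
  by apply: (le_sub_eq (ler_wpM2l c0 huu)); field; rewrite gt_eqF.
have e2 : k_poinc K / th * vv <= th^-1 * (- (k_poinc K / 2%:R * x3 ^+ 2))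
    + 2%:R * k_poinc K * th * x2 ^+ 2.
  have c0 : 0 <= k_poinc K / th by rewrite divr_ge0// ltW.
  by apply: (le_sub_eq (ler_wpM2l c0 hvv)); field; rewrite gt_eqF.
have e3 : k_trace K / th * Au <= th^-1 * (2%:R * k_trace K * x3 ^+ 2)
    + k_trace K * th * x2 ^+ 2.
  have c0 : 0 <= k_trace K / th by rewrite divr_ge0// ltW.
  by apply: (le_sub_eq (ler_wpM2l c0 hAu)); field; rewrite gt_eqF.
have kh0 : 0 <= k_hardy K by rewrite /k_hardy mulr_ge0// exprn_ge0// ltW.
(* Here [k_hardy K * K^4] is [k_diss K - 4]; the remaining [4 D] meets the [4 D] of [hm]. *)
have e4 : k_hardy K * br <= - (k_hardy K * h) + (kd - 4%:R) * D.
  by apply: (le_sub_eq (ler_wpM2l kh0 hbr)); rewrite /kd /k_diss /k_hardy; ring.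
have e5 := ler_wpM2l (ltW kd0) hD.
(* All contributions with a factor [1 / th]; [k_poinc] is twice a sum of majorants of their
   coefficients. *)
have e6 : th^-1 * (9%:R * kd * K ^+ 4 * au ^+ 2 + 9%:R / 4%:R * kd * K ^+ 4 * x3 ^+ 2
   + 2%:R * k_trace K * x3 ^+ 2 + 10%:R * K ^+ 4 * x3 ^+ 2
   - k_poinc K / 2%:R * au ^+ 2 - k_poinc K / 2%:R * x3 ^+ 2) <= 0.
  rewrite pmulr_rle0// /k_poinc -/kd.
  have -> : 9%:R * kd * K ^+ 4 * au ^+ 2 + 9%:R / 4%:R * kd * K ^+ 4 * x3 ^+ 2
    + 2%:R * k_trace K * x3 ^+ 2 + 10%:R * K ^+ 4 * x3 ^+ 2
    - 2%:R * (9%:R * kd * K ^+ 4 + 10%:R * K ^+ 4 + 2%:R * k_trace K) / 2%:R * au ^+ 2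
    - 2%:R * (9%:R * kd * K ^+ 4 + 10%:R * K ^+ 4 + 2%:R * k_trace K) / 2%:R * x3 ^+ 2
    = - ((10%:R * K ^+ 4 + 2%:R * k_trace K) * au ^+ 2
         + 27%:R / 4%:R * kd * K ^+ 4 * x3 ^+ 2) by field.
  have := ltW K0; have := ltW kd0; have := ltW kt0 => a1 a2 a3.
  have c1 : 0 <= (10%:R * K ^+ 4 + 2%:R * k_trace K) * au ^+ 2.
    by rewrite mulr_ge0 ?sqr_ge0// addr_ge0// mulr_ge0// exprn_ge0.
  have c2 : 0 <= 27%:R / 4%:R * kd * K ^+ 4 * x3 ^+ 2.
    by rewrite mulr_ge0 ?sqr_ge0// mulr_ge0 ?exprn_ge0// mulr_ge0.
  by rewrite oppr_le0 addr_ge0.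
have e7 : 10%:R * K ^+ 4 * x3 ^+ 2 <= th^-1 * (10%:R * K ^+ 4 * x3 ^+ 2).
  apply: ler_peMl; last by rewrite invf_ge1.
  by rewrite mulr_ge0 ?sqr_ge0// mulr_ge0// exprn_ge0// ltW.
have e8 : (kd * (48%:R * K ^+ 2 + 8%:R) * th + 2%:R * k_poinc K * th
    + k_trace K * th) * m <= 3%:R / 4%:R * m by rewrite ler_wpM2r.
have e9 := ler_wpM2l kp2 (proj2 (andP x120)).
have e10 : k_trace K * th * x2 ^+ 2 <= k_trace K * th * m.
  apply: ler_wpM2l => //.
  by case/andP: x120 => _; apply: le_trans; rewrite lerDr sqr_ge0.
have e11 : 300%:R * K ^+ 4 * kd ^+ 2 * auy ^+ 2 <=
    12%:R * kd ^+ 2 * (K ^+ 2 + 25%:R * K ^+ 4) * auy ^+ 2.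
  apply: ler_wpM2r; first exact: sqr_ge0.
  rewrite -subr_ge0.
  have -> : 12%:R * kd ^+ 2 * (K ^+ 2 + 25%:R * K ^+ 4) - 300%:R * K ^+ 4 * kd ^+ 2 =
    12%:R * kd ^+ 2 * K ^+ 2 by ring.
  by rewrite !mulr_ge0 ?exprn_ge0 ?sqr_ge0// ltW.
have e12 : 12%:R * kd ^+ 2 * K ^+ 2 * (F ^+ 2 + G ^+ 2) <=
    12%:R * kd ^+ 2 * (K ^+ 2 + 25%:R * K ^+ 4) * (F ^+ 2 + G ^+ 2).
  apply: ler_wpM2r; first by rewrite addr_ge0 ?sqr_ge0.
  apply: ler_wpM2l; first by rewrite mulr_ge0 ?sqr_ge0.
  by rewrite lerDl mulr_ge0 ?exprn_ge0// ltW.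
clear - hm e1 e2 e3 e4 e5 e6 e7 e8 e9 e10 e11 e12 hS1 hS2.
by lra.
Qed.
End FinalPointwise.

Section PointwiseEnergy.
Context {R : realFieldType}.

(** The inequality that is integrated. After the four squares every summand on the left is, up to
    the weight [rho], an exact derivative in [w] or in [y], so integration leaves the squares and
    boundary terms. Only [uy] and the sources stay on the right. *)
Lemma pointwise_energy (k th s r y U U1 U2 sp sp1 usw vs vsw vsy delta w : R)
    (u uy uyy uww uyw v vw vy vyy vww vyw P Pw Py : R) :
  let K := bigK k in
  let beta := mult_beta delta s r U U1 in
  let eta := mult_eta delta s r U U1 U2 in
  let uw := - (r * vy + s * v) in
  let q := r * v / U in
  let qy := (r * vy + s * v - U1 / U * (r * v)) / U in
  0 <= delta <= 1 -> profile_bounds k th s r y U U1 U2 sp sp1 usw vs vsw vsy ->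
  s * y <= r -> 0 <= w <= th -> th <= th_max K ->
  ((r * vy + s * v) ^+ 2 + (s * vw) ^+ 2 + (s * v) ^+ 2 + (r * v / y ^+ 2) ^+ 2)
  + k_diss K * (dens_Xw r s U beta uy uww uyw v vw vy vww vyw P Pw +
    dens_Yy r s U beta eta uy uyy uyw v vw vy vyy vyw P Py)
  + k_poinc K / th * (- u ^+ 2 + 2%:R * (th - w) * u * uw)
  + k_poinc K / th * (s ^+ 2 * (- v ^+ 2 + 2%:R * (th - w) * v * vw))
  + k_trace K / th * (s ^+ 2 * (v ^+ 2 + 2%:R * w * v * vw))
  + k_hardy K * (delta * s * q ^+ 2 / (r * y ^+ 3) + 2%:R * q * qy / y ^+ 3
                 - 3%:R * q ^+ 2 / y ^+ 4)
  <= 12%:R * k_diss K ^+ 2 * (K ^+ 2 + 25%:R * K ^+ 4) *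
     (uy ^+ 2
      + (r * dens_f r s U U1 sp sp1 usw vs u uy uyy uww v vw vy Pw) ^+ 2
      + (s * r * dens_g r s U sp vs vsw vsy u v vw vy vyy vww Py) ^+ 2).
Proof.
move=> K beta eta uw q qy hd hp sy hw hth.
have [k1 [s0 sth th1] [r0 ry rk yk] [[U0 Uk iUk] _ _ _]] := hp.
have y0 : 0 < y by exact: lt_le_trans ry.
have th0 : 0 < th by exact: lt_le_trans sth.
have [herr hpS hvwS hbeta [[K1 UK iUK rK hU1] yK]] :=
  profile_bounds_err u uy v vw vy hd hp.
rewrite -/K in herr hpS hbeta K1 UK iUK rK hU1 yK.
rewrite -/beta -/eta in herr hpS hbeta.
have r_neq0 : r != 0 by rewrite gt_eqF.
have s_neq0 : s != 0 by rewrite gt_eqF.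
have U_neq0 : U != 0 by rewrite gt_eqF.
set f := dens_f _ _ _ _ _ _ _ _ _ _ _ _ _ _ _ _.
set g := dens_g _ _ _ _ _ _ _ _ _ _ _ _ _ _.
have id := energy_identity U1 beta eta sp sp1 usw vs vsw vsy u uy uyy uww uyw v
  vw vy vyy vww vyw P Pw Py r_neq0 s_neq0 U_neq0.
rewrite -/f -/g in id.
set Xw := dens_Xw _ _ _ _ _ _ _ _ _ _ _ _ _ _ in id *.
set Yy := dens_Yy _ _ _ _ _ _ _ _ _ _ _ _ _ _ _ in id *.
set err := dens_err _ _ _ _ _ _ _ _ _ _ _ _ _ _ _ _ _ in id herr.
set S := Ssum s r y v vw vy in herr hpS hvwS.
set D := dens_M r s U U1 v vw vy in id.
have S0 : 0 <= S by exact: le_trans hvwS.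
have K0 : 0 <= K by exact: le_trans ler01 K1.
have sr0 : 0 <= s * r by rewrite mulr_ge0 ?ltW.
have nU : `|U^-1| = U^-1 by rewrite gtr0_norm ?invr_gt0.
have sv : s * `|v| = `|s * v| by rewrite normrM (gtr0_norm s0).
have y2 : 0 < (y ^+ 2)^-1 by rewrite invr_gt0 exprn_gt0.
have hXY : D + (Xw + Yy) <= K * S * (`|r * f| + `|s * r * g|)
    + K ^+ 2 * (12%:R * th * S ^+ 2
                + S * (5%:R * `|uy| + 6%:R * `|u| + 3%:R * `|s * v|)).
  rewrite -sv.
  have -> : D + (Xw + Yy) = - r * ((r * vy + s * v) / U + beta * (r * v)) * f
      + s ^+ 2 * (r / U * vw) * g - err by rewrite id; ring.
  rewrite [K * S * _]mulrDr; apply: lerD; last first.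
    by apply: le_trans herr; rewrite -normrN ler_norm.
  apply: lerD.
    set p := (r * vy + s * v) / U + _ in hpS *.
    have -> : - r * p * f = p * (- (r * f)) by ring.
    apply: (le_trans (ler_norm _)); rewrite normrM normrN.
    by rewrite ler_wpM2r.
  have -> : s ^+ 2 * (r / U * vw) * g = (U^-1 * (s * vw)) * (s * r * g) by ring.
  apply: (le_trans (ler_norm _)); rewrite normrM ler_wpM2r//.
  by rewrite normrM nU ler_pM// invr_ge0 ltW.
have hfin := @final_algebra _ K th S (Xw + Yy)
  (delta * s * q ^+ 2 / (r * y ^+ 3) + 2%:R * q * qy / y ^+ 3 - 3%:R * q ^+ 2 / y ^+ 4)
  `|r * vy + s * v| `|s * vw| `|s * v| (`|r * v| / y ^+ 2)
  `|u| `|uy| `|r * f| `|s * r * g|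
  (- u ^+ 2 + 2%:R * (th - w) * u * uw)
  (s ^+ 2 * (- v ^+ 2 + 2%:R * (th - w) * v * vw)) D (q ^+ 2 / y ^+ 4)
  (s ^+ 2 * (v ^+ 2 + 2%:R * w * v * vw)) K1 th0 th1 hth erefl S0 hXY.
have n2 (x : R) : `|x| ^+ 2 = x ^+ 2 by rewrite real_normK// num_real.
have x4E : (`|r * v| / y ^+ 2) ^+ 2 = (r * v / y ^+ 2) ^+ 2.
  by rewrite -[RHS]n2 [`|r * v / y ^+ 2|]normrM (gtr0_norm y2).
rewrite !n2 x4E in hfin.
have DE : D = (r * vy + s * v - U1 / U * (r * v)) ^+ 2 + (s * vw) ^+ 2 by [].
apply: hfin.
(* The difference between [phi_y] and [Qy] is [(U1 / U) phi]. The decay of [U1] lets the Hardy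
   quantity and [s v] pay for it. *)
- have hU1sq : (U1 / U * (r * v)) ^+ 2 <= 2%:R * K ^+ 4 * ((r * v / y ^+ 2) ^+ 2 + (s * v) ^+ 2).
    rewrite -[(U1 / U * (r * v)) ^+ 2]n2.
    apply: (@le_trans _ _ ((K ^+ 2 * (`|r * v| / y ^+ 2 + s * `|v|)) ^+ 2)).
      apply: lerXn2r => //; rewrite nnegrE//.
      by rewrite mulr_ge0 ?exprn_ge0// sv addr_ge0// mulr_ge0// ltW.
    rewrite sv -x4E -(n2 (s * v)).
    set a := `|r * v| / y ^+ 2; set b := `|s * v|.
    have K4 : 0 <= K ^+ 4 by rewrite exprn_ge0.
    have := mulr_ge0 K4 (sqr_ge0 (a - b)) => h.
    by apply: (le_sub_eq h); ring.
  have hd2 : (r * v / y ^+ 2) ^+ 2 <= K ^+ 2 * (q ^+ 2 / y ^+ 4).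
    have -> : (r * v / y ^+ 2) ^+ 2 = U ^+ 2 * (q ^+ 2 / y ^+ 4).
      by rewrite /q; field; rewrite U_neq0 gt_eqF.
    apply: ler_wpM2r; first by rewrite divr_ge0 ?sqr_ge0// exprn_ge0// ltW.
    by apply: lerXn2r; rewrite ?nnegrE// ltW.
  have hd3 := ler_wpM2l (exprn_ge0 4 K0) hd2.
  have K41 : 1 <= K ^+ 4 by rewrite exprn_ege1.
  rewrite DE /k_hardy.
  set Q := r * vy + s * v - _.
  have hph : (r * vy + s * v) ^+ 2 <= 2%:R * Q ^+ 2 + 2%:R * (U1 / U * (r * v)) ^+ 2.
    have := sqr_ge0 (Q - U1 / U * (r * v)) => h.
    by apply: (le_sub_eq h); rewrite /Q; ring.
  have e1 : (s * v) ^+ 2 <= K ^+ 4 * (s * v) ^+ 2 by rewrite ler_peMl// sqr_ge0.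
  have e2 : (r * v / y ^+ 2) ^+ 2 <= K ^+ 4 * (r * v / y ^+ 2) ^+ 2.
    by rewrite ler_peMl// sqr_ge0.
  have e3 : 0 <= (s * vw) ^+ 2 by exact: sqr_ge0.
  have -> : 10%:R * K ^+ 6 * (q ^+ 2 / y ^+ 4) =
     10%:R * (K ^+ 4 * (K ^+ 2 * (q ^+ 2 / y ^+ 4))) by ring.
  have -> : 10%:R * K ^+ 4 * (s * v) ^+ 2 = 10%:R * (K ^+ 4 * (s * v) ^+ 2) by ring.
  have hU' : (U1 / U * (r * v)) ^+ 2 <= 2%:R * (K ^+ 4 * (r * v / y ^+ 2) ^+ 2)
      + 2%:R * (K ^+ 4 * (s * v) ^+ 2).
    by apply: (le_sub_eq hU1sq); ring.
  move: hU' hd3 hph e1 e2 e3; clear.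
  set a1 := K ^+ 4 * (r * v / y ^+ 2) ^+ 2; set a2 := K ^+ 4 * (s * v) ^+ 2.
  set a3 := K ^+ 4 * (K ^+ 2 * _); set a4 := (U1 / U * (r * v)) ^+ 2.
  set a5 := (r * vy + s * v) ^+ 2; set a6 := (s * vw) ^+ 2; set a7 := (s * v) ^+ 2.
  set a8 := (r * v / y ^+ 2) ^+ 2; set a9 := Q ^+ 2.
  move: a1 a2 a3 a4 a5 a6 a7 a8 a9 => a1 a2 a3 a4 a5 a6 a7 a8 a9.
  by lra.
- apply: (le_trans (hardy_pointwise q qy K1 hd s0 r0 y0 sy yK)).
  rewrite lerD2l.
  have -> : K ^+ 4 * D = K ^+ 2 * (K ^+ 2 * D) by ring.
  rewrite ler_wpM2l ?exprn_ge0// /qy expr_div_n mulrC.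
  apply: ler_pM; rewrite ?invr_ge0 ?sqr_ge0//; last by rewrite DE lerDl sqr_ge0.
  by rewrite -exprVn; apply: lerXn2r; rewrite ?nnegrE// invr_ge0 ltW.
- by apply: (le_trans (poincare_pointwise u uw hw)); rewrite /uw sqrrN.
- apply: (le_trans (ler_wpM2l (sqr_ge0 s) (poincare_pointwise v vw hw))).
  by rewrite le_eqVlt; apply/orP; left; apply/eqP; field.
- apply: (le_trans (ler_wpM2l (sqr_ge0 s) (trace_pointwise v vw hw))).
  by rewrite le_eqVlt; apply/orP; left; apply/eqP; ring.
Qed.

(* The density [X] of the identity at [w = th], after the boundary conditions. *)
Lemma outflow_pointwise (K s r U beta uw vy v : R) : 1 <= K ->
  0 < r -> 0 < U -> U <= K -> `|beta| <= K -> `|r * beta| <= K ->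
  s ^+ 2 * uw ^+ 2 / (K * r) - K ^+ 3 * (s * v) ^+ 2 <=
  3%:R / 2%:R * s ^+ 2 / r ^+ 2 * (r / U) * uw ^+ 2 - s ^+ 2 * beta * uw * v
  + s ^+ 2 / 2%:R * (r / U) * vy ^+ 2.
Proof.
move=> K1 r0 U0 UK hb hrb.
have K0 : 0 < K by exact: lt_le_trans ltr01 K1.
have h1 : beta * uw * v <= uw ^+ 2 / (2%:R * (r * U)) + K ^+ 3 * v ^+ 2.
  have e : beta * uw * v <= uw ^+ 2 / (2%:R * (r * U)) + r * U * beta ^+ 2 * v ^+ 2 / 2%:R.
    have h : 0 <= (uw - r * U * beta * v) ^+ 2 / (2%:R * (r * U)).
      by rewrite divr_ge0 ?sqr_ge0// mulr_ge0// mulr_ge0// ltW.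
    by apply: (le_sub_eq h); field; rewrite !gt_eqF.
  apply: (le_trans e); rewrite lerD2l.
  have e2 : r * U * beta ^+ 2 <= K ^+ 3.
    have -> : r * U * beta ^+ 2 = U * ((r * beta) * beta) by ring.
    have -> : K ^+ 3 = K * (K * K) by ring.
    apply: (le_trans (ler_norm _)); apply: normM_le; last exact: normM_le.
    by rewrite gtr0_norm.
  have e3 := ler_wpM2r (sqr_ge0 v) e2.
  have e4 : 0 <= K ^+ 3 * v ^+ 2 by rewrite mulr_ge0 ?sqr_ge0// exprn_ge0// ltW.
  by clear - e3 e4; lra.
have h2 : uw ^+ 2 / (K * r) <= uw ^+ 2 / (r * U).
  rewrite ler_wpM2l ?sqr_ge0// lef_pV2 ?posrE ?mulr_gt0// mulrC.
  by rewrite ler_wpM2r// ltW.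
have h3 := ler_wpM2l (sqr_ge0 s) h1. have h4 := ler_wpM2l (sqr_ge0 s) h2.
have h5 : 0 <= s ^+ 2 / 2%:R * (r / U) * vy ^+ 2.
  by rewrite mulr_ge0 ?sqr_ge0// mulr_ge0 ?divr_ge0 ?sqr_ge0// ltW.
have -> : 3%:R / 2%:R * s ^+ 2 / r ^+ 2 * (r / U) * uw ^+ 2 =
  s ^+ 2 * (uw ^+ 2 / (r * U)) + s ^+ 2 * (uw ^+ 2 / (2%:R * (r * U))).
  by field; rewrite !gt_eqF.
have -> : s ^+ 2 * beta * uw * v = s ^+ 2 * (beta * uw * v) by ring.
have -> : s ^+ 2 * uw ^+ 2 / (K * r) = s ^+ 2 * (uw ^+ 2 / (K * r)) by ring.
have -> : K ^+ 3 * (s * v) ^+ 2 = s ^+ 2 * (K ^+ 3 * v ^+ 2) by ring.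
by move: h3; rewrite mulrDr; clear - h4 h5; lra.
Qed.
End PointwiseEnergy.

(** * The flux produced by the derivative of the cutoff *)

Section CutoffBound.
Context {R : realFieldType}.

(** The factor [s / r] from the logarithmic cutoff cancels the [r] of the multipliers and changes
    [v_w] and [r v] into [s v_w] and [s v]; what results is quadratic in quantities whose weighted
    integrals are finite by assumption. *)
Lemma cutoff_pointwise (K s r U rb P uy v vw vy phiy : R) :
  phiy = r * vy + s * v -> 1 <= K -> 0 < s -> s <= 1 ->
  0 < r -> r^-1 <= K -> 0 < U -> U^-1 <= K -> `|rb| <= K ->
  `|s / r * (r / U * (P * vw - uy * - phiy - s ^+ 2 * (vy * vw)) + rb * (uy * (r * v)))|
  <= K * (1 + K ^+ 2) * (P ^+ 2 + uy ^+ 2 + (phiy ^+ 2 + (s * vw) ^+ 2 + (s * v) ^+ 2)).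
Proof.
move=> phiyE K1 s0 s1 r0 rK U0 UK hrb.
have K0 : 0 <= K by exact: le_trans ler01 K1.
have -> : s / r * (r / U * (P * vw - uy * - phiy - s ^+ 2 * (vy * vw)) + rb * (uy * (r * v)))
  = U^-1 * (P * (s * vw) + s * uy * phiy - s * (s * vy) * (s * vw)) + rb * (uy * (s * v)).
  by field; rewrite !gt_eqF.
have n1 : `|U^-1| <= K by rewrite gtr0_norm ?invr_gt0.
have ns : `|s| <= 1 by rewrite gtr0_norm.
have mm (a b : R) : `|a * b| <= (a ^+ 2 + b ^+ 2) / 2%:R.
  rewrite normrM -(real_normK (num_real a)) -(real_normK (num_real b)).
  have := sqr_ge0 (`|a| - `|b|) => h.
  have h2 : 0 <= (`|a| - `|b|) ^+ 2 / 2%:R by rewrite divr_ge0.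
  by apply: (le_sub_eq h2); field.
have hvy : (s * vy) ^+ 2 <= 2%:R * K ^+ 2 * (phiy ^+ 2 + (s * v) ^+ 2).
  have -> : s * vy = s * r^-1 * (phiy - s * v) by rewrite phiyE; field; rewrite gt_eqF.
  rewrite exprMn.
  have e1 : (s * r^-1) ^+ 2 <= K ^+ 2.
    apply: lerXn2r; rewrite ?nnegrE//; first by rewrite mulr_ge0// ?invr_ge0 ltW.
    by apply: le_trans rK; rewrite ler_piMl// invr_ge0 ltW.
  have e2 : (phiy - s * v) ^+ 2 <= 2%:R * (phiy ^+ 2 + (s * v) ^+ 2).
    by apply: (le_sub_eq (sqr_ge0 (phiy + s * v))); ring.
  apply: (le_trans (ler_pM (sqr_ge0 _) (sqr_ge0 _) e1 e2)).
  by rewrite le_eqVlt; apply/orP; left; apply/eqP; ring.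
have a1 := mm P (s * vw). have a2 := mm uy phiy.
have a3 := mm (s * vy) (s * vw). have a4 := mm uy (s * v).
have b2 : `|s * uy * phiy| <= (uy ^+ 2 + phiy ^+ 2) / 2%:R.
  rewrite -mulrA normrM; apply: le_trans a2; rewrite ler_piMl//.
have b3 : `|s * (s * vy) * (s * vw)| <= ((s * vy) ^+ 2 + (s * vw) ^+ 2) / 2%:R.
  by rewrite -[s * (s * vy) * _]mulrA normrM; apply: le_trans a3; rewrite ler_piMl.
apply: (le_trans (normD_le (normM_le n1 (normB_le (normD_le a1 b2) b3)) (normM_le hrb a4))).
rewrite -mulrDr -mulrA ler_wpM2l//.
have p1 := sqr_ge0 P; have p2 := sqr_ge0 uy; have p3 := sqr_ge0 phiy.
have p4 := sqr_ge0 (s * vw); have p5 := sqr_ge0 (s * v).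
have q1 := mulr_ge0 (sqr_ge0 K) p1; have q2 := mulr_ge0 (sqr_ge0 K) p2.
have q4 := mulr_ge0 (sqr_ge0 K) p4.
rewrite !mulrDr !mulrDl !mul1r in hvy *.
move: hvy p1 p2 p3 p4 p5 q1 q2 q4.
set t1 := (s * vy) ^+ 2; set t2 := P ^+ 2; set t3 := uy ^+ 2; set t4 := phiy ^+ 2.
set t5 := (s * vw) ^+ 2; set t6 := (s * v) ^+ 2.
clear; move: t1 t2 t3 t4 t5 t6 => t1 t2 t3 t4 t5 t6.
by move=> *; lra.
Qed.
End CutoffBound.

(** * The integrated energy estimate *)

Section Schwarz.
Context {R : realType}.
Notation mu := (@lebesgue_measure R).

Lemma Ck_cont_rect k (f : R -> R -> R) (a b c d : R) : Ck k f -> cont_rect a b c d f.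
Proof. by move=> cf w y _ _; exact: Ck_ptc cf. Qed.

(* Differentiate [f w y - f w c = \int_c^y f_y (w, t) dt] in [w], then in [y]. *)
Lemma Ck_schwarz k (f : R -> R -> R) (w0 y0 : R) : Ck k.+2 f ->
  dw (dy f) w0 y0 = dy (dw f) w0 y0.
Proof.
move=> cf; have cdy := Ck_dy cf; have cdw := Ck_dw cf.
pose c := y0 - 1.
have h y : c < y < y0 + 1 -> dw f w0 y - dw f w0 c = segint c y (dw (dy f) w0).
  move=> /andP[cy _].
  have d1 : is_derive w0 1 (fun w => segint c y (dy f w)) (segint c y (dw (dy f) w0)).
    apply: (@segint_param_derive _ (w0 - 1) (w0 + 1)).
    - by lra.
    - exact: Ck_cont_rect cdy.
    - exact: Ck_cont_rect (Ck_dw cdy).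
    - by move=> w t _ _; exact: Ck_dvw cdy.
    - by apply/andP; split; lra.
  have d2 : is_derive w0 1 (fun w => f w y - f w c) (dw f w0 y - dw f w0 c).
    by apply: dvB; exact: Ck_dvw cf.
  apply: (dv_unique d2); rewrite (_ : (fun w => f w y - f w c) = (fun w => segint c y (dy f w)))//.
  apply/funext => w; symmetry; apply: (@segint_FTC _ _ _ (f w)) => //.
  - by apply: cont_seg_pt => t _; exact: dv_cont (Ck_dvy w t cdy).
  - by apply: cont_seg_pt => t _; exact: dv_cont (Ck_dvy w t cf).
  - by move=> t _; exact: Ck_dvy cf.
have cseg t : {for t, continuous (dw (dy f) w0)}.
  have hc := @Ck_ptc _ _ _ w0 t (Ck_dw cdy).
  have pc : {for t, continuous (fun y : R => (w0, y))}.
    by apply: (@cvg_pair _ _ _ _ (nbhs w0) (nbhs t)); [exact: cvg_cst|exact: cvg_id].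
  exact: (continuous_comp pc hc).
have y01 : y0 < y0 + 1 by rewrite ltrDl.
have cy0 : c < y0 by rewrite /c; lra.
have int1 : mu.-integrable `[c, (y0 + 1)] (EFin \o dw (dy f) w0).
  by apply: cont_seg_integrable; apply: cont_seg_pt => t _.
have [e1 e2] := continuous_FTC1_closed y01 int1 cy0 (cseg y0).
have d3 := derivable_dv e1; rewrite e2 in d3.
apply: (dv_unique d3).
have d4 : is_derive y0 1 (fun y => dw f w0 y - dw f w0 c) (dy (dw f) w0 y0 - 0).
  exact: (dvB (@Ck_dvy _ _ _ w0 y0 cdw) (dvC _ _)).
rewrite subr0 in d4; apply: dv_eq_near d4.
have yI : y0 \in `]c, (y0 + 1)[ by rewrite in_itv/= cy0.
near=> y; apply: h.
have : y \in `]c, (y0 + 1)[ by near: y; exact: near_in_itvoo.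
by rewrite in_itv.
Unshelve. all: by end_near. Qed.
End Schwarz.
(** Differentiates by recursion on the expression, building the derivative in an existential
    variable that is afterwards compared with the expected formula through [is_derive_eq].
    Nonvanishing of denominators is left as goals. *)
Ltac dvs :=
  lazymatch goal with
  | |- is_derive _ _ (fun _ => ?c) _ => exact: dvC
  | |- is_derive _ _ (fun t => t) _ => exact: dvI
  | |- is_derive _ _ (fun t => @?f t + @?g t) _ => eapply (@dvD _ f g); [dvs|dvs]
  | |- is_derive _ _ (fun t => - @?f t) _ => eapply (@dvN _ f); dvs
  | |- is_derive _ _ (fun t => @?f t * @?g t) _ => eapply (@dvM _ f g); [dvs|dvs]
  | |- is_derive _ _ (fun t => @?f t ^+ ?n) _ => eapply (@dvX _ f _ _ n); dvs
  | |- is_derive _ _ (fun t => (@?f t)^-1) _ => eapply (@dvV _ f); [|dvs]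
  | |- _ => match goal with
    | H : is_derive ?x _ ?f _ |- is_derive ?x _ ?f _ => exact: H
    | |- _ => idtac
    end
  end.

(** Atoms are closed only by syntactically equal hypotheses, so that unification does not unfold
    integrands; this is why continuity facts are recorded in eta-expanded form. *)
Ltac ptcs :=
  lazymatch goal with
  | |- ptc (fun _ _ => ?c) _ _ => exact: ptcC
  | |- ptc (fun w y => @?f w y + @?g w y) _ _ => apply: (@ptcD _ f g); [ptcs|ptcs]
  | |- ptc (fun w y => - @?f w y) _ _ => apply: (@ptcN _ f); ptcs
  | |- ptc (fun w y => @?f w y * @?g w y) _ _ => apply: (@ptcM _ f g); [ptcs|ptcs]
  | |- ptc (fun w y => @?f w y ^+ ?n) _ _ => apply: (@ptcX _ f n); ptcs
  | |- ptc (fun w y => (@?f w y)^-1) _ _ => apply: (@ptcV _ f); [|ptcs]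
  | |- _ => match goal with
    | H : ?T |- ?T' => constr_eq T T'; exact H
    | |- _ => idtac
    end
  end.

(** * Extension of identities from the open to the closed strip *)

Section ContinuousZero.
Context {R : realType}.

Lemma cont_right_zero (h : R -> R) (x e : R) : 0 < e -> {for x, continuous h} ->
  (forall t, x < t < x + e -> h t = 0) -> h x = 0.
Proof.
move=> e0 ch h0.
have c : h t @[t --> x^'+] --> h x by exact: cvg_at_right_filter.
apply: (cvg_unique _ c) => //.
apply: (@cvg_trans _ ((fun=> 0 : R) @ x^'+)); last exact: cvg_cst.
apply: near_eq_cvg; near=> t.
rewrite h0//; apply/andP; split; near: t; first exact: nbhs_right_gt.
by apply: nbhs_right_lt; rewrite ltrDl.
Unshelve. all: by end_near. Qed.

Lemma cont_left_zero (h : R -> R) (x e : R) : 0 < e -> {for x, continuous h} ->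
  (forall t, x - e < t < x -> h t = 0) -> h x = 0.
Proof.
move=> e0 ch h0.
have c : h t @[t --> x^'-] --> h x by exact: cvg_at_left_filter.
apply: (cvg_unique _ c) => //.
apply: (@cvg_trans _ ((fun=> 0 : R) @ x^'-)); last exact: cvg_cst.
apply: near_eq_cvg; near=> t.
rewrite h0//; apply/andP; split; near: t; last exact: nbhs_left_lt.
by apply: nbhs_left_gt; rewrite gtrBl.
Unshelve. all: by end_near. Qed.

Lemma ptc_slice_w (h : R -> R -> R) (w y : R) : ptc h w y -> {for w, continuous (h^~ y)}.
Proof.
move=> hc; have pc : {for w, continuous (fun w : R => (w, y))}.
  by apply: (@cvg_pair _ _ _ _ (nbhs w) (nbhs y)); [exact: cvg_id|exact: cvg_cst].
exact: (continuous_comp pc hc).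
Qed.

Lemma ptc_slice_y (h : R -> R -> R) (w y : R) : ptc h w y -> {for y, continuous (h w)}.
Proof.
move=> hc; have pc : {for y, continuous (fun y : R => (w, y))}.
  by apply: (@cvg_pair _ _ _ _ (nbhs w) (nbhs y)); [exact: cvg_cst|exact: cvg_id].
exact: (continuous_comp pc hc).
Qed.

(** Serves to use the divergence equation on the boundary, where the fluxes are evaluated although
    the equations hold inside only. *)
Lemma strip_zero_closure (th c : R) (h : R -> R -> R) : 0 < th ->
  (forall w y, 0 <= w <= th -> c <= y -> ptc h w y) ->
  (forall w y, 0 < w < th -> c < y -> h w y = 0) ->
  forall w y, 0 <= w <= th -> c <= y -> h w y = 0.
Proof.
move=> th0 ch h0.
have h1 w y : 0 < w < th -> c <= y -> h w y = 0.
  move=> wI; rewrite le_eqVlt => /predU1P[<-|]; last exact: h0.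
  apply: (@cont_right_zero (h w) _ 1) => //.
    by apply: ptc_slice_y; apply: ch => //; case/andP: wI => /ltW -> /ltW ->.
  by move=> t /andP[ct _]; exact: h0.
move=> w y /andP[]; rewrite le_eqVlt => /predU1P[<- _ cy|w0].
  apply: (@cont_right_zero (h^~ y) _ th) => //.
    by apply: ptc_slice_w; apply: ch => //; rewrite lexx ltW.
  by move=> t; rewrite add0r => tI; exact: h1.
rewrite le_eqVlt => /predU1P[-> cy|wth cy]; last by apply: h1 => //; rewrite w0.
apply: (@cont_left_zero (h^~ y) _ th) => //.
  by apply: ptc_slice_w; apply: ch => //; rewrite lexx ltW.
by move=> t; rewrite subrr => tI; exact: h1.
Qed.
End ContinuousZero.
Lemma ptc_for {R : realType} (h : R -> R -> R) (w y : R) : ptc h w y ->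
  {for (w, y), continuous (fun z : R * R => h z.1 z.2)}.
Proof. by []. Qed.

Section MonotoneDomain.
Context {R : realType}.
Implicit Types (a b c d e : R).

Lemma segint_sub c d e (f : R -> R) : d <= e -> cont_seg c e f ->
  (forall x, c <= x <= e -> 0 <= f x) -> segint c d f <= segint c e f.
Proof.
move=> de cf f0.
have sub : [set` `[c, d]] `<=` [set` `[c, e]] by exact: subset_itvl.
have cf' : cont_seg c d f by exact: continuous_subspaceW cf.
rewrite -lee_fin -!segint_fine//; apply: ge0_subset_integral => //.
by have /integrableP[] := cont_seg_integrable cf.
Qed.

Lemma rectint_sub a b c d e (h : R -> R -> R) : a < b -> d <= e ->
  cont_rect a b c e h -> (forall w y, a <= w <= b -> c <= y <= e -> 0 <= h w y) ->
  rectint a b c d h <= rectint a b c e h.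
Proof.
move=> ab de ch h0.
have ch' : cont_rect a b c d h.
  by move=> w y wI /andP[cy yd]; apply: ch => //; rewrite cy (le_trans yd de).
apply: segint_le; try exact: segint_param_continuous (ltW ab) _.
move=> w /andP[/ltW aw /ltW wb]; have wI : a <= w <= b by rewrite aw.
by apply: segint_sub => // [|x xI]; [exact: cont_rect_slice ch|exact: h0].
Qed.

(** Replaces the limit of a vanishing cutoff parameter. No sign is assumed on [z]; were [y < x], the
    hypothesis at [k0] would force it to be positive. *)
Lemma le_eps_slack (x y z k0 : R) : 0 < k0 ->
  (forall k, 0 < k -> k <= k0 -> x <= y + k * z) -> x <= y.
Proof.
move=> k00 h; rewrite leNgt; apply/negP => yx.
have z0 : 0 < z.
  rewrite ltNge; apply/negP => z0.
  have := h _ k00 (lexx _); apply/negP; rewrite -ltNge.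
  by apply: le_lt_trans yx; rewrite gerDl pmulr_rle0.
pose k1 := Num.min k0 ((x - y) / (2%:R * z)).
have d0 : 0 < (x - y) / (2%:R * z) by rewrite divr_gt0 ?subr_gt0// mulr_gt0.
have k1_gt0 : 0 < k1 by rewrite lt_min k00.
have := h k1 k1_gt0; rewrite ge_min lexx => /(_ isT).
apply/negP; rewrite -ltNge -ltrBrDl.
apply: (@le_lt_trans _ _ ((x - y) / (2%:R * z) * z)).
  by apply: ler_wpM2r; [exact: ltW|rewrite ge_min lexx orbT].
have -> : (x - y) / (2%:R * z) * z = (x - y) / 2%:R by field; rewrite gt_eqF.
by rewrite ltr_pdivrMr// ltr_pMr ?subr_gt0// ltr1n.
Qed.
End MonotoneDomain.

(** * Energy estimate for an abstract base flow with given pointwise bounds *)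

Section EnergyEstimate.
Context {R : realType}.
Variables (R0 s th delta k : R) (U U1 U2 : R -> R).
Variables (us vs u v P f g : R -> R -> R).

Let r (y : R) : R := R0 + s * (y - R0).
Let rho (y : R) : R := r y `^ delta.
Let K := bigK k.
Let beta (y : R) : R := mult_beta delta s (r y) (U y) (U1 y).
Let eta (y : R) : R := mult_eta delta s (r y) (U y) (U1 y) (U2 y).
Let phiy (w y : R) : R := r y * dy v w y + s * v w y.
Let q (w y : R) : R := r y * v w y / U y.
(** Primitive in [w] of [rho * Xw], as [Yf] is one in [y] of [rho * Yy], once [u_w] is replaced by
    [- phiy]. *)
Let Xf (w y : R) : R :=
  - (P w y * (rho y * (r y / U y) * dy v w y + rho y * (s / U y + r y * beta y) * v w y))
  + 2^-1 * (rho y * (r y / U y)) * dy u w y ^+ 2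
  - 2^-1 * (s ^+ 2 / r y ^+ 2) * (rho y * (r y / U y)) * dw u w y ^+ 2
  + s ^+ 2 * (rho y * beta y) * (dw u w y * v w y)
  + 2^-1 * s ^+ 2 * (rho y * (r y / U y)) * dy v w y ^+ 2
  - 2^-1 * (s ^+ 4 / r y ^+ 2) * (rho y * (r y / U y)) * dw v w y ^+ 2.

Let Yf (w y : R) : R :=
  rho y * (r y / U y) * (P w y * dw v w y - dy u w y * dw u w y
                         - s ^+ 2 * (dy v w y * dw v w y))
  + rho y * (r y * beta y) * (dy u w y * (r y * v w y)).

Let Xw (w y : R) : R := dens_Xw (r y) s (U y) (beta y) (dy u w y) (dw (dw u) w y) (dy (dw u) w y)
  (v w y) (dw v w y) (dy v w y) (dw (dw v) w y) (dy (dw v) w y) (P w y) (dw P w y).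

Let Yy (w y : R) : R := dens_Yy (r y) s (U y) (beta y) (eta y) (dy u w y) (dy (dy u) w y)
  (dy (dw u) w y) (v w y) (dw v w y) (dy v w y) (dy (dy v) w y) (dy (dw v) w y)
  (P w y) (dy P w y).

Let qy (w y : R) : R := (phiy w y - U1 y / U y * (r y * v w y)) / U y.

Let br (w y : R) : R := delta * s * q w y ^+ 2 / (r y * y ^+ 3) + 2%:R * q w y * qy w y / y ^+ 3
  - 3%:R * q w y ^+ 2 / y ^+ 4.

Let kfin : R := 12%:R * k_diss K ^+ 2 * (K ^+ 2 + 25%:R * K ^+ 4).
Let kcut : R := k_diss K * (K * (1 + K ^+ 2)).
Let bint (w y : R) : R :=
  rho y * (phiy w y ^+ 2 + (s * dw v w y) ^+ 2 + (s * v w y) ^+ 2).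
Let cint (w y : R) : R := rho y * (P w y ^+ 2 + dy u w y ^+ 2) + bint w y.
Let aint (w y : R) : R := rho y * dy u w y ^+ 2.
Let fint (w y : R) : R := rho y * ((r y * f w y) ^+ 2 + (s * r y * g w y) ^+ 2).
Let trint (y : R) : R := rho y * (s ^+ 2 * dw u th y ^+ 2 / r y).

Hypotheses (R0_gt0 : 0 < R0) (s_gt0 : 0 < s) (th_gt0 : 0 < th) (hdelta : 0 <= delta <= 1).
Hypothesis dU : forall y, R0 <= y -> is_derive y 1 U (U1 y).
Hypothesis dU1 : forall y, R0 <= y -> is_derive y 1 U1 (U2 y).
Hypothesis cU2 : forall y, R0 <= y -> {for y, continuous U2}.
Hypothesis U_gt0 : forall y, R0 <= y -> 0 < U y.
Hypothesis hprof : forall w y : R, 0 < w < th -> R0 < y ->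
  profile_bounds k th s (r y) y (U y) (U1 y) (U2 y) (us w y - U y)
    (dy us w y - U1 y) (dw us w y) (vs w y) (dw vs w y) (dy vs w y).
Hypothesis hth : th <= th_max K.
Hypotheses (cu : Ck 2 u) (cv : Ck 2 v) (cP : Ck 1 P).
Hypothesis hmw : forall w y : R, 0 < w < th -> R0 < y ->
  dens_f (r y) s (U y) (U1 y) (us w y - U y) (dy us w y - U1 y) (dw us w y) (vs w y)
    (u w y) (dy u w y) (dy (dy u) w y) (dw (dw u) w y) (v w y) (dw v w y) (dy v w y)
    (dw P w y) = f w y.
Hypothesis hmr : forall w y : R, 0 < w < th -> R0 < y ->
  dens_g (r y) s (U y) (us w y - U y) (vs w y) (dw vs w y) (dy vs w y)
    (u w y) (v w y) (dw v w y) (dy v w y) (dy (dy v) w y) (dw (dw v) w y)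
    (dy P w y) = g w y.
Hypothesis hdiv : forall w y : R, 0 < w < th -> R0 < y -> dw u w y + phiy w y = 0.
Hypothesis bc0 : forall y, R0 <= y -> u 0 y = 0 /\ v 0 y = 0.
Hypothesis bcR : forall w : R, 0 <= w <= th -> u w R0 = 0 /\ v w R0 = 0.
Hypothesis bcth : forall y, R0 <= y ->
  s ^+ 2 * dw v th y + r y * dy u th y = 0 /\ P th y * r y = 2%:R * s ^+ 2 * dw u th y.
Hypotheses (cf : cont_strip 0 th R0 f) (cg : cont_strip 0 th R0 g).

Let r_gt0 (y : R) : R0 <= y -> 0 < r y.
Proof. by move=> hy; rewrite /r ltr_wpDr// mulr_ge0// ?subr_ge0// ltW. Qed.

Let y_gt0 (y : R) : R0 <= y -> 0 < y.
Proof. exact: lt_le_trans. Qed.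

Let rho_gt0 (y : R) : R0 <= y -> 0 < rho y.
Proof. by move=> hy; rewrite /rho powR_gt0// r_gt0. Qed.

Let dr (y : R) : is_derive y 1 r s.
Proof.
rewrite /r; eapply is_derive_eq; first by dvs.
by ring.
Qed.

Let drho (y : R) : R0 <= y -> is_derive y 1 rho (rho y * (delta * s / r y)).
Proof.
move=> hy; have ry := r_gt0 hy.
have h := dv_comp (is_derive1_powR delta ry) (dr y).
apply: (is_derive_eq h); rewrite /rho.
have -> : r y `^ (delta - 1) = r y `^ delta / r y.
  rewrite powRB; last by rewrite (gt_eqF ry) implybT.
  by rewrite powRr1// ltW.
by ring.
Qed.

Let dbeta (y : R) : R0 <= y -> is_derive y 1 (fun y => rho y * (r y * beta y)) (rho y * eta y).
Proof.
move=> hy; have ry := r_gt0 hy; have Uy := U_gt0 hy.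
have dry := dr y; have drhoy := drho hy; have dUy := dU hy; have dU1y := dU1 hy.
rewrite /beta /mult_beta.
eapply is_derive_eq; first by dvs; rewrite ?mulf_neq0 ?expf_neq0 ?gt_eqF.
by rewrite /eta /mult_eta /mult_beta; field; rewrite !gt_eqF.
Qed.

Let dA (y : R) : R0 <= y ->
  is_derive y 1 (fun y => rho y * (r y / U y)) (rho y * (s / U y + r y * beta y)).
Proof.
move=> hy; have ry := r_gt0 hy; have Uy := U_gt0 hy.
have dry := dr y; have drhoy := drho hy; have dUy := dU hy.
eapply is_derive_eq; first by dvs; rewrite gt_eqF.
by rewrite /beta /mult_beta; field; rewrite !gt_eqF.
Qed.

Let div_closed (w y : R) : 0 <= w <= th -> R0 <= y -> dw u w y = - phiy w y.
Proof.
move=> wI hy; apply/eqP; rewrite -addr_eq0; apply/eqP.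
apply: (@strip_zero_closure _ th R0 (fun w y => dw u w y + phiy w y)) => // {wI hy}w {}y _ hy.
have c1 := @Ck_ptc _ _ _ w y (Ck_dw cu). have c2 := @Ck_ptc _ _ _ w y (Ck_dy cv).
have c3 := @Ck_ptc _ _ _ w y cv.
have c4 : ptc (fun _ y => r y) w y by apply: (@ptc_y _ r); exact: dv_cont (dr y).
by rewrite /phiy; ptcs.
Qed.

Let ptc_facts (w y : R) : R0 <= y ->
  [/\ [/\ ptc (fun w y => u w y) w y, ptc (fun w y => v w y) w y & ptc (fun w y => P w y) w y],
      [/\ ptc (fun w y => dw u w y) w y, ptc (fun w y => dw v w y) w y,
          ptc (fun w y => dy u w y) w y & ptc (fun w y => dy v w y) w y] &
      [/\ ptc (fun _ y => r y) w y & ptc (fun _ y => rho y) w y] /\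
      [/\ ptc (fun _ y => U y) w y, ptc (fun _ y => U1 y) w y, ptc (fun _ y => U2 y) w y,
          ptc (fun w _ => w) w y & ptc (fun _ y => y) w y]].
Proof.
move=> hy; split.
- by split; [exact: Ck_ptc cu|exact: Ck_ptc cv|exact: Ck_ptc cP].
- by split; [exact: Ck_ptc (Ck_dw cu)|exact: Ck_ptc (Ck_dw cv)|
             exact: Ck_ptc (Ck_dy cu)|exact: Ck_ptc (Ck_dy cv)].
split; split.
- exact: (@ptc_y _ _ _ _ (dv_cont (dr y))).
- exact: (@ptc_y _ _ _ _ (dv_cont (drho hy))).
- exact: (@ptc_y _ _ _ _ (dv_cont (dU hy))).
- exact: (@ptc_y _ _ _ _ (dv_cont (dU1 hy))).
- exact: (@ptc_y _ _ _ _ (cU2 hy)).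
- exact: (@ptc_w _ id).
- exact: (@ptc_y _ id).
Qed.

Let ptc_facts2 (w y : R) :
  [/\ ptc (fun w y => dw (dw u) w y) w y, ptc (fun w y => dy (dw u) w y) w y &
      ptc (fun w y => dy (dy u) w y) w y] /\
  [/\ ptc (fun w y => dw (dw v) w y) w y, ptc (fun w y => dy (dw v) w y) w y,
      ptc (fun w y => dy (dy v) w y) w y, ptc (fun w y => dw P w y) w y &
      ptc (fun w y => dy P w y) w y].
Proof.
split; split.
- exact: Ck_ptc (Ck_dw (Ck_dw cu)).
- exact: Ck_ptc (Ck_dy (Ck_dw cu)).
- exact: Ck_ptc (Ck_dy (Ck_dy cu)).
- exact: Ck_ptc (Ck_dw (Ck_dw cv)).
- exact: Ck_ptc (Ck_dy (Ck_dw cv)).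
- exact: Ck_ptc (Ck_dy (Ck_dy cv)).
- exact: Ck_ptc (Ck_dw cP).
- exact: Ck_ptc (Ck_dy cP).
Qed.

Let neqs (y : R) : R0 <= y -> [/\ r y != 0, U y != 0 & y != 0].
Proof.
by move=> hy; rewrite !gt_eqF//; [exact: y_gt0|exact: U_gt0|exact: r_gt0].
Qed.

Let int_ptc (w y : R) : R0 <= y -> [/\ ptc bint w y, ptc cint w y & ptc aint w y].
Proof.
move=> hy; have [[? ? ?] [? ? ? ?] [[? ?] [? ? ? ? ?]]] := ptc_facts w hy.
by split; rewrite /cint /bint /aint /phiy; ptcs.
Qed.

Let K1 : 1 <= K.
Proof.
have y1 : R0 < R0 + 1 by rewrite ltrDl.
have w1 : 0 < th / 2%:R < th by rewrite divr_gt0//= ltr_pdivrMr// ltr_pMr// ltr1n.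
have [k1 _ _ _] := hprof w1 y1.
by have := bigK_ge k1 (isT : (1 <= 12)%N) (isT : (0 <= 6)%N); rewrite expr0 mul1r.
Qed.

Let kd_gt0 : 0 < k_diss K.
Proof. by apply: lt_le_trans (k_diss_gt0 K1). Qed.

(** These bounds concern functions of [y] alone, so they are read off at the middle angle. *)
Let profile_facts (y : R) : R0 < y ->
  [/\ s <= 1, `|beta y| <= K, `|r y * beta y| <= K & (U y)^-1 <= K] /\
  [/\ U y <= K, (r y)^-1 <= K & s * y <= r y].
Proof.
move=> hy.
have w1 : 0 < th / 2%:R < th by rewrite divr_gt0//= ltr_pdivrMr// ltr_pMr// ltr1n.
have hp := hprof w1 hy.
have [_ _ _ [b1 b2] [[_ UK iUK rK _] _]] :=
  profile_bounds_err (u (th / 2%:R) y) (dy u (th / 2%:R) y) (v (th / 2%:R) y)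
    (dw v (th / 2%:R) y) (dy v (th / 2%:R) y) hdelta hp.
have [_ [_ sth th1] _ _] := hp.
have s1 : s <= 1 by exact: le_trans th1.
split; split => //.
rewrite /r mulrBr addrA [R0 + _]addrC -addrA lerDl subr_ge0.
by rewrite ler_piMl// ltW.
Qed.

Let fint_cont : cont_strip 0 th R0 fint.
Proof.
move=> w y wI hy; apply: ptc_for.
have [_ _ [[? ?] [? ? ? ? ?]]] := ptc_facts w (ltW hy).
have cfp : ptc (fun w y => f w y) w y by exact: cf.
have cgp : ptc (fun w y => g w y) w y by exact: cg.
by rewrite /fint; ptcs.
Qed.

Let kfin_ge0 : 0 <= kfin.
Proof.
have K0 := le_trans ler01 K1.
rewrite /kfin; apply: mulr_ge0; first by rewrite mulr_ge0 ?sqr_ge0.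
by apply: addr_ge0; [exact: exprn_ge0|rewrite mulr_ge0 ?exprn_ge0].
Qed.

Let fint_ge0 (w y : R) : 0 < w < th -> R0 < y -> 0 <= fint w y.
Proof.
move=> _ hy; rewrite /fint mulr_ge0 ?(ltW (rho_gt0 (ltW hy)))//.
by rewrite addr_ge0 ?sqr_ge0.
Qed.

Section Cutoff.
Variables (kap N : R).
(** Equals 1 at the wall and 0 where [r = R0 exp (1 / kap)], with derivative [- kap s / r]: its
    transition is spread over so many scales that the flux is controlled and has the small factor
    [kap]. *)
Let chi (y : R) : R := 1 - kap * ln (r y / R0).

(** The weights [th - w] are those of the Poincare inequalities and vanish at the outflow; the
    weight [w] of the trace inequality vanishes at the inflow. *)
Let Xt (w y : R) : R := chi y * (k_diss K * Xf w y + rho y * (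
    k_poinc K / th * ((th - w) * u w y ^+ 2)
  + k_poinc K / th * (s ^+ 2 * ((th - w) * v w y ^+ 2))
  + k_trace K / th * (s ^+ 2 * (w * v w y ^+ 2)))).

Let Yt (w y : R) : R := chi y * (k_diss K * Yf w y + k_hardy K * (rho y * (q w y ^+ 2 / y ^+ 3))).

Let dXt (w y : R) : R := chi y * (k_diss K * (rho y * Xw w y) + rho y * (
    k_poinc K / th * (- u w y ^+ 2 + 2%:R * (th - w) * u w y * - phiy w y)
  + k_poinc K / th * (s ^+ 2 * (- v w y ^+ 2 + 2%:R * (th - w) * v w y * dw v w y))
  + k_trace K / th * (s ^+ 2 * (v w y ^+ 2 + 2%:R * w * v w y * dw v w y)))).

Let dYt (w y : R) : R := - (kap * (s / r y)) *
    (k_diss K * Yf w y + k_hardy K * (rho y * (q w y ^+ 2 / y ^+ 3)))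
  + chi y * (k_diss K * (rho y * Yy w y) + k_hardy K * (rho y * br w y)).

Hypotheses (kap_gt0 : 0 < kap) (R0N : R0 < N) (hN : r N = R0 * expR kap^-1).

Let dchi (y : R) : R0 <= y -> is_derive y 1 chi (- (kap * (s / r y))).
Proof.
move=> hy; have ry := r_gt0 hy.
have ry' : 0 < r y / R0 by rewrite divr_gt0.
have d1 : is_derive y 1 (fun y => r y / R0) (s / R0).
  have dry := dr y.
  by eapply is_derive_eq; [dvs|ring].
have d2 := @dv_comp R (@ln R) (fun y => r y / R0) y _ _ (is_derive1_ln ry') d1.
rewrite /chi; eapply is_derive_eq; first by dvs.
by field; rewrite !gt_eqF.
Qed.

Let dXt_deriv (w y : R) : 0 <= w <= th -> R0 <= y -> is_derive w 1 (Xt^~ y) (dXt w y).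
Proof.
move=> wI hy; have ry := r_gt0 hy; have Uy := U_gt0 hy.
have d1 := @Ck_dvw _ _ _ w y cu. have d2 := @Ck_dvw _ _ _ w y cv.
have d3 := @Ck_dvw _ _ _ w y cP. have d4 := @Ck_dvw _ _ _ w y (Ck_dw cu).
have d5 := @Ck_dvw _ _ _ w y (Ck_dy cu). have d6 := @Ck_dvw _ _ _ w y (Ck_dw cv).
have d7 := @Ck_dvw _ _ _ w y (Ck_dy cv).
rewrite (Ck_schwarz _ _ cu) in d5; rewrite (Ck_schwarz _ _ cv) in d7.
rewrite /Xt /Xf /=.
eapply is_derive_eq; first by dvs.
rewrite /= (div_closed wI hy) /dXt /Xw /dens_Xw /phiy !expr1.
have {}ry : r y != 0 by rewrite gt_eqF. have {}Uy : U y != 0 by rewrite gt_eqF.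
have th0 : th != 0 by rewrite gt_eqF.
move: ry Uy th0.
move: (k_diss K) (k_poinc K) (k_trace K) (chi y) (rho y) (beta y) (r y) (U y).
move: (P w y) (dw P w y) (u w y) (dy u w y) (dw (dw u) w y) (dy (dw u) w y).
move: (v w y) (dw v w y) (dy v w y) (dw (dw v) w y) (dy (dw v) w y).
by move=> *; field; repeat (apply/andP; split).
Qed.

Let dYt_deriv (w y : R) : 0 <= w <= th -> R0 <= y -> is_derive y 1 (Yt w) (dYt w y).
Proof.
move=> wI hy; have ry := r_gt0 hy; have Uy := U_gt0 hy; have y0 := y_gt0 hy.
have d1 : is_derive y 1 (fun y => u w y) _ := @Ck_dvy _ _ _ w y cu.
have d2 : is_derive y 1 (fun y => v w y) _ := @Ck_dvy _ _ _ w y cv.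
have d3 : is_derive y 1 (fun y => P w y) _ := @Ck_dvy _ _ _ w y cP.
have d4 : is_derive y 1 (fun y => dw u w y) _ := @Ck_dvy _ _ _ w y (Ck_dw cu).
have d5 : is_derive y 1 (fun y => dy u w y) _ := @Ck_dvy _ _ _ w y (Ck_dy cu).
have d6 : is_derive y 1 (fun y => dw v w y) _ := @Ck_dvy _ _ _ w y (Ck_dw cv).
have d7 : is_derive y 1 (fun y => dy v w y) _ := @Ck_dvy _ _ _ w y (Ck_dy cv).
have dry := dr y; have drhoy := drho hy; have dUy := dU hy; have dchiy := dchi hy.
have dAy := dA hy; have dBy := dbeta hy.
pose A y := rho y * (r y / U y); pose B y := rho y * (r y * beta y).
have dA' : is_derive y 1 (fun y => A y) _ := dAy.
have dB' : is_derive y 1 (fun y => B y) _ := dBy.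
have YtE : Yt w = fun y => chi y * (k_diss K * (A y * (P w y * dw v w y
   - dy u w y * dw u w y - s ^+ 2 * (dy v w y * dw v w y))
   + B y * (dy u w y * (r y * v w y)))
   + k_hardy K * (rho y * ((r y * v w y / U y) ^+ 2 / y ^+ 3))) by [].
rewrite YtE.
eapply is_derive_eq; first by dvs; rewrite ?expf_neq0 ?gt_eqF.
rewrite /= /dYt /Yf /Yy /dens_Yy (div_closed wI hy) /br /q /qy /phiy /A /B !expr1.
have {}ry : r y != 0 by rewrite gt_eqF. have {}Uy : U y != 0 by rewrite gt_eqF.
have {}y0 : y != 0 by rewrite gt_eqF.
move: ry Uy y0.
move: (k_diss K) (k_hardy K) (chi y) (rho y) (beta y) (eta y) (r y) (U y) (U1 y).
move: (P w y) (dy P w y) (dy u w y) (dy (dy u) w y) (dy (dw u) w y).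
move: (v w y) (dw v w y) (dy v w y) (dy (dy v) w y) (dy (dw v) w y).
by move=> *; field; repeat (apply/andP; split).
Qed.
Lemma chi_ptc (w y : R) : R0 <= y -> ptc (fun _ y => chi y) w y.
Proof. by move=> hy; exact: (@ptc_y _ _ _ _ (dv_cont (dchi hy))). Qed.

Let Xt_cont : cont_rect 0 th R0 N Xt.
Proof.
move=> w y _ /andP[hy _]; apply: ptc_for.
have [[? ? ?] [? ? ? ?] [[? ?] [? ? ? ? ?]]] := ptc_facts w hy.
have ? := @chi_ptc w y hy.
have [hr0 hU0 hy0] := neqs hy.
rewrite /Xt /Xf /beta /mult_beta.
by ptcs; rewrite ?mulf_neq0 ?expf_neq0.
Qed.

Let Yt_cont : cont_rect 0 th R0 N Yt.
Proof.
move=> w y _ /andP[hy _]; apply: ptc_for.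
have [[? ? ?] [? ? ? ?] [[? ?] [? ? ? ? ?]]] := ptc_facts w hy.
have ? := @chi_ptc w y hy.
have [hr0 hU0 hy0] := neqs hy.
rewrite /Yt /Yf /q /beta /mult_beta.
by ptcs; rewrite ?mulf_neq0 ?expf_neq0.
Qed.

Let dXt_cont : cont_rect 0 th R0 N dXt.
Proof.
move=> w y _ /andP[hy _]; apply: ptc_for.
have [[? ? ?] [? ? ? ?] [[? ?] [? ? ? ? ?]]] := ptc_facts w hy.
have ? := @chi_ptc w y hy.
have [[? ? ?] [? ? ? ? ?]] := ptc_facts2 w y.
have [hr0 hU0 hy0] := neqs hy.
rewrite /dXt /Xw /dens_Xw /phiy /beta /mult_beta /=.
by ptcs; rewrite ?mulf_neq0 ?expf_neq0.
Qed.

Let dYt_cont : cont_rect 0 th R0 N dYt.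
Proof.
move=> w y _ /andP[hy _]; apply: ptc_for.
have [[? ? ?] [? ? ? ?] [[? ?] [? ? ? ? ?]]] := ptc_facts w hy.
have ? := @chi_ptc w y hy.
have [[? ? ?] [? ? ? ? ?]] := ptc_facts2 w y.
have [hr0 hU0 hy0] := neqs hy.
rewrite /dYt /br /Yf /Yy /dens_Yy /q /qy /phiy /eta /mult_eta /beta /mult_beta /=.
by ptcs; rewrite ?mulf_neq0 ?expf_neq0.
Qed.

Lemma chi_bound (y : R) : R0 <= y <= N -> 0 <= chi y <= 1.
Proof.
move=> /andP[hy yN]; have ry := r_gt0 hy.
have h1 : 1 <= r y / R0.
  by rewrite ler_pdivlMr// mul1r /r lerDl mulr_ge0 ?subr_ge0// ltW.
have l0 : 0 <= ln (r y / R0) by exact: ln_ge0.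
have l1 : ln (r y / R0) <= kap^-1.
  rewrite -[X in _ <= X]expRK ler_ln ?posrE ?expR_gt0 ?divr_gt0//.
  rewrite ler_pdivrMr// mulrC -hN /r lerD2l ler_wpM2l ?(ltW s_gt0)//.
  by rewrite lerD2r.
rewrite /chi; apply/andP; split.
  rewrite subr_ge0; apply: (le_trans (ler_wpM2l (ltW kap_gt0) l1)).
  by rewrite mulfV ?gt_eqF.
by rewrite gerBl mulr_ge0// ltW.
Qed.

Let chi_N : chi N = 0.
Proof.
rewrite /chi hN [R0 * _]mulrC mulfK ?gt_eqF// expRK mulfV ?subrr ?gt_eqF//.
Qed.

(** [chi * rho] times the pointwise inequality, with the derivative of [chi] added. Where it meets
    [Yf] it is paid by [kap * kcut * cint]; where it meets the Hardy flux it has the favourable sign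
    because [chi] decreases. *)
Let energy_pointwise (w y : R) : 0 < w < th -> R0 < y < N ->
  chi y * bint w y + dXt w y + dYt w y - kfin * aint w y - kap * kcut * cint w y
  <= kfin * fint w y.
Proof.
move=> wI /andP[hy yN]; have hy' := ltW hy.
have ry := r_gt0 hy'; have Uy := U_gt0 hy'; have ry0 := rho_gt0 hy'.
have yI : R0 <= y <= N by rewrite hy' ltW.
have /andP[c0 c1] := chi_bound yI.
have [[s1 hb1 hb2 iUK] [UK rK sy]] := profile_facts hy.
have wI' : 0 <= w <= th by case/andP: wI => /ltW -> /ltW ->.
have pe := pointwise_energy (u w y) (dy u w y) (dy (dy u) w y) (dw (dw u) w y)
  (dy (dw u) w y) (v w y) (dw v w y) (dy v w y) (dy (dy v) w y) (dw (dw v) w y)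
  (dy (dw v) w y) (P w y) (dw P w y) (dy P w y) hdelta (hprof wI hy) sy wI' hth.
rewrite (hmw wI hy) (hmr wI hy) -/K -/(beta y) -/(eta y) -/(q w y) -/kfin in pe.
rewrite -/(phiy w y) -/(qy w y) -/(br w y) -/(Xw w y) -/(Yy w y) in pe.
have kfin0 : 0 <= kfin.
  have K0 := le_trans ler01 K1.
  rewrite /kfin; apply: mulr_ge0; first by rewrite mulr_ge0 ?sqr_ge0.
  by apply: addr_ge0; [exact: exprn_ge0|rewrite mulr_ge0 ?exprn_ge0].
have cr0 : 0 <= chi y * rho y by rewrite mulr_ge0// ltW.
have h1 := ler_wpM2l cr0 pe.
set G := dy u w y ^+ 2 + _ + _ in h1.
have G0 : 0 <= G by rewrite /G !addr_ge0 ?sqr_ge0.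
have h2 : chi y * rho y * (kfin * G) <= kfin * (rho y * G).
  have -> : chi y * rho y * (kfin * G) = chi y * (kfin * (rho y * G)) by ring.
  by rewrite ler_piMl// mulr_ge0// mulr_ge0// ltW.
have h3 : 0 <= chi y * rho y * (r y * v w y / y ^+ 2) ^+ 2.
  by rewrite mulr_ge0 ?sqr_ge0.
have h4 : 0 <= kap * (s / r y) * (k_hardy K * (rho y * (q w y ^+ 2 / y ^+ 3))).
  have K0 := le_trans ler01 K1.
  have kh0 : 0 <= k_hardy K by rewrite /k_hardy mulr_ge0// exprn_ge0.
  have y30 : 0 <= y ^+ 3 by rewrite exprn_ge0// ltW// y_gt0.
  have a1 : 0 <= kap * (s / r y) by rewrite ltW// mulr_gt0// divr_gt0.
  have a2 : 0 <= q w y ^+ 2 / y ^+ 3 by rewrite mulr_ge0 ?sqr_ge0// invr_ge0.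
  by rewrite mulr_ge0// mulr_ge0// mulr_ge0// ltW.
have cb := @cutoff_pointwise _ K s (r y) (U y) (r y * beta y) (P w y) (dy u w y) (v w y)
  (dw v w y) (dy v w y) (phiy w y) erefl K1 s_gt0 s1 ry rK Uy iUK hb2.
have YfE : s / r y * Yf w y = rho y * (s / r y *
   (r y / U y * (P w y * dw v w y - dy u w y * - phiy w y - s ^+ 2 * (dy v w y * dw v w y))
    + r y * beta y * (dy u w y * (r y * v w y)))).
  by rewrite /Yf (div_closed wI' hy'); ring.
have h5 : - (kap * k_diss K * (s / r y * Yf w y)) <= kap * kcut * cint w y.
  apply: (le_trans (ler_norm _)); rewrite normrN normrM ger0_norm; last first.
    by rewrite mulr_ge0// ltW.
  have -> : kap * kcut * cint w y = kap * k_diss K * (K * (1 + K ^+ 2) * cint w y).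
    by rewrite /kcut; ring.
  apply: ler_wpM2l; first by rewrite mulr_ge0// ltW.
  rewrite YfE normrM (gtr0_norm ry0).
  apply: (le_trans (ler_wpM2l (ltW ry0) cb)).
  by rewrite le_eqVlt; apply/orP; left; apply/eqP; rewrite /cint /bint; ring.
have e1 : chi y * bint w y + dXt w y + dYt w y =
  chi y * rho y *
   (phiy w y ^+ 2 + (s * dw v w y) ^+ 2 + (s * v w y) ^+ 2 + (r y * v w y / y ^+ 2) ^+ 2 +
    k_diss K * (Xw w y + Yy w y) +
    k_poinc K / th * (- u w y ^+ 2 + 2 * (th - w) * u w y * - phiy w y) +
    k_poinc K / th * (s ^+ 2 * (- v w y ^+ 2 + 2 * (th - w) * v w y * dw v w y)) +
    k_trace K / th * (s ^+ 2 * (v w y ^+ 2 + 2 * w * v w y * dw v w y)) +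
    k_hardy K * br w y)
  - chi y * rho y * (r y * v w y / y ^+ 2) ^+ 2
  - kap * (s / r y) * (k_hardy K * (rho y * (q w y ^+ 2 / y ^+ 3)))
  - kap * k_diss K * (s / r y * Yf w y).
  by rewrite /dXt /dYt /bint; ring.
rewrite e1.
have e2 : kfin * (rho y * G) = kfin * aint w y + kfin * fint w y.
  by rewrite /G /aint /fint; ring.
rewrite e2 in h2.
move: h1 h2 h3 h4 h5.
set t1 := chi y * rho y * (_ + _ + _ + _ + _); set t2 := chi y * rho y * _ ^+ 2.
set t3 := kap * (s / r y) * _; set t4 := kap * k_diss K * _; set t5 := kfin * aint w y.
set t6 := kap * kcut * _; set t7 := kfin * fint w y; set t8 := chi y * rho y * (kfin * G).
move: t1 t2 t3 t4 t5 t6 t7 t8 => t1 t2 t3 t4 t5 t6 t7 t8 *.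
by lra.
Qed.

Let cont_rectD (h h' : R -> R -> R) : cont_rect 0 th R0 N h -> cont_rect 0 th R0 N h' ->
  cont_rect 0 th R0 N (fun w y => h w y + h' w y).
Proof. by move=> c c' w y wI yI; apply: (@ptcD _ h h'); [exact: c|exact: c']. Qed.

Let cont_rectZ (c : R) (h : R -> R -> R) : cont_rect 0 th R0 N h ->
  cont_rect 0 th R0 N (fun w y => c * h w y).
Proof. by move=> ch w y wI yI; apply: (@ptcM _ (fun _ _ => c) h); [exact: ptcC|exact: ch]. Qed.

(** At [w = 0] the functions [u] and [v] vanish with their radial derivatives, and so does [u_w] by
    incompressibility; the single surviving term is minus a square of [v_w]. *)
Let inflow_sign (y : R) : R0 < y -> y < N -> Xt 0 y <= 0.
Proof.
move=> hy yN; have hy' := ltW hy; have ry := r_gt0 hy'; have Uy := U_gt0 hy'.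
have [u0 v0] := bc0 hy'.
have wI : 0 <= (0 : R) <= th by rewrite lexx ltW.
have y1 : 0 < y - R0 by rewrite subr_gt0.
have vy0 : dy v 0 y = 0.
  apply: (dv_right_eq ltr01 (@Ck_dvy _ _ _ 0 y cv) (dvC 0 y)) => t /andP[yt _].
  by have [] := bc0 (le_trans hy' yt).
have uy0 : dy u 0 y = 0.
  apply: (dv_right_eq ltr01 (@Ck_dvy _ _ _ 0 y cu) (dvC 0 y)) => t /andP[yt _].
  by have [] := bc0 (le_trans hy' yt).
have uw0 : dw u 0 y = 0.
  by rewrite (div_closed wI hy') /phiy vy0 v0 !mulr0 addr0 oppr0.
have yI : R0 <= y <= N by rewrite hy' ltW.
have /andP[c0 _] := chi_bound yI.
have -> : Xt 0 y = - (chi y * (k_diss K * (2^-1 * (s ^+ 4 / r y ^+ 2) *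
    (rho y * (r y / U y)) * dw v 0 y ^+ 2))).
  by rewrite /Xt /Xf vy0 uy0 uw0 u0 v0; ring.
have ry0 := rho_gt0 hy'.
have a1 : 0 <= 2^-1 * (s ^+ 4 / r y ^+ 2) * (rho y * (r y / U y)).
  by rewrite ltW// !mulr_gt0 ?invr_gt0 ?exprn_gt0.
by rewrite oppr_le0 mulr_ge0// mulr_ge0 ?(ltW kd_gt0)// mulr_ge0 ?sqr_ge0.
Qed.

(** The condition on [P] contributes [2] and the viscous term [- 1/2] to the coefficient of [u_w^2],
    hence [3/2]; the condition on [u_y] makes its square cancel that of [v_w]. The remaining cross
    term with [v] is paid by the trace term, since [k_trace K = k_diss K * K^3]. *)
Let outflow_lower (y : R) : R0 < y -> y < N ->
  chi y * (k_diss K / K * trint y) <= Xt th y.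
Proof.
move=> hy yN; have hy' := ltW hy; have ry := r_gt0 hy'; have Uy := U_gt0 hy'.
have ry0 := rho_gt0 hy'.
have [b1 b2] := bcth hy'.
have wI : 0 <= th <= th by rewrite lexx ltW.
have yI : R0 <= y <= N by rewrite hy' ltW.
have /andP[c0 _] := chi_bound yI.
have [[s1 hb1 hb2 iUK] [UK rK sy]] := profile_facts hy.
have K0 : 0 < K by exact: lt_le_trans ltr01 K1.
have div := div_closed wI hy'.
have vyE : dy v th y = - (dw u th y + s * v th y) / r y.
  by rewrite div /phiy; field; rewrite gt_eqF.
have PE : P th y = 2%:R * s ^+ 2 * dw u th y / r y by rewrite -b2 mulfK// gt_eqF.
have uyE : dy u th y = - (s ^+ 2 * dw v th y / r y).
  apply: (mulfI (lt0r_neq0 ry)); move/eqP: b1; rewrite addrC addr_eq0 => /eqP ->.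
  by field; rewrite gt_eqF.
have XfE : Xf th y = rho y * (3%:R / 2%:R * s ^+ 2 / r y ^+ 2 * (r y / U y) * dw u th y ^+ 2
    - s ^+ 2 * beta y * dw u th y * v th y + s ^+ 2 / 2%:R * (r y / U y) * dy v th y ^+ 2).
  by rewrite /Xf PE uyE vyE; field; rewrite !gt_eqF.
have op := outflow_pointwise s (dw u th y) (dy v th y) (v th y) K1 ry Uy UK hb1 hb2.
rewrite /Xt ler_wpM2l// XfE /k_trace.
have th0 : th != 0 by rewrite gt_eqF.
have -> : k_diss K * K ^+ 3 / th * (s ^+ 2 * (th * v th y ^+ 2)) =
  k_diss K * (K ^+ 3 * (s * v th y) ^+ 2) by field.
rewrite !subrr !mul0r !mulr0 !addr0 add0r.
have h := ler_wpM2l (mulr_ge0 (ltW kd_gt0) (ltW ry0)) op.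
by apply: (le_sub_eq h); rewrite /trint; field; rewrite !gt_eqF.
Qed.

(** No-slip along the wall annihilates the angular derivatives, and every term of the flux contains
    [v], [v_w] or [u_w]. *)
Let wall_zero (w : R) : 0 < w < th -> Yt w R0 = 0.
Proof.
move=> wI; have /andP[w0 wth] := wI.
have wI' : 0 <= w <= th by rewrite !ltW.
have [u0 v0] := bcR wI'.
have e0 : 0 < th - w by rewrite subr_gt0.
have sub t : w <= t < w + (th - w) -> 0 <= t <= th.
  rewrite addrC subrK => /andP[wt tt]; rewrite (ltW tt) andbT.
  exact: le_trans (ltW w0) wt.
have uw0 : dw u w R0 = 0.
  apply: (dv_right_eq e0 (@Ck_dvw _ _ _ w R0 cu) (dvC 0 w)) => t /sub tI.
  by have [] := bcR tI.
have vw0 : dw v w R0 = 0.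
  apply: (dv_right_eq e0 (@Ck_dvw _ _ _ w R0 cv) (dvC 0 w)) => t /sub tI.
  by have [] := bcR tI.
by rewrite /Yt /Yf /q uw0 vw0 v0; ring.
Qed.

Lemma trace_cont : cont_seg R0 N (fun y => chi y * (k_diss K / K * trint y)).
Proof.
apply: cont_seg_pt => y /andP[hy _]; have [hr0 hU0 hy0] := neqs hy.
have c : ptc (fun _ y => chi y * (k_diss K / K * trint y)) 0 y.
  have [_ _ [[? ?] [? ? ? ? ?]]] := ptc_facts 0 hy.
  have ? := @chi_ptc 0 y hy.
  have c1 : ptc (fun _ y => dw u th y) 0 y.
    by apply: (@ptc_y _ (dw u th)); apply: ptc_slice_y; exact: Ck_ptc (Ck_dw cu).
  by rewrite /trint; ptcs.
exact: (ptc_slice_y c).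
Qed.

Lemma energy_cutoff (M : R) : (stripint 0 th R0 fint <= M%:E)%E ->
  rectint 0 th R0 N (fun w y => chi y * bint w y)
  + segint R0 N (fun y => chi y * (k_diss K / K * trint y))
  <= kfin * rectint 0 th R0 N aint + kap * kcut * rectint 0 th R0 N cint + kfin * M.
Proof.
move=> hM.
have cb : cont_rect 0 th R0 N (fun w y => chi y * bint w y).
  move=> w y _ /andP[hy _]; have [cbw _ _] := int_ptc w hy.
  by apply: (@ptcM _ (fun _ y => chi y) bint); [exact: chi_ptc|].
have cc : cont_rect 0 th R0 N cint.
  by move=> w y _ /andP[hy _]; have [_ + _] := int_ptc w hy.
have ca : cont_rect 0 th R0 N aint.
  by move=> w y _ /andP[hy _]; have [_ _] := int_ptc w hy.
have ca' := @cont_rectZ (- kfin) _ ca. have cc' := @cont_rectZ (- (kap * kcut)) _ cc.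
have c1 := cont_rectD cb dXt_cont. have c2 := cont_rectD c1 dYt_cont.
have c3 := cont_rectD c2 ca'. have c4 := cont_rectD c3 cc'.
have hL : rectint 0 th R0 N (fun w y => chi y * bint w y + dXt w y + dYt w y
    + - kfin * aint w y + - (kap * kcut) * cint w y) <= kfin * M.
  rewrite -lee_fin.
  have cF : cont_strip 0 th R0 (fun w y => kfin * fint w y).
    by move=> w y wI hy; apply: (@ptcM _ (fun _ _ => kfin) fint); [exact: ptcC|exact: fint_cont].
  apply: (@le_trans _ _ (stripint 0 th R0 (fun w y => kfin * fint w y))).
    apply: rectint_le_strip => // w y wI hy.
      by rewrite mulr_ge0// fint_ge0.
    by have := energy_pointwise wI hy; rewrite !mulNr.
  by rewrite stripintZ// [X in (_ <= X)%E]EFinM lee_wpmul2l// lee_fin.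
rewrite (rectintD th_gt0 c3 cc') (rectintD th_gt0 c2 ca') (rectintD th_gt0 c1 dYt_cont)
  (rectintD th_gt0 cb dXt_cont) (rectintZ th_gt0 _ ca) (rectintZ th_gt0 _ cc) in hL.
have hX : segint R0 N (fun y => chi y * (k_diss K / K * trint y)) <= rectint 0 th R0 N dXt.
  have -> : rectint 0 th R0 N dXt = segint R0 N (Xt th) - segint R0 N (Xt 0).
    apply: (rectint_div_w th_gt0 Xt_cont dXt_cont).
    by move=> w y /andP[/ltW w0 /ltW w1] /andP[hy _]; apply: dXt_deriv; rewrite ?w0.
  have i0 : 0 <= (0 : R) <= th by rewrite lexx ltW. have i1 : 0 <= th <= th by rewrite lexx ltW.
  have s0 := cont_rect_slice i0 Xt_cont. have s1 := cont_rect_slice i1 Xt_cont.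
  rewrite lerBrDr -[X in _ <= X]addr0; apply: lerD.
    by apply: segint_le => // [|y /andP[]]; [exact: trace_cont|exact: outflow_lower].
  have c0 : cont_seg R0 N (fun=> 0 : R) by apply: cont_seg_pt => ? _; exact: cvg_cst.
  apply: (@le_trans _ _ (segint R0 N (fun=> 0))).
    by apply: segint_le => // y /andP[]; exact: inflow_sign.
  by rewrite /segint Rintegral_cst// mul0r.
have hY : 0 <= rectint 0 th R0 N dYt.
  have -> : rectint 0 th R0 N dYt = segint 0 th (Yt^~ N) - segint 0 th (Yt^~ R0).
    apply: (rectint_div_y R0N Yt_cont dYt_cont).
    by move=> w y wI /andP[/ltW hy _]; exact: dYt_deriv.
  have iN : R0 <= N <= N by rewrite lexx ltW. have i0 : R0 <= R0 <= N by rewrite lexx ltW.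
  have c0 : cont_seg 0 th (fun=> 0 : R) by apply: cont_seg_pt => ? _; exact: cvg_cst.
  have e0 : segint 0 th (fun=> 0 : R) = 0 by rewrite /segint Rintegral_cst// mul0r.
  have sR := cont_rect_cst_y Yt_cont i0. have sN := cont_rect_cst_y Yt_cont iN.
  rewrite subr_ge0; apply: (@le_trans _ _ (segint 0 th (fun=> 0))).
    by apply: segint_le => // w wI; rewrite wall_zero.
  by apply: segint_le => // w wI; rewrite /Yt chi_N mul0r.
move: hL hX hY.
set I1 := rectint _ _ _ _ _; set I2 := rectint _ _ _ _ _; set I3 := rectint _ _ _ _ _.
set I4 := kfin * rectint _ _ _ _ _; set I5 := kap * kcut * rectint _ _ _ _ _.
rewrite !mulNr => hL hX hY.
have hL' : I1 + I2 + I3 - I4 - I5 <= kfin * M by exact: hL.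
clear hL.
move: hL' hX hY; set I6 := segint _ _ _; set I7 := kfin * M.
move: I1 I2 I3 I4 I5 I6 I7 => I1 I2 I3 I4 I5 I6 I7 *.
by lra.
Qed.

End Cutoff.

Let bint_ge0 (w y : R) : R0 <= y -> 0 <= bint w y.
Proof.
by move=> hy; rewrite /bint mulr_ge0 ?(ltW (rho_gt0 hy))// !addr_ge0 ?sqr_ge0.
Qed.

Let aint_ge0 (w y : R) : R0 <= y -> 0 <= aint w y.
Proof. by move=> hy; rewrite /aint mulr_ge0 ?sqr_ge0// ltW// rho_gt0. Qed.

Let cint_ge0 (w y : R) : R0 <= y -> 0 <= cint w y.
Proof.
move=> hy; rewrite /cint addr_ge0 ?bint_ge0// mulr_ge0 ?(ltW (rho_gt0 hy))//.
by rewrite addr_ge0 ?sqr_ge0.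
Qed.

Let trint_ge0 (y : R) : R0 <= y -> 0 <= trint y.
Proof.
move=> hy; rewrite /trint mulr_ge0 ?(ltW (rho_gt0 hy))// mulr_ge0 ?invr_ge0 ?(ltW (r_gt0 hy))//.
by rewrite mulr_ge0 ?sqr_ge0.
Qed.

Let trint_ptc (y : R) : R0 <= y -> ptc (fun _ y => trint y) 0 y.
Proof.
move=> hy; have [hr0 hU0 hy0] := neqs hy.
have [_ _ [[? ?] [? ? ? ? ?]]] := ptc_facts 0 hy.
have c1 : ptc (fun _ y => dw u th y) 0 y.
  by apply: (@ptc_y _ (dw u th)); apply: ptc_slice_y; exact: Ck_ptc (Ck_dw cu).
by rewrite /trint; ptcs.
Qed.

(** The rectangle is fixed while the cutoff parameter tends to zero. [chi >= 1/2] on it costs the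
    factor 2, and [MC], which includes the pressure, is multiplied by [kap] and disappears. *)
Let energy_rect (MA MC M d : R) : R0 < d ->
  (stripint 0 th R0 aint <= MA%:E)%E -> (stripint 0 th R0 cint <= MC%:E)%E ->
  (stripint 0 th R0 fint <= M%:E)%E ->
  rectint 0 th R0 d bint + k_diss K / K * segint R0 d trint <= 2%:R * kfin * (MA + M).
Proof.
move=> R0d hA hC hM.
have K0 : 0 < K by exact: lt_le_trans ltr01 K1.
have rd1 : 1 <= r d / R0.
  by rewrite ler_pdivlMr// mul1r /r lerDl mulr_ge0 ?subr_ge0// ltW.
have l0 : 0 <= ln (r d / R0) by exact: ln_ge0.
(* Makes [kap * ln (r d / R0)] at most one half for all [kap <= k0]. *)
pose k0 : R := (2%:R * (1 + ln (r d / R0)))^-1.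
have den0 : 0 < 2%:R * (1 + ln (r d / R0)) by rewrite mulr_gt0// ltr_pwDl.
have k00 : 0 < k0 by rewrite invr_gt0.
apply: (le_eps_slack (z := 2%:R * kcut * MC) k00) => kap kap0 kapk.
(* The point where the cutoff vanishes, solved from [r N = R0 exp (1 / kap)]. *)
pose N := R0 + (R0 * expR kap^-1 - R0) / s.
have hN : r N = R0 * expR kap^-1.
  by rewrite /r /N; field; rewrite gt_eqF.
have kl : kap * ln (r d / R0) <= 2%:R^-1.
  apply: (le_trans (ler_wpM2r l0 kapk)).
  rewrite /k0 invfM -mulrA ler_piMr ?invr_ge0// mulrC ler_pdivrMr ?ltr_pwDl//.
  by rewrite mul1r lerDr.
have dN : d <= N.
  have : r d <= r N.
    rewrite hN -ler_pdivrMl// mulrC -[r d / R0]lnK ?posrE ?divr_gt0 ?r_gt0 ?(ltW R0d)//.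
    rewrite ler_expR -[X in X <= _](mulKf (lt0r_neq0 kap0)) -[X in _ <= X]mulr1.
    rewrite ler_wpM2l ?invr_ge0 ?(ltW kap0)//.
    by apply: (le_trans kl); rewrite invf_le1// ler1n.
  by rewrite /r lerD2l ler_pM2l// lerD2r.
have R0N : R0 < N by exact: lt_le_trans dN.
have en := energy_cutoff kap0 R0N hN hM.
pose chi y := 1 - kap * ln (r y / R0).
have chiN y : R0 <= y <= N -> 0 <= chi y.
  by move=> yI; have /andP[] := chi_bound kap0 hN yI.
have chi_half y : R0 <= y <= d -> 1 <= 2%:R * chi y.
  move=> /andP[hy yd].
  have ll : ln (r y / R0) <= ln (r d / R0).
    rewrite ler_ln ?posrE ?divr_gt0 ?r_gt0 ?(ltW R0d)// ler_pM2r ?invr_gt0//.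
    by rewrite /r lerD2l ler_pM2l// lerD2r.
  have := le_trans (ler_wpM2l (ltW kap0) ll) kl.
  rewrite /chi; set t := kap * _; move: t => t ht.
  by lra.
have cbN : cont_rect 0 th R0 N (fun w y => chi y * bint w y).
  move=> w y _ /andP[hy _]; have [cbw _ _] := int_ptc w hy.
  by apply: (@ptcM _ (fun _ y => chi y) bint); [exact: (@chi_ptc kap)|].
have cbN2 : cont_rect 0 th R0 N (fun w y => 2%:R * (chi y * bint w y)).
  move=> w y wI yI; apply: (@ptcM _ (fun _ _ => 2%:R) (fun w y => chi y * bint w y)).
    exact: ptcC.
  exact: cbN.
have sub_rect h : cont_rect 0 th R0 N h -> cont_rect 0 th R0 d h.
  by move=> ch w y wI /andP[cy yd]; apply: ch => //; rewrite cy (le_trans yd dN).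
have cbd : cont_rect 0 th R0 d bint.
  by move=> w y _ /andP[hy _]; have [] := int_ptc w hy.
have caN : cont_rect 0 th R0 N aint.
  by move=> w y _ /andP[hy _]; have [_ _] := int_ptc w hy.
have ccN : cont_rect 0 th R0 N cint.
  by move=> w y _ /andP[hy _]; have [_ + _] := int_ptc w hy.
have cas : cont_strip 0 th R0 aint.
  by move=> w y _ /ltW hy; have [_ _] := int_ptc w hy.
have ccs : cont_strip 0 th R0 cint.
  by move=> w y _ /ltW hy; have [_ + _] := int_ptc w hy.
have b1 : rectint 0 th R0 d bint <= 2%:R * rectint 0 th R0 N (fun w y => chi y * bint w y).
  rewrite -(rectintZ th_gt0 _ cbN).
  apply: (@le_trans _ _ (rectint 0 th R0 d (fun w y => 2%:R * (chi y * bint w y)))).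
    apply: rectint_le => //; first exact: sub_rect.
    move=> w y _ /andP[hy yd]; rewrite mulrA ler_peMl ?bint_ge0 ?(ltW hy)//.
    by apply: chi_half; rewrite (ltW hy) ltW.
  apply: rectint_sub => // w y _ yI; rewrite mulr_ge0// mulr_ge0 ?chiN// bint_ge0//.
  by case/andP: yI.
have ctN : cont_seg R0 N (fun y => chi y * (k_diss K / K * trint y)) by exact: (@trace_cont kap N).
have b2 : k_diss K / K * segint R0 d trint <=
    2%:R * segint R0 N (fun y => chi y * (k_diss K / K * trint y)).
  have kdK : 0 <= k_diss K / K by rewrite divr_ge0// ltW.
  have ctd : cont_seg R0 d trint.
    by apply: cont_seg_pt => y /andP[hy _]; exact: (ptc_slice_y (trint_ptc hy)).
  have ctN2 : cont_seg R0 N (fun y => 2%:R * (chi y * (k_diss K / K * trint y))).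
    apply: cont_seg_pt => y /andP[hy _].
    have h : ptc (fun _ y => 2%:R * (chi y * (k_diss K / K * trint y))) 0 y.
      have ? := trint_ptc hy; have ? := @chi_ptc kap 0 y hy.
      by ptcs.
    exact: (ptc_slice_y h).
  rewrite -(segintZ _ ctd) -(segintZ _ ctN).
  apply: (@le_trans _ _ (segint R0 d (fun y => 2%:R * (chi y * (k_diss K / K * trint y))))).
    apply: segint_le.
    - apply: cont_seg_pt => y /andP[hy _].
      have h : ptc (fun _ y => k_diss K / K * trint y) 0 y.
        by have ? := trint_ptc hy; ptcs.
      exact: (ptc_slice_y h).
    - apply: continuous_subspaceW ctN2; exact: subset_itvl.
    - move=> y /andP[hy yd]; rewrite mulrA; apply: ler_peMl.
        by apply: mulr_ge0 => //; rewrite trint_ge0// ltW.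
      by apply: chi_half; rewrite (ltW hy) ltW.
  apply: segint_sub => // y yI; apply: mulr_ge0 => //; apply: mulr_ge0; first exact: chiN.
  by apply: mulr_ge0 => //; rewrite trint_ge0//; case/andP: yI.
have b3 : rectint 0 th R0 N aint <= MA.
  rewrite -lee_fin; apply: le_trans hA; apply: rectint_le_strip => // w y _ hy.
  by rewrite aint_ge0// ltW.
have b4 : rectint 0 th R0 N cint <= MC.
  rewrite -lee_fin; apply: le_trans hC; apply: rectint_le_strip => // w y _ hy.
  by rewrite cint_ge0// ltW.
have kcut0 : 0 <= kap * kcut.
  have K0' := ltW K0.
  rewrite mulr_ge0 ?(ltW kap0)// /kcut mulr_ge0 ?(ltW kd_gt0)// mulr_ge0//.
  by rewrite addr_ge0// exprn_ge0.
have b5 := ler_wpM2l kfin_ge0 b3. have b6 := ler_wpM2l kcut0 b4.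
have -> : 2%:R * kfin * (MA + M) + kap * (2%:R * kcut * MC) =
  2%:R * (kfin * MA + kap * kcut * MC + kfin * M) by ring.
apply: (le_trans (lerD b1 b2)).
rewrite -mulrDr ler_wpM2l//; apply: (le_trans en).
by rewrite lerD2r; exact: lerD.
Qed.

Lemma energy_estimate (MA MC M : R) :
  (stripint 0 th R0 aint <= MA%:E)%E -> (stripint 0 th R0 cint <= MC%:E)%E ->
  (stripint 0 th R0 fint <= M%:E)%E ->
  (stripint 0 th R0 bint <= (2%:R * kfin * (MA + M))%:E)%E /\
  (\int[lebesgue_measure]_(y in `]R0, +oo[) (trint y)%:E <=
    (K / k_diss K * (2%:R * kfin * (MA + M)))%:E)%E.
Proof.
move=> hA hC hM.
have K0 : 0 < K by exact: lt_le_trans ltr01 K1.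
have kdK : 0 < k_diss K / K by rewrite divr_gt0.
split.
  apply: stripint_le_rect => //.
  - by move=> d hd w y _ /andP[hy _]; have [] := int_ptc w hy.
  - by move=> w y _ hy; exact: bint_ge0.
  - move=> d hd; apply: le_trans (energy_rect hd hA hC hM).
    rewrite lerDl mulr_ge0 ?(ltW kdK)//; apply: segint_ge0 => y /andP[hy _].
    exact: trint_ge0.
apply: ray_le_seg.
- move=> y; rewrite in_itv/= andbT => hy; exact: (ptc_slice_y (trint_ptc hy)).
- exact: trint_ge0.
- move=> d hd; have := energy_rect hd hA hC hM => h.
  have -> : K / k_diss K * (2%:R * kfin * (MA + M)) =
    (k_diss K / K)^-1 * (2%:R * kfin * (MA + M)) by rewrite invf_div.
  rewrite -ler_pdivrMl ?invr_gt0// invrK; apply: le_trans h.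
  rewrite lerDr; apply: rectint_ge0 => w y _ /andP[hy _]; exact: bint_ge0.
Qed.

End EnergyEstimate.

(** * Finite differences and decaying integrals *)

Section RealCalculus.
Context {R : realType}.
Implicit Types (f g : R -> R) (x y a b c e t h C : R).

Let quot f x (h : R) : R := h^-1 * (f (x + h) - f x).

Lemma dv_quot_right f x a : is_derive x 1 f a -> quot f x h @[h --> 0^'+] --> a.
Proof.
move=> [hd hv]; rewrite -hv.
have -> : quot f x = (fun t : R => t^-1 *: (f (t *: 1 + x) - f x)).
  by apply/funext => t; rewrite /quot /GRing.scale/= mulr1 [t + x]addrC.
apply: cvg_trans hd.
by apply: cvg_app; apply: within_subset => // t /=; rewrite lt_def => /andP[].
Qed.

(** Comparison arguments bound increments, obtained from shifts and dilations to the right; this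
    turns them into bounds on derivatives. *)
Lemma dv_bound_right f x a C e : 0 < e -> is_derive x 1 f a ->
  (forall h, 0 < h < e -> `|f (x + h) - f x| <= C * h) -> `|a| <= C.
Proof.
move=> e0 fa fC; have p : ProperFilter (0 : R)^'+ by exact: at_right_proper_filter.
have c := cvg_norm (dv_quot_right fa).
apply: (cvgr_to_le (c _)).
near=> h.
have h0 : 0 < h by near: h; exact: nbhs_right_gt.
have he : h < e by near: h; exact: nbhs_right_lt.
rewrite /quot normrM gtr0_norm ?invr_gt0// mulrC ler_pdivrMr//.
by apply: fC; rewrite h0.
Unshelve. all: by end_near. Qed.

(** A quadratic remainder yields the derivative itself; this is how improper integrals are
    differentiated in a parameter. *)
Lemma dv_quad f x a C : (forall h, `|f (x + h) - f x - h * a| <= C * h ^+ 2) ->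
  is_derive x 1 f a.
Proof.
move=> fC.
have c : (fun t : R => t^-1 *: (f (t *: 1 + x) - f x)) @ 0^' --> a.
  apply/cvgrPdist_le => /= e e0; near=> h.
  have h0 : h != 0 by near: h; exact: nbhs_dnbhs_neq.
  have hC : (`|C| + 1) * `|h| <= e.
    rewrite mulrC -ler_pdivlMr ?ltr_pwDr//.
    near: h; apply: dnbhs0_le.
    by rewrite divr_gt0// ltr_pwDr.
  rewrite /GRing.scale/= mulr1 [h + x]addrC.
  have -> : a - h^-1 * (f (x + h) - f x) = - (h^-1 * (f (x + h) - f x - h * a)) by field.
  rewrite normrN normrM normfV mulrC ler_pdivrMr ?normr_gt0//.
  apply: (le_trans (fC h)).
  rewrite (_ : h ^+ 2 = `|h| * `|h|); last by rewrite -normrM -expr2 ger0_norm ?sqr_ge0.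
  rewrite mulrA ler_wpM2r//.
  apply: le_trans hC; rewrite ler_wpM2r//.
  by apply: (le_trans (ler_norm C)); rewrite lerDl.
by apply: DeriveDef; [apply/cvg_ex; exists a|exact: cvg_lim c].
Unshelve. all: by end_near. Qed.

Lemma dv_lip f (f' : R -> R) C a b : a <= b ->
  (forall t, a <= t <= b -> is_derive t 1 f (f' t)) ->
  (forall t, a <= t <= b -> `|f' t| <= C) -> `|f b - f a| <= C * (b - a).
Proof.
move=> ab df fC.
have [|//|c cab ->] := @MVT_segment R f f' a b ab.
- by move=> t; rewrite in_itv/= => /andP[/ltW at_ /ltW tb]; apply: df; rewrite at_.
- apply: continuous_in_subspaceT => t /set_mem /=; rewrite in_itv/= => tI.
  exact: dv_cont (df t tI).
rewrite in_itv/= in cab.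
rewrite normrM [X in _ * X]ger0_norm ?subr_ge0// ler_wpM2r ?subr_ge0//.
exact: fC.
Qed.

Lemma dv_lipT f (f' : R -> R) C x y : (forall t, is_derive t 1 f (f' t)) ->
  (forall t, `|f' t| <= C) -> `|f x - f y| <= C * `|x - y|.
Proof.
move=> df fC; wlog xy : x y / y <= x.
  by move=> H; have [/H//|/ltW/H] := leP y x; rewrite distrC [`|y - x|]distrC.
by rewrite [`|x - y|]ger0_norm ?subr_ge0//; exact: dv_lip.
Qed.

Lemma dv_quad_remainder f (f' f'' : R -> R) C x h : (forall t, is_derive t 1 f (f' t)) ->
  (forall t, is_derive t 1 f' (f'' t)) -> (forall t, `|f'' t| <= C) ->
  `|f (x + h) - f x - h * f' x| <= C * h ^+ 2.
Proof.
move=> df df' fC.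
have C0 : 0 <= C by exact: le_trans (fC 0).
pose g t := f (x + t * h) - t * (h * f' x).
pose g' t := h * (f' (x + t * h) - f' x).
have dg t : is_derive t 1 g (g' t).
  have d1 : is_derive t 1 (fun t => x + t * h) h.
    by apply: (is_derive_eq (dvD (dvC x t) (dvM (dvI t) (dvC h t)))); ring.
  have d2 := @dv_comp _ f (fun t => x + t * h) t _ _ (df (x + t * h)) d1.
  have d3 := dvB d2 (dvM (dvI t) (dvC (h * f' x) t)).
  by apply: (is_derive_eq d3); rewrite /g'; ring.
have := @dv_lip g g' (C * h ^+ 2) 0 1 ler01 (fun t _ => dg t).
rewrite /g !mul1r !mul0r addr0 !subr0 mulr1 => H.
have -> : f (x + h) - f x - h * f' x = f (x + h) - h * f' x - f x by ring.
apply: H => t /andP[t0 t1]; rewrite /g' normrM.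
have := dv_lipT (x + t * h) x df' fC.
have -> : x + t * h - x = t * h by ring.
rewrite normrM (ger0_norm t0) => h1.
have -> : C * h ^+ 2 = `|h| * (C * `|h|).
  by rewrite [RHS]mulrCA -normrM -expr2 ger0_norm ?sqr_ge0.
rewrite ler_wpM2l//; apply: (le_trans h1).
by rewrite ler_wpM2l// ler_piMl.
Qed.

(** A positive [c] would make [f'] positive just to the right of [x], and the mean value theorem
    would produce a value above the maximum. Differentiability of [f'] at [x] alone is enough. *)
Lemma second_derivative_test f (f' : R -> R) x c a b : a < x < b ->
  (forall t, a < t < b -> is_derive t 1 f (f' t)) -> is_derive x 1 f' c ->
  (forall t, a < t < b -> f t <= f x) -> f' x = 0 /\ c <= 0.
Proof.
move=> /andP[ax xb] df df' fmax.
have ab : a <= b by exact: ltW (lt_trans ax xb).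
have xI : a < x < b by rewrite ax.
have f'0 : f' x = 0.
  apply: (dv_unique (df x xI)); apply: (@derive1_at_max _ f a b x) => //.
  - by move=> t; rewrite in_itv/= => tI; have [] := df t tI.
split => //; rewrite leNgt; apply/negP => c0.
have q := dv_quot_right df'.
have q1 : \forall h \near 0^'+, 0 < quot f' x h by exact: (cvgr_gt _ q).
have [e e0 he] : exists2 e : R, 0 < e & forall h, 0 < h < e -> 0 < quot f' x h.
  case: q1 => e /= e0 he; exists e => // h /andP[h0 he']; apply: he => //=.
  by rewrite sub0r normrN gtr0_norm.
pose d := Num.min (e / 2%:R) ((b - x) / 2%:R).
have bx0 : 0 < b - x by rewrite subr_gt0.
have half (z : R) : 0 < z -> z / 2%:R < z by move=> z0; rewrite ltr_pdivrMr// ltr_pMr// ltr1n.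
have d0 : 0 < d by rewrite lt_min !divr_gt0.
have de : d < e by apply: le_lt_trans (half _ e0); rewrite ge_min lexx.
have db : d < b - x by apply: le_lt_trans (half _ bx0); rewrite ge_min lexx orbT.
have xd : x < x + d by rewrite ltrDl.
have sub t : x <= t <= x + d -> a < t < b.
  move=> /andP[xt td]; rewrite (lt_le_trans ax xt)/=.
  by apply: (le_lt_trans td); rewrite -ltrBrDl.
have [||t] := @MVT R f f' x (x + d) xd.
- move=> t; rewrite in_itv/= => /andP[/ltW xt /ltW td]; apply: df; apply: sub.
  by rewrite xt.
- apply: continuous_in_subspaceT => t /set_mem /=; rewrite in_itv/= => /sub tI.
  exact: dv_cont (df t tI).
rewrite in_itv/= => /andP[xt td] E.
have xdI : x <= x + d <= x + d by rewrite lexx ltW.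
have := fmax (x + d) (sub _ xdI).
apply/negP; rewrite -ltNge -subr_gt0 E mulr_gt0 ?subr_gt0//.
have := he (t - x); rewrite subr_gt0 xt ltrBlDl /= (lt_trans td) ?ltrD2l// => /(_ isT).
by rewrite /quot f'0 subr0 [x + _]addrC subrK pmulr_rgt0// invr_gt0 subr_gt0.
Qed.

Lemma exp_decay_poly n (M c x z : R) : 0 < c -> 0 <= x ->
  `|z| <= M * expR (- (c * x)) -> x ^+ n * `|z| <= M * (n`!%:R / c ^+ n).
Proof.
move=> c0 x0 zM.
have M0 : 0 <= M.
  by have := le_trans (normr_ge0 z) zM; rewrite pmulr_lge0// expR_gt0.
(* One term of the exponential series: [(c x)^n / n! <= exp (c x)]. *)
have h : x ^+ n <= n`!%:R / c ^+ n * expR (c * x).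
  case: n => [|n]; first by rewrite !expr0 fact0 divr1 mul1r -expR0 ler_expR mulr_ge0// ltW.
  have := expR_ge1Dxn n (mulr_ge0 (ltW c0) x0).
  move=> /(le_trans _) H; have {}H : (c * x) ^+ n.+1 / n.+1`!%:R <= expR (c * x).
    by apply: H; rewrite lerDr.
  rewrite mulrAC ler_pdivlMr ?exprn_gt0// -exprMn [x * c]mulrC [X in _ <= X]mulrC.
  by rewrite -ler_pdivrMr ?ltr0n ?fact_gt0.
apply: (@le_trans _ _ ((n`!%:R / c ^+ n * expR (c * x)) * (M * expR (- (c * x))))).
  by apply: ler_pM => //; exact: exprn_ge0.
rewrite expRN le_eqVlt; apply/orP; left; apply/eqP; field.
by rewrite !gt_eqF ?expR_gt0 ?exprn_gt0.
Qed.
End RealCalculus.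

Section RectangleMaximum.
Context {R : realType}.

Lemma cont_rect_max (a b c d : R) (h : R -> R -> R) : a <= b -> c <= d ->
  cont_rect a b c d h -> exists w y, [/\ a <= w <= b, c <= y <= d &
    forall w' y', a <= w' <= b -> c <= y' <= d -> h w' y' <= h w y].
Proof.
move=> ab cd ch.
pose A : set (R * R) := `[a, b] `*` `[c, d].
have cA : compact A by apply: compact_setX; exact: segment_compact.
have cf : {within A, continuous (fun z : R * R => h z.1 z.2)}.
  apply: continuous_in_subspaceT => -[w y] /set_mem [] /=.
  by rewrite !in_itv/= => ? ?; exact: ch.
have A0 : A !=set0 by exists (a, c); split; rewrite /= in_itv/= lexx.
have [[w y] /set_mem [/=]] := compact_EVT_max A0 cA cf.
rewrite !in_itv/= => wI yI hmax; exists w, y; split => // w' y' wI' yI'.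
by apply: (hmax (w', y')); apply/mem_set; split; rewrite /= in_itv.
Qed.
End RectangleMaximum.

(** * Improper integrals of functions with inverse-square decay *)

Section TailIntegral.
Context {R : realType}.
Notation mu := (@lebesgue_measure R).
Implicit Types (g : R -> R) (c y t M : R).

Definition tail g y : R := \int[mu]_(t in `[y, +oo[) g t.

(** Inverse-square decay gives integrability together with the explicit tail [M / y]. *)
Definition tail_bound c M g := continuous g /\ forall t, c <= t -> `|g t| <= M / t ^+ 2.

Lemma tail_bound_ge0 c M g : 0 < c -> tail_bound c M g -> 0 <= M.
Proof.
move=> c0 [_ /(_ c (lexx _)) h]; have := le_trans (normr_ge0 _) h.
by rewrite pmulr_lge0// invr_gt0 exprn_gt0.
Qed.

Lemma tail_bound_comb c (M M' k : R) g g' : tail_bound c M g -> tail_bound c M' g' ->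
  tail_bound c (M + `|k| * M') (fun t => g t + k * g' t).
Proof.
move=> [cg gM] [cg' gM']; split.
  move=> t; apply: (@continuousD _ _ _ g (fun t => k * g' t)); first exact: cg.
  by apply: (@continuousM _ _ (fun=> k) g'); [exact: cvg_cst|exact: cg'].
move=> t ct; rewrite mulrDl; apply: (le_trans (ler_normD _ _)).
by apply: lerD; [exact: gM|rewrite normrM -mulrA ler_wpM2l// gM'].
Qed.

Lemma segint_inv_sq (M y d : R) : 0 < y -> y < d ->
  segint y d (fun t => M / t ^+ 2) = M / y - M / d.
Proof.
move=> y0 yd.
have ne t : y <= t -> t != 0 by move=> yt; rewrite gt_eqF// (lt_le_trans y0 yt).
have dF t : y <= t -> is_derive t 1 (fun t => - (M / t)) (M / t ^+ 2).
  move=> yt; eapply is_derive_eq; first by dvs; exact: ne.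
  by field; exact: ne.
have dF2 t : y <= t -> is_derive t 1 (fun t => M / t ^+ 2) (- 2%:R * M / t ^+ 3).
  move=> yt; have n2 : t ^+ 2 != 0 by rewrite expf_neq0// ne.
  eapply is_derive_eq; first by dvs.
  by field; exact: ne.
have -> : M / y - M / d = - (M / d) - - (M / y) by ring.
apply: (@segint_FTC _ y d (fun t => - (M / t))) => //.
- by apply: cont_seg_pt => t /andP[yt _]; exact: dv_cont (dF2 t yt).
- by apply: cont_seg_pt => t /andP[yt _]; exact: dv_cont (dF t yt).
- by move=> t /andP[yt _]; apply: dF; exact: ltW.
Qed.

Lemma tail_abs_le c M g y : 0 < c -> tail_bound c M g -> c <= y ->
  (\int[mu]_(t in `[y, +oo[) `|g t|%:E <= (M / y)%:E)%E.
Proof.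
move=> c0 gb cy; have M0 := tail_bound_ge0 c0 gb; case: gb => cg gM.
have y0 : 0 < y by exact: lt_le_trans cy.
have cn : continuous (fun t => `|g t|) by move=> t; apply: cvg_norm; exact: cg.
rewrite -integral_itv_obnd_cbnd; last first.
  apply/measurable_EFinP; apply: measurable_funTS.
  exact: continuous_measurable_fun.
apply: ray_le_seg => // d yd.
apply: (@le_trans _ _ (segint y d (fun t => M / t ^+ 2))).
  apply: segint_le.
  - by apply: cont_seg_pt => t _; exact: cn.
  - apply: cont_seg_pt => t /andP[yt _].
    have t0 : t != 0 by rewrite gt_eqF// (lt_le_trans y0 yt).
    have n2 : t ^+ 2 != 0 by rewrite expf_neq0.
    by eapply dv_cont; dvs.
  - by move=> t /andP[yt _]; apply: gM; apply: (le_trans cy); exact: ltW.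
by rewrite segint_inv_sq// gerBl divr_ge0// ltW// (lt_trans y0 yd).
Qed.

Lemma tail_integrable c M g y : 0 < c -> tail_bound c M g -> c <= y ->
  mu.-integrable `[y, +oo[ (EFin \o g).
Proof.
move=> c0 gb cy; apply/integrableP; split.
  apply/measurable_EFinP; apply: measurable_funTS.
  by apply: continuous_measurable_fun; case: gb.
by apply: le_lt_trans (ltry (M / y)); exact: tail_abs_le gb cy.
Qed.

Lemma tail_le c M g y : 0 < c -> tail_bound c M g -> c <= y -> `|tail g y| <= M / y.
Proof.
move=> c0 gb cy; rewrite -lee_fin /tail EFin_normr_Rintegral//; last first.
  exact: tail_integrable gb cy.
apply: le_trans (tail_abs_le c0 gb cy).
apply: le_abse_integral => //; apply/measurable_EFinP; apply: measurable_funTS.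
by apply: continuous_measurable_fun; case: gb.
Qed.

Lemma tail_comb c (M M' k : R) g g' y : 0 < c -> tail_bound c M g -> tail_bound c M' g' ->
  c <= y -> tail (fun t => g t + k * g' t) y = tail g y + k * tail g' y.
Proof.
move=> c0 gb gb' cy.
have ig := tail_integrable c0 gb cy; have ig' := tail_integrable c0 gb' cy.
rewrite /tail RintegralD ?RintegralZl//.
have b0 : tail_bound c 0 (fun=> 0 : R).
  by split=> [t|t _]; [exact: cvg_cst|rewrite normr0 mul0r].
have := tail_integrable c0 (tail_bound_comb k b0 gb') cy.
by congr (_.-integrable _ (_ \o _)); apply/funext => t; rewrite add0r.
Qed.

Lemma tail_derive c M g y : 0 < c -> tail_bound c M g -> c < y ->
  is_derive y 1 (tail g) (- g y).
Proof.
move=> c0 gb cy.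
have ig := tail_integrable c0 gb (lexx c).
pose F x := segint c x g.
have [dF vF] : derivable F y 1 /\ derive1 F y = g y.
  have yy : y < y + 1 by rewrite ltrDl.
  have iy : mu.-integrable `[c, y + 1] (EFin \o g).
    by apply: integrableS ig => //; exact: subset_itvl.
  case: gb => cg _.
  exact: (continuous_FTC1_closed yy iy cy (cg y)).
have h : is_derive y 1 (fun x => tail g c - F x) (- g y).
  apply: (is_derive_eq (dvB (dvC (tail g c) y) (derivable_dv dF))).
  by rewrite vF sub0r.
apply: dv_eq_near h; near=> x.
have cx : c < x by near: x; exact: lt_nbhsr.
rewrite /tail /F /segint Rintegral_itvB//=.
- rewrite Rintegral_itv_obnd_cbnd//; apply: integrableS ig => //.
  by apply: subset_itvr; rewrite bnd_simp ltW.
- by rewrite bnd_simp ltW.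
Unshelve. all: by end_near. Qed.
End TailIntegral.

Section TailParameter.
Context {R : realType}.
Variables (c : R) (c_gt0 : 0 < c).
Implicit Types (g : R -> R -> R) (w y M : R).

(** Taylor's formula in the parameter, at each point of integration, has a remainder with the same
    decay; integrating it gives the explicit bound from which differentiability under the improper
    integral follows. *)
Lemma tail_quad_remainder g gw gww M w y h : c <= y ->
  (forall w y, is_derive w 1 (g^~ y) (gw w y)) ->
  (forall w y, is_derive w 1 (gw^~ y) (gww w y)) ->
  (forall w, tail_bound c M (g w)) -> (forall w, tail_bound c M (gw w)) ->
  (forall w, tail_bound c M (gww w)) ->
  `|tail (g (w + h)) y - tail (g w) y - h * tail (gw w) y| <= (M / y) * h ^+ 2.
Proof.
move=> cy dg dgw bg bgw bgww.
have b1 := tail_bound_comb (-1) (bg (w + h)) (bg w).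
have b2 := tail_bound_comb (- h) b1 (bgw w).
have -> : tail (g (w + h)) y - tail (g w) y - h * tail (gw w) y =
  tail (fun t => g (w + h) t + -1 * g w t + - h * gw w t) y.
  by rewrite (tail_comb _ c_gt0 b1 (bgw w) cy) (tail_comb _ c_gt0 (bg (w + h)) (bg w) cy); ring.
have b3 : tail_bound c (M * h ^+ 2) (fun t => g (w + h) t + -1 * g w t + - h * gw w t).
  case: b2 => cb _; split=> // t ct.
  have -> : g (w + h) t + -1 * g w t + - h * gw w t = g (w + h) t - g w t - h * gw w t by ring.
  have -> : M * h ^+ 2 / t ^+ 2 = M / t ^+ 2 * h ^+ 2 by rewrite mulrAC.
  apply: (@dv_quad_remainder _ (g^~ t) (gw^~ t) (gww^~ t)) => // w'.
  by case: (bgww w') => _; apply.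
by rewrite mulrAC; exact: tail_le b3 cy.
Qed.

Lemma tail_derive_param g gw gww M w y : c <= y ->
  (forall w y, is_derive w 1 (g^~ y) (gw w y)) ->
  (forall w y, is_derive w 1 (gw^~ y) (gww w y)) ->
  (forall w, tail_bound c M (g w)) -> (forall w, tail_bound c M (gw w)) ->
  (forall w, tail_bound c M (gww w)) ->
  is_derive w 1 (fun w => tail (g w) y) (tail (gw w) y).
Proof.
move=> cy dg dgw bg bgw bgww; apply: (@dv_quad _ _ _ _ (M / y)) => h.
exact: (tail_quad_remainder w h cy dg dgw).
Qed.

(** Joint continuity of functions defined by integrals: uniformly Lipschitz in the first variable
    near the point, continuous in the second. *)
Lemma ptc_lip (h : R -> R -> R) (L w y e : R) : 0 < e ->
  (forall w' y', `|w' - w| < e -> `|y' - y| < e -> `|h w' y' - h w y'| <= L * `|w' - w|) ->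
  {for y, continuous (h w)} -> ptc h w y.
Proof.
move=> e0 hL hc.
have c1 : (fun z : R * R => h w z.2) @ (w, y) --> h w y.
  exact: (@ptc_y _ (h w) w y hc).
have c2 : (fun z : R * R => h z.1 z.2 - h w z.2) @ (w, y) --> (0 : R).
  apply/cvgrPdist_le => /= d d0.
  have n1 : \forall z \near (w, y), `|w - (z.1 : R)| <= d / (`|L| + 1).
    have p : (fst : R * R -> R) @ (w, y) --> w by exact: cvg_fst.
    by move/cvgrPdist_le : p; apply; rewrite divr_gt0// ltr_pwDr.
  have n2 : \forall z \near (w, y), `|y - (z.2 : R)| < e.
    have p : (snd : R * R -> R) @ (w, y) --> y by exact: cvg_snd.
    by move/cvgrPdist_lt : p; exact.
  have n3 : \forall z \near (w, y), `|w - (z.1 : R)| < e.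
    have p : (fst : R * R -> R) @ (w, y) --> w by exact: cvg_fst.
    by move/cvgrPdist_lt : p; exact.
  apply: filterS3 n1 n2 n3 => z z1 z2 z3; rewrite sub0r normrN.
  rewrite distrC in z1; rewrite distrC in z2; rewrite distrC in z3.
  apply: (le_trans (hL _ _ z3 z2)).
  apply: (@le_trans _ _ ((`|L| + 1) * `|z.1 - w|)).
    by rewrite ler_wpM2r// (le_trans (ler_norm L))// lerDl.
  by rewrite mulrC -ler_pdivlMr// ltr_pwDr.
have := cvgD c2 c1; rewrite add0r => cc.
have E : (fun z : R * R => h z.1 z.2 - h w z.2 + h w z.2) = (fun z => h z.1 z.2).
  by apply/funext => z; rewrite subrK.
have {}cc : (fun z : R * R => h z.1 z.2 - h w z.2 + h w z.2) @ (w, y) --> h w y by exact: cc.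
by rewrite E in cc; exact: cc.
Qed.

Lemma tail_ptc g gw gww M w y : c < y ->
  (forall w y, is_derive w 1 (g^~ y) (gw w y)) ->
  (forall w y, is_derive w 1 (gw^~ y) (gww w y)) ->
  (forall w, tail_bound c M (g w)) -> (forall w, tail_bound c M (gw w)) ->
  (forall w, tail_bound c M (gww w)) ->
  ptc (fun w y => tail (g w) y) w y.
Proof.
move=> cy dg dgw bg bgw bgww.
have yc0 : 0 < y - c by rewrite subr_gt0.
apply: (@ptc_lip _ (M / c) _ _ (y - c)) => //; last first.
  exact: dv_cont (tail_derive c_gt0 (bg w) cy).
move=> w' y' _ hy.
have cy' : c <= y'.
  move: hy; rewrite ltr_norml => /andP[+ _].
  by rewrite opprB ltrBrDr subrK => /ltW.
have M0 := tail_bound_ge0 c_gt0 (bg w).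
apply: (@dv_lipT _ (fun w => tail (g w) y') (fun w => tail (gw w) y')) => t.
  exact: (tail_derive_param t cy' dg dgw bg bgw bgww).
apply: (le_trans (tail_le c_gt0 (bgw t) cy')).
by rewrite ler_wpM2l// lef_pV2 ?posrE// (lt_le_trans c_gt0).
Qed.
End TailParameter.

(** * Maximum principle and barriers for the Euler operator *)

Section StripC2.
Context {R : realType}.
Implicit Types (a b c w r : R) (Z : R -> R -> R).

(** The derivatives are given as explicit functions, so that linear combinations, shifts and
    dilations carry formulas for them and nothing has to be differentiated again. *)
Definition strip_C2 a b c Z Zw Zww Zr Zrr := forall w r, a <= w <= b -> c <= r ->
  [/\ ptc Z w r, is_derive w 1 (Z^~ r) (Zw w r), is_derive w 1 (Zw^~ r) (Zww w r),
      is_derive r 1 (Z w) (Zr w r) & is_derive r 1 (Zr w) (Zrr w r)].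

Lemma strip_C2_sep a b c (al al' al'' be be' be'' : R -> R) :
  (forall w, a <= w <= b -> is_derive w 1 al (al' w)) ->
  (forall w, a <= w <= b -> is_derive w 1 al' (al'' w)) ->
  (forall r, c <= r -> is_derive r 1 be (be' r)) ->
  (forall r, c <= r -> is_derive r 1 be' (be'' r)) ->
  strip_C2 a b c (fun w r => al w * be r) (fun w r => al' w * be r)
    (fun w r => al'' w * be r) (fun w r => al w * be' r) (fun w r => al w * be'' r).
Proof.
move=> d1 d2 d3 d4 w r wI cr.
have e1 := d1 w wI; have e2 := d2 w wI; have e3 := d3 r cr; have e4 := d4 r cr.
split.
- apply: (@ptcM _ (fun w _ => al w) (fun _ r => be r)).
    exact: (@ptc_w _ _ _ _ (dv_cont e1)).
  exact: (@ptc_y _ _ _ _ (dv_cont e3)).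
- by apply: (is_derive_eq (dvM e1 (dvC (be r) w))); ring.
- by apply: (is_derive_eq (dvM e2 (dvC (be r) w))); ring.
- by apply: (is_derive_eq (dvM (dvC (al w) r) e3)); ring.
- by apply: (is_derive_eq (dvM (dvC (al w) r) e4)); ring.
Qed.

Lemma strip_C2_comb a b c (k k' : R) Z Zw Zww Zr Zrr Y Yw Yww Yr Yrr :
  strip_C2 a b c Z Zw Zww Zr Zrr -> strip_C2 a b c Y Yw Yww Yr Yrr ->
  strip_C2 a b c (fun w r => k * Z w r + k' * Y w r)
    (fun w r => k * Zw w r + k' * Yw w r) (fun w r => k * Zww w r + k' * Yww w r)
    (fun w r => k * Zr w r + k' * Yr w r) (fun w r => k * Zrr w r + k' * Yrr w r).
Proof.
move=> hZ hY w r wI cr.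
have [z0 z1 z2 z3 z4] := hZ w r wI cr; have [y0 y1 y2 y3 y4] := hY w r wI cr.
split.
- by ptcs.
- by eapply is_derive_eq; [dvs|ring].
- by eapply is_derive_eq; [dvs|ring].
- have z3' : is_derive r 1 (fun r => Z w r) _ := z3.
  have y3' : is_derive r 1 (fun r => Y w r) _ := y3.
  by eapply is_derive_eq; [dvs|ring].
- have z4' : is_derive r 1 (fun r => Zr w r) _ := z4.
  have y4' : is_derive r 1 (fun r => Yr w r) _ := y4.
  by eapply is_derive_eq; [dvs|ring].
Qed.

Lemma strip_C2_shift a b c h Z Zw Zww Zr Zrr : strip_C2 a b c Z Zw Zww Zr Zrr ->
  strip_C2 (a - h) (b - h) c (fun w => Z (w + h)) (fun w => Zw (w + h))
    (fun w => Zww (w + h)) (fun w => Zr (w + h)) (fun w => Zrr (w + h)).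
Proof.
move=> hZ w r; rewrite lerBlDr lerBrDr => wI cr.
have [z0 z1 z2 z3 z4] := hZ _ r wI cr.
have ds : is_derive w 1 (fun w => w + h) 1.
  by apply: (is_derive_eq (dvD (dvI w) (dvC h w))); ring.
split => //.
- have cs : ptc (fun w _ => w + h) w r by apply: (@ptc_w _ (fun w => w + h)); exact: dv_cont ds.
  have pc : {for (w, r), continuous (fun z : R * R => (z.1 + h, z.2))}.
    by apply: (@cvg_pair _ _ _ _ (nbhs (w + h)) (nbhs r)); [exact: cs|exact: cvg_snd].
  exact: (continuous_comp pc z0).
- by apply: (is_derive_eq (@dv_comp _ (Z^~ r) (fun w => w + h) w _ _ z1 ds)); rewrite mulr1.
- by apply: (is_derive_eq (@dv_comp _ (Zw^~ r) (fun w => w + h) w _ _ z2 ds)); rewrite mulr1.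
Qed.

Lemma strip_C2_dilate a b c (l : R) Z Zw Zww Zr Zrr : 0 < c -> 1 <= l ->
  strip_C2 a b c Z Zw Zww Zr Zrr ->
  strip_C2 a b c (fun w r => Z w (l * r)) (fun w r => Zw w (l * r))
    (fun w r => Zww w (l * r)) (fun w r => l * Zr w (l * r))
    (fun w r => l ^+ 2 * Zrr w (l * r)).
Proof.
move=> c0 l1 hZ w r wI cr.
have clr : c <= l * r.
  by apply: (le_trans cr); rewrite ler_peMl// (le_trans (ltW c0)).
have [z0 z1 z2 z3 z4] := hZ w _ wI clr.
have ds : is_derive r 1 (fun r => l * r) l.
  by apply: (is_derive_eq (dvM (dvC l r) (dvI r))); ring.
split => //.
- by apply: ptc_comp_y => //; exact: dv_cont ds.
- by apply: (is_derive_eq (@dv_comp _ (Z w) (fun r => l * r) r _ _ z3 ds)); rewrite mulrC.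
- apply: (is_derive_eq (dvM (dvC l r) (@dv_comp _ (Zr w) (fun r => l * r) r _ _ z4 ds))).
  by ring.
Qed.

Lemma strip_C2_sub a b c a' b' Z Zw Zww Zr Zrr : a <= a' -> b' <= b ->
  strip_C2 a b c Z Zw Zww Zr Zrr -> strip_C2 a' b' c Z Zw Zww Zr Zrr.
Proof.
move=> aa bb hZ w r /andP[aw wb]; apply: hZ.
by rewrite (le_trans aa aw) (le_trans wb bb).
Qed.
End StripC2.

(** * Maximum principle and comparison on a narrow strip *)

Section MaximumPrinciple.
Context {R : realType}.
Variables (c k0 : R) (kap : R -> R).
Hypothesis hkap : forall r, c <= r -> `|kap r| <= k0.
Implicit Types (a b w r e : R).

(** [r] times the Euler operator. The multiplication makes the second and first order terms
    invariant under dilations in [r] and shifts in [w]. *)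
Definition euler_op (Z Zww Zr Zrr : R -> R -> R) w r : R :=
  - r ^+ 2 * Zrr w r - 3%:R * r * Zr w r - Zww w r + kap r * Z w r.

(* The quotient by [p] is maximal at an interior point; [p] is a strict
   supersolution because the strip is narrow. *)
Lemma maximum_principle a b Z Zw Zww Zr Zrr : a < b -> k0 * (b - a) ^+ 2 < 1 ->
  strip_C2 a b c Z Zw Zww Zr Zrr ->
  (forall w r, a < w < b -> c < r -> euler_op Z Zww Zr Zrr w r <= 0) ->
  (forall r, c <= r -> Z a r <= 0 /\ Z b r <= 0) ->
  (forall w, a <= w <= b -> Z w c <= 0) ->
  (forall e, 0 < e -> exists N : R, forall w r, a <= w <= b -> N <= r -> Z w r <= e) ->
  forall w r, a <= w <= b -> c <= r -> Z w r <= 0.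
Proof.
move=> ab small hZ hM hlat hwall hinf w1 r1 w1I cr1.
rewrite leNgt; apply/negP => Z1.
have l0 : 0 < b - a by rewrite subr_gt0.
(* Lies between 1 and 2, and [- p'' = 2 / (b - a)^2] exceeds [2 k0 >= |kap| p] on a narrow strip. *)
pose p w := 2%:R - ((w - a) / (b - a)) ^+ 2.
have pb w : a <= w <= b -> 1 <= p w <= 2%:R.
  move=> /andP[aw wb].
  have q0 : 0 <= (w - a) / (b - a) by rewrite divr_ge0 ?subr_ge0// ltW.
  have q1 : (w - a) / (b - a) <= 1 by rewrite ler_pdivrMr// mul1r lerD2r.
  have := exprn_ile1 2 q0 q1; have := exprn_ge0 2 q0; rewrite /p.
  move: (_ ^+ 2) => t t0 t1; apply/andP; split; lra.
have p0 w : a <= w <= b -> 0 < p w by move=> /pb/andP[+ _]; exact: lt_le_trans.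
(* A quarter suffices: since [p <= 2], the maximum of [Z / p] is at least half the value at
   [(w1, r1)], so it cannot be attained at the far end, where [Z] is at most a quarter of that
   value. *)
have [N hN] := hinf _ (divr_gt0 Z1 (ltr0n _ 4)).
pose d := Num.max N r1.
have cd : c <= d by rewrite le_max cr1 orbT.
have r1d : c <= r1 <= d by rewrite cr1 le_max lexx orbT.
pose h w r := Z w r * (p w)^-1.
have dp w : is_derive w 1 p (- (2%:R * (w - a) / (b - a) ^+ 2)).
  rewrite /p; eapply is_derive_eq; first by dvs.
  by field; rewrite gt_eqF.
have dp' w : is_derive w 1 (fun w => - (2%:R * (w - a) / (b - a) ^+ 2)) (- (2%:R / (b - a) ^+ 2)).
  by eapply is_derive_eq; [dvs|field; rewrite gt_eqF].
have ch : cont_rect a b c d h.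
  move=> w r wI /andP[cr _]; apply: (@ptcM _ Z (fun w _ => (p w)^-1)).
    by have [] := hZ w r wI cr.
  apply: (@ptcV _ (fun w _ => p w)); first by rewrite gt_eqF// p0.
  by apply: ptc_w; exact: dv_cont (dp w).
have [w [r [wI rI hmax]]] := cont_rect_max (ltW ab) cd ch.
have /andP[cr rd] := rI.
pose m := h w r.
have mE : Z w r = m * p w by rewrite /m /h mulfVK// gt_eqF// p0.
have m1 : Z w1 r1 / 2%:R <= m.
  apply: le_trans (hmax _ _ w1I r1d); rewrite /h ler_pM2l// lef_pV2 ?posrE ?p0//.
  by have /andP[] := pb w1 w1I.
have m0 : 0 < m by apply: lt_le_trans m1; rewrite divr_gt0.
have Zwr : 0 < Z w r by rewrite mE mulr_gt0// p0.
have rltd : r < d.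
  rewrite lt_neqAle rd andbT; apply/negP => /eqP rdE.
  have Nr : N <= r by rewrite rdE le_max lexx.
  have := hN w r wI Nr; apply/negP; rewrite -ltNge mE.
  apply: (@lt_le_trans _ _ m).
    apply: lt_le_trans m1; rewrite ltr_pM2l// ltf_pV2 ?posrE//.
    by rewrite ltr_nat.
  by rewrite ler_peMr ?(ltW m0)//; have /andP[] := pb w wI.
have cltr : c < r.
  rewrite lt_neqAle cr andbT; apply/negP => /eqP rE.
  by have := hwall w wI; rewrite leNgt rE Zwr.
have wI' : a < w < b.
  have /andP[aw wb] := wI; rewrite !lt_neqAle aw wb !andbT; apply/andP; split.
    by apply/negP => /eqP wE; have [+ _] := hlat r cr; rewrite leNgt wE Zwr.
  by apply/negP => /eqP wE; have [_ +] := hlat r cr; rewrite leNgt -wE Zwr.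
have below w' r' : a <= w' <= b -> c <= r' <= d -> Z w' r' <= m * p w'.
  move=> w'I r'I; have := hmax w' r' w'I r'I.
  by rewrite {1}/h ler_pdivrMr// p0.
have [_ _ _ _ zrr] := hZ w r wI cr.
have [_ _ zww _ _] := hZ w r wI cr.
have [zr0 zrr0] : Zr w r = 0 /\ Zrr w r <= 0.
  apply: (@second_derivative_test _ (Z w) (Zr w) r _ c d) => //.
  - by rewrite cltr.
  - by move=> t /andP[/ltW ct _]; have [] := hZ w t wI ct.
  - by move=> t /andP[/ltW ct /ltW td]; rewrite mE; apply: below => //; rewrite ct.
have [_ zww0] : Zw w r - m * - (2%:R * (w - a) / (b - a) ^+ 2) = 0 /\
    Zww w r - m * - (2%:R / (b - a) ^+ 2) <= 0.
  apply: (@second_derivative_test _ (fun w => Z w r - m * p w)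
    (fun w => Zw w r - m * - (2%:R * (w - a) / (b - a) ^+ 2)) w
    (Zww w r - m * - (2%:R / (b - a) ^+ 2)) a b) => //.
  - move=> t /andP[/ltW at_ /ltW tb]; have tI : a <= t <= b by rewrite at_.
    have [_ dz _ _ _] := hZ t r tI cr; have dpt := dp t.
    by eapply is_derive_eq; [dvs|ring].
  - move=> t /andP[/ltW at_ /ltW tb]; rewrite mE subrr subr_le0.
    by apply: below; rewrite ?at_// cr ltW.
have := hM w r wI' cltr; apply/negP; rewrite -ltNge /euler_op zr0 mulr0 subr0.
have h1 : 0 <= - r ^+ 2 * Zrr w r by rewrite mulNr -mulrN mulr_ge0 ?sqr_ge0// oppr_ge0.
have h2 : - (k0 * (2%:R * m)) <= kap r * Z w r.
  rewrite lerNl; apply: (le_trans (ler_norm _)); rewrite normrN normrM.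
  apply: ler_pM => //; first exact: hkap.
  rewrite gtr0_norm// mE mulrC ler_wpM2r ?(ltW m0)//.
  by have /andP[] := pb w wI.
have h3 : k0 * (2%:R * m) < 2%:R * m / (b - a) ^+ 2.
  rewrite ltr_pdivlMr ?exprn_gt0// mulrAC -[X in _ < X]mul1r ltr_pM2r//.
  exact: mulr_gt0.
rewrite mulrN opprK in zww0.
have h4 : 2%:R * m / (b - a) ^+ 2 = m * (2%:R / (b - a) ^+ 2) by ring.
rewrite h4 in h3.
move: h1 h2 h3 zww0.
set t1 := - r ^+ 2 * _; set t2 := k0 * _; set t3 := kap r * _; set t4 := m * _.
move: t1 t2 t3 t4 (Zww w r) => t1 t2 t3 t4 t5 *.
by lra.
Qed.

Lemma comparison a b W Ww Www Wr Wrr Q Qw Qww Qr Qrr : a < b -> k0 * (b - a) ^+ 2 < 1 ->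
  strip_C2 a b c W Ww Www Wr Wrr -> strip_C2 a b c Q Qw Qww Qr Qrr ->
  (forall w r, a < w < b -> c < r ->
    `|euler_op W Www Wr Wrr w r| <= euler_op Q Qww Qr Qrr w r) ->
  (forall r, c <= r -> `|W a r| <= Q a r /\ `|W b r| <= Q b r) ->
  (forall w, a <= w <= b -> `|W w c| <= Q w c) ->
  (forall e, 0 < e -> exists N : R, forall w r, a <= w <= b -> N <= r -> `|W w r| <= e) ->
  (forall w r, a <= w <= b -> c <= r -> 0 <= Q w r) ->
  forall w r, a <= w <= b -> c <= r -> `|W w r| <= Q w r.
Proof.
move=> ab small hW hQ hM hlat hwall hinf Q0 w r wI cr.
have key s : `|s| = 1 -> s * W w r - Q w r <= 0.
  move=> s1.
  have sle (x y : R) : `|x| <= y -> s * x + -1 * y <= 0.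
    move=> xy; rewrite mulN1r subr_le0; apply: le_trans xy.
    by apply: (le_trans (ler_norm _)); rewrite normrM s1 mul1r.
  rewrite -[Q w r]mul1r -mulNr.
  apply: (maximum_principle ab small (strip_C2_comb s (-1) hW hQ)) wI cr.
  - move=> w' r' w'I cr'; have := sle _ _ (hM w' r' w'I cr').
    by congr (_ <= _); rewrite /euler_op; ring.
  - by move=> r' cr'; have [h1 h2] := hlat r' cr'; split; exact: sle.
  - by move=> w' w'I; apply: sle; exact: hwall.
  - move=> e e0; have [N hN] := hinf e e0; exists (Num.max N c) => w' r' w'I.
    rewrite ge_max => /andP[Nr cr'].
    have := sle _ _ (hN w' r' w'I Nr); have := Q0 w' r' w'I cr'.
    move: (s * W w' r') (Q w' r') => t1 t2 *; lra.
rewrite ler_norml; have := key 1 (normr1 _); have := key (-1) (normrN1 _).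
by rewrite mul1r mulN1r => h1 h2; apply/andP; split; lra.
Qed.
End MaximumPrinciple.

(** * Barriers for the corrector with homogeneous boundary values *)

Section EulerLayer.
Context {R : realType}.
Implicit Types (w r h l e x y : R).
Variables (c k0 th eps C1 C2 kc : R) (kap chi : R -> R).
Variables (G W Ww Www Wr Wrr : R -> R -> R).
Hypotheses (c_gt0 : 0 < c) (k0_ge1 : 1 <= k0).
Hypothesis hkap : forall r, c <= r -> `|kap r| <= k0.
Hypothesis hkapL : forall r l, c <= r -> 1 <= l -> `|kap (l * r) - kap r| <= k0 * (l - 1).
Hypotheses (th_gt0 : 0 < th) (small : 8%:R * k0 * th ^+ 2 <= 1).
Hypotheses (eps_gt0 : 0 < eps) (eps_le1 : eps <= 1).
Hypothesis hchi : forall x, 0 <= x -> `|chi x| <= kc.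
Hypothesis hchiL : forall x y, 0 <= x -> x <= y -> `|chi y - chi x| <= kc * (y - x).
Hypothesis hchi1 : forall x, 1 <= x -> chi x = 0.
Hypothesis hG1 : forall w r, 0 <= w <= th -> c <= r -> `|G w r| <= C1 / th / r.
Hypothesis hG2 : forall w r, 0 <= w <= th -> c <= r -> `|G w r| <= C2.
Hypothesis hGr : forall w r l, 0 <= w <= th -> c <= r -> 1 <= l ->
  `|G w (l * r) - G w r| <= C2 * (l - 1).
Hypothesis hGw : forall w h r, 0 <= w -> 0 <= h -> w + h <= th -> c <= r ->
  `|G (w + h) r - G w r| <= C2 * h.

(** Source left after subtraction of the boundary extension, [G] being [euler_op] applied to that
    extension. The constant [m] counts its three copies of [G], two of them multiplied by the
    cutoff. *)
Let Phi (w r : R) : R := chi (w / eps) * G 0 r + chi ((th - w) / eps) * G th r - G w r.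
Let m : R := 2%:R * kc + 1.

Hypothesis hW : strip_C2 0 th c W Ww Www Wr Wrr.
Hypothesis hM : forall w r, 0 < w < th -> c < r -> euler_op kap W Www Wr Wrr w r = Phi w r.
Hypothesis hlat : forall r, c <= r -> W 0 r = 0 /\ W th r = 0.
Hypothesis hwall : forall w, 0 <= w <= th -> W w c = 0.
Hypothesis hinf : forall e, 0 < e -> exists N : R, forall w r, 0 <= w <= th -> N <= r ->
  `|W w r| <= e.

Let k0_ge0 : 0 <= k0. Proof. exact: le_trans ler01 _. Qed.
Let kc_ge0 : 0 <= kc. Proof. exact: le_trans (normr_ge0 _) (hchi (lexx 0)). Qed.
Let m_ge0 : 0 <= m. Proof. by rewrite addr_ge0// mulr_ge0. Qed.
Let i0 : 0 <= (0 : R) <= th. Proof. by rewrite lexx ltW. Qed.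
Let ith : 0 <= th <= th. Proof. by rewrite lexx ltW. Qed.
Let C2_ge0 : 0 <= C2. Proof. exact: le_trans (normr_ge0 _) (hG2 i0 (lexx c)). Qed.
Let C1_ge0 : 0 <= C1.
Proof.
have := le_trans (normr_ge0 _) (hG1 i0 (lexx c)).
by rewrite -mulrA pmulr_lge0// mulr_gt0 ?invr_gt0.
Qed.

Let small' : k0 * th ^+ 2 <= 8%:R^-1.
Proof. by rewrite -[8%:R^-1]mulr1 ler_pdivlMl// mulrA. Qed.

Let small1 : k0 * (th - 0) ^+ 2 < 1.
Proof. by rewrite subr0; apply: (le_lt_trans small'); rewrite invf_lt1// ltr1n. Qed.

Let inv_th : 16%:R * k0 <= 2%:R / th ^+ 2.
Proof.
rewrite ler_pdivlMr ?exprn_gt0//.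
have h := small; move: h; move: (th ^+ 2) => t h.
have -> : 16%:R * k0 * t = 2%:R * (8%:R * k0 * t) by ring.
by rewrite -[X in _ <= X]mulr1 ler_wpM2l.
Qed.

Let r_gt0 (r : R) : c <= r -> 0 < r. Proof. exact: lt_le_trans. Qed.

Let Phi_le (w r e : R) : 0 <= w <= th -> `|G 0 r| <= e -> `|G th r| <= e -> `|G w r| <= e ->
  `|Phi w r| <= m * e.
Proof.
move=> /andP[w0 wth] h0 h1 hw.
have e0 : 0 <= e by exact: le_trans hw.
have a0 : 0 <= w / eps by rewrite divr_ge0// ltW.
have a1 : 0 <= (th - w) / eps by rewrite divr_ge0 ?subr_ge0// ltW.
have -> : m * e = kc * e + kc * e + e by rewrite /m; ring.
apply: (le_trans (ler_normB _ _)); apply: lerD => //.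
apply: (le_trans (ler_normD _ _)); rewrite !normrM.
by apply: lerD; apply: ler_pM => //; exact: hchi.
Qed.

Let p (w : R) : R := 2%:R - (w / th) ^+ 2.
Let p' (w : R) : R := - (2%:R * w / th ^+ 2).
Let p'' (w : R) : R := - (2%:R / th ^+ 2).
Let dp (w : R) : is_derive w 1 p (p' w).
Proof. by rewrite /p; eapply is_derive_eq; [dvs|rewrite /p'; field; rewrite gt_eqF]. Qed.
Let dp' (w : R) : is_derive w 1 p' (p'' w).
Proof. by rewrite /p'; eapply is_derive_eq; [dvs|rewrite /p''; field; rewrite gt_eqF]. Qed.

Let p_bound (w : R) : 0 <= w <= th -> 1 <= p w <= 2%:R.
Proof.
move=> /andP[w0 wth].
have q0 : 0 <= w / th by rewrite divr_ge0// ltW.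
have q1 : w / th <= 1 by rewrite ler_pdivrMr// mul1r.
have := exprn_ile1 2 q0 q1; have := exprn_ge0 2 q0; rewrite /p.
by move: (_ ^+ 2) => t t0 t1; apply/andP; split; lra.
Qed.

Let kapM_ge (r x e : R) : c <= r -> 0 <= x -> x <= e -> - (k0 * e) <= kap r * x.
Proof.
move=> cr x0 xe; rewrite lerNl; apply: (le_trans (ler_norm _)).
by rewrite normrN normrM ler_pM ?hkap// ger0_norm.
Qed.

(** For the barrier [A w (th - w) / r] the radial part reproduces [1 / r] with factor one and the
    angular part gives [2 A / r], which outweighs the zeroth-order term. Although [A] is of order
    [1 / th], the product with [w (th - w) <= th^2] stays bounded as [th] decreases. *)
Lemma euler_lateral_bound w r : 0 <= w <= th -> c <= r ->
  `|W w r| <= m * C1 / th * (w * (th - w)) / r.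
Proof.
move=> wI cr; pose A := m * C1 / th.
have A0 : 0 <= A by rewrite divr_ge0 ?mulr_ge0// ltW.
pose al (w : R) := A * (w * (th - w)); pose al' (w : R) := A * (th - 2%:R * w).
pose al'' (w : R) := - (2%:R * A).
have d1 w' : is_derive w' 1 al (al' w').
  by rewrite /al; eapply is_derive_eq; [dvs|rewrite /al'; ring].
have d2 w' : is_derive w' 1 al' (al'' w').
  by rewrite /al'; eapply is_derive_eq; [dvs|rewrite /al''; ring].
have d3 r' : c <= r' -> is_derive r' 1 (fun r => r^-1) (- (r' ^+ 2)^-1).
  move=> /r_gt0 r0.
  by eapply is_derive_eq; [dvs; rewrite gt_eqF|field; rewrite gt_eqF].
have d4 r' : c <= r' -> is_derive r' 1 (fun r => - (r ^+ 2)^-1) (2%:R / r' ^+ 3).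
  move=> /r_gt0 r0.
  by eapply is_derive_eq; [dvs; rewrite expf_neq0// gt_eqF|field; rewrite gt_eqF].
have hQ := strip_C2_sep (a := 0) (b := th) (fun w _ => d1 w) (fun w _ => d2 w) d3 d4.
have al0 w' : 0 <= w' <= th -> 0 <= al w' <= A * th ^+ 2.
  move=> /andP[w0 wth]; have b0 : 0 <= th - w' by rewrite subr_ge0.
  rewrite /al; apply/andP; split; first by apply: mulr_ge0 => //; exact: mulr_ge0.
  by rewrite ler_wpM2l// expr2 ler_pM// gerBl.
apply: (comparison hkap th_gt0 small1 hW hQ _ _ _ _ _ wI cr) => //.
- move=> {wI cr}w {}r wI cr; rewrite hM//.
  have wI' : 0 <= w <= th by case/andP: wI => /ltW -> /ltW ->.
  have cr' := ltW cr; have r0 := r_gt0 cr'.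
  have /andP[a0 a1] := al0 w wI'.
  have -> : euler_op kap (fun w r => al w * r^-1) (fun w r => al'' w * r^-1)
      (fun w r => al w * - (r ^+ 2)^-1) (fun w r => al w * (2%:R / r ^+ 3)) w r =
      (2%:R * A + al w + kap r * al w) / r.
    by rewrite /euler_op /al''; field; rewrite gt_eqF.
  apply: (@le_trans _ _ (A / r)).
    have -> : A / r = m * (C1 / th / r) by rewrite /A; ring.
    by apply: Phi_le => //; exact: hG1.
  rewrite ler_pM2r ?invr_gt0//.
  have h1 := kapM_ge cr' a0 a1.
  have h2 : k0 * (A * th ^+ 2) <= A.
    rewrite mulrCA ler_piMr//; apply: (le_trans small').
    by rewrite invf_le1// ler1n.
  move: h1 h2; move: (kap r * al w) (k0 * (A * th ^+ 2)) => t1 t2 *.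
  by have A0' := A0; lra.
- move=> {cr}{}r cr'; have [-> ->] := hlat cr'.
  by rewrite normr0 /al subrr mul0r !mulr0 mul0r.
- by move=> {wI}{}w wI; rewrite hwall// normr0 mulr_ge0 ?invr_ge0 ?(ltW c_gt0)//;
    case/andP: (al0 w wI).
- by move=> {wI cr}{}w {}r wI /r_gt0 r0; rewrite mulr_ge0 ?invr_ge0 ?(ltW r0)//;
    case/andP: (al0 w wI).
Qed.

Let A2 : R := m * C2.
Let A2_ge0 : 0 <= A2. Proof. exact: mulr_ge0. Qed.
Let x3 (r : R) : R := (c / r) ^+ 3.

Let x3_bound (r : R) : c <= r -> 0 <= x3 r <= 1.
Proof.
move=> cr; have r0 := r_gt0 cr.
have q0 : 0 <= c / r by rewrite divr_ge0// ltW.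
by rewrite /x3 exprn_ge0//= exprn_ile1// ler_pdivrMr// mul1r.
Qed.

(** [1 - (c / r)^3] vanishes at the wall, and the radial part of the operator maps it to
    [3 (c / r)^3]. Positivity near the wall comes from this term, elsewhere from
    [- p'' = 2 / th^2]. *)
Let wall_barrier w r : 0 <= w <= th -> c <= r -> `|W w r| <= A2 * p w * (1 - x3 r).
Proof.
move=> wI cr.
pose al (w : R) := A2 * p w; pose al' (w : R) := A2 * p' w; pose al'' (w : R) := A2 * p'' w.
pose be (r : R) := 1 - x3 r.
pose be' (r : R) := 3%:R * c ^+ 3 / r ^+ 4; pose be'' (r : R) := - (12%:R * c ^+ 3 / r ^+ 5).
have d1 w' : is_derive w' 1 al (al' w').
  by rewrite /al; have ? := dp w'; eapply is_derive_eq; [dvs|rewrite /al'; ring].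
have d2 w' : is_derive w' 1 al' (al'' w').
  by rewrite /al'; have ? := dp' w'; eapply is_derive_eq; [dvs|rewrite /al''; ring].
have d3 r' : c <= r' -> is_derive r' 1 be (be' r').
  move=> /r_gt0 r0; rewrite /be /x3.
  by eapply is_derive_eq; [dvs; rewrite gt_eqF|rewrite /be'; field; rewrite gt_eqF].
have d4 r' : c <= r' -> is_derive r' 1 be' (be'' r').
  move=> /r_gt0 r0; rewrite /be'.
  by eapply is_derive_eq; [dvs; rewrite expf_neq0// gt_eqF|rewrite /be''; field; rewrite gt_eqF].
have hQ := strip_C2_sep (a := 0) (b := th) (fun w _ => d1 w) (fun w _ => d2 w) d3 d4.
have al0 w' : 0 <= w' <= th -> A2 <= al w' <= A2 * 2%:R.
  by move=> /p_bound/andP[p1 p2]; rewrite /al ler_peMr//= ler_wpM2l.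
have Q0 w' r' : 0 <= w' <= th -> c <= r' -> 0 <= al w' * be r'.
  move=> /al0/andP[a1 _] /x3_bound/andP[_ x1].
  by rewrite mulr_ge0 ?subr_ge0// (le_trans A2_ge0).
apply: (comparison hkap th_gt0 small1 hW hQ _ _ _ _ _ wI cr) => //.
- move=> {wI cr}w {}r wI cr; rewrite hM//.
  have wI' : 0 <= w <= th by case/andP: wI => /ltW -> /ltW ->.
  have cr' := ltW cr; have r0 := r_gt0 cr'.
  have /andP[a1 a2] := al0 w wI'; have /andP[xr0 xr1] := x3_bound cr'.
  apply: (@le_trans _ _ A2).
    by apply: Phi_le => //; exact: hG2.
  have -> : euler_op kap (fun w r => al w * be r) (fun w r => al'' w * be r)
      (fun w r => al w * be' r) (fun w r => al w * be'' r) w r =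
      3%:R * (al w * x3 r) + A2 * (2%:R / th ^+ 2) * (1 - x3 r) + kap r * (al w * (1 - x3 r)).
    by rewrite /euler_op /al'' /p'' /be /be' /be'' /x3; field; rewrite !gt_eqF.
  have b0 : 0 <= 1 - x3 r by rewrite subr_ge0.
  have a0 : 0 <= al w by exact: le_trans a1.
  have h1 : - (k0 * (A2 * 2%:R * (1 - x3 r))) <= kap r * (al w * (1 - x3 r)).
    by apply: kapM_ge => //; [exact: mulr_ge0|rewrite ler_wpM2r].
  have h2 : A2 * (16%:R * k0) * (1 - x3 r) <= A2 * (2%:R / th ^+ 2) * (1 - x3 r).
    by rewrite ler_wpM2r// ler_wpM2l.
  have h3 : A2 * x3 r <= al w * x3 r by rewrite ler_wpM2r.
  have h4 : A2 * (1 - x3 r) <= k0 * (A2 * (1 - x3 r)) by rewrite ler_peMl// mulr_ge0.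
  have h5 : 0 <= A2 * x3 r by exact: mulr_ge0.
  have h6 : 0 <= A2 * (1 - x3 r) by exact: mulr_ge0.
  have e1 : A2 * (16%:R * k0) * (1 - x3 r) = 16%:R * (k0 * (A2 * (1 - x3 r))) by ring.
  have e2 : k0 * (A2 * 2%:R * (1 - x3 r)) = 2%:R * (k0 * (A2 * (1 - x3 r))) by ring.
  have e3 : A2 = A2 * x3 r + A2 * (1 - x3 r) by ring.
  rewrite e1 in h2; rewrite e2 in h1; rewrite [X in X <= _]e3.
  move: h1 h2 h3 h4 h5 h6.
  move: (kap r * (al w * (1 - x3 r))) (A2 * (2%:R / th ^+ 2) * (1 - x3 r)).
  move: (al w * x3 r) (A2 * x3 r) (k0 * (A2 * (1 - x3 r))) (A2 * (1 - x3 r)).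
  by move=> t1 t2 t3 t4 t5 t6 *; lra.
- move=> {cr}{}r cr'; have [-> ->] := hlat cr'.
  by rewrite normr0 !Q0.
- by move=> {wI}{}w wI; rewrite hwall// normr0 Q0.
Qed.

Let sup_bound w r : 0 <= w <= th -> c <= r -> `|W w r| <= 2%:R * A2.
Proof.
move=> wI cr; apply: (le_trans (wall_barrier wI cr)).
have /andP[p1 p2] := p_bound wI; have /andP[xr0 xr1] := x3_bound cr.
have -> : 2%:R * A2 = A2 * 2%:R * 1 by ring.
apply: ler_pM; rewrite ?subr_ge0 ?gerBl//; last by rewrite ler_wpM2l.
by rewrite mulr_ge0// (le_trans ler01 p1).
Qed.

(** Linear vanishing at the wall, from [1 - l^-3 <= 3 (l - 1)]; it is the wall condition for
    dilation differences. *)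
Let wall_bound w l : 0 <= w <= th -> 1 <= l -> `|W w (l * c)| <= 6%:R * A2 * (l - 1).
Proof.
move=> wI l1; have l0 : 0 < l by exact: lt_le_trans l1.
have clc : c <= l * c by rewrite ler_peMl// ltW.
apply: (le_trans (wall_barrier wI clc)).
have /andP[p1 p2] := p_bound wI; have /andP[xr0 xr1] := x3_bound clc.
have -> : 6%:R * A2 * (l - 1) = A2 * 2%:R * (3%:R * (l - 1)) by ring.
apply: ler_pM.
- by rewrite mulr_ge0// (le_trans ler01 p1).
- by rewrite subr_ge0.
- by rewrite ler_wpM2l.
have -> : x3 (l * c) = (l ^+ 3)^-1 by rewrite /x3; field; rewrite !gt_eqF.
have l3 : 0 < l ^+ 3 by rewrite exprn_gt0.
rewrite -(ler_pM2r l3) mulrBl mul1r mulVf ?gt_eqF//.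
have h : l ^+ 2 + l + 1 <= 3%:R * l ^+ 3.
  have a1 : l <= l ^+ 2 by rewrite expr2 ler_peMl// ltW.
  have a2 : l ^+ 2 <= l ^+ 3 by rewrite [X in _ <= X]exprS ler_peMl// exprn_ge0// ltW.
  move: a1 a2; move: (l ^+ 2) (l ^+ 3) => t1 t2 *.
  by have l1' := l1; lra.
have -> : l ^+ 3 - 1 = (l - 1) * (l ^+ 2 + l + 1) by ring.
have -> : 3%:R * (l - 1) * l ^+ 3 = (l - 1) * (3%:R * l ^+ 3) by ring.
by rewrite ler_wpM2l// subr_ge0.
Qed.

Let A3 : R := 6%:R * k0 * A2.

(* Dilations [r -> l r] preserve the principal part of the operator, so the
   dilation difference has a source of order [l - 1] and the barrier
   [(l - 1) p w] applies once the wall has been controlled. *)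
Let dilation_bound w r l : 0 <= w <= th -> c <= r -> 1 <= l ->
  `|W w (l * r) - W w r| <= A3 * (l - 1) * p w.
Proof.
move=> wI cr l1; have l10 : 0 <= l - 1 by rewrite subr_ge0.
pose A := A3 * (l - 1).
have A30 : 0 <= A3 by rewrite !mulr_ge0.
have A0 : 0 <= A by rewrite mulr_ge0.
have d1 w' : is_derive w' 1 (fun w => A * p w) (A * p' w').
  by have ? := dp w'; eapply is_derive_eq; [dvs|ring].
have d2 w' : is_derive w' 1 (fun w => A * p' w) (A * p'' w').
  by have ? := dp' w'; eapply is_derive_eq; [dvs|ring].
have hQ := strip_C2_sep (a := 0) (b := th) (c := c) (fun w _ => d1 w) (fun w _ => d2 w)
  (fun r _ => dvC 1 r) (fun r _ => dvC 0 r).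
have hV := strip_C2_comb 1 (-1) (strip_C2_dilate c_gt0 l1 hW) hW.
have Q0 w' : 0 <= w' <= th -> A <= A * p w'.
  by move=> /p_bound/andP[p1 _]; rewrite ler_peMr.
have clr r' : c <= r' -> c <= l * r'.
  by move=> cr'; apply: (le_trans cr'); rewrite ler_peMl// ltW// r_gt0.
have -> : A3 * (l - 1) * p w = A * p w * 1 by rewrite mulr1.
have -> : W w (l * r) - W w r = 1 * W w (l * r) + -1 * W w r by ring.
apply: (comparison hkap th_gt0 small1 hV hQ _ _ _ _ _ wI cr) => //.
- move=> {wI cr}w {}r wI cr.
  have wI' : 0 <= w <= th by case/andP: wI => /ltW -> /ltW ->.
  have cr' := ltW cr; have r0 := r_gt0 cr'.
  have clr1 : c < l * r by apply: (lt_le_trans cr); rewrite ler_peMl// ltW.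
  have e1 := hM wI cr; have e2 := hM wI clr1.
  set lhs := euler_op _ _ _ _ _ w r.
  (* The zeroth-order coefficient is the only part of the operator that does not commute with the
     dilation. *)
  have -> : lhs = Phi w (l * r) - Phi w r + (kap r - kap (l * r)) * W w (l * r).
    by rewrite -e1 -e2 /lhs /euler_op; ring.
  rewrite /euler_op !mulr0 !subr0 mulr1 sub0r.
  have h1 : `|Phi w (l * r) - Phi w r| <= A2 * (l - 1).
    have -> : A2 * (l - 1) = kc * (C2 * (l - 1)) + kc * (C2 * (l - 1)) + C2 * (l - 1).
      by rewrite /A2 /m; ring.
    have -> : Phi w (l * r) - Phi w r = chi (w / eps) * (G 0 (l * r) - G 0 r) +
      chi ((th - w) / eps) * (G th (l * r) - G th r) - (G w (l * r) - G w r).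
      by rewrite /Phi; ring.
    have /andP[w0 w1] := wI'.
    apply: (le_trans (ler_normB _ _)); apply: lerD; last exact: hGr.
    apply: (le_trans (ler_normD _ _)); rewrite !normrM.
    apply: lerD; apply: ler_pM => //; try exact: hGr; apply: hchi.
      by rewrite divr_ge0// ltW.
    by rewrite divr_ge0 ?subr_ge0// ltW.
  have h2 : `|(kap r - kap (l * r)) * W w (l * r)| <= k0 * (l - 1) * (2%:R * A2).
    rewrite normrM distrC; apply: ler_pM => //; first exact: hkapL.
    by apply: sup_bound => //; exact: clr.
  have /andP[p1 p2] := p_bound wI'.
  have Ap : 0 <= A * p w by rewrite mulr_ge0// (le_trans ler01 p1).
  have h3 : - (k0 * (A * 2%:R)) <= kap r * (A * p w * 1).
    by rewrite mulr1; apply: kapM_ge => //; rewrite ler_wpM2l.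
  have h4 : A * (16%:R * k0) <= A * (2%:R / th ^+ 2) by rewrite ler_wpM2l.
  apply: (le_trans (ler_normD _ _)); apply: (le_trans (lerD h1 h2)).
  have h5 : A2 * (l - 1) <= k0 * (A2 * (l - 1)) by rewrite ler_peMl// mulr_ge0.
  have h6 : k0 * (A2 * (l - 1)) <= k0 * A.
    rewrite ler_wpM2l// /A /A3 ler_wpM2r// -[X in X <= _]mul1r ler_wpM2r//.
    by have := k0_ge1; move: k0 => t ht; lra.
  have e3 : A * p'' w = - (A * (2%:R / th ^+ 2)) by rewrite /p''; ring.
  rewrite e3.
  move: h3 h4 h5 h6.
  have -> : k0 * (l - 1) * (2%:R * A2) = 2%:R * (k0 * (A2 * (l - 1))) by ring.
  have -> : k0 * (A * 2%:R) = 2%:R * (k0 * A) by ring.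
  have -> : A * (16%:R * k0) = 16%:R * (k0 * A) by ring.
  have kA : 0 <= k0 * A by exact: mulr_ge0.
  move: kA; move: (A2 * (l - 1)) (k0 * A) (k0 * (A2 * _)) (A * (2%:R / _)) (kap r * _).
  by move=> t1 t2 t3 t4 t5 *; lra.
- move=> {cr}{}r cr'; have [-> ->] := hlat cr'; have [-> ->] := hlat (clr r cr').
  rewrite !mulr0 addr0 normr0 !mulr1; split; exact: le_trans (Q0 _ _).
- move=> {wI}{}w wI; rewrite (hwall wI) mulr0 addr0 mul1r mulr1.
  apply: (le_trans (wall_bound wI l1)); apply: le_trans (Q0 _ wI).
  by rewrite /A /A3 ler_wpM2r// ler_wpM2r// ler_peMr.
- move=> e e0; have [N hN] := hinf (divr_gt0 e0 (ltr0n _ 2)).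
  exists (Num.max N c) => {wI cr}{}w {}r wI; rewrite ge_max => /andP[Nr cr'].
  have Nlr : N <= l * r by apply: (le_trans Nr); rewrite ler_peMl// ltW// r_gt0.
  rewrite mul1r mulN1r; apply: (le_trans (ler_normB _ _)).
  apply: (le_trans (lerD (hN _ _ wI Nlr) (hN _ _ wI Nr))).
  by rewrite -mulrDl -mulr2n -[e *+ 2]mulr_natr mulfK.
- by move=> {wI cr}{}w {}r wI _; rewrite mulr1; exact: le_trans (Q0 _ wI).
Qed.

Lemma euler_radial_derivative w r : 0 <= w <= th -> c <= r ->
  `|r * Wr w r| <= 12%:R * k0 * m * C2.
Proof.
move=> wI cr; have r0 := r_gt0 cr.
have [_ _ _ d _] := hW wI cr.
have A30 : 0 <= A3 by rewrite !mulr_ge0.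
rewrite normrM gtr0_norm// -ler_pdivlMl//.
apply: (dv_bound_right ltr01 d) => h /andP[h0 _].
pose l := 1 + h / r.
have l1 : 1 <= l by rewrite lerDl divr_ge0// ltW.
have -> : r + h = l * r by rewrite /l; field; rewrite gt_eqF.
apply: (le_trans (dilation_bound wI cr l1)).
have /andP[p1 p2] := p_bound wI.
have -> : r^-1 * (12%:R * k0 * m * C2) * h = A3 * (l - 1) * 2%:R.
  by rewrite /A3 /A2 /l; field; rewrite gt_eqF.
by rewrite ler_wpM2l// mulr_ge0// subr_ge0.
Qed.

Let A4 : R := m * C1 / c + C2 * (1 + kc * expR 1).

Let A4_ge0 : 0 <= A4.
Proof.
have e0 := expR_ge0 (1 : R).
apply: addr_ge0; first by rewrite divr_ge0 ?mulr_ge0// ltW.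
by rewrite mulr_ge0// addr_ge0// mulr_ge0.
Qed.

(** The cutoff varies only for arguments below 1, where [exp (1 - x) >= 1]; this puts its Lipschitz
    bound into the shape of the exponential layers of the barrier. *)
Let chi_diff x y : 0 <= x -> x <= y -> `|chi y - chi x| <= kc * (y - x) * (expR 1 * expR (- x)).
Proof.
move=> x0 xy; rewrite -expRD.
have [x1|x1] := leP 1 x.
  rewrite !hchi1 ?(le_trans x1)// subrr normr0.
  by rewrite mulr_ge0 ?expR_ge0// mulr_ge0// subr_ge0.
apply: (le_trans (hchiL x0 xy)); apply: ler_peMr; first by rewrite mulr_ge0// subr_ge0.
by rewrite -[X in X <= _]expR0 ler_expR subr_ge0 ltW.
Qed.

(* The cutoffs in the source vary at scale [eps]; the barrier contains the layers
   [exp (- w / eps)] and [exp (- (th - w) / eps)] to match them. *)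
Let shift_bound h w r : 0 < h < th -> 0 <= w <= th - h -> c <= r ->
  `|W (w + h) r - W w r| <= 4%:R * A4 * h.
Proof.
move=> /andP[h0 hth] wI cr.
have b0 : 0 < th - h by rewrite subr_gt0.
have small2 : k0 * (th - h - 0) ^+ 2 < 1.
  apply: le_lt_trans small1; rewrite ler_wpM2l// !subr0.
  by rewrite ler_pXn2r ?nnegrE ?(ltW b0)// ?(ltW th_gt0)// gerBl ltW.
have wsub w' : 0 <= w' <= th - h -> 0 <= w' <= th /\ 0 <= w' + h <= th.
  move=> /andP[w0 wth]; rewrite w0 addr_ge0 ?(ltW h0)//= -lerBrDr wth.
  by split => //; apply: (le_trans wth); rewrite gerBl ltW.
pose E (w : R) := expR (- (w / eps)); pose E' (w : R) := expR (- ((th - h - w) / eps)).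
have dE w' : is_derive w' 1 E (- (E w' / eps)).
  have d1 : is_derive w' 1 (fun w => - (w / eps)) (- eps^-1).
    by eapply is_derive_eq; [dvs|ring].
  apply: (is_derive_eq (@dv_comp _ expR (fun w => - (w / eps)) w' _ _ (is_derive_expR _) d1)).
  by rewrite /E; ring.
have dE' w' : is_derive w' 1 E' (E' w' / eps).
  have d1 : is_derive w' 1 (fun w => - ((th - h - w) / eps)) (eps^-1).
    by eapply is_derive_eq; [dvs|ring].
  exact: (@dv_comp _ expR (fun w => - ((th - h - w) / eps)) w' _ _ (is_derive_expR _) d1).
have Eb w' : 0 <= w' <= th - h -> [/\ 0 <= E w', E w' <= 1, 0 <= E' w' & E' w' <= 1].
  move=> /andP[w0 wth]; rewrite !expR_ge0; split => //; rewrite -expR0 ler_expR oppr_le0.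
    by rewrite divr_ge0// ltW.
  by rewrite divr_ge0 ?subr_ge0// ltW.
pose A := A4 * h.
have A0 : 0 <= A by rewrite mulr_ge0// ltW.
(* The layers have amplitude [eps], so two derivatives give [1 / eps], the size of the
   differentiated cutoffs; [eps <= 1] keeps the barrier below [4 A]. *)
pose al w := A * (p w + eps * (2%:R - E w - E' w)).
pose al' w := A * (p' w + E w - E' w).
pose al'' w := A * (p'' w - E w / eps - E' w / eps).
have d1 w' : is_derive w' 1 al (al' w').
  have ? := dp w'; have ? := dE w'; have ? := dE' w'.
  by eapply is_derive_eq; [rewrite /al; dvs|rewrite /al'; field; rewrite gt_eqF].
have d2 w' : is_derive w' 1 al' (al'' w').
  have ? := dp' w'; have ? := dE w'; have ? := dE' w'.
  by eapply is_derive_eq; [rewrite /al'; dvs|rewrite /al''; field; rewrite gt_eqF].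
have hQ := strip_C2_sep (a := 0) (b := th - h) (c := c) (fun w _ => d1 w) (fun w _ => d2 w)
  (fun r _ => dvC 1 r) (fun r _ => dvC 0 r).
have hS := strip_C2_shift (h := h) hW; rewrite sub0r in hS.
have le1 : - h <= 0 by rewrite oppr_le0 ltW.
have le2 : th - h <= th by rewrite gerBl ltW.
have hV := strip_C2_comb 1 (-1) (strip_C2_sub le1 (lexx _) hS) (strip_C2_sub (lexx _) le2 hW).
have bb w' : 0 <= w' <= th - h -> 1 <= p w' + eps * (2%:R - E w' - E' w') <= 4%:R.
  move=> w'I; have [w'I2 _] := wsub w' w'I.
  have /andP[p1 p2] := p_bound w'I2; have [E0 E1 E'0 E'1] := Eb w' w'I.
  have b1 : 0 <= 2%:R - E w' - E' w' by move: (E w') (E' w') E0 E1 E'0 E'1 => t1 t2 *; lra.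
  have b2 : 2%:R - E w' - E' w' <= 2%:R by move: (E w') (E' w') E0 E1 E'0 E'1 => t1 t2 *; lra.
  have b3 : 0 <= eps * (2%:R - E w' - E' w') by rewrite mulr_ge0// ltW.
  have b4 : eps * (2%:R - E w' - E' w') <= 2%:R by rewrite (le_trans _ b2)// ler_piMl.
  by move: (eps * _) (p w') b3 b4 p1 p2 => t1 t2 *; apply/andP; split; lra.
have Q0 w' : 0 <= w' <= th - h -> A <= al w'.
  by move=> /bb/andP[b1 _]; rewrite /al ler_peMr.
have -> : W (w + h) r - W w r = 1 * W (w + h) r + -1 * W w r by ring.
apply: (@le_trans _ _ (al w * 1)); last first.
  have /andP[_ b4] := bb w wI.
  have -> : 4%:R * A4 * h = A * 4%:R by rewrite /A; ring.
  by rewrite mulr1 ler_wpM2l.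
(* On each lateral side one of the two values in the difference is zero, and the other is linear in
   [h] by the lateral bound. *)
have lat r' : c <= r' -> m * C1 / th * (h * (th - h)) / r' <= A.
  move=> cr'; have r0 := r_gt0 cr'.
  apply: (@le_trans _ _ (m * C1 / c * h)); last first.
    rewrite /A /A4; apply: ler_wpM2r; first exact: ltW.
    by rewrite lerDl mulr_ge0// addr_ge0// mulr_ge0// expR_ge0.
  have -> : m * C1 / th * (h * (th - h)) / r' = m * C1 * h * ((th - h) / th * r'^-1).
    by field; rewrite !gt_eqF.
  have -> : m * C1 / c * h = m * C1 * h * c^-1 by ring.
  rewrite ler_wpM2l ?mulr_ge0 ?(ltW h0)// -[X in _ <= X]mul1r.
  apply: ler_pM; rewrite ?invr_ge0 ?(ltW r0)//.
  - by rewrite divr_ge0// ltW.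
  - by rewrite ler_pdivrMr// mul1r.
  - by rewrite lef_pV2 ?posrE.
apply: (comparison hkap b0 small2 hV hQ _ _ _ _ _ wI cr) => //.
- move=> {wI cr}w {}r wI cr.
  have wI' : 0 <= w <= th - h by case/andP: wI => /ltW -> /ltW ->.
  have [wI1 wI2] := wsub w wI'; have /andP[w0 wth] := wI'.
  have cr' := ltW cr; have r0 := r_gt0 cr'.
  have wI3 : 0 < w < th by case/andP: wI => -> wb; rewrite (lt_le_trans wb).
  have wI4 : 0 < w + h < th by rewrite addr_gt0 ?(andP wI).1//= -ltrBrDr; case/andP: wI.
  have e1 := hM wI3 cr; have e2 := hM wI4 cr.
  set lhs := euler_op _ _ _ _ _ w r.
  have -> : lhs = Phi (w + h) r - Phi w r by rewrite -e1 -e2 /lhs /euler_op; ring.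
  have [E0 E1 E'0 E'1] := Eb w wI'.
  have h1 : `|Phi (w + h) r - Phi w r| <= C2 * h * (1 + kc * expR 1 * ((E w + E' w) / eps)).
    have -> : Phi (w + h) r - Phi w r = (chi ((w + h) / eps) - chi (w / eps)) * G 0 r
      - (chi ((th - w) / eps) - chi ((th - h - w) / eps)) * G th r - (G (w + h) r - G w r).
      have -> : th - h - w = th - (w + h) by ring.
      by rewrite /Phi; ring.
    have -> : C2 * h * (1 + kc * expR 1 * ((E w + E' w) / eps)) =
      kc * (h / eps) * (expR 1 * E w) * C2 + kc * (h / eps) * (expR 1 * E' w) * C2 + C2 * h by ring.
    apply: (le_trans (ler_normB _ _)); apply: lerD; last first.
      by apply: hGw => //; [exact: ltW|case/andP: wI2].
    apply: (le_trans (ler_normB _ _)); rewrite !normrM.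
    apply: lerD; apply: ler_pM => //; try exact: hG2.
      have -> : kc * (h / eps) = kc * ((w + h) / eps - w / eps) by ring.
      apply: chi_diff; first by rewrite divr_ge0// ltW.
      by rewrite ler_pM2r ?invr_gt0// lerDl ltW.
    have -> : kc * (h / eps) = kc * ((th - w) / eps - (th - h - w) / eps) by ring.
    apply: chi_diff; first by rewrite divr_ge0 ?subr_ge0// ltW.
    by rewrite ler_pM2r ?invr_gt0// lerD2r gerBl ltW.
  apply: (le_trans h1).
  have -> : euler_op kap (fun w _ => al w * 1) (fun w _ => al'' w * 1) (fun w _ => al w * 0)
     (fun w _ => al w * 0) w r =
     A * (2%:R / th ^+ 2) + A * ((E w + E' w) / eps) +
     kap r * (A * (p w + eps * (2%:R - E w - E' w))).
    by rewrite /euler_op /al /al'' /p''; field; rewrite !gt_eqF.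
  have /andP[b1 b4] := bb w wI'.
  set pe := p w + _ in b1 b4 *.
  have h3 : - (k0 * (A * 4%:R)) <= kap r * (A * pe).
    by apply: kapM_ge => //; [rewrite mulr_ge0// (le_trans ler01 b1)|rewrite ler_wpM2l].
  have h4 : A * (16%:R * k0) <= A * (2%:R / th ^+ 2) by rewrite ler_wpM2l.
  have h5 : A <= k0 * A by rewrite ler_peMl.
  have X0 : 0 <= (E w + E' w) / eps by rewrite divr_ge0 ?addr_ge0// ltW.
  have h6 : C2 * h * (1 + kc * expR 1 * ((E w + E' w) / eps)) <= A + A * ((E w + E' w) / eps).
    have a1 : 0 <= m * C1 / c by rewrite divr_ge0 ?mulr_ge0// ltW.
    have a2 : 0 <= kc * expR 1 by rewrite mulr_ge0// expR_ge0.
    have a3 : 0 <= h * C2 by rewrite mulr_ge0// ltW.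
    have a4 : C2 * h <= A.
      rewrite /A /A4 [C2 * h]mulrC [X in _ <= X]mulrC.
      by rewrite ler_wpM2l ?(ltW h0)// ler_wpDl// ler_peMr// lerDl.
    have a5 : C2 * h * (kc * expR 1) <= A.
      rewrite mulrAC /A ler_wpM2r ?(ltW h0)// /A4 ler_wpDl// ler_wpM2l//.
      by rewrite lerDr.
    rewrite mulrDr mulr1 lerD// [C2 * h * (_ * _)]mulrA.
    by rewrite ler_wpM2r.
  apply: (le_trans h6).
  have -> : A * (2%:R / th ^+ 2) + A * ((E w + E' w) / eps) + kap r * (A * pe) =
    A * (2%:R / th ^+ 2) + kap r * (A * pe) + A * ((E w + E' w) / eps) by ring.
  rewrite lerD2r.
  move: h3 h4 h5.
  have -> : k0 * (A * 4%:R) = 4%:R * (k0 * A) by ring.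
  have -> : A * (16%:R * k0) = 16%:R * (k0 * A) by ring.
  have aux (t1 t2 t3 t4 : R) : 0 <= t1 -> - (4%:R * t2) <= t4 -> 16%:R * t2 <= t3 ->
    t1 <= t2 -> t1 <= t3 + t4 by move=> *; lra.
  exact: aux A0.
- move=> {cr}{}r cr'; have [w0 w1] := hlat cr'.
  have i1 : 0 <= th - h <= th by rewrite (ltW b0).
  have i2 : 0 <= h <= th by rewrite !ltW.
  have j0 : 0 <= (0 : R) <= th - h by rewrite lexx ltW.
  have j1 : 0 <= th - h <= th - h by rewrite lexx ltW.
  rewrite add0r subrK w0 w1 !mulr0 addr0 add0r !mulr1 !mul1r mulN1r normrN; split.
    apply: le_trans (Q0 _ j0); apply: le_trans (lat r cr').
    exact: euler_lateral_bound.
  apply: le_trans (Q0 _ j1); apply: le_trans (lat r cr').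
  have := euler_lateral_bound i1 cr'.
  by have -> : (th - h) * (th - (th - h)) = h * (th - h) by ring.
- move=> {wI}{}w wI; have [wI1 wI2] := wsub w wI.
  by rewrite (hwall wI1) (hwall wI2) !mulr0 addr0 normr0 mulr1 (le_trans A0)// Q0.
- move=> e e0; have [N hN] := hinf (divr_gt0 e0 (ltr0n _ 2)).
  exists N => {wI cr}{}w {}r wI Nr; have [wI1 wI2] := wsub w wI.
  rewrite mul1r mulN1r; apply: (le_trans (ler_normB _ _)).
  apply: (le_trans (lerD (hN _ _ wI2 Nr) (hN _ _ wI1 Nr))).
  by rewrite -mulrDl -mulr2n -[e *+ 2]mulr_natr mulfK.
- by move=> {wI cr}{}w {}r wI _; rewrite mulr1 (le_trans A0)// Q0.
Qed.

Lemma euler_angular_derivative w r : 0 <= w < th -> c <= r ->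
  `|Ww w r| <= 4%:R * (m * C1 / c + C2 * (1 + kc * expR 1)).
Proof.
move=> /andP[w0 wth] cr.
have wI : 0 <= w <= th by rewrite w0 ltW.
have [_ d _ _ _] := hW wI cr.
have e0 : 0 < th - w by rewrite subr_gt0.
apply: (dv_bound_right e0 d) => h /andP[h0 hw].
have hth : h < th by apply: (lt_le_trans hw); rewrite gerBl.
apply: shift_bound => //; first by rewrite h0.
by rewrite w0 lerBrDr -lerBrDl ltW.
Qed.
End EulerLayer.

(** * The Euler corrector *)

Section SmoothFunctions.
Context {R : realType}.
Implicit Types (f : R -> R -> R) (h : R -> R) (w x y r c M : R).

Lemma smooth2_dw f : smooth2 f -> smooth2 (dw f).
Proof. by move=> sf k; have [_ [_ _ +]] := sf k.+1. Qed.

Lemma smooth2_dy f : smooth2 f -> smooth2 (dy f).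
Proof. by move=> sf k; have [_ [_ _ _ +]] := sf k.+1. Qed.

Lemma smooth2_iter_dw f k : smooth2 f -> smooth2 (iter k dw f).
Proof. by move=> sf; elim: k => //= k; exact: smooth2_dw. Qed.

Lemma smooth2_ptc f w y : smooth2 f -> ptc f w y.
Proof. by move=> sf; exact: (@Ck_ptc _ _ _ w y (sf 0%N)). Qed.

Lemma smooth2_dvw f w y : smooth2 f -> is_derive w 1 (f^~ y) (dw f w y).
Proof. by move=> sf; exact: (@Ck_dvw _ _ _ w y (sf 1%N)). Qed.

Lemma smooth2_dvy f w y : smooth2 f -> is_derive y 1 (f w) (dy f w y).
Proof. by move=> sf; exact: (@Ck_dvy _ _ _ w y (sf 1%N)). Qed.

Lemma smooth1_dv h n x : smooth1 h -> is_derive x 1 (derive1n n h) (derive1n n.+1 h x).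
Proof. by move=> sh; exact: derivable_dv (sh n x). Qed.

Lemma uniform_bound n (P : nat -> R -> Prop) :
  (forall i M M', M <= M' -> P i M -> P i M') -> (forall i, exists M, P i M) ->
  exists M, 1 <= M /\ forall i, (i < n)%N -> P i M.
Proof.
move=> mono ex; elim: n => [|n [M [M1 hM]]]; first by exists 1.
have [M' hM'] := ex n; exists (Num.max M M'); split; first by rewrite le_max M1.
move=> i; rewrite ltnS leq_eqVlt => /predU1P[->|iN].
  by apply: mono hM'; rewrite le_max lexx orbT.
by apply: mono (hM i iN); rewrite le_max lexx.
Qed.

Lemma ge_pos_poly (x a M : R) n : 0 < x -> x ^+ n * `|a| <= M -> `|a| <= M / x ^+ n.
Proof. by move=> x0 h; rewrite ler_pdivlMr ?exprn_gt0// mulrC. Qed.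

Lemma exp_decay_bounds (h : nat -> R -> R) c : 0 < c -> (forall n, exp_decay c (h n)) ->
  forall N, exists M, 1 <= M /\
    forall n j x, (n < N)%N -> (j < N)%N -> c <= x -> x ^+ j * `|h n x| <= M.
Proof.
move=> c0 dh N.
pose P j n M := forall x, c <= x -> x ^+ j * `|h n x| <= M.
have mono j n M M' : M <= M' -> P j n M -> P j n M'.
  by move=> MM hM x cx; apply: le_trans MM; exact: hM.
have exP j n : exists M, P j n M.
  have [M0 [a [a0 ha]]] := dh n.
  exists (M0 * (j`!%:R / a ^+ j)) => x cx; apply: exp_decay_poly => //; last exact: ha.
  by rewrite (le_trans (ltW c0)).
have ex n : exists M, forall j, (j < N)%N -> P j n M.
  by have [M [_ hM]] := uniform_bound N (fun j => @mono j n) (exP^~ n); exists M.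
have [|M [M1 hM]] := uniform_bound N (P := fun n M => forall j, (j < N)%N -> P j n M) _ ex.
  by move=> n M M' MM hM j jN; apply: mono MM _; exact: hM.
by exists M; split => // n j x nN jN; exact: hM.
Qed.

(* Functions that are bounded and Lipschitz along dilations form an algebra; for
   a differentiable [f] the condition is boundedness of [f] and of [r f']. *)
Definition dilation_lip c h := exists M, forall r l, c <= r -> 1 <= l ->
  `|h r| <= M /\ `|h (l * r) - h r| <= M * (l - 1).

Lemma dilation_lip_dv c h (h' : R -> R) M : 0 < c ->
  (forall r, c <= r -> is_derive r 1 h (h' r)) ->
  (forall r, c <= r -> `|h r| <= M) -> (forall r, c <= r -> `|r * h' r| <= M) ->
  dilation_lip c h.
Proof.
move=> c0 dh hM h'M; exists M => r l cr l1; split; first exact: hM.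
have r0 : 0 < r by exact: lt_le_trans cr.
have rl : r <= l * r by rewrite ler_peMl// ltW.
have -> : M * (l - 1) = M / r * (l * r - r) by field; rewrite gt_eqF.
apply: (dv_lip rl (f' := h')) => t /andP[rt _]; first exact: dh (le_trans cr rt).
have ct := le_trans cr rt; have t0 : 0 < t by exact: lt_le_trans ct.
have M0 : 0 <= M by exact: le_trans (normr_ge0 _) (hM r cr).
apply: (@le_trans _ _ (M / t)).
  by rewrite ler_pdivlMr// mulrC -[X in X * _](gtr0_norm t0) -normrM h'M.
by rewrite ler_wpM2l// lef_pV2 ?posrE.
Qed.

Lemma dilation_lip_cst c (a : R) : dilation_lip c (fun=> a).
Proof.
exists `|a| => r l _ l1; rewrite subrr normr0; split => //.
by rewrite mulr_ge0// subr_ge0.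
Qed.

Lemma dilation_lipD c h k : dilation_lip c h -> dilation_lip c k ->
  dilation_lip c (fun r => h r + k r).
Proof.
move=> [M hM] [N hN]; exists (M + N) => r l cr l1.
have [h1 h2] := hM r l cr l1; have [k1 k2] := hN r l cr l1; split.
  by apply: (le_trans (ler_normD _ _)); exact: lerD.
have -> : h (l * r) + k (l * r) - (h r + k r) = (h (l * r) - h r) + (k (l * r) - k r) by ring.
by rewrite mulrDl; apply: (le_trans (ler_normD _ _)); exact: lerD.
Qed.

Lemma dilation_lipM c h k : 0 < c -> dilation_lip c h -> dilation_lip c k ->
  dilation_lip c (fun r => h r * k r).
Proof.
move=> c0 [M hM] [N hN]; exists (2%:R * (M * N)) => r l cr l1.
have clr : c <= l * r by apply: (le_trans cr); rewrite ler_peMl// ltW// (lt_le_trans c0).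
have [h1 h2] := hM r l cr l1; have [k1 k2] := hN r l cr l1.
have [h3 _] := hM (l * r) l clr l1.
have MN : `|h r * k r| <= M * N by rewrite normrM ler_pM.
have MN0 : 0 <= M * N by exact: le_trans MN.
split; first by rewrite (le_trans MN)// ler_peMl// ler1n.
have -> : h (l * r) * k (l * r) - h r * k r =
  h (l * r) * (k (l * r) - k r) + (h (l * r) - h r) * k r by ring.
have -> : 2%:R * (M * N) * (l - 1) = M * (N * (l - 1)) + M * (l - 1) * N by ring.
by apply: (le_trans (ler_normD _ _)); rewrite !normrM; apply: lerD; apply: ler_pM.
Qed.

Lemma dilation_lipZ c (a : R) h : 0 < c -> dilation_lip c h -> dilation_lip c (fun r => a * h r).
Proof. by move=> c0; apply: dilation_lipM => //; exact: dilation_lip_cst. Qed.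

Lemma dilation_lip_weighted c h (M : R) j n : 0 < c -> smooth1 h ->
  (forall n' j' x, (n' < n.+2)%N -> (j' < j.+2)%N -> c <= x ->
    x ^+ j' * `|derive1n n' h x| <= M) ->
  dilation_lip c (fun r => r ^+ j * derive1n n h r).
Proof.
move=> c0 sh hM.
have dh r : is_derive r 1 (fun r => r ^+ j * derive1n n h r)
    (j%:R * r ^+ j.-1 * derive1n n h r + r ^+ j * derive1n n.+1 h r).
  have d1 := @smooth1_dv h n r sh; have d2 := dvX j (dvI r).
  by apply: (is_derive_eq (dvM d2 d1)); ring.
apply: (dilation_lip_dv (M := (j.+1)%:R * M) c0 (fun r _ => dh r)) => r cr.
  have r0 : 0 <= r by exact: le_trans (ltW c0) cr.
  rewrite normrM normrX (ger0_norm r0).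
  have h1 := @hM n j r (leqnSn _) (leqnSn _) cr.
  apply: (le_trans h1); rewrite ler_peMl ?ler1n//.
  by apply: le_trans h1; rewrite mulr_ge0// exprn_ge0.
have r0 : 0 <= r by exact: le_trans (ltW c0) cr.
have h1 := @hM n j r (leqnSn _) (leqnSn _) cr.
have h2 := @hM n.+1 j.+1 r (leqnn _) (leqnn _) cr.
have -> : r * (j%:R * r ^+ j.-1 * derive1n n h r + r ^+ j * derive1n n.+1 h r) =
  j%:R * (r ^+ j * derive1n n h r) + r ^+ j.+1 * derive1n n.+1 h r.
  by case: (j) => [|i] /=; rewrite ?exprS; ring.
apply: (le_trans (ler_normD _ _)).
have -> : j.+1%:R * M = j%:R * M + M by rewrite -addn1 natrD mulrDl mul1r.
apply: lerD; last by rewrite normrM normrX (ger0_norm r0).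
by rewrite !normrM normrX (ger0_norm r0) normr_nat ler_wpM2l.
Qed.
End SmoothFunctions.

(** * Angular derivatives of the Prandtl radial velocity *)

Section RadialVelocity.
Context {R : realType}.
Variables (c M : R) (up : R -> R -> R).
Hypotheses (c_gt0 : 0 < c) (sup : smooth2 up).
Hypothesis hup : forall k w y, (k < 7)%N -> c <= y -> y ^+ 2 * `|iter k dw up w y| <= M.
Implicit Types (w y : R).

(* [rv k] is the [k]-th angular derivative of [r v_p^0]. *)
Definition rv (f : R -> R -> R) k w y : R := tail (iter k.+1 dw f w) y.

Let tb k w : (k < 7)%N -> tail_bound c M (iter k dw up w).
Proof.
move=> k7; split.
  by move=> y; apply: ptc_slice_y; apply: smooth2_ptc; exact: smooth2_iter_dw.
move=> t ct; apply: ge_pos_poly; first exact: lt_le_trans ct.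
exact: hup.
Qed.

Let d k w y : is_derive w 1 ((iter k dw up)^~ y) (iter k.+1 dw up w y).
Proof. by apply: smooth2_dvw; exact: smooth2_iter_dw. Qed.

(** Differentiating the tail uses three consecutive derivatives of [up]: the integrand, its
    derivative and the Taylor remainder. Four derivatives of [rv] thus fit into the range below
    7. *)
Lemma rv_dw k w y : (k < 4)%N -> c <= y -> is_derive w 1 ((rv up k)^~ y) (rv up k.+1 w y).
Proof.
move=> k4 cy; have [k1 k2 k3] : [/\ (k.+1 < 7)%N, (k.+2 < 7)%N & (k.+3 < 7)%N].
  by move: k4; case: k => [|[|[|[|]]]].
exact: (@tail_derive_param _ c c_gt0 _ _ _ M w y cy (d k.+1) (d k.+2)
  (fun w => tb w k1) (fun w => tb w k2) (fun w => tb w k3)).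
Qed.

Lemma rv_dy k w y : (k < 6)%N -> c < y -> is_derive y 1 (rv up k w) (- iter k.+1 dw up w y).
Proof. by move=> k6 cy; exact: (@tail_derive _ c M _ y c_gt0 (@tb k.+1 w k6) cy). Qed.

Lemma rv_le k w y : (k < 6)%N -> c <= y -> `|rv up k w y| <= M / y.
Proof. by move=> k6 cy; exact: (@tail_le _ c M _ y c_gt0 (@tb k.+1 w k6) cy). Qed.

Lemma rv_ptc k w y : (k < 4)%N -> c < y -> ptc (rv up k) w y.
Proof.
move=> k4 cy; have [k1 k2 k3] : [/\ (k.+1 < 7)%N, (k.+2 < 7)%N & (k.+3 < 7)%N].
  by move: k4; case: k => [|[|[|[|]]]].
exact: (@tail_ptc _ c c_gt0 _ _ _ M w y cy (d k.+1) (d k.+2)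
  (fun w => tb w k1) (fun w => tb w k2) (fun w => tb w k3)).
Qed.
End RadialVelocity.

(** * Coefficients of the lateral interpolation *)

Section LateralCoefficients.
Context {R : realType}.
Variables (ga : nat -> R -> R) (a0 a1 g : R).
Hypothesis dga : forall (k : nat) (w : R), (k < 3)%N -> is_derive w 1 (ga k) (ga k.+1 w).
Implicit Types (w : R).

(* [lat_coef k] is the [k]-th derivative of [(a0 + a1 w) ga 0 w / g]. *)
Definition lat_coef k w : R := ((a0 + a1 * w) * ga k w + k%:R * a1 * ga k.-1 w) / g.

Lemma lat_coef_dv k w : (k < 3)%N -> is_derive w 1 (lat_coef k) (lat_coef k.+1 w).
Proof.
move=> k3; have d1 := dga w k3; rewrite /lat_coef.
case: k k3 d1 => [|k] k3 d1 /=.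
  have E : (fun w => ((a0 + a1 * w) * ga 0%N w + 0 * a1 * ga 0%N w) / g) =
           (fun w => (a0 + a1 * w) * ga 0%N w / g).
    by apply/funext => x; rewrite mul0r mul0r addr0.
  rewrite E; have d1' : is_derive w 1 (fun w => ga 0%N w) _ := d1.
  by eapply is_derive_eq; [dvs|ring].
have d2 := dga w (ltnW k3).
have d1' : is_derive w 1 (fun w => ga k.+1 w) _ := d1.
have d2' : is_derive w 1 (fun w => ga k w) _ := d2.
by eapply is_derive_eq; [dvs|rewrite -(addn1 k.+1) natrD; ring].
Qed.

(** Since the interpolation weight is affine, derivatives of any order cost one factor [m], later
    [1 / th], and no higher power; 4 is 1 plus the largest order 3. *)
Lemma lat_coef_le k w (m Ga : R) : (k < 4)%N -> `|a0 + a1 * w| <= 1 -> `|a1| <= m -> 1 <= m ->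
  (forall i, (i < 4)%N -> `|ga i w| <= Ga) -> `|lat_coef k w| <= 4%:R * m * (Ga / `|g|).
Proof.
move=> k4 b0 b1 m1 hGa.
have Ga0 : 0 <= Ga by exact: le_trans (hGa 0%N isT).
rewrite /lat_coef normrM normfV [X in _ <= X]mulrA ler_wpM2r ?invr_ge0//.
have -> : 4%:R * m * Ga = 1 * (m * Ga) + 3%:R * m * Ga by ring.
apply: (le_trans (ler_normD _ _)); apply: lerD.
  rewrite normrM; apply: ler_pM => //; apply: (le_trans (hGa _ k4)).
  by rewrite ler_peMl.
rewrite !normrM normr_nat; apply: ler_pM => //.
  by apply: ler_pM => //; rewrite ler_nat -ltnS.
by apply: hGa; rewrite (leq_ltn_trans (leq_pred k)).
Qed.

Lemma lat_coef0_le w (Ga : R) : `|a0 + a1 * w| <= 1 -> `|ga 0%N w| <= Ga ->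
  `|lat_coef 0 w| <= Ga / `|g|.
Proof.
move=> b0 hGa; rewrite /lat_coef mul0r mul0r addr0 normrM normfV ler_wpM2r ?invr_ge0//.
by rewrite normrM -[X in _ <= X]mul1r ler_pM.
Qed.
End LateralCoefficients.

(** * Zeroth-order coefficient of the Euler operator *)

Section EulerCoefficient.
Context {R : realType}.
Variables (c m0 : R) (ue : R -> R).
Hypotheses (c_gt0 : 0 < c) (m0_gt0 : 0 < m0) (sue : smooth1 ue).
Hypothesis ue_ge : forall r, c <= r -> m0 <= ue r.
Hypothesis ue_decay : forall k, (0 < k)%N -> exp_decay c (derive1n k ue).
Implicit Types (r l : R).

(** Coefficient of [v] in [r] times the Euler operator, with [- 2 / r] included. *)
Definition kappa (f : R -> R) r : R :=
  r * (r * derive1n 2 f r / f r + derive1 f r / f r) - 2%:R.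

Let derive1n_derive1 n : derive1n n (derive1 ue) = derive1n n.+1 ue.
Proof. by rewrite /derive1n -iterSr. Qed.

Lemma kappa_bounds : exists k0, 1 <= k0 /\ forall r l, c <= r -> 1 <= l ->
  `|kappa ue r| <= k0 /\ `|kappa ue (l * r) - kappa ue r| <= k0 * (l - 1).
Proof.
have sue' : smooth1 (derive1 ue) by move=> k x; rewrite derive1n_derive1; exact: sue.
have [|M [M1 hM]] := @exp_decay_bounds _ (fun n => derive1n n (derive1 ue)) c c_gt0 _ 5.
  by move=> n; rewrite derive1n_derive1; exact: ue_decay.
have w1 : dilation_lip c (fun r => r ^+ 1 * derive1n 0 (derive1 ue) r).
  apply: (@dilation_lip_weighted _ _ _ M) => // n j x n1 j1 cx; apply: hM => //.
    exact: ltn_trans n1 _.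
  exact: ltn_trans j1 _.
have w2 : dilation_lip c (fun r => r ^+ 2 * derive1n 1 (derive1 ue) r).
  apply: (@dilation_lip_weighted _ _ _ M) => // n j x n1 j1 cx; apply: hM => //.
    exact: ltn_trans n1 _.
  exact: ltn_trans j1 _.
have ue0 r : c <= r -> 0 < ue r by move=> cr; exact: lt_le_trans (ue_ge cr).
have w3 : dilation_lip c (fun r => (ue r)^-1).
  refine (@dilation_lip_dv _ c (fun r => (ue r)^-1) (fun r => - derive1 ue r / ue r ^+ 2)
    (m0^-1 + M * (m0 ^+ 2)^-1) c_gt0 _ _ _) => r cr; have u0 := ue0 r cr; have ug := ue_ge cr.
  - by apply: dvV; [rewrite gt_eqF|exact: (@smooth1_dv _ ue 0 r)].
  - rewrite gtr0_norm ?invr_gt0//; apply: (@le_trans _ _ m0^-1).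
      by rewrite lef_pV2 ?posrE.
    by rewrite lerDl mulr_ge0 ?invr_ge0 ?sqr_ge0// (le_trans ler01).
  - rewrite mulrA mulrN normrM normrN normfV.
    apply: (@le_trans _ _ (M * (m0 ^+ 2)^-1)); last by rewrite lerDr invr_ge0 ltW.
    have r0 : 0 <= r by exact: le_trans (ltW c_gt0) cr.
    apply: ler_pM => //.
      have := @hM 0%N 1%N r isT isT cr; rewrite expr1 normrM (ger0_norm r0).
      exact.
    rewrite ger0_norm ?sqr_ge0// lef_pV2 ?posrE ?exprn_gt0//.
    by rewrite ler_pXn2r ?nnegrE// ltW.
have [k0 hk] : dilation_lip c (kappa ue).
  have h1 := dilation_lipM c_gt0 w2 w3; have h2 := dilation_lipM c_gt0 w1 w3.
  have := dilation_lipD (dilation_lipD h1 h2) (dilation_lip_cst c (- 2%:R)).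
  congr dilation_lip; apply/funext => r; rewrite /kappa !derive1n_derive1 expr1.
  by rewrite (_ : derive1n 1 ue = derive1 ue)//; ring.
exists (Num.max 1 k0); split; first by rewrite le_max lexx.
move=> r l cr l1; have [h1 h2] := hk r l cr l1; split.
  by apply: (le_trans h1); rewrite le_max lexx orbT.
by apply: (le_trans h2); rewrite ler_wpM2r ?subr_ge0// le_max lexx orbT.
Qed.
End EulerCoefficient.

Section CutoffFunction.
Context {R : realType}.
Variable (chi : R -> R).
Hypotheses (schi : smooth1 chi) (chi1 : forall x, 1 <= x -> chi x = 0).

Lemma cutoff_lipschitz : exists kc, (forall x, 0 <= x -> `|chi x| <= kc) /\
  forall x y : R, 0 <= x -> x <= y -> `|chi y - chi x| <= kc * (y - x).
Proof.
have c1 : cont_rect 0 1 0 1 (fun w _ => derive1 chi w).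
  move=> w y _ _; apply: (@ptc_w _ (derive1 chi)).
  exact: dv_cont (@smooth1_dv _ chi 1 w schi).
have [M hM] := cont_rect_bounded c1.
have i0 : 0 <= (0 : R) <= 1 by rewrite lexx ler01.
have M0 : 0 <= M by exact: le_trans (normr_ge0 _) (hM 0 0 i0 i0).
have lip x y : 0 <= x -> x <= y -> `|chi y - chi x| <= M * (y - x).
  move=> x0 xy.
  have lip1 x' y' : 0 <= x' -> x' <= y' -> y' <= 1 -> `|chi y' - chi x'| <= M * (y' - x').
    move=> x'0 x'y' y'1; apply: (dv_lip x'y' (f' := derive1 chi)) => t /andP[xt ty].
      exact: (@smooth1_dv _ chi 0 t).
    by apply: (hM t 0) => //; rewrite (le_trans x'0)//= (le_trans ty).
  have [y1|/ltW y1] := leP y 1; first exact: lip1.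
  have [x1|/ltW x1] := leP x 1; last first.
    by rewrite !chi1// subrr normr0 mulr_ge0// subr_ge0.
  rewrite (chi1 y1) -(chi1 (lexx 1)); apply: (le_trans (lip1 _ _ x0 x1 (lexx _))).
  by rewrite ler_wpM2l// lerD2r.
exists M; split => // x x0.
have [x1|/ltW x1] := leP x 1; last by rewrite chi1// normr0.
have := lip x 1 x0 x1; rewrite chi1// sub0r normrN => h.
by apply: (le_trans h); rewrite ler_piMr// gerBl.
Qed.
End CutoffFunction.

(** * The extension of the boundary data and the source it generates *)

Section BoundaryExtension.
Context {R : realType}.
Variables (c th m k0 : R) (ka : R -> R) (A B : nat -> R -> R) (V0 V1 : R -> R).
Hypotheses (c_gt0 : 0 < c) (th_ge0 : 0 <= th).
Hypotheses (sV0 : smooth1 V0) (sV1 : smooth1 V1).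
Hypotheses (dA : forall (k : nat) (w : R), (k < 3)%N -> is_derive w 1 (A k) (A k.+1 w)).
Hypotheses (dB : forall (k : nat) (w : R), (k < 3)%N -> is_derive w 1 (B k) (B k.+1 w)).
Hypotheses (hA : forall k w, (k < 4)%N -> 0 <= w <= th -> `|A k w| <= m).
Hypotheses (hB : forall k w, (k < 4)%N -> 0 <= w <= th -> `|B k w| <= m).
Hypothesis (hka : forall r, c <= r -> `|ka r| <= k0).
Implicit Types (w r l h : R).

(** Derivative of order [i] in the angle and [j] in the radius of the extension; the factors [1]
    match the linear combinations of [strip_C2_comb]. *)
Definition bext (i j : nat) w r : R :=
  1 * (A i w * derive1n j V0 r) + 1 * (B i w * derive1n j V1 r).

Lemma bext_C2 : strip_C2 0 th c (bext 0 0) (bext 1 0) (bext 2 0) (bext 0 1) (bext 0 2).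
Proof.
apply: strip_C2_comb; apply: strip_C2_sep => w _; try exact: dA; try exact: dB;
  exact: smooth1_dv.
Qed.

Definition bext_src w r : R := euler_op ka (bext 0 0) (bext 2 0) (bext 0 1) (bext 0 2) w r.

(** One more power of [r] on the data than the operator consumes gives the decay [1 / r]; 5 is the
    sum of the coefficients 1, 3, 1 of the operator. Linearity in [m] means that a single factor
    [1 / th] appears. *)
Lemma bext_src_le Mv w r : 0 <= w <= th -> c <= r ->
  (forall n, (n < 3)%N -> r ^+ n.+1 * `|derive1n n V0 r| <= Mv) ->
  (forall n, (n < 3)%N -> r ^+ n.+1 * `|derive1n n V1 r| <= Mv) ->
  `|bext_src w r| <= 2%:R * m * Mv * (5%:R + k0) / r.
Proof.
move=> wI cr h0 h1; have r0 : 0 < r by exact: lt_le_trans cr.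
have m_ge0 : 0 <= m by exact: le_trans (normr_ge0 _) (hA (k := 0) isT wI).
have Mv0 : 0 <= Mv by apply: le_trans (h0 0%N isT); rewrite expr1 mulr_ge0// ltW.
have k00 : 0 <= k0 by exact: le_trans (normr_ge0 _) (hka cr).
have b (n i : nat) : (n < 3)%N -> (i < 4)%N -> `|r ^+ n * bext i n w r| <= 2%:R * m * Mv / r.
  move=> n3 i4; rewrite ler_pdivlMr// mulrC -[X in X * _](gtr0_norm r0) -normrM.
  have -> : r * (r ^+ n * bext i n w r) =
    A i w * (r ^+ n.+1 * derive1n n V0 r) + B i w * (r ^+ n.+1 * derive1n n V1 r).
    by rewrite /bext exprS; ring.
  have -> : 2%:R * m * Mv = m * Mv + m * Mv by ring.
  have rn : 0 <= r ^+ n.+1 by rewrite exprn_ge0// ltW.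
  apply: (le_trans (ler_normD _ _)); apply: lerD; rewrite normrM; apply: ler_pM => //.
  - exact: hA.
  - by rewrite normrM (ger0_norm rn); exact: h0.
  - exact: hB.
  - by rewrite normrM (ger0_norm rn); exact: h1.
have -> : bext_src w r = - (r ^+ 2 * bext 0 2 w r) - 3%:R * (r ^+ 1 * bext 0 1 w r)
   - r ^+ 0 * bext 2 0 w r + ka r * (r ^+ 0 * bext 0 0 w r).
  by rewrite /bext_src /euler_op; ring.
have -> : 2%:R * m * Mv * (5%:R + k0) / r = 2%:R * m * Mv / r + 3%:R * (2%:R * m * Mv / r)
  + 2%:R * m * Mv / r + k0 * (2%:R * m * Mv / r) by ring.
apply: (le_trans (ler_normD _ _)); apply: lerD; last first.
  by rewrite normrM; apply: ler_pM => //; [exact: hka|exact: b].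
apply: (le_trans (ler_normB _ _)); apply: lerD; last exact: b.
apply: (le_trans (ler_normB _ _)); apply: lerD; first by rewrite normrN; exact: b.
by rewrite normrM normr_nat ler_wpM2l//; exact: b.
Qed.

Let aV (V : R -> R) r : R := - (r ^+ 2 * derive1n 2 V r) - 3%:R * (r * derive1n 1 V r)
  + ka r * V r.

(** The constant may depend on the angle here: it enters only bounds on derivatives of [v_e^1],
    which are later multiplied by [sqrt eps]. *)
Lemma bext_src_lipschitz :
  dilation_lip c ka ->
  (forall n j, exists M, forall r, c <= r -> r ^+ j * `|derive1n n V0 r| <= M) ->
  (forall n j, exists M, forall r, c <= r -> r ^+ j * `|derive1n n V1 r| <= M) ->
  exists C, [/\ forall w r, 0 <= w <= th -> c <= r -> `|bext_src w r| <= C,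
    forall w r l, 0 <= w <= th -> c <= r -> 1 <= l ->
      `|bext_src w (l * r) - bext_src w r| <= C * (l - 1) &
    forall w h r, 0 <= w -> 0 <= h -> w + h <= th -> c <= r ->
      `|bext_src (w + h) r - bext_src w r| <= C * h].
Proof.
move=> dka bV0 bV1.
have wtd V : smooth1 V ->
    (forall n j, exists M, forall r, c <= r -> r ^+ j * `|derive1n n V r| <= M) ->
    forall n j, dilation_lip c (fun r => r ^+ j * derive1n n V r).
  move=> sV bV n j.
  have [Ma ha] := bV n j; have [Mb hb] := bV n j.-1; have [Mc hc] := bV n j.+1.
  have [Md hd] := bV n.+1 j.+1.
  have d1 r := @smooth1_dv _ V n r sV; have d2 r := dvX j (dvI r).
  have d3 r := dvM (d2 r) (d1 r).
  apply: (@dilation_lip_dv _ _ _ _ (Ma + (j%:R * Ma + Md)) c_gt0 (fun r _ => d3 r)) => r cr.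
    have r0 : 0 <= r by exact: le_trans (ltW c_gt0) cr.
    have Mx (M x : R) : r ^+ j * `|x| <= M -> 0 <= M.
      by apply: le_trans; rewrite mulr_ge0// exprn_ge0.
    have hd0 := le_trans (mulr_ge0 (exprn_ge0 j.+1 r0) (normr_ge0 _)) (hd r cr).
    rewrite normrM normrX (ger0_norm r0); apply: (le_trans (ha r cr)).
    by rewrite lerDl addr_ge0// mulr_ge0// (Mx _ _ (ha r cr)).
  have r0 : 0 <= r by exact: le_trans (ltW c_gt0) cr.
  have Ma0 : 0 <= Ma by apply: le_trans (ha r cr); rewrite mulr_ge0// exprn_ge0.
  apply: (@le_trans _ _ (j%:R * Ma + Md)); last by rewrite lerDr.
  have -> : r * (j%:R * r ^+ j.-1 * 1 * derive1n n V r + r ^+ j * derive1n n.+1 V r) =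
    j%:R * (r ^+ j * derive1n n V r) + r ^+ j.+1 * derive1n n.+1 V r.
    by clear -r; case: j => [|i] /=; rewrite ?exprS; ring.
  apply: (le_trans (ler_normD _ _)); apply: lerD.
    by rewrite normrM normr_nat ler_wpM2l// normrM normrX (ger0_norm r0) ha.
  by rewrite normrM normrX (ger0_norm r0) hd.
have la V : smooth1 V ->
    (forall n j, exists M, forall r, c <= r -> r ^+ j * `|derive1n n V r| <= M) ->
    dilation_lip c (aV V) /\ dilation_lip c V.
  move=> sV bV; have W := wtd V sV bV.
  have lV : dilation_lip c V.
    have := W 0%N 0%N; congr dilation_lip; apply/funext => r.
    by rewrite expr0 mul1r.
  split => //.
  have h1 := dilation_lipZ (-1) c_gt0 (W 2%N 2%N).
  have h2 := dilation_lipZ (- 3%:R) c_gt0 (W 1%N 1%N).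
  have := dilation_lipD (dilation_lipD h1 h2) (dilation_lipM c_gt0 dka lV).
  by congr dilation_lip; apply/funext => r; rewrite /aV expr1; ring.
have [[N1 h1] [N2 h2]] := la V0 sV0 bV0; have [[N3 h3] [N4 h4]] := la V1 sV1 bV1.
pose N := Num.max (Num.max N1 N2) (Num.max N3 N4).
have [n1 n2 n3 n4] : [/\ N1 <= N, N2 <= N, N3 <= N & N4 <= N].
  by rewrite /N; split; rewrite !le_max lexx ?orbT.
have up (V : R -> R) (M : R) : M <= N ->
    (forall r l, c <= r -> 1 <= l -> `|V r| <= M /\ `|V (l * r) - V r| <= M * (l - 1)) ->
    forall r l, c <= r -> 1 <= l -> `|V r| <= N /\ `|V (l * r) - V r| <= N * (l - 1).
  move=> MN H r l cr l1; have [x1 x2] := H r l cr l1; split; first exact: le_trans MN.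
  by apply: (le_trans x2); rewrite ler_wpM2r ?subr_ge0.
have {h1}h1 := up _ _ n1 h1; have {h2}h2 := up _ _ n2 h2.
have {h3}h3 := up _ _ n3 h3; have {h4}h4 := up _ _ n4 h4.
have srcE w r : bext_src w r = A 0%N w * aV V0 r - A 2 w * V0 r
    + B 0%N w * aV V1 r - B 2 w * V1 r.
  rewrite /bext_src /euler_op /bext /aV (_ : derive1n 0 V0 = V0)// (_ : derive1n 0 V1 = V1)//.
  move: (derive1n 1 V0 r) (derive1n 2 V0 r) (derive1n 1 V1 r) (derive1n 2 V1 r) (V0 r) (V1 r).
  by move=> *; ring.
have m_ge0 : 0 <= m.
  by apply: le_trans (normr_ge0 _) (@hA 0%N 0 isT _); rewrite lexx.
have four (x1 x2 x3 x4 y1 y2 y3 y4 e : R) :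
    `|x1 * y1| <= e -> `|x2 * y2| <= e -> `|x3 * y3| <= e -> `|x4 * y4| <= e ->
    `|x1 * y1 - x2 * y2 + x3 * y3 - x4 * y4| <= 4%:R * e.
  move=> e1 e2 e3 e4; have -> : 4%:R * e = e + e + e + e by ring.
  apply: (le_trans (ler_normB _ _)); apply: lerD => //.
  apply: (le_trans (ler_normD _ _)); apply: lerD => //.
  by apply: (le_trans (ler_normB _ _)); apply: lerD.
exists (4%:R * (m * N)); split.
- move=> w r wI cr; have [x1 _] := h1 r 1 cr (lexx _); have [x2 _] := h2 r 1 cr (lexx _).
  have [x3 _] := h3 r 1 cr (lexx _); have [x4 _] := h4 r 1 cr (lexx _).
  by rewrite srcE; apply: four; rewrite normrM; apply: ler_pM => //;
    [exact: hA|exact: hA|exact: hB|exact: hB].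
- move=> w r l wI cr l1; have [_ x1] := h1 r l cr l1; have [_ x2] := h2 r l cr l1.
  have [_ x3] := h3 r l cr l1; have [_ x4] := h4 r l cr l1.
  rewrite !srcE.
  have -> : A 0%N w * aV V0 (l * r) - A 2 w * V0 (l * r) + B 0%N w * aV V1 (l * r) -
    B 2 w * V1 (l * r) - (A 0%N w * aV V0 r - A 2 w * V0 r + B 0%N w * aV V1 r - B 2 w * V1 r) =
    A 0%N w * (aV V0 (l * r) - aV V0 r) - A 2 w * (V0 (l * r) - V0 r)
    + B 0%N w * (aV V1 (l * r) - aV V1 r) - B 2 w * (V1 (l * r) - V1 r) by ring.
  have -> : 4%:R * (m * N) * (l - 1) = 4%:R * (m * (N * (l - 1))) by ring.
  by apply: four; rewrite normrM; apply: ler_pM => //; [exact: hA|exact: hA|exact: hB|exact: hB].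
- move=> w h r w0 h0 wh cr; have [x1 _] := h1 r 1 cr (lexx _); have [x2 _] := h2 r 1 cr (lexx _).
  have [x3 _] := h3 r 1 cr (lexx _); have [x4 _] := h4 r 1 cr (lexx _).
  rewrite !srcE.
  have -> : A 0%N (w + h) * aV V0 r - A 2 (w + h) * V0 r + B 0%N (w + h) * aV V1 r -
    B 2 (w + h) * V1 r - (A 0%N w * aV V0 r - A 2 w * V0 r + B 0%N w * aV V1 r - B 2 w * V1 r) =
    (A 0%N (w + h) - A 0%N w) * aV V0 r - (A 2 (w + h) - A 2 w) * V0 r
    + (B 0%N (w + h) - B 0%N w) * aV V1 r - (B 2 (w + h) - B 2 w) * V1 r by ring.
  have -> : 4%:R * (m * N) * h = 4%:R * (m * h * N) by ring.
  have sub t : w <= t <= w + h -> 0 <= t <= th.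
    by move=> /andP[wt tt]; rewrite (le_trans w0 wt) (le_trans tt wh).
  have lip (F : nat -> R -> R) k : (k < 3)%N ->
      (forall (k : nat) w, (k < 3)%N -> is_derive w 1 (F k) (F k.+1 w)) ->
      (forall k w, (k < 4)%N -> 0 <= w <= th -> `|F k w| <= m) ->
      `|F k (w + h) - F k w| <= m * h.
    move=> k3 dF hF; have ww : w <= w + h by rewrite lerDl.
    have -> : m * h = m * (w + h - w) by ring.
    by apply: (dv_lip ww (f' := F k.+1)) => t /sub tI; [exact: dF|exact: hF].
  by apply: four; rewrite normrM; apply: ler_pM => //; exact: lip.
Qed.
End BoundaryExtension.

(** * Bounds on the corrector at a fixed opening angle *)

Section EulerFixedAngle.
Context {R : realType}.
Variables (D : profile_data R) (up : R -> R -> R) (ga : nat -> R -> R) (th k0 kc Ga g Mv : R).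
Let c : R := Defs.R0 D.
Let ka : R -> R := kappa (u_e0 D).
Let V0 : R -> R := V_b0 D.
Let V1 : R -> R := V_b1 D th.
Implicit Types (w x r l e eps : R).

Hypotheses (c_gt0 : 0 < c) (k0_ge1 : 1 <= k0).
Hypothesis hka : forall r l, c <= r -> 1 <= l ->
  `|ka r| <= k0 /\ `|ka (l * r) - ka r| <= k0 * (l - 1).
Hypothesis ue_gt0 : forall r, c <= r -> 0 < u_e0 D r.
Hypothesis hchi : forall x : R, 0 <= x -> `|chi0 D x| <= kc.
Hypothesis hchiL : forall x y : R, 0 <= x -> x <= y -> `|chi0 D y - chi0 D x| <= kc * (y - x).
Hypothesis hchi1 : forall x : R, 1 <= x -> chi0 D x = 0.
Hypotheses (th_gt0 : 0 < th) (th_le1 : th <= 1) (small : 8%:R * k0 * th ^+ 2 <= 1).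
Hypothesis wall_ga : forall w, vp_wall D up w = ga 0%N w.
Hypothesis dga : forall (k : nat) w, (k < 3)%N -> is_derive w 1 (ga k) (ga k.+1 w).
Hypothesis hGa : forall (k : nat) w, (k < 4)%N -> `|ga k w| <= Ga.
Hypotheses (g_gt0 : 0 < g) (hg0 : g <= `|ga 0 0|) (hgth : g <= `|ga 0 th|).
Hypotheses (sV0 : smooth1 V0) (sV1 : smooth1 V1).
Hypothesis hV0 : forall n r, (n < 3)%N -> c <= r -> r ^+ n.+1 * `|derive1n n V0 r| <= Mv.
Hypothesis hV1 : forall n r, (n < 3)%N -> c <= r -> r ^+ n.+1 * `|derive1n n V1 r| <= Mv.
Hypothesis bV0 : forall n j, exists M, forall r, c <= r -> r ^+ j * `|derive1n n V0 r| <= M.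
Hypothesis bV1 : forall n j, exists M, forall r, c <= r -> r ^+ j * `|derive1n n V1 r| <= M.
Hypotheses (V0c : V0 c = - vp_wall D up 0) (V1c : V1 c = - vp_wall D up th).

Let A : nat -> R -> R := lat_coef ga 1 (- th^-1) (ga 0 0).
Let B : nat -> R -> R := lat_coef ga 0 th^-1 (ga 0 th).
Let G : R -> R -> R := bext_src ka A B V0 V1.
Let bx := bext A B V0 V1.

Let ga0 : ga 0 0 != 0. Proof. by rewrite -normr_gt0; exact: lt_le_trans hg0. Qed.
Let gath : ga 0 th != 0. Proof. by rewrite -normr_gt0; exact: lt_le_trans hgth. Qed.
Let th0 : th != 0. Proof. by rewrite gt_eqF. Qed.
Let Ga_ge0 : 0 <= Ga. Proof. exact: le_trans (normr_ge0 _) (@hGa 0%N 0 isT). Qed.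
Let r_gt0 r : c <= r -> 0 < r. Proof. exact: lt_le_trans. Qed.
Let Mv_ge0 : 0 <= Mv.
Proof. by apply: le_trans (@hV0 0%N c isT (lexx _)); rewrite mulr_ge0// exprn_ge0// ltW. Qed.
Let k0_ge0 : 0 <= k0. Proof. exact: le_trans ler01 _. Qed.
Let kc_ge0 : 0 <= kc. Proof. exact: le_trans (normr_ge0 _) (hchi (lexx 0)). Qed.

Let dA (k : nat) w : (k < 3)%N -> is_derive w 1 (A k) (A k.+1 w).
Proof. exact: lat_coef_dv. Qed.
Let dB (k : nat) w : (k < 3)%N -> is_derive w 1 (B k) (B k.+1 w).
Proof. exact: lat_coef_dv. Qed.

Let m : R := 4%:R * th^-1 * (Ga / g).

Let wA w : 0 <= w <= th -> `|1 + - th^-1 * w| <= 1.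
Proof.
move=> /andP[w0 wth]; have q0 : 0 <= w / th by rewrite divr_ge0// ltW.
have q1 : w / th <= 1 by rewrite ler_pdivrMr// mul1r.
by rewrite mulNr [th^-1 * w]mulrC ger0_norm ?subr_ge0// gerBl.
Qed.

Let wB w : 0 <= w <= th -> `|0 + th^-1 * w| <= 1.
Proof.
move=> /andP[w0 wth]; have q0 : 0 <= w / th by rewrite divr_ge0// ltW.
by rewrite add0r [th^-1 * w]mulrC ger0_norm// ler_pdivrMr// mul1r.
Qed.

Let Gag x : g <= `|x| -> Ga / `|x| <= Ga / g.
Proof. by move=> gx; rewrite ler_wpM2l// lef_pV2 ?posrE// (lt_le_trans g_gt0). Qed.

Let th_inv : 1 <= th^-1. Proof. by rewrite invf_ge1. Qed.

Let hA (k : nat) w : (k < 4)%N -> 0 <= w <= th -> `|A k w| <= m.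
Proof.
move=> k4 wI; have ti : `|- th^-1| <= th^-1 by rewrite normrN gtr0_norm// invr_gt0.
apply: (le_trans (lat_coef_le (ga 0 0) k4 (wA wI) ti th_inv (fun i i4 => @hGa i w i4))).
by rewrite ler_wpM2l ?Gag// mulr_ge0// invr_ge0 ltW.
Qed.

Let hB (k : nat) w : (k < 4)%N -> 0 <= w <= th -> `|B k w| <= m.
Proof.
move=> k4 wI; have ti : `|th^-1| <= th^-1 by rewrite gtr0_norm// invr_gt0.
apply: (le_trans (lat_coef_le (ga 0 th) k4 (wB wI) ti th_inv (fun i i4 => @hGa i w i4))).
by rewrite ler_wpM2l ?Gag// mulr_ge0// invr_ge0 ltW.
Qed.

Let bx_le w r : 0 <= w <= th -> c <= r -> `|bx 0 0 w r| <= 2%:R * (Ga / g) * Mv / r.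
Proof.
move=> wI cr; have r0 := r_gt0 cr.
have hA0 := lat_coef0_le (ga 0 0) (wA wI) (@hGa 0%N w isT).
have hB0 := lat_coef0_le (ga 0 th) (wB wI) (@hGa 0%N w isT).
have v0 := ge_pos_poly r0 (@hV0 0%N r isT cr); have v1 := ge_pos_poly r0 (@hV1 0%N r isT cr).
rewrite expr1 in v0 v1.
have -> : 2%:R * (Ga / g) * Mv / r = Ga / g * (Mv / r) + Ga / g * (Mv / r) by ring.
rewrite /bx /bext !mul1r; apply: (le_trans (ler_normD _ _)).
by apply: lerD; rewrite normrM; apply: ler_pM => //;
  [exact: le_trans hA0 (Gag hg0)|exact: le_trans hB0 (Gag hgth)].
Qed.

Let euler_BE : euler_B D up th = bx 0 0.
Proof.
apply/funext => w; apply/funext => r.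
rewrite /euler_B -/V0 -/V1 !wall_ga /bx /bext /A /B /lat_coef.
rewrite (_ : derive1n 0 V0 = V0)// (_ : derive1n 0 V1 = V1)//.
move: ga0 gath th0; move: (ga 0 0) (ga 0 th) (ga 0 w) (V0 r) (V1 r) => x1 x2 x3 x4 x5 h1 h2 h3.
by field; rewrite h1 h2 h3.
Qed.

Let dw_bx i j : (i < 3)%N -> dw (bx i j) = bx i.+1 j.
Proof.
move=> i3; apply/funext => w; apply/funext => r; rewrite /dw.
apply: (@dv_derive1 _ (fun t => bx i j t r)).
have d1 : is_derive w 1 (fun w => A i w) _ := dA w i3.
have d2 : is_derive w 1 (fun w => B i w) _ := dB w i3.
by rewrite /bx /bext; eapply is_derive_eq; [dvs|ring].
Qed.

Let dy_bx i j : dy (bx i j) = bx i j.+1.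
Proof.
apply/funext => w; apply/funext => r; rewrite /dy.
apply: (@dv_derive1 _ (fun t => bx i j w t)).
have d1 : is_derive r 1 (fun r => derive1n j V0 r) _ := smooth1_dv j r sV0.
have d2 : is_derive r 1 (fun r => derive1n j V1 r) _ := smooth1_dv j r sV1.
rewrite /bx /bext; eapply is_derive_eq; first by dvs.
move: (derive1n j V0 r) (derive1n j.+1 V0 r) (derive1n j V1 r) (derive1n j.+1 V1 r).
by move=> *; ring.
Qed.

Let euler_LE (v : R -> R -> R) w r : c <= r ->
  r * euler_L D v w r = euler_op ka v (dw (dw v)) (dy v) (dy (dy v)) w r.
Proof.
move=> cr; have r0 : r != 0 by rewrite gt_eqF// r_gt0.
rewrite /euler_L /laplace /euler_op /ka /kappa.
move: (v w r) (dw (dw v) w r) (dy v w r) (dy (dy v) w r) => v0 v1 v2 v3.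
have := gt_eqF (ue_gt0 cr).
move: (derive1n 2 (u_e0 D) r) (derive1 (u_e0 D) r) (u_e0 D r) => p2 p1 p0 /negbT p00.
by field; rewrite p00 r0.
Qed.

Let euler_FE w r : c <= r -> r * euler_F D up th w r = G w r.
Proof.
move=> cr; rewrite /euler_F euler_LE// euler_BE !dw_bx// !dy_bx//.
Qed.

Let small_eps (x e : R) : 0 <= x -> 0 < e -> forall r, x / e <= r -> c <= r -> x / r <= e.
Proof.
move=> x0 e0 r xr cr; have r0 := r_gt0 cr.
by rewrite ler_pdivrMr// mulrC -ler_pdivrMr.
Qed.

Let C1 : R := 2%:R * (4%:R * (Ga / g)) * Mv * (5%:R + k0).

Let hG1 w r : 0 <= w <= th -> c <= r -> `|G w r| <= C1 / th / r.
Proof.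
move=> wI cr; have -> : C1 / th / r = 2%:R * m * Mv * (5%:R + k0) / r by rewrite /C1 /m; ring.
apply: (bext_src_le c_gt0 hA hB (fun r cr => (hka cr (lexx 1)).1) wI cr) => n n3;
  [exact: hV0|exact: hV1].
Qed.

Let C1_ge0 : 0 <= C1.
Proof.
have Gg : 0 <= Ga / g by rewrite divr_ge0// ltW.
have q : 0 <= 2%:R * (4%:R * (Ga / g)) by rewrite mulr_ge0// mulr_ge0.
by rewrite /C1; apply: mulr_ge0; [exact: mulr_ge0|exact: addr_ge0].
Qed.

Let dka : dilation_lip c ka.
Proof. by exists k0 => r l cr l1; exact: hka. Qed.

(** The bound on [ve] itself is free of [1 / th], because [w (th - w) / th] is bounded. The constant
    [C] depends on the angle but is chosen before [eps]. *)
Lemma euler1_bounds_fixed : exists C, forall eps ve, 0 < eps -> eps <= 1 ->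
  euler1 D up th eps ve -> forall w r, 0 <= w < th -> c <= r ->
  [/\ `|ve w r| <= ((2%:R * kc + 1) * C1 + 2%:R * (Ga / g) * Mv) / r,
      `|dw ve w r| <= C, `|r * dy ve w r| <= C & `|r * euler_E D up th eps w r| <= C].
Proof.
have [C2 [hG2 hGr hGw]] := bext_src_lipschitz c_gt0 (ltW th_gt0) sV0 sV1 dA dB hA hB dka bV0 bV1.
have [Cb hCb] : exists Cb, forall w r, 0 <= w <= th -> c <= r ->
    `|bx 1 0 w r| <= Cb /\ `|r * bx 0 1 w r| <= Cb.
  exists (2%:R * m * Mv * (1 + c^-1)) => w r wI cr; have r0 := r_gt0 cr.
  have m0 : 0 <= m by apply: le_trans (normr_ge0 _) (@hA 0%N w isT wI).
  have a0 := ge_pos_poly r0 (@hV0 0%N r isT cr); have a1 := ge_pos_poly r0 (@hV1 0%N r isT cr).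
  have a2 := ge_pos_poly r0 (@hV0 1%N r isT cr); have a3 := ge_pos_poly r0 (@hV1 1%N r isT cr).
  have ri : r^-1 <= c^-1 by rewrite lef_pV2 ?posrE.
  have q : Mv / r <= Mv * c^-1 by rewrite ler_wpM2l.
  have ci : 0 <= c^-1 by rewrite invr_ge0 ltW.
  have mM : 0 <= m * Mv by exact: mulr_ge0.
  have mMc : 0 <= m * (Mv * c^-1) by apply: mulr_ge0 => //; exact: mulr_ge0.
  have e : 2%:R * m * Mv * (1 + c^-1) = 2%:R * (m * Mv) + 2%:R * (m * (Mv * c^-1)) by ring.
  split.
    rewrite e; apply: (@le_trans _ _ (m * (Mv * c^-1) + m * (Mv * c^-1))); last first.
      by move: mM mMc; move: (m * Mv) (m * _) => t1 t2 *; lra.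
    rewrite /bx /bext !mul1r; apply: (le_trans (ler_normD _ _)).
    rewrite expr1 in a0 a1.
    apply: lerD; rewrite normrM; apply: ler_pM => //; first exact: hA.
    - exact: le_trans q.
    - exact: hB.
    - exact: le_trans q.
  have rM (x : R) : `|x| <= Mv / r ^+ 2 -> `|r * x| <= Mv * c^-1.
    move=> hx; rewrite normrM gtr0_norm//.
    apply: (le_trans (ler_wpM2l (ltW r0) hx)); apply: le_trans q.
    by rewrite le_eqVlt; apply/orP; left; apply/eqP; field; rewrite gt_eqF.
  rewrite e; apply: (@le_trans _ _ (m * (Mv * c^-1) + m * (Mv * c^-1))); last first.
    by move: mM mMc; move: (m * Mv) (m * _) => t1 t2 *; lra.
  have -> : r * bx 0 1 w r = A 0%N w * (r * derive1n 1 V0 r) + B 0%N w * (r * derive1n 1 V1 r).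
    by rewrite /bx /bext; ring.
  apply: (le_trans (ler_normD _ _)); apply: lerD; rewrite normrM; apply: ler_pM => //.
  - exact: hA.
  - exact: rM.
  - exact: hB.
  - exact: rM.
have cge0 : 0 <= C2.
  have i0 : 0 <= (0 : R) <= th by rewrite lexx ltW.
  exact: le_trans (normr_ge0 _) (hG2 0 c i0 (lexx c)).
pose Cw : R := 4%:R * ((2%:R * kc + 1) * C1 / c + C2 * (1 + kc * expR 1)).
pose Cr : R := 12%:R * k0 * (2%:R * kc + 1) * C2.
exists (Num.max (Num.max (Cw + Cb) (Cr + Cb)) (2%:R * kc * C2)).
move=> eps ve eps0 eps1 [cve eqE wallE latE infE].
pose W w r := 1 * ve w r + -1 * bx 0 0 w r.
have hve : strip_C2 0 th c ve (dw ve) (dw (dw ve)) (dy ve) (dy (dy ve)).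
  move=> w r _ _; split.
  - exact: Ck_ptc cve.
  - exact: (@Ck_dvw _ _ _ w r cve).
  - exact: (@Ck_dvw _ _ _ w r (Ck_dw cve)).
  - exact: (@Ck_dvy _ _ _ w r cve).
  - exact: (@Ck_dvy _ _ _ w r (Ck_dy cve)).
have hbx := bext_C2 (c := c) (th := th) sV0 sV1 dA dB.
have hW := strip_C2_comb 1 (-1) hve hbx.
have hE w r : c <= r -> r * euler_E D up th eps w r =
    chi0 D (w / eps) * G 0 r + chi0 D ((th - w) / eps) * G th r.
  move=> cr; have e1 := euler_FE 0 cr; have e2 := euler_FE th cr; rewrite /euler_E -e1 -e2.
  move: (euler_F D up th 0 r) (euler_F D up th th r) => x1 x2.
  by move: (chi0 D _) (chi0 D _) => y1 y2; ring.
have hM w r : 0 < w < th -> c < r ->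
    euler_op ka (fun w r => 1 * ve w r + -1 * bx 0 0 w r)
      (fun w r => 1 * dw (dw ve) w r + -1 * bx 2 0 w r)
      (fun w r => 1 * dy ve w r + -1 * bx 0 1 w r)
      (fun w r => 1 * dy (dy ve) w r + -1 * bx 0 2 w r) w r =
    chi0 D (w / eps) * G 0 r + chi0 D ((th - w) / eps) * G th r - G w r.
  move=> wI cr; rewrite -(hE w r (ltW cr)) -(eqE w r wI cr) euler_LE ?(ltW cr)//.
  by rewrite /G /bext_src -/bx /euler_op; ring.
have bx0 r : bx 0 0 0 r = V0 r.
  rewrite -euler_BE /euler_B -/V0 !wall_ga.
  by rewrite !mul0r subr0 addr0 divff// !mul1r.
have bxth r : bx 0 0 th r = V1 r.
  rewrite -euler_BE /euler_B -/V1 !wall_ga.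
  by rewrite !divff// subrr !mul0r add0r !mul1r.
have hlat r : c <= r -> 1 * ve 0 r + -1 * bx 0 0 0 r = 0 /\ 1 * ve th r + -1 * bx 0 0 th r = 0.
  move=> cr; have [-> ->] := latE r cr; rewrite bx0 bxth -/V0 -/V1.
  by rewrite !mul1r !mulN1r !subrr.
(* At the wall the lateral data equal minus the wall velocity at each end, so the normalised ratios
   leave [- v_p^0(w, R0)] multiplied by weights of sum one. *)
have hwall w : 0 <= w <= th -> 1 * ve w c + -1 * bx 0 0 w c = 0.
  move=> wI; rewrite (wallE w wI) -euler_BE /euler_B -/V0 -/V1 V0c V1c !wall_ga.
  move: ga0 gath th0; move: (ga 0 0) (ga 0 th) (ga 0 w) => x1 x2 x3 h1 h2 h3.
  by field; rewrite h1 h2 h3.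
have hinf e : 0 < e -> exists N : R, forall w r, 0 <= w <= th -> N <= r ->
    `|1 * ve w r + -1 * bx 0 0 w r| <= e.
  move=> e0; have e2 : 0 < e / 2%:R by rewrite divr_gt0.
  have [N hN] := infE _ e2.
  have Gg' : 0 <= Ga / g by rewrite divr_ge0// ltW.
  have Gg : 0 <= 2%:R * (Ga / g) * Mv by rewrite mulr_ge0// mulr_ge0.
  exists (Num.max (Num.max N c) (2%:R * (Ga / g) * Mv / (e / 2%:R))) => w r wI.
  rewrite !ge_max => /andP[/andP[Nr cr] xr].
  rewrite mul1r mulN1r; apply: (le_trans (ler_normB _ _)).
  have h1 := ltW (hN w r wI Nr); have h2 := le_trans (bx_le wI cr) (small_eps Gg e2 xr cr).
  apply: (le_trans (lerD h1 h2)).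
  by rewrite -mulrDl -mulr2n -[e *+ 2]mulr_natr mulfK.
have hka1 r : c <= r -> `|ka r| <= k0 by move=> cr; exact: (hka cr (lexx 1)).1.
have hka2 r l : c <= r -> 1 <= l -> `|ka (l * r) - ka r| <= k0 * (l - 1).
  by move=> cr l1; exact: (hka cr l1).2.
move=> w r wI' cr; have r0 := r_gt0 cr.
have wI : 0 <= w <= th by case/andP: wI' => -> /ltW.
have b1 := euler_lateral_bound c_gt0 hka1 th_gt0 small eps0 hchi hG1 hW hM hlat hwall hinf wI cr.
have b2 := euler_radial_derivative c_gt0 k0_ge1 hka1 hka2 th_gt0 small eps0 hchi hG2 hGr
  hW hM hlat hwall hinf wI cr.
have b3 := euler_angular_derivative c_gt0 k0_ge1 hka1 th_gt0 small eps0 eps1 hchi hchiL hchi1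
  hG1 hG2 hGw hW hM hlat hwall hinf wI' cr.
have [b4 b5] := hCb w r wI cr.
have /andP[w0 wth] := wI.
split.
- have -> : ve w r = (1 * ve w r + -1 * bx 0 0 w r) + bx 0 0 w r by ring.
  apply: (le_trans (ler_normD _ _)); rewrite mulrDl; apply: lerD; last exact: bx_le.
  apply: (le_trans b1); rewrite ler_wpM2r ?invr_ge0 ?(ltW r0)//.
  have kC : 0 <= (2%:R * kc + 1) * C1 by rewrite mulr_ge0// addr_ge0// mulr_ge0.
  rewrite -mulrA ler_piMr// mulrC ler_pdivrMr// mul1r.
  apply: (@le_trans _ _ (w * 1)); last by rewrite mulr1.
  by rewrite ler_wpM2l// (le_trans _ th_le1)// gerBl.
- rewrite !le_max; apply/orP; left; apply/orP; left.
  have -> : dw ve w r = (1 * dw ve w r + -1 * bx 1 0 w r) + bx 1 0 w r by ring.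
  by apply: (le_trans (ler_normD _ _)); apply: lerD.
- rewrite !le_max; apply/orP; left; apply/orP; right.
  have -> : r * dy ve w r = r * (1 * dy ve w r + -1 * bx 0 1 w r) + r * bx 0 1 w r by ring.
  by apply: (le_trans (ler_normD _ _)); apply: lerD.
- rewrite le_max; apply/orP; right; rewrite hE//.
  have -> : 2%:R * kc * C2 = kc * C2 + kc * C2 by ring.
  have i0 : 0 <= (0 : R) <= th by rewrite lexx ltW.
  have i1 : 0 <= th <= th by rewrite lexx ltW.
  apply: (le_trans (ler_normD _ _)); apply: lerD; rewrite normrM; apply: ler_pM => //.
  - by apply: hchi; rewrite divr_ge0// ltW.
  - exact: hG2.
  - by apply: hchi; rewrite divr_ge0 ?subr_ge0// ltW.
  - exact: hG2.
Qed.

Lemma euler1_equation eps ve w r : euler1 D up th eps ve -> 0 < w < th -> c < r ->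
  - r ^+ 2 * dy (dy ve) w r - 3%:R * r * dy ve w r - dw (dw ve) w r + ka r * ve w r =
  r * euler_E D up th eps w r.
Proof. by move=> [_ eqE _ _ _] wI cr; rewrite -eqE// euler_LE// ltW. Qed.
End EulerFixedAngle.

Lemma dvZr {R : realType} (f : R -> R) (x a k : R) : is_derive x 1 f a ->
  is_derive x 1 (fun t => f t / k) (a / k).
Proof. by move=> fa; apply: (is_derive_eq (dvM fa (dvC k^-1 x))); rewrite mulr0 addr0. Qed.

(** * Choice of the maximal angle and uniformity of the bounds *)

Section EulerBounds.
Context {R : realType}.
Variables (D : profile_data R) (Theta : R) (up : R -> R -> R).
Hypotheses (hD : outer_data D) (Theta_gt0 : 0 < Theta).
Hypotheses (hup : prandtl0 D Theta up) (hV : lateral_data D Theta up).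
Let c : R := Defs.R0 D.
Implicit Types (w y r : R).

Lemma prandtl0_bounds : exists M, 1 <= M /\ forall k l m w y,
  (k < 7)%N -> (l < 7)%N -> (m < 7)%N -> c <= y -> y ^+ m * `|iter k dw (iter l dy up) w y| <= M.
Proof.
have [_ hb _ _ _] := hup.
pose P k l m M := forall w y, c <= y -> y ^+ m * `|iter k dw (iter l dy up) w y| <= M.
have mono k l m M M' : M <= M' -> P k l m M -> P k l m M'.
  by move=> MM hM w y cy; apply: le_trans MM; exact: hM.
have ex1 k l : exists M, forall m, (m < 7)%N -> P k l m M.
  have [M [_ hM]] := uniform_bound 7 (fun m => @mono k l m) (hb k l).
  by exists M.
have ex2 k : exists M, forall l, (l < 7)%N -> forall m, (m < 7)%N -> P k l m M.
  have mono2 l M M' : M <= M' -> (forall m, (m < 7)%N -> P k l m M) ->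
      forall m, (m < 7)%N -> P k l m M'.
    by move=> MM hM m m7; apply: mono MM _; exact: hM.
  by have [M [_ hM]] := uniform_bound 7 mono2 (ex1 k); exists M.
have mono3 k M M' : M <= M' ->
    (forall l, (l < 7)%N -> forall m, (m < 7)%N -> P k l m M) ->
    forall l, (l < 7)%N -> forall m, (m < 7)%N -> P k l m M'.
  by move=> MM hM l l7 m m7; apply: mono MM _; exact: hM.
have [M [M1 hM]] := uniform_bound 7 mono3 ex2.
by exists M; split => // k l m w y k7 l7 m7; exact: hM.
Qed.

Lemma euler1_bounds : exists k0 Cv t1, [/\ 1 <= k0, 0 < t1, t1 <= Theta, t1 <= 1 &
  (forall r, c <= r -> `|kappa (u_e0 D) r| <= k0) /\
  forall th, 0 < th -> th < t1 -> exists C, forall eps ve, 0 < eps -> eps <= 1 ->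
    euler1 D up th eps ve -> forall w r, 0 <= w < th -> c <= r ->
    [/\ `|ve w r| <= Cv / r, `|dw ve w r| <= C, `|r * dy ve w r| <= C &
        `|r * euler_E D up th eps w r| <= C]].
Proof.
have [[c0 ub0 sue [m0 m00 hm0] due] [_ _ _ [schi _ chi1]]] := hD.
have [sup _ _ _ _] := hup.
have [wall0 [sV0 dV0] V0c [sV1 dV1 _]] := hV.
have [k0 [k01 hka]] := kappa_bounds c0 m00 sue hm0 due.
have [kc [hchi hchiL]] := cutoff_lipschitz schi chi1.
have [M [M1 hM]] := prandtl0_bounds.
have hM2 k w y : (k < 7)%N -> c <= y -> y ^+ 2 * `|iter k dw up w y| <= M.
  by move=> k7 cy; exact: (hM k 0%N 2%N).
pose ga (k : nat) (w : R) : R := rv up k w c / c.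
have wall_ga w : vp_wall D up w = ga 0%N w by [].
have dga (k : nat) (w : R) : (k < 4)%N -> is_derive w 1 (ga k) (ga k.+1 w).
  move=> k4; have d := rv_dw c0 sup hM2 w k4 (lexx c).
  have d' : is_derive w 1 (fun w => rv up k w c) _ := d.
  exact: (@dvZr _ (fun w => rv up k w c) w (rv up k.+1 w c) c d').
pose Ga : R := M / c / c.
have M0 : 0 < M by exact: lt_le_trans M1.
have Ga0 : 0 < Ga by rewrite /Ga !divr_gt0.
have hGa (k : nat) (w : R) : (k < 6)%N -> `|ga k w| <= Ga.
  move=> k6; rewrite /ga normrM normfV (gtr0_norm c0) ler_wpM2r ?invr_ge0 ?(ltW c0)//.
  exact: (rv_le c0 sup hM2 w k6 (lexx c)).
rewrite wall_ga in wall0.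
pose g : R := `|ga 0%N 0| / 2%:R.
have g0 : 0 < g by rewrite divr_gt0 ?normr_gt0.
clearbody ga.
have expb V n : smooth1 V -> exp_decay c (derive1n n V) -> forall j,
    exists M, forall r, c <= r -> r ^+ j * `|derive1n n V r| <= M.
  move=> sV [M' [a [a0 ha]]] j; exists (M' * (j`!%:R / a ^+ j)) => r cr.
  by apply: exp_decay_poly => //; [rewrite (le_trans (ltW c0))|exact: ha].
have [N0 [_ hN0]] : exists N, 1 <= N /\ forall n, (n < 3)%N -> forall r, c <= r ->
    r ^+ n.+1 * `|derive1n n (V_b0 D) r| <= N.
  apply: (uniform_bound 3 (P := fun n N => forall r, c <= r ->
    r ^+ n.+1 * `|derive1n n (V_b0 D) r| <= N)) => [n N N' NN hN r cr|n].
    by apply: le_trans NN; exact: hN.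
  exact: (expb _ _ sV0 (dV0 n)).
have [N1 [_ hN1]] : exists N, 1 <= N /\ forall n, (n < 3)%N ->
    forall th r, 0 < th < Theta -> c <= r ->
    r ^+ n.+1 * `|derive1n n (V_b1 D th) r| <= N.
  apply: (uniform_bound 3 (P := fun n N => forall th r, 0 < th < Theta -> c <= r ->
    r ^+ n.+1 * `|derive1n n (V_b1 D th) r| <= N)) => [n N N' NN hN th r thI cr|n].
    by apply: le_trans NN; exact: hN.
  have [M' [a [a0 ha]]] := dV1 n.
  exists (M' * (n.+1`!%:R / a ^+ n.+1)) => th r thI cr.
  by apply: exp_decay_poly => //; [rewrite (le_trans (ltW c0))|exact: ha].
pose Mv := Num.max N0 N1.
(* [(8 k0)^-1] gives the narrowness condition of the barriers; [g / Ga] keeps the wall velocity at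
   the outflow above [g], half its size at the inflow, by its Lipschitz bound [Ga]. *)
pose t1 := Num.min Theta (Num.min (8%:R * k0)^-1 (g / Ga)).
have k00 : 0 < 8%:R * k0 by rewrite mulr_gt0// (lt_le_trans ltr01).
have t10 : 0 < t1 by rewrite !lt_min Theta_gt0 invr_gt0 k00 divr_gt0.
have t1k : t1 <= (8%:R * k0)^-1 by rewrite /t1 !ge_min lexx orbT.
have t11 : t1 <= 1.
  apply: (le_trans t1k); rewrite invf_le1//.
  by apply: (le_trans k01); rewrite ler_peMl ?ler1n// (le_trans ler01).
exists k0, ((2%:R * kc + 1) * (2%:R * (4%:R * (Ga / g)) * Mv * (5%:R + k0)) +
  2%:R * (Ga / g) * Mv), t1.
split => //; first by rewrite /t1 ge_min lexx.
split => [r cr|th th0 tht]; first exact: (hka r 1 cr (lexx _)).1.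
have thI : 0 < th < Theta by rewrite th0 (lt_le_trans tht)// /t1 ge_min lexx.
have th1 : th <= 1 by rewrite (le_trans (ltW tht)).
have [sV1th V1c] := sV1 th thI.
apply: (euler1_bounds_fixed c0 k01 hka _ hchi hchiL chi1 th0 th1 _ wall_ga) => //.
- by move=> r cr; exact: lt_le_trans (hm0 r cr).
- apply: (@le_trans _ _ (8%:R * k0 * th)).
    by rewrite ler_wpM2l ?(ltW k00)// expr2 ler_piMl// ltW.
  by rewrite mulrC -ler_pdivlMr// mul1r (le_trans (ltW tht)).
- by move=> k w k3; apply: dga; exact: ltnW.
- by move=> k w k4; apply: hGa; exact: ltn_trans k4 _.
- by rewrite /g ler_pdivrMr// ler_peMr// ler1n.
- have lip := dv_lipT th 0 (fun t => dga 0%N t isT) (fun t => hGa 1%N t isT).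
  rewrite subr0 (gtr0_norm th0) in lip.
  have tg : Ga * th <= g.
    by rewrite mulrC -ler_pdivlMr// (le_trans (ltW tht))// /t1 !ge_min lexx !orbT.
  have e : `|ga 0%N 0| = g + g by rewrite /g; field.
  have tr : `|ga 0%N 0| <= `|ga 0%N th| + `|ga 0%N th - ga 0%N 0|.
    have -> : ga 0%N 0 = ga 0%N th - (ga 0%N th - ga 0%N 0) by ring.
    by apply: (le_trans (ler_normB _ _)); rewrite subKr.
  rewrite e in tr.
  by have := le_trans tr (lerD (lexx _) (le_trans lip tg)); rewrite lerD2r.
- by move=> n r n3 cr; apply: (le_trans (hN0 n n3 r cr)); rewrite le_max lexx.
- by move=> n r n3 cr; apply: (le_trans (hN1 n n3 th r thI cr)); rewrite le_max lexx orbT.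
- by move=> n j; exact: (expb _ _ sV0 (dV0 n)).
- move=> n j; apply: (expb _ _ sV1th).
  by have [M' [a [a0 ha]]] := dV1 n; exists M', a; split => // r cr; exact: ha.
Qed.
End EulerBounds.

(** * The shear flow *)

Section SegmentIntegral.
Context {R : realType}.
Implicit Types (f : R -> R) (a b x M w y : R).

Lemma segint_cst a b M : a <= b -> segint a b (fun=> M) = M * (b - a).
Proof.
rewrite le_eqVlt => /predU1P[->|ab].
  by rewrite subrr mulr0 /segint set_itv1 Rintegral_set1.
rewrite mulrBr; apply: (segint_FTC (F := fun t => M * t) ab).
- by apply: cont_seg_pt => x _; exact: cvg_cst.
- by apply: cont_seg_pt => x _; exact: dv_cont (dvM (dvC M x) (dvI x)).
- by move=> x _; apply: (is_derive_eq (dvM (dvC M x) (dvI x))); ring.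
Qed.

Lemma segint_abs_le a b M f : a <= b -> cont_seg a b f ->
  (forall x, a < x < b -> `|f x| <= M) -> `|segint a b f| <= M * (b - a).
Proof.
move=> ab cf fM.
have cc (k : R) : cont_seg a b (fun=> k) by apply: cont_seg_pt => x _; exact: cvg_cst.
rewrite ler_norml -mulNr -!segint_cst//; apply/andP; split; apply: segint_le => // x xI.
  by have := fM x xI; rewrite ler_norml => /andP[].
by have := fM x xI; rewrite ler_norml => /andP[].
Qed.

Lemma segint_split a b x f : a <= x -> x <= b -> cont_seg a b f ->
  segint a b f - segint a x f = segint x b f.
Proof.
move=> ax xb cf; have fi := cont_seg_integrable cf.
rewrite /segint Rintegral_itvB//= ?bnd_simp//.
rewrite Rintegral_itv_obnd_cbnd//; apply: integrableS fi => //.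
by apply: subset_itvr; rewrite bnd_simp.
Qed.

Lemma segint_derive a x f : a < x -> (forall y, {for y, continuous f}) ->
  is_derive x 1 (fun x => segint a x f) (f x).
Proof.
move=> ax cf.
have xx : x < x + 1 by rewrite ltrDl.
have fi : (@lebesgue_measure R).-integrable `[a, x + 1] (EFin \o f).
  by apply: cont_seg_integrable; apply: cont_seg_pt => y _; exact: cf.
have [dF vF] := continuous_FTC1_closed xx fi ax (cf x).
exact: (is_derive_eq (derivable_dv dF) vF).
Qed.

Lemma segint_shift_le a b x f M : a <= x -> a <= b -> (forall y, {for y, continuous f}) ->
  (forall y, a <= y -> y <= Num.max x b -> `|f y| <= M) ->
  `|segint a b f - segint a x f| <= M * `|b - x|.
Proof.
move=> ax ab cf; wlog xb : x b ax ab / x <= b.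
  move=> H fM; have [/H|/ltW bx] := leP x b; first exact.
  by rewrite distrC [`|b - x|]distrC; apply: H => // y; rewrite maxC; exact: fM.
rewrite (max_r xb) => fM; rewrite segint_split//; last by apply: cont_seg_pt.
rewrite (ger0_norm (x := b - x)) ?subr_ge0//; apply: segint_abs_le => //;
  first by apply: cont_seg_pt.
by move=> y /andP[/ltW xy /ltW yb]; apply: fM => //; exact: le_trans xy.
Qed.

Lemma ptc_segint (k : R -> R -> R) w y : 0 < w -> (forall w y, ptc k w y) ->
  ptc (fun w y => segint 0 w (k^~ y)) w y.
Proof.
move=> w0 ck.
have cr : cont_rect 0 (w + w) (y - w) (y + w) k by move=> ? ? _ _; exact: ck.
have [M hM] := cont_rect_bounded cr.
have cs y' t : {for t, continuous (k^~ y')} by apply: ptc_slice_w; exact: ck.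
apply: (@ptc_lip _ _ M _ _ w w0) => [w' y'|].
  rewrite !ltr_norml => /andP[w1 w2] /andP[y1 y2].
  have w'0 : 0 <= w' by move: w1; rewrite ltrBrDr addNr => /ltW.
  apply: segint_shift_le => //; first exact: ltW.
  move=> t t0 tw; apply: hM.
    rewrite t0 (le_trans tw)// ge_max lerDl (ltW w0)/= ltW//.
    by move: w2; rewrite ltrBlDr.
  by apply/andP; split; lra.
have ch : cont_rect (y - 1) (y + 1) 0 w (fun y t => k t y).
  move=> y' t _ _.
  have sw : {for (y', t), continuous (fun z : R * R => (z.2, z.1))}.
    by apply: (@cvg_pair _ _ _ _ (nbhs t) (nbhs y')); [exact: cvg_snd|exact: cvg_fst].
  exact: (continuous_comp sw (ck t y')).
have yy : y - 1 < y + 1 by lra.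
have := segint_param_continuous (ltW yy) ch.
move=> /(within_continuous_continuous yy); apply.
by rewrite in_itv/=; apply/andP; split; lra.
Qed.

Lemma segint_param_derive_line (k k' : R -> R -> R) w y : 0 <= w ->
  (forall w y, ptc k w y) -> (forall w y, ptc k' w y) ->
  (forall w y, is_derive y 1 (k w) (k' w y)) ->
  is_derive y 1 (fun y => segint 0 w (k^~ y)) (segint 0 w (k'^~ y)).
Proof.
move=> w0 ck ck' dk.
have swap h : (forall w y, ptc h w y) -> cont_rect (y - 1) (y + 1) 0 w (fun y t => h t y).
  move=> ch y' t _ _.
  have sw : {for (y', t), continuous (fun z : R * R => (z.2, z.1))}.
    by apply: (@cvg_pair _ _ _ _ (nbhs t) (nbhs y')); [exact: cvg_snd|exact: cvg_fst].
  exact: (continuous_comp sw (ch t y')).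
have yy : y - 1 <= y + 1 by lra.
have yI : y - 1 < y < y + 1 by apply/andP; split; lra.
exact: (segint_param_derive yy (swap k ck) (swap k' ck') (fun y t _ _ => dk t y) yI).
Qed.
End SegmentIntegral.

(** * The tangential Euler corrector *)

Section EulerTangential.
Context {R : realType}.
Variables (D : profile_data R) (up ve : R -> R -> R) (th eps k0 Cv C Mb : R).
Let c : R := Defs.R0 D.
Implicit Types (w r : R).

Hypotheses (c_gt0 : 0 < c) (th_gt0 : 0 < th) (th_le1 : th <= 1) (sub1 : smooth1 (u_b1 D)).
Hypothesis ue_gt0 : forall r, c <= r -> 0 < u_e0 D r.
Hypothesis hka : forall r, c <= r -> `|kappa (u_e0 D) r| <= k0.
Hypothesis hE : euler1 D up th eps ve.
Hypothesis hve : forall w r, 0 <= w < th -> c <= r ->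
  [/\ `|ve w r| <= Cv / r, `|dw ve w r| <= C, `|r * dy ve w r| <= C &
      `|r * euler_E D up th eps w r| <= C].
Hypothesis hMb : forall r, c <= r -> `|u_b1 D r| <= Mb /\ `|r * derive1 (u_b1 D) r| <= Mb.

Let cve : Ck 2 ve. Proof. by have [] := hE. Qed.

(* [rve_r] is [d/dr (r v_e^1)]. *)
Definition rve_r w r : R := ve w r + r * dy ve w r.
Definition rve_rr w r : R := 2%:R * dy ve w r + r * dy (dy ve) w r.

Let dve_y w r : is_derive r 1 (fun r => ve w r) (dy ve w r).
Proof. exact: (@Ck_dvy _ _ _ w r cve). Qed.
Let ddve_y w r : is_derive r 1 (fun r => dy ve w r) (dy (dy ve) w r).
Proof. exact: (@Ck_dvy _ _ _ w r (Ck_dy cve)). Qed.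

Lemma rve_rE : dy (fun t' r' => r' * ve t' r') = rve_r.
Proof.
apply/funext => w; apply/funext => r; rewrite /dy.
apply: (@dv_derive1 _ (fun t => t * ve w t)).
have d := dve_y w r.
by eapply is_derive_eq; [dvs|rewrite /rve_r; ring].
Qed.

Lemma rve_r_dv w r : is_derive r 1 (rve_r w) (rve_rr w r).
Proof.
have d := dve_y w r; have dd := ddve_y w r; rewrite /rve_r.
by eapply is_derive_eq; [dvs|rewrite /rve_rr; ring].
Qed.

Lemma rve_r_ptc w r : ptc rve_r w r.
Proof.
have p1 := @Ck_ptc _ _ _ w r cve; have p2 := @Ck_ptc _ _ _ w r (Ck_dy cve).
have p3 : ptc (fun _ r => r) w r by exact: (@ptc_y _ id).
by rewrite /rve_r; ptcs.
Qed.

Lemma rve_rr_ptc w r : ptc rve_rr w r.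
Proof.
have p1 := @Ck_ptc _ _ _ w r (Ck_dy cve).
have p2 := @Ck_ptc _ _ _ w r (Ck_dy (Ck_dy cve)).
have p3 : ptc (fun _ r => r) w r by exact: (@ptc_y _ id).
by rewrite /rve_rr; ptcs.
Qed.

Lemma u_e1E w r : u_e1 D ve w r = u_b1 D r - segint 0 w (rve_r^~ r).
Proof. by rewrite /u_e1 rve_rE. Qed.

(** For negative angles the integral runs over an empty segment, so the two-sided derivative is
    claimed for [0 < w] only. *)
Lemma u_e1_dw w r : 0 < w -> is_derive w 1 (fun w => u_e1 D ve w r) (- rve_r w r).
Proof.
move=> w0.
have -> : (fun w => u_e1 D ve w r) = (fun w => u_b1 D r - segint 0 w (rve_r^~ r)).
  by apply/funext => t; exact: u_e1E.
have cs t : {for t, continuous (rve_r^~ r)} by apply: ptc_slice_w; exact: rve_r_ptc.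
by apply: (is_derive_eq (dvB (dvC (u_b1 D r) w) (segint_derive w0 cs))); rewrite sub0r.
Qed.

Definition u_e1_y w r : R := derive1 (u_b1 D) r - segint 0 w (rve_rr^~ r).

Lemma u_e1_dy w r : 0 <= w -> is_derive r 1 (u_e1 D ve w) (u_e1_y w r).
Proof.
move=> w0.
have -> : u_e1 D ve w = (fun r => u_b1 D r - segint 0 w (rve_r^~ r)).
  by apply/funext => t; exact: u_e1E.
apply: (dvB (smooth1_dv 0 r sub1)).
exact: (segint_param_derive_line r w0 rve_r_ptc rve_rr_ptc rve_r_dv).
Qed.

Lemma u_e1_ptc w r : 0 < w -> ptc (u_e1 D ve) w r.
Proof.
move=> w0.
have -> : u_e1 D ve = (fun w r => u_b1 D r - segint 0 w (rve_r^~ r)).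
  by apply/funext => t; apply/funext => r'; exact: u_e1E.
have p1 := ptc_segint (y := r) w0 rve_r_ptc.
have p2 : ptc (fun _ r => u_b1 D r) w r.
  by apply: (@ptc_y _ (u_b1 D)); exact: dv_cont (smooth1_dv 0 r sub1).
by ptcs.
Qed.

Lemma u_e1_y_ptc w r : 0 < w -> ptc u_e1_y w r.
Proof.
move=> w0; have p1 := ptc_segint (y := r) w0 rve_rr_ptc.
have p2 : ptc (fun _ r => derive1 (u_b1 D) r) w r.
  by apply: (@ptc_y _ (derive1 (u_b1 D))); exact: dv_cont (smooth1_dv 1 r sub1).
by rewrite /u_e1_y; ptcs.
Qed.

Let r_gt0 r : c <= r -> 0 < r. Proof. exact: lt_le_trans. Qed.
Let C_ge0 : 0 <= C.
Proof. by have [||_ + _ _] := hve (w := 0) (r := c); rewrite ?lexx//; exact: le_trans. Qed.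
Let Cv_ge0 : 0 <= Cv.
Proof.
have [||+ _ _ _] := hve (w := 0) (r := c); rewrite ?lexx// => h.
by have := le_trans (normr_ge0 _) h; rewrite pmulr_lge0// invr_gt0.
Qed.

Let Cv_le r : c <= r -> Cv / r <= Cv / c.
Proof. by move=> cr; rewrite ler_wpM2l// lef_pV2 ?posrE// r_gt0. Qed.

Lemma rve_r_le w r : 0 <= w < th -> c <= r -> `|rve_r w r| <= Cv / c + C.
Proof.
move=> wI cr; have [h1 _ h3 _] := hve wI cr.
by apply: (le_trans (ler_normD _ _)); apply: lerD => //; exact: le_trans (Cv_le cr).
Qed.

Lemma u_e1_le w r : 0 < w < th -> c <= r -> `|u_e1 D ve w r| <= Mb + (Cv / c + C).
Proof.
move=> /andP[w0 wth] cr; rewrite u_e1E; apply: (le_trans (ler_normB _ _)).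
apply: lerD; first exact: (hMb cr).1.
have X0 : 0 <= Cv / c + C by rewrite addr_ge0// divr_ge0// ltW.
apply: (@le_trans _ _ ((Cv / c + C) * (w - 0))); last first.
  by rewrite subr0 ler_piMr// (le_trans (ltW wth)).
apply: segint_abs_le; first exact: ltW.
  by apply: cont_seg_pt => t _; apply: ptc_slice_w; exact: rve_r_ptc.
by move=> t /andP[t0 tw]; apply: rve_r_le; rewrite ?(ltW t0)// (lt_trans tw).
Qed.

(* The Euler equation expresses [r (r v_e)_rr + v_e,ww] through lower-order
   terms, so that no second derivative of [v_e] has to be estimated. *)
Lemma u_e1_y_le w r : 0 < w < th -> c < r ->
  `|r * u_e1_y w r| <= Mb + (4%:R * C + k0 * (Cv / c)).
Proof.
move=> /andP[w0 wth] cr; have cr' := ltW cr; have r0 := r_gt0 cr'.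
have k00 : 0 <= k0 by exact: le_trans (normr_ge0 _) (hka cr').
rewrite /u_e1_y mulrBr; apply: (le_trans (ler_normB _ _)); apply: lerD; first exact: (hMb cr').2.
pose q t := r * rve_rr t r + dw (dw ve) t r.
have c1 : cont_seg 0 w (rve_rr^~ r).
  by apply: cont_seg_pt => t _; apply: ptc_slice_w; exact: rve_rr_ptc.
have c1' : cont_seg 0 w (fun t => r * rve_rr t r).
  apply: cont_seg_pt => t _; apply: (@continuousM _ _ (fun=> r) (rve_rr^~ r)).
    exact: cvg_cst.
  by apply: ptc_slice_w; exact: rve_rr_ptc.
have c2 : cont_seg 0 w (fun t => dw (dw ve) t r).
  apply: cont_seg_pt => t _; apply: (@ptc_slice_w _ (dw (dw ve))).
  exact: Ck_ptc (Ck_dw (Ck_dw cve)).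
have c3 : cont_seg 0 w q.
  apply: cont_seg_pt => t _; apply: (@continuousD _ _ _ (fun t => r * rve_rr t r)).
    apply: (@continuousM _ _ (fun=> r) (rve_rr^~ r)); first exact: cvg_cst.
    by apply: ptc_slice_w; exact: rve_rr_ptc.
  by apply: (@ptc_slice_w _ (dw (dw ve))); exact: Ck_ptc (Ck_dw (Ck_dw cve)).
(* Integrated over the angle, the second angular derivative becomes a difference of first
   derivatives, which are already bounded. *)
have e1 : segint 0 w (fun t => dw (dw ve) t r) = dw ve w r - dw ve 0 r.
  apply: (segint_FTC w0 c2) => [|t _]; last exact: (@Ck_dvw _ _ _ t r (Ck_dw cve)).
  apply: cont_seg_pt => t _; apply: (@ptc_slice_w _ (dw ve)).
  exact: Ck_ptc (Ck_dw cve).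
have e2 : r * segint 0 w (rve_rr^~ r) = segint 0 w q - (dw ve w r - dw ve 0 r).
  by rewrite -e1 /q (segintD c1' c2) addrK segintZ.
have hq t : 0 < t < w -> `|q t| <= 2%:R * C + k0 * (Cv / c).
  move=> /andP[t0 tw]; have tI : 0 < t < th by rewrite t0 (lt_trans tw).
  have tI' : 0 <= t < th by rewrite ltW//= (lt_trans tw).
  have [h1 _ h3 h4] := hve tI' cr'.
  have eq := euler1_equation c_gt0 ue_gt0 hE tI cr.
  have -> : q t = - (r * dy ve t r) + kappa (u_e0 D) r * ve t r - r * euler_E D up th eps t r.
    by rewrite -eq /q /rve_rr; ring.
  have -> : 2%:R * C + k0 * (Cv / c) = C + k0 * (Cv / c) + C by ring.
  apply: (le_trans (ler_normB _ _)); apply: lerD => //.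
  apply: (le_trans (ler_normD _ _)); apply: lerD; first by rewrite normrN.
  by rewrite normrM; apply: ler_pM => //; [exact: hka|exact: le_trans (Cv_le cr')].
rewrite e2; have -> : 4%:R * C + k0 * (Cv / c) = (2%:R * C + k0 * (Cv / c)) + (C + C) by ring.
have i0 : 0 <= (0 : R) < th by rewrite lexx.
have iw : 0 <= w < th by rewrite ltW.
have [_ g1 _ _] := hve i0 cr'; have [_ g2 _ _] := hve iw cr'.
apply: (le_trans (ler_normB _ _)); apply: lerD; last first.
  by apply: (le_trans (ler_normB _ _)); apply: lerD.
have X0 : 0 <= 2%:R * C + k0 * (Cv / c).
  by rewrite addr_ge0 ?mulr_ge0// invr_ge0 ltW.
apply: (@le_trans _ _ ((2%:R * C + k0 * (Cv / c)) * (w - 0))); last first.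
  by rewrite subr0 ler_piMr// (le_trans (ltW wth)).
by apply: segint_abs_le => //; exact: ltW.
Qed.
End EulerTangential.

(** * The base flow compared with the inlet shear flow *)

Section ShearFlow.
Context {R : realType}.
Variables (D : profile_data R) (up ve : R -> R -> R) (th eps M : R).
Let c : R := Defs.R0 D.
Let s : R := Num.sqrt eps.
Let rr (y : R) : R := Defs.rad D eps y.
Implicit Types (w y : R).

Hypotheses (c_gt0 : 0 < c) (eps_gt0 : 0 < eps).
Hypotheses (sue : smooth1 (u_e0 D)) (sub1 : smooth1 (u_b1 D)) (sup : smooth2 up).
Hypothesis hM2 : forall k w y, (k < 7)%N -> c <= y -> y ^+ 2 * `|iter k dw up w y| <= M.
Hypothesis hE : euler1 D up th eps ve.

Let cve : Ck 2 ve. Proof. by have [] := hE. Qed.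
Let s_gt0 : 0 < s. Proof. by rewrite sqrtr_gt0. Qed.

Lemma rad_dv y : is_derive y 1 (fun y => Defs.rad D eps y) s.
Proof. by rewrite /Defs.rad -/s; eapply is_derive_eq; [dvs|ring]. Qed.

Lemma rad_gt0 y : c <= y -> 0 < Defs.rad D eps y.
Proof. by move=> cy; rewrite /Defs.rad ltr_wpDr// mulr_ge0 ?subr_ge0// ltW. Qed.

(** Closed formulas for the derivatives of the base flow, valid in the open strip; continuity is
    shown for them and then transferred. *)
Definition us_w w y : R := dw up w y + s * - rve_r ve w (rr y).
Definition us_y w y : R :=
  s * derive1 (u_e0 D) (rr y) + dy up w y + s * (s * u_e1_y D ve w (rr y)).
Definition vs_w w y : R := rv up 1 w y / rr y + dw ve w (rr y).
Definition vs_y w y : R := - (dw up w y / rr y) - s * rv up 0 w y / rr y ^+ 2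
  + s * dy ve w (rr y).

Lemma u_s_dw w y : 0 < w -> dw (u_s D up ve eps) w y = us_w w y.
Proof.
move=> w0; rewrite /dw; apply: (@dv_derive1 _ (fun t => u_s D up ve eps t y)).
have d1 : is_derive w 1 (fun t => up t y) (dw up w y) := smooth2_dvw w y sup.
have d2 : is_derive w 1 (fun t => u_e1 D ve t (Defs.rad D eps y)) _ :=
  u_e1_dw hE (Defs.rad D eps y) w0.
by rewrite /u_s -/s; eapply is_derive_eq; [dvs|rewrite /us_w; ring].
Qed.

Lemma u_s_dy w y : 0 < w -> dy (u_s D up ve eps) w y = us_y w y.
Proof.
move=> w0; rewrite /dy; apply: (@dv_derive1 _ (fun t => u_s D up ve eps w t)).
have d1 : is_derive y 1 (fun t => up w t) (dy up w y) := smooth2_dvy w y sup.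
have d2 : is_derive y 1 (fun t => u_e1 D ve w (Defs.rad D eps t)) _ :=
  @dv_comp _ (u_e1 D ve w) (fun t => Defs.rad D eps t) y _ _
    (u_e1_dy sub1 hE (Defs.rad D eps y) (ltW w0))
    (rad_dv y).
have d3 : is_derive y 1 (fun t => u_e0 D (Defs.rad D eps t)) _ :=
  @dv_comp _ (u_e0 D) (fun t => Defs.rad D eps t) y _ _
    (smooth1_dv 0 (Defs.rad D eps y) sue) (rad_dv y).
rewrite /u_s -/s; eapply is_derive_eq; first by dvs.
rewrite /us_y -/(rr y) (_ : derive1n 1 (u_e0 D) = derive1 (u_e0 D))//.
by move: (derive1 _ _) (dy up w y) (u_e1_y _ _ _ _) => *; ring.
Qed.

Lemma v_s_dw w y : c <= y -> dw (v_s D up ve eps) w y = vs_w w y.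
Proof.
move=> cy; rewrite /dw; apply: (@dv_derive1 _ (fun t => v_s D up ve eps t y)).
have d1 : is_derive w 1 (fun t => rvp up t y) (rv up 1 w y) :=
  rv_dw c_gt0 sup hM2 w (k := 0) isT cy.
have d2 : is_derive w 1 (fun t => ve t (Defs.rad D eps y)) (dw ve w (Defs.rad D eps y)).
  exact: (@Ck_dvw _ _ _ w _ cve).
exact: dvD (dvZr _ d1) d2.
Qed.

Lemma v_s_dy w y : c < y -> dy (v_s D up ve eps) w y = vs_y w y.
Proof.
move=> cy; have r0 := rad_gt0 (ltW cy).
rewrite /dy; apply: (@dv_derive1 _ (fun t => v_s D up ve eps w t)).
have d1 : is_derive y 1 (fun t => rvp up w t) (- dw up w y) :=
  rv_dy c_gt0 sup hM2 w (k := 0) isT cy.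
have d2 := rad_dv y.
have d3 : is_derive y 1 (fun t => ve w (Defs.rad D eps t)) _ :=
  @dv_comp _ (ve w) (fun t => Defs.rad D eps t) y _ _ (@Ck_dvy _ _ _ w (Defs.rad D eps y) cve) d2.
rewrite /v_s /v_p0; eapply is_derive_eq; first by dvs; rewrite gt_eqF.
rewrite /vs_y -/(rr y) (_ : rv up 0 w y = rvp up w y)//.
have {}r0 : rr y != 0 by rewrite gt_eqF.
by move: (rvp up w y) (dw up w y) (dy ve w (rr y)) (rr y) r0 => *; field.
Qed.

Lemma ptc_rad h w y : ptc h w (Defs.rad D eps y) -> ptc (fun w y => h w (Defs.rad D eps y)) w y.
Proof. by apply: ptc_comp_y; exact: dv_cont (rad_dv y). Qed.

Lemma shear_ptc w y : 0 < w -> c < y ->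
  [/\ [/\ ptc (u_s D up ve eps) w y, ptc us_w w y & ptc us_y w y],
      [/\ ptc (v_s D up ve eps) w y, ptc vs_w w y & ptc vs_y w y] &
      ptc (fun _ y => Defs.rad D eps y) w y].
Proof.
move=> w0 cy; have r0 := rad_gt0 (ltW cy).
have rn : Defs.rad D eps y != 0 by rewrite gt_eqF.
have pr : ptc (fun _ y => Defs.rad D eps y) w y.
  by apply: (@ptc_y _ (fun y => Defs.rad D eps y)); exact: dv_cont (rad_dv y).
have pu0 : ptc (fun _ y => u_e0 D (Defs.rad D eps y)) w y.
  apply: (@ptc_rad (fun _ r => u_e0 D r)); apply: (@ptc_y _ (u_e0 D)).
  exact: dv_cont (smooth1_dv 0 _ sue).
have pu1 : ptc (fun _ y => derive1 (u_e0 D) (Defs.rad D eps y)) w y.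
  apply: (@ptc_rad (fun _ r => derive1 (u_e0 D) r)); apply: (@ptc_y _ (derive1 (u_e0 D))).
  exact: dv_cont (smooth1_dv 1 _ sue).
have pup : ptc (fun w y => up w y) w y by exact: smooth2_ptc sup.
have pupw : ptc (fun w y => dw up w y) w y by exact: smooth2_ptc (smooth2_dw sup).
have pupy : ptc (fun w y => dy up w y) w y by exact: smooth2_ptc (smooth2_dy sup).
have pe : ptc (fun w y => u_e1 D ve w (Defs.rad D eps y)) w y.
  by apply: ptc_rad; exact: (@u_e1_ptc _ D up ve th eps).
have pey : ptc (fun w y => u_e1_y D ve w (Defs.rad D eps y)) w y.
  by apply: ptc_rad; exact: (@u_e1_y_ptc _ D up ve th eps).
have prv : ptc (fun w y => rve_r ve w (Defs.rad D eps y)) w y.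
  by apply: ptc_rad; exact: (@rve_r_ptc _ D up ve th eps).
have pve : ptc (fun w y => ve w (Defs.rad D eps y)) w y by apply: ptc_rad; exact: Ck_ptc cve.
have pvw : ptc (fun w y => dw ve w (Defs.rad D eps y)) w y.
  by apply: ptc_rad; exact: Ck_ptc (Ck_dw cve).
have pvy : ptc (fun w y => dy ve w (Defs.rad D eps y)) w y.
  by apply: ptc_rad; exact: Ck_ptc (Ck_dy cve).
have p0 : ptc (fun w y => rv up 0 w y) w y by apply: (rv_ptc c_gt0 sup hM2 (k := 0%N)).
have p0' : ptc (fun w y => rvp up w y) w y := p0.
have p1 : ptc (fun w y => rv up 1 w y) w y by apply: (rv_ptc c_gt0 sup hM2 (k := 1%N)).
split => //; split.
- by rewrite /u_s -/s; ptcs.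
- by rewrite /us_w /rr; ptcs.
- by rewrite /us_y /rr; ptcs.
- by rewrite /v_s /v_p0; ptcs.
- by rewrite /vs_w /rr; ptcs.
- by rewrite /vs_y /rr; ptcs; rewrite ?expf_neq0.
Qed.

Definition shear0 y : R := u_e0 D (rr y) + up 0 y.
Definition shear1 y : R := s * derive1 (u_e0 D) (rr y) + dy up 0 y.
Definition shear2 y : R := s ^+ 2 * derive1n 2 (u_e0 D) (rr y) + dy (dy up) 0 y.

Let due (n : nat) y :
  is_derive y 1 (fun y => derive1n n (u_e0 D) (rr y)) (derive1n n.+1 (u_e0 D) (rr y) * s).
Proof.
exact: (@dv_comp _ (derive1n n (u_e0 D)) rr y _ _ (smooth1_dv n (rr y) sue) (rad_dv y)).
Qed.

Lemma shear0_dv y : is_derive y 1 shear0 (shear1 y).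
Proof.
have d := due 0 y; have d2 : is_derive y 1 (fun y => up 0 y) _ := smooth2_dvy 0 y sup.
have d' : is_derive y 1 (fun y => u_e0 D (rr y)) _ := d.
by have := dvD d' d2; rewrite [_ * s]mulrC.
Qed.

Lemma shear1_dv y : is_derive y 1 shear1 (shear2 y).
Proof.
have d := dvM (dvC s y) (due 1 y).
have d2 : is_derive y 1 (fun y => dy up 0 y) _ := smooth2_dvy 0 y (smooth2_dy sup).
have := dvD d d2; rewrite mul0r add0r [_ * s]mulrC mulrA -expr2; exact.
Qed.

Lemma shear2_cont y : {for y, continuous shear2}.
Proof.
have d := dvM (dvC (s ^+ 2) y) (due 2 y).
have d2 : is_derive y 1 (fun y => dy (dy up) 0 y) _ :=
  smooth2_dvy 0 y (smooth2_dy (smooth2_dy sup)).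
exact: dv_cont (dvD d d2).
Qed.

Section Bounds.
Variables (k k0 Cv C Mb mm : R).
Hypotheses (th_gt0 : 0 < th) (th_le1 : th <= 1).
Hypothesis ue_gt0 : forall r, c <= r -> 0 < u_e0 D r.
Hypothesis hka : forall r, c <= r -> `|kappa (u_e0 D) r| <= k0.
Hypothesis hve : forall w r, 0 <= w < th -> c <= r ->
  [/\ `|ve w r| <= Cv / r, `|dw ve w r| <= C, `|r * dy ve w r| <= C &
      `|r * euler_E D up th eps w r| <= C].
Hypothesis hMb : forall r, c <= r -> `|u_b1 D r| <= Mb /\ `|r * derive1 (u_b1 D) r| <= Mb.
Hypothesis hMue : forall r, c <= r -> [/\ u_e0 D r <= Mb, `|r * derive1 (u_e0 D) r| <= Mb &
  `|r ^+ 2 * derive1n 2 (u_e0 D) r| <= Mb].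
Hypothesis hM : forall k l m w y, (k < 7)%N -> (l < 7)%N -> (m < 7)%N -> c <= y ->
  y ^+ m * `|iter k dw (iter l dy up) w y| <= M.
Hypothesis (M1 : 1 <= M).
Hypotheses (mm_gt0 : 0 < mm) (hmm : forall y, c <= y -> mm <= shear0 y).
Hypotheses (hk1 : Mb + M + 1 <= k) (hk2 : mm^-1 <= k) (hk3 : c^-1 <= k)
  (hk4 : M / c + Cv <= k) (hk5 : M + M / c / c + 1 <= k).
Hypotheses (s_th : s <= th) (hs1 : s * (Mb + (Cv / c + C)) <= th)
  (hs2 : s * (Mb + (4%:R * C + k0 * (Cv / c))) <= th).

Let Mb_ge0 : 0 <= Mb. Proof. exact: le_trans (normr_ge0 _) (hMb (lexx c)).1. Qed.
Let M_ge0 : 0 <= M. Proof. exact: le_trans ler01 M1. Qed.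
Let s_ge0 : 0 <= s. Proof. exact: ltW. Qed.
Let s_le1 : s <= 1. Proof. exact: le_trans s_th th_le1. Qed.
Let Cv_ge0 : 0 <= Cv.
Proof.
have [||+ _ _ _] := hve (w := 0) (r := c); rewrite ?lexx// => h.
by have := le_trans (normr_ge0 _) h; rewrite pmulr_lge0// invr_gt0.
Qed.

Let k_ge : [/\ 1 <= k, M + 1 <= k, Mb <= k & M <= k].
Proof.
have aux (x y z : R) : 0 <= x -> 0 <= y -> x + y + 1 <= z ->
  [/\ 1 <= z, y + 1 <= z, x <= z & y <= z] by move=> *; split; lra.
exact: aux Mb_ge0 M_ge0 hk1.
Qed.

(** Rapid decay of [up] gives the inverse-square rates, the chain rule with [r u_e0'] bounded gives
    [s / r]. Differences to the inlet gain [th] by the mean value theorem in [w], and the corrector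
    terms are at most [th] because [s] times their angle-dependent bounds is. *)
Lemma shear_profile_bounds w y : 0 < w < th -> c < y ->
  profile_bounds k th s (rr y) y (shear0 y) (shear1 y) (shear2 y)
    (u_s D up ve eps w y - shear0 y) (dy (u_s D up ve eps) w y - shear1 y)
    (dw (u_s D up ve eps) w y) (v_s D up ve eps w y) (dw (v_s D up ve eps) w y)
    (dy (v_s D up ve eps) w y).
Proof.
move=> wI cy; have /andP[w0 wth] := wI; have cy' := ltW cy.
have wI' : 0 <= w < th by rewrite ltW.
have [k1 kM kMb kM'] := k_ge; have k_ge0 : 0 <= k by exact: le_trans k1.
have y0 : 0 < y by exact: lt_trans cy.
have cr : c < rr y by rewrite /rr /Defs.rad -/s ltrDl mulr_gt0// subr_gt0.
have cr' := ltW cr; have r0 : 0 < rr y by exact: lt_trans cr.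
have ry : rr y <= y.
  rewrite /rr /Defs.rad -/s -lerBrDl -[X in _ <= X]mul1r ler_wpM2r//.
  by rewrite subr_ge0.
have ic : 0 < c^-1 by rewrite invr_gt0.
have rc : (rr y)^-1 <= c^-1 by rewrite lef_pV2 ?posrE.
have yc : y^-1 <= c^-1 by rewrite lef_pV2 ?posrE.
pose L := (y ^+ 2)^-1 + s / rr y.
have y2 : 0 <= (y ^+ 2)^-1 by rewrite invr_ge0 sqr_ge0.
have sr : 0 <= s / rr y by rewrite divr_ge0// ltW.
have up_le a b m t : (a < 7)%N -> (b < 7)%N -> (m < 7)%N ->
    `|iter a dw (iter b dy up) t y| <= M / y ^+ m.
  by move=> a7 b7 m7; apply: ge_pos_poly => //; exact: hM.
have [ue1 ue2 ue3] := hMue cr'.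
have e1 := u_e1_le c_gt0 th_gt0 th_le1 hE hve hMb wI cr'.
have e2 := u_e1_y_le c_gt0 th_gt0 th_le1 ue_gt0 hka hE hve hMb wI cr.
have e3 := rve_r_le c_gt0 th_gt0 hve wI' cr'.
have [v1 v2 v3 _] := hve wI' cr'.
have rv0 : `|rv up 0 w y| <= M / c.
  by apply: (le_trans (rv_le c_gt0 sup hM2 w (k := 0) isT cy')); rewrite ler_wpM2l.
have rv1 : `|rv up 1 w y| <= M / c.
  by apply: (le_trans (rv_le c_gt0 sup hM2 w (k := 1) isT cy')); rewrite ler_wpM2l.
have sE1 : s * `|u_e1 D ve w (rr y)| <= th by apply: le_trans hs1; rewrite ler_wpM2l.
have sC : s * C <= 1.
  apply: (le_trans _ th_le1); apply: le_trans hs1; rewrite ler_wpM2l//.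
  by rewrite addrA lerDr addr_ge0// divr_ge0// ltW.
have sX : s * (Cv / c + C) <= 1.
  apply: (le_trans _ th_le1); apply: le_trans hs1; rewrite ler_wpM2l//.
  by rewrite lerDr.
have U0 : 0 < shear0 y by exact: lt_le_trans (hmm cy').
have div_r (x a : R) : `|rr y * x| <= a -> `|x| <= a / rr y.
  by rewrite normrM gtr0_norm// ler_pdivlMr// mulrC.
have s_ue1 : `|s * derive1 (u_e0 D) (rr y)| <= Mb * (s / rr y).
  rewrite normrM (gtr0_norm s_gt0) mulrCA.
  by rewrite ler_wpM2l//; exact: div_r.
split => //; first by split => //; exact: le_trans hk3.
split.
- split => //.
  + apply: le_trans hk1; apply: (@le_trans _ _ (Mb + M)); last by rewrite lerDl.
    apply: lerD => //; apply: (le_trans (ler_norm _)).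
    by have := @up_le 0%N 0%N 0%N 0 isT isT isT; rewrite expr0 divr1.
  + by apply: le_trans hk2; rewrite lef_pV2 ?posrE// hmm.
- split.
    rewrite /shear1 mulrDr addrC; apply: (le_trans (ler_normD _ _)); apply: lerD.
      apply: (le_trans (@up_le 0%N 1%N 2%N 0 isT isT isT)).
      by rewrite ler_wpM2r.
    by apply: (le_trans s_ue1); rewrite ler_wpM2r.
  rewrite /shear2 mulrDr mulrDr addrC; apply: (le_trans (ler_normD _ _)); apply: lerD.
    rewrite normrM gtr0_norm//.
    apply: (@le_trans _ _ (y * (M / y ^+ 3))).
      apply: ler_pM => //; first exact: ltW.
      exact: (@up_le 0%N 2%N 3%N 0 isT isT isT).
    have -> : y * (M / y ^+ 3) = M * (y ^+ 2)^-1 by field; rewrite gt_eqF.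
    by rewrite ler_wpM2r.
  have -> : rr y * (s ^+ 2 * derive1n 2 (u_e0 D) (rr y)) =
    (s / rr y) * s * (rr y ^+ 2 * derive1n 2 (u_e0 D) (rr y)) by field; rewrite gt_eqF.
  have ss : 0 <= s / rr y * s by exact: mulr_ge0.
  rewrite normrM (ger0_norm ss) [X in X <= _]mulrC; apply: ler_pM => //.
    exact: le_trans kMb.
  by rewrite ler_piMr.
- split.
    have -> : u_s D up ve eps w y - shear0 y = (up w y - up 0 y) + s * u_e1 D ve w (rr y).
      by rewrite /u_s /shear0 -/s -/(rr y); ring.
    apply: (@le_trans _ _ ((M + 1) * th)); last by rewrite ler_wpM2r// ltW.
    rewrite mulrDl mul1r; apply: (le_trans (ler_normD _ _)); apply: lerD; last first.
      by rewrite normrM (gtr0_norm s_gt0).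
    have := @dv_lipT _ (up^~ y) (fun t => dw up t y) M w 0 (fun t => smooth2_dvw t y sup) _.
    rewrite subr0 (gtr0_norm w0) => lip; apply: (le_trans (lip _)) => [t|].
      by have := @up_le 1%N 0%N 0%N t isT isT isT; rewrite expr0 divr1.
    by rewrite ler_wpM2l// ltW.
  have -> : dy (u_s D up ve eps) w y - shear1 y =
      (dy up w y - dy up 0 y) + s * (s * u_e1_y D ve w (rr y)).
    by rewrite u_s_dy// /us_y /shear1; ring.
  apply: (@le_trans _ _ ((M + 1) * (th * L))); last first.
    by rewrite ler_wpM2r// mulr_ge0 ?(ltW th_gt0)// addr_ge0.
  apply: (@le_trans _ _ (M * (th * (y ^+ 2)^-1) + th * (s / rr y))); last first.
    rewrite -subr_ge0 /L.
    have -> : (M + 1) * (th * ((y ^+ 2)^-1 + s / rr y)) -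
      (M * (th / y ^+ 2) + th * (s / rr y)) = M * (th * (s / rr y)) + th * (y ^+ 2)^-1 by ring.
    by rewrite addr_ge0// mulr_ge0 ?(ltW th_gt0)// mulr_ge0// ltW.
  apply: (le_trans (ler_normD _ _)); apply: lerD; last first.
    rewrite !normrM (gtr0_norm s_gt0).
    have h := div_r _ _ e2.
    apply: (@le_trans _ _ (s * (s * ((Mb + (4%:R * C + k0 * (Cv / c))) / rr y)))).
      by rewrite !ler_wpM2l.
    have -> : s * (s * ((Mb + (4 * C + k0 * (Cv / c))) / rr y)) =
      (s * (Mb + (4 * C + k0 * (Cv / c)))) * (s / rr y) by ring.
    by rewrite ler_wpM2r.
  have := @dv_lipT _ ((dy up)^~ y) (fun t => dw (dy up) t y) (M / y ^+ 2) w 0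
    (fun t => smooth2_dvw t y (smooth2_dy sup)) _.
  rewrite subr0 (gtr0_norm w0) => lip; apply: (le_trans (lip _)) => [t|].
    exact: (@up_le 1%N 1%N 2%N t isT isT isT).
  have -> : M * (th / y ^+ 2) = M / y ^+ 2 * th by ring.
  by rewrite ler_wpM2l ?mulr_ge0// ltW.
- split.
  + rewrite u_s_dw// /us_w; apply: le_trans kM; apply: (le_trans (ler_normD _ _)).
    apply: lerD; first by have := @up_le 1%N 0%N 0%N w isT isT isT; rewrite expr0 divr1.
    rewrite normrM normrN (gtr0_norm s_gt0); apply: le_trans sX.
    by rewrite ler_wpM2l.
  + have -> : rr y * v_s D up ve eps w y = rv up 0 w y + rr y * ve w (rr y).
      rewrite /v_s /v_p0 -/(rr y) (_ : rv up 0 w y = rvp up w y)//.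
      by field; rewrite gt_eqF.
    apply: le_trans hk4; apply: (le_trans (ler_normD _ _)); apply: lerD; first exact: rv0.
    by rewrite normrM gtr0_norm// mulrC -ler_pdivlMr.
  + rewrite v_s_dw// /vs_w mulrDr; apply: (le_trans (ler_normD _ _)).
    apply: (@le_trans _ _ (M / c / c + 1)); last first.
      by apply: le_trans hk5; rewrite lerD2r lerDr.
    apply: lerD; rewrite normrM (gtr0_norm s_gt0).
      rewrite -[X in _ <= X]mul1r; apply: ler_pM => //.
      rewrite normrM normfV (gtr0_norm r0).
      by apply: ler_pM; [exact: normr_ge0|rewrite invr_ge0 ltW|exact: rv1|exact: rc].
    by apply: le_trans sC; rewrite ler_wpM2l.
  + rewrite v_s_dy// /vs_y.
    have -> : rr y * (- (dw up w y / rr y) - s * rv up 0 w y / rr y ^+ 2 + s * dy ve w (rr y)) =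
      - dw up w y - s * (rv up 0 w y / rr y) + s * (rr y * dy ve w (rr y)).
      by field; rewrite gt_eqF.
    apply: le_trans hk5; apply: (le_trans (ler_normD _ _)); apply: lerD.
      apply: (le_trans (ler_normB _ _)); apply: lerD.
        by rewrite normrN; have := @up_le 1%N 0%N 0%N w isT isT isT; rewrite expr0 divr1.
      rewrite normrM (gtr0_norm s_gt0) -[X in _ <= X]mul1r; apply: ler_pM => //.
      rewrite normrM normfV (gtr0_norm r0).
      by apply: ler_pM; [exact: normr_ge0|rewrite invr_ge0 ltW|exact: rv0|exact: rc].
    rewrite normrM (gtr0_norm s_gt0); apply: le_trans sC.
    by rewrite ler_wpM2l.
Qed.
End Bounds.
End ShearFlow.

(** * The linearized system *)

Section LinearizedSystem.
Context {R : realType}.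
Variables (D : profile_data R) (th eps delta : R) (us vs u v P f g : R -> R -> R).
Let c : R := Defs.R0 D.
Let s : R := Num.sqrt eps.
Let r (y : R) : R := Defs.rad D eps y.
Implicit Types (w y : R).

Hypotheses (c_gt0 : 0 < c) (eps_gt0 : 0 < eps).

Let s_gt0 : 0 < s. Proof. by rewrite sqrtr_gt0. Qed.
Let s2 : s ^+ 2 = eps. Proof. by rewrite sqr_sqrtr// ltW. Qed.
Let r_gt0 y : c <= y -> 0 < r y. Proof. exact: rad_gt0. Qed.

Lemma divergence_eq0 w y : c <= y -> divergence D eps u v w y = 0 ->
  dw u w y + (r y * dy v w y + s * v w y) = 0.
Proof.
move=> cy; have r0 : r y != 0 by rewrite gt_eqF// r_gt0.
rewrite /divergence -/(r y) -/s => h.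
have -> : dw u w y + (r y * dy v w y + s * v w y) =
  r y * ((r y)^-1 * dw u w y + s / r y * v w y + dy v w y) by field.
by rewrite h mulr0.
Qed.

(** The density of the energy identity has [u_w] eliminated by incompressibility and the base flow
    split as [U] plus a deviation; here it is identified with the given equation. *)
Lemma momentum_wE w y (U U1 : R) : dw u w y + (r y * dy v w y + s * v w y) = 0 ->
  dens_f (r y) s U U1 (us w y - U) (dy us w y - U1) (dw us w y)
    (vs w y) (u w y) (dy u w y) (dy (dy u) w y) (dw (dw u) w y) (v w y) (dw v w y)
    (dy v w y) (dw P w y) = momentum_w D us vs eps u v P w y.
Proof.
move=> h; rewrite /momentum_w /dens_f -/(r y) -/s -s2.
have -> : dw u w y = - (r y * dy v w y + s * v w y) by apply/eqP; rewrite -addr_eq0 h.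
move: (us w y) (dy us w y) (dw us w y) (vs w y) (u w y) (dy u w y) (dy (dy u) w y)
  (dw (dw u) w y) (v w y) (dw v w y) (dy v w y) (dw P w y) (r y) s.
by move=> *; ring.
Qed.

Lemma momentum_rE w y (U : R) : dw u w y + (r y * dy v w y + s * v w y) = 0 ->
  dens_g (r y) s U (us w y - U) (vs w y) (dw vs w y) (dy vs w y) (u w y) (v w y) (dw v w y)
    (dy v w y) (dy (dy v) w y) (dw (dw v) w y) (dy P w y) =
  momentum_r D us vs eps u v P w y.
Proof.
move=> h; rewrite /momentum_r /dens_g -/(r y) -/s -s2.
have -> : dw u w y = - (r y * dy v w y + s * v w y) by apply/eqP; rewrite -addr_eq0 h.
move: (us w y) (vs w y) (dw vs w y) (dy vs w y) (u w y) (v w y) (dw v w y)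
  (dy v w y) (dy (dy v) w y) (dw (dw v) w y) (dy P w y) (r y) s.
by move=> *; ring.
Qed.

End LinearizedSystem.

(** * The norms rewritten as integrals of the energy densities *)

Section WeightedNorms.
Context {R : realType}.
Variables (D : profile_data R) (th eps delta : R).
Let c : R := Defs.R0 D.
Let s : R := Num.sqrt eps.
Let r (y : R) : R := Defs.rad D eps y.
Let rho (y : R) : R := r y `^ delta.
Implicit Types (w y : R) (u v P f g : R -> R -> R).

Hypotheses (c_gt0 : 0 < c) (eps_gt0 : 0 < eps).

Let s_gt0 : 0 < s. Proof. by rewrite sqrtr_gt0. Qed.
Let s2 : s ^+ 2 = eps. Proof. by rewrite sqr_sqrtr// ltW. Qed.
Let r_gt0 y : c <= y -> 0 < r y. Proof. exact: rad_gt0. Qed.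
Let rho_ge0 y : 0 <= rho y. Proof. exact: powR_ge0. Qed.

Lemma powR_rad_ptc (a : R) w y : c <= y -> ptc (fun _ y => Defs.rad D eps y `^ a) w y.
Proof.
move=> cy; apply: (@ptc_y _ (fun y => Defs.rad D eps y `^ a)).
have d := @dv_comp _ (fun x => x `^ a) (fun y => Defs.rad D eps y) y _ _
  (is_derive1_powR a (r_gt0 cy)) (rad_dv D eps y).
exact: (dv_cont d).
Qed.

Let rad_pow (a : R) y : c <= y -> r y `^ (a + delta) = r y `^ a * rho y.
Proof. by move=> cy; rewrite powRD// (gt_eqF (r_gt0 cy)) implybT. Qed.

Lemma normB2E v : Ck 2 v -> normB2 D th eps delta v = stripint 0 th c (fun w y =>
  rho y * ((r y * dy v w y + s * v w y) ^+ 2 + (s * dw v w y) ^+ 2 + (s * v w y) ^+ 2)).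
Proof.
move=> cv; rewrite /normB2 /iint /stripint -/c.
congr (integral _ _ _); apply/funext => w; congr (integral _ _ _); apply/funext => y.
congr (_%:E); have -> : dy (fun w' y' => Defs.rad D eps y' * v w' y') w y =
    r y * dy v w y + s * v w y.
  rewrite {1}/dy; apply: (@dv_derive1 _ (fun t => Defs.rad D eps t * v w t)).
  have d1 := rad_dv D eps y; have d2 : is_derive y 1 (fun t => v w t) _ := @Ck_dvy _ _ _ w y cv.
  by rewrite -/s in d1; eapply is_derive_eq; [dvs|rewrite /r; ring].
by rewrite -/(r y) -/(rho y) -{1 2}s2; ring.
Qed.

(** As [r >= R0], one factor [r] of the weight can be given up at the cost of [R0^-1]. *)
Lemma normA2_ge u : Ck 2 u ->
  (stripint 0 th c (fun w y => (rho y * dy u w y ^+ 2)%R) <= c^-1%:E * normA2 D th eps delta u)%E.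
Proof.
move=> cu.
have pt w y : c < y -> [/\ ptc (fun w y => dy u w y) w y, ptc (fun w y => dw u w y) w y,
    ptc (fun w y => u w y) w y & ptc (fun _ y => rho y) w y].
  move=> cy; split; [exact: Ck_ptc (Ck_dy cu)|exact: Ck_ptc (Ck_dw cu)|exact: Ck_ptc cu|].
  exact: powR_rad_ptc (ltW cy).
pose N w y : R := dy u w y ^+ 2 * Defs.rad D eps y `^ (1 + delta)
    + eps * dw u w y ^+ 2 * Defs.rad D eps y `^ (- 1 + delta)
    + eps * u w y ^+ 2 * Defs.rad D eps y `^ (- 1 + delta).
have cN : cont_strip 0 th c N.
  move=> w y _ cy; have [p1 p2 p3 p4] := pt w y cy.
  have p5 := @powR_rad_ptc (1 + delta) w y (ltW cy).
  have p6 := @powR_rad_ptc (- 1 + delta) w y (ltW cy).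
  have h : ptc N w y by rewrite /N; ptcs.
  exact: h.
have t0 (x a y : R) : 0 <= eps * x ^+ 2 * Defs.rad D eps y `^ a.
  by rewrite mulr_ge0 ?powR_ge0// mulr_ge0 ?sqr_ge0// ltW.
have N0 w y : 0 < w < th -> c < y -> 0 <= N w y.
  by move=> _ cy; rewrite /N !addr_ge0// mulr_ge0 ?powR_ge0 ?sqr_ge0.
have c1 : cont_strip 0 th c (fun w y => c^-1 * N w y).
  by move=> w y wI cy; apply: (@ptcM _ (fun _ _ => c^-1) N); [exact: ptcC|exact: cN].
have cI : 0 <= c^-1 by rewrite invr_ge0 ltW.
have c2 : cont_strip 0 th c (fun w y => rho y * dy u w y ^+ 2).
  move=> w y wI cy; have [p1 p2 p3 p4] := pt w y cy.
  have h : ptc (fun w y => rho y * dy u w y ^+ 2) w y by ptcs.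
  exact: h.
have := stripintZ cN cI N0; rewrite -[X in _ = (_ * X)%E]/(normA2 D th eps delta u) => <-.
apply: stripint_le => // w y wI cy; apply/andP; split; first by rewrite mulr_ge0 ?sqr_ge0.
have cr : c <= r y by rewrite /r /Defs.rad lerDl mulr_ge0 ?sqrtr_ge0// subr_ge0 ltW.
apply: (@le_trans _ _ (c^-1 * (dy u w y ^+ 2 * r y `^ (1 + delta)))).
  rewrite (rad_pow _ (ltW cy)) powRr1 ?(ltW (r_gt0 (ltW cy)))//.
  have -> : c^-1 * (dy u w y ^+ 2 * (r y * rho y)) = (c^-1 * r y) * (rho y * dy u w y ^+ 2) by ring.
  apply: ler_peMl; last by rewrite ler_pdivlMl// mulr1.
  by apply: mulr_ge0; [exact: rho_ge0|exact: sqr_ge0].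
rewrite ler_wpM2l// /N -addrA lerDl.
by rewrite addr_ge0.
Qed.

Lemma normP2E P : normL2 D th eps delta P = stripint 0 th c (fun w y => rho y * P w y ^+ 2).
Proof.
rewrite /normL2 /iint /stripint -/c.
congr (integral _ _ _); apply/funext => w; congr (integral _ _ _); apply/funext => y.
by rewrite mulrC.
Qed.

Lemma norm_fg_ge f g : cont_strip 0 th c f -> cont_strip 0 th c g ->
  (stripint 0 th c (fun w y => (rho y * ((r y * f w y) ^+ 2 + (s * r y * g w y) ^+ 2))%R) <=
   normL2 D th eps (2 + delta) f + eps%:E * normL2 D th eps (2 + delta) g)%E.
Proof.
move=> cf cg.
pose N (f : R -> R -> R) w y : R := f w y ^+ 2 * Defs.rad D eps y `^ (2 + delta).
have cN h : cont_strip 0 th c h -> cont_strip 0 th c (N h).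
  move=> ch w y wI cy; have p1 : ptc (fun w y => h w y) w y by exact: ch.
  have p5 := @powR_rad_ptc (2 + delta) w y (ltW cy).
  have hh : ptc (N h) w y by rewrite /N; ptcs.
  exact: hh.
have N0 h w y : 0 < w < th -> c < y -> 0 <= N h w y.
  by move=> _ cy; rewrite /N mulr_ge0 ?powR_ge0 ?sqr_ge0.
have e0 : 0 <= eps by exact: ltW.
have cNg : cont_strip 0 th c (fun w y => eps * N g w y).
  by move=> w y wI cy; apply: (@ptcM _ (fun _ _ => eps) (N g)); [exact: ptcC|exact: cN].
have Ng0 w y : 0 < w < th -> c < y -> 0 <= eps * N g w y.
  by move=> wI cy; rewrite mulr_ge0// N0.
have -> : (normL2 D th eps (2 + delta) f + eps%:E * normL2 D th eps (2 + delta) g =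
    stripint 0 th c (fun w y => (N f w y + eps * N g w y)%R))%E.
  by rewrite (stripintD (cN f cf) cNg (N0 f) Ng0) (stripintZ (cN g cg) e0 (N0 g)).
have E w y : c < y -> rho y * ((r y * f w y) ^+ 2 + (s * r y * g w y) ^+ 2) =
    N f w y + eps * N g w y.
  move=> cy; rewrite /N -/(r y) (rad_pow _ (ltW cy)).
  have -> : r y `^ 2 = r y ^+ 2 by rewrite -powR_mulrn// ltW// r_gt0// ltW.
  by rewrite -s2; ring.
have cD : cont_strip 0 th c (fun w y => N f w y + eps * N g w y).
  by move=> w y wI cy; apply: (@ptcD _ (N f) (fun w y => eps * N g w y)); [exact: cN|exact: cNg].
apply: stripint_le => //.
  move=> w y wI cy; have p1 : ptc (fun w y => f w y) w y by exact: cf.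
  have p2 : ptc (fun w y => g w y) w y by exact: cg.
  have p3 : ptc (fun _ y => rho y) w y by exact: powR_rad_ptc (ltW cy).
  have p4 : ptc (fun _ y => r y) w y.
    by apply: (@ptc_y _ r); exact: dv_cont (rad_dv D eps y).
  have h : ptc (fun w y => rho y * ((r y * f w y) ^+ 2 + (s * r y * g w y) ^+ 2)) w y by ptcs.
  exact: h.
by move=> w y wI cy; rewrite E// lexx andbT addr_ge0// ?N0// Ng0.
Qed.

Lemma outflow_traceE u : outflow_trace D th eps delta u =
  (\int[lebesgue_measure]_(y in `]c, +oo[) (rho y * (s ^+ 2 * dw u th y ^+ 2 / r y))%R%:E)%E.
Proof.
rewrite /outflow_trace -/c; apply: eq_integral => y; rewrite inE/= in_itv/= andbT => cy.
congr (_%:E); rewrite -/(r y) addrC rad_pow ?(ltW cy)//.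
have -> : r y `^ (- 1) = (r y)^-1 by rewrite powR_inv1// ltW// r_gt0// ltW.
by rewrite s2; ring.
Qed.
End WeightedNorms.

Lemma estimate_factors_ge0 {R : realType} (K : R) : 0 <= K ->
  0 <= 2%:R * (12%:R * k_diss K ^+ 2 * (K ^+ 2 + 25%:R * K ^+ 4)) /\ 0 <= K / k_diss K.
Proof.
move=> K0.
have kd0 : 0 <= k_diss K by rewrite /k_diss addr_ge0// mulr_ge0// exprn_ge0.
split; last exact: divr_ge0.
rewrite mulr_ge0// mulr_ge0//; first by rewrite mulr_ge0// exprn_ge0.
by rewrite addr_ge0 ?exprn_ge0// mulr_ge0// exprn_ge0.
Qed.

Lemma bigK_ge0 {R : realType} (k : R) : 1 <= k -> 0 <= bigK k.
Proof. by move=> k1; rewrite /bigK mulr_ge0// exprn_ge0// (le_trans ler01). Qed.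

Lemma final_sum {R : realType} (F q d a b p x z : R) : 0 <= F -> 0 <= q -> 0 <= d ->
  0 <= a -> 0 <= b -> 0 <= p -> 0 <= x -> 0 <= z ->
  F * (d * a + (x + z)) + q * (F * (d * a + (x + z))) <=
  F * (1 + q) * (d + 1) * (a + b + p + x + z).
Proof.
move=> F0 q0 d0 a0 b0 p0 x0 z0.
have -> : F * (d * a + (x + z)) + q * (F * (d * a + (x + z))) =
  F * (1 + q) * (d * a + (x + z)) by ring.
rewrite -[X in _ <= X]mulrA; apply: ler_wpM2l; first by rewrite mulr_ge0 ?addr_ge0.
have -> : (d + 1) * (a + b + p + x + z) = d * a + (x + z) +
  (a + b + p + d * b + d * p + d * x + d * z) by ring.
by rewrite lerDl !addr_ge0 ?mulr_ge0.
Qed.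

Lemma ge0_EFin {R : realType} (x : \bar R) : (0 <= x)%E -> (x < +oo)%E ->
  exists a : R, x = a%:E.
Proof. by case: x => // a _ _; exists a. Qed.

(** * Assembly of the estimate for the linearized system *)

Section LinearizedEstimate.
Context {R : realType}.
Variables (D : profile_data R) (th eps delta k : R) (U U1 U2 : R -> R).
Variables (us vs u v P f g : R -> R -> R).
Let c : R := Defs.R0 D.
Let s : R := Num.sqrt eps.
Implicit Types (w y : R).

Hypotheses (c_gt0 : 0 < c) (eps_gt0 : 0 < eps) (th_gt0 : 0 < th) (k_ge1 : 1 <= k).
Hypothesis hdelta : 0 <= delta <= 1.
Hypothesis dU : forall y, is_derive y 1 U (U1 y).
Hypothesis dU1 : forall y, is_derive y 1 U1 (U2 y).
Hypothesis cU2 : forall y, {for y, continuous U2}.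
Hypothesis U_gt0 : forall y, c <= y -> 0 < U y.
Hypothesis hprof : forall w y, 0 < w < th -> c < y ->
  profile_bounds k th s (Defs.rad D eps y) y (U y) (U1 y) (U2 y) (us w y - U y)
    (dy us w y - U1 y) (dw us w y) (vs w y) (dw vs w y) (dy vs w y).
Hypothesis hth : th <= th_max (bigK k).
Hypothesis cus : cont_strip 0 th c us.
Hypothesis cusw : cont_strip 0 th c (dw us).
Hypothesis cusy : cont_strip 0 th c (dy us).
Hypothesis cvs : cont_strip 0 th c vs.
Hypothesis cvsw : cont_strip 0 th c (dw vs).
Hypothesis cvsy : cont_strip 0 th c (dy vs).
Hypothesis lin : linearized D us vs th eps u v P f g.
Hypothesis fin : finite_norms D th eps delta u v P f g.

(** The second line adds the trace bound to the bound on the strip, through [1 + K / k_diss K], and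
    accounts for the loss of [normA2_ge], through [c^-1 + 1]. *)
Definition estimate_const (k c : R) : R :=
  2%:R * (12%:R * k_diss (bigK k) ^+ 2 * (bigK k ^+ 2 + 25%:R * bigK k ^+ 4)) *
  (1 + bigK k / k_diss (bigK k)) * (c^-1 + 1).

Let s_gt0 : 0 < s. Proof. by rewrite sqrtr_gt0. Qed.
Let s2 : s ^+ 2 = eps. Proof. by rewrite sqr_sqrtr// ltW. Qed.

(** Continuity at a point of the open strip depends on nearby values only, so equality inside
    suffices, whatever happens at the boundary. *)
Lemma cont_strip_eq (h h' : R -> R -> R) :
  (forall w y, 0 < w < th -> c < y -> h' w y = h w y) ->
  (forall w y, 0 < w < th -> c < y -> ptc h w y) -> cont_strip 0 th c h'.
Proof.
move=> E ch w y wI cy; have {}ch := ch w y wI cy.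
have nE : \forall z \near (w, y), h z.1 z.2 = h' z.1 z.2.
  have n1 : \forall z \near (w, y), 0 < (z.1 : R) < th.
    have p : (fst : R * R -> R) @ (w, y) --> w by exact: cvg_fst.
    by apply: (p [set x | 0 < x < th]); apply: (near_in_itvoo (a := 0) (b := th)); rewrite in_itv.
  have n2 : \forall z \near (w, y), c < (z.2 : R).
    have p : (snd : R * R -> R) @ (w, y) --> y by exact: cvg_snd.
    by apply: (p [set x | c < x]); exact: lt_nbhsr.
  by apply: filterS2 n1 n2 => z z1 z2; rewrite E.
have c1 : (fun z : R * R => h z.1 z.2) @ (w, y) --> h w y by exact: ch.
have : (fun z : R * R => h' z.1 z.2) @ (w, y) --> h' w y.
  by rewrite (E w y wI cy); exact: (cvg_trans (near_eq_cvg nE) c1).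
exact.
Qed.

Let cvu : [/\ Ck 2 u, Ck 2 v & Ck 1 P]. Proof. by have [] := lin. Qed.

Let fields_ptc w y : 0 < w < th -> c < y ->
  [/\ [/\ ptc (fun w y => u w y) w y, ptc (fun w y => dw u w y) w y,
        ptc (fun w y => dy u w y) w y, ptc (fun w y => dw (dw u) w y) w y &
        ptc (fun w y => dy (dy u) w y) w y],
      [/\ ptc (fun w y => v w y) w y, ptc (fun w y => dw v w y) w y,
        ptc (fun w y => dy v w y) w y, ptc (fun w y => dw (dw v) w y) w y &
        ptc (fun w y => dy (dy v) w y) w y],
      ptc (fun w y => dw P w y) w y, ptc (fun w y => dy P w y) w y &
      ptc (fun _ y => Defs.rad D eps y) w y] /\
  [/\ ptc (fun w y => us w y) w y, ptc (fun w y => dw us w y) w y &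
      ptc (fun w y => dy us w y) w y] /\
  [/\ ptc (fun w y => vs w y) w y, ptc (fun w y => dw vs w y) w y &
      ptc (fun w y => dy vs w y) w y].
Proof.
move=> wI cy; have [cu cv cP] := cvu.
split; last by split; split; [exact: cus|exact: cusw|exact: cusy|
  exact: cvs|exact: cvsw|exact: cvsy].
split.
- split; [exact: Ck_ptc cu|exact: Ck_ptc (Ck_dw cu)|exact: Ck_ptc (Ck_dy cu)| |].
    exact: Ck_ptc (Ck_dw (Ck_dw cu)).
  exact: Ck_ptc (Ck_dy (Ck_dy cu)).
- split; [exact: Ck_ptc cv|exact: Ck_ptc (Ck_dw cv)|exact: Ck_ptc (Ck_dy cv)| |].
    exact: Ck_ptc (Ck_dw (Ck_dw cv)).
  exact: Ck_ptc (Ck_dy (Ck_dy cv)).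
- exact: Ck_ptc (Ck_dw cP).
- exact: Ck_ptc (Ck_dy cP).
- by apply: (@ptc_y _ (fun y => Defs.rad D eps y)); exact: dv_cont (rad_dv D eps y).
Qed.

(** The sources are given no regularity of their own; the continuity that makes their integrals
    tractable is read off from the equations. *)
Let cf : cont_strip 0 th c f.
Proof.
have [_ _ mom _ _] := lin.
apply: (@cont_strip_eq (fun w y => momentum_w D us vs eps u v P w y)) => w y wI cy.
  by have [] := mom w y wI cy.
have r0 : Defs.rad D eps y != 0 by rewrite gt_eqF// rad_gt0// ltW.
have [[[? ? ? ? ?] [? ? ? ? ?] ? ? ?] [[? ? ?] [? ? ?]]] := fields_ptc wI cy.
by rewrite /momentum_w /=; ptcs; rewrite ?expf_neq0.
Qed.

Let cg : cont_strip 0 th c g.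
Proof.
have [_ _ mom _ _] := lin.
apply: (@cont_strip_eq (fun w y => momentum_r D us vs eps u v P w y)) => w y wI cy.
  by have [] := mom w y wI cy.
have r0 : Defs.rad D eps y != 0 by rewrite gt_eqF// rad_gt0// ltW.
have [[[? ? ? ? ?] [? ? ? ? ?] ? ? ?] [[? ? ?] [? ? ?]]] := fields_ptc wI cy.
by rewrite /momentum_r /=; ptcs; rewrite ?expf_neq0.
Qed.

Lemma linearized_estimate :
  (normB2 D th eps delta v + outflow_trace D th eps delta u
   <= (estimate_const k c)%:E * (normA2 D th eps delta u
                + (th + Num.sqrt eps)%:E * normB2 D th eps delta v
                + ((1 - delta) ^+ 2)%:E * normL2 D th eps delta P
                + normL2 D th eps (2 + delta) f
                + eps%:E * normL2 D th eps (2 + delta) g))%E.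
Proof.
have [cu cv cP] := cvu.
have [_ _ mom [bc0 bcR] bcth] := lin.
have [finA finB finP finf fing] := fin.
have div w y : 0 < w < th -> c < y ->
    dw u w y + (Defs.rad D eps y * dy v w y + s * v w y) = 0.
  move=> wI cy; have [_ _ h] := mom w y wI cy.
  exact: (divergence_eq0 c_gt0 (ltW cy) h).
have hmw w y : 0 < w < th -> c < y -> _ := fun wI cy =>
  etrans (momentum_wE us vs P eps_gt0 (U y) (U1 y) (div w y wI cy))
    (let: And3 h _ _ := mom w y wI cy in h).
have hmr w y : 0 < w < th -> c < y -> _ := fun wI cy =>
  etrans (momentum_rE us vs P eps_gt0 (U y) (div w y wI cy))
    (let: And3 _ h _ := mom w y wI cy in h).
have hbcth y : c <= y -> s ^+ 2 * dw v th y + Defs.rad D eps y * dy u th y = 0 /\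
    P th y * Defs.rad D eps y = 2%:R * s ^+ 2 * dw u th y.
  by move=> cy; have [h1 h2] := bcth y cy; rewrite s2.
have est := energy_estimate c_gt0 s_gt0 th_gt0 hdelta (fun y _ => dU y) (fun y _ => dU1 y)
  (fun y _ => @cU2 y) U_gt0 hprof hth cu cv cP hmw hmr div bc0 bcR hbcth cf cg.
pose rho (y : R) : R := Defs.rad D eps y `^ delta.
have nn (h : R -> R -> R) (a : R) : (0 <= normL2 D th eps a h)%E.
  by apply: stripint_ge0 => w y _ _; rewrite mulr_ge0 ?sqr_ge0 ?powR_ge0.
have e0 : 0 <= eps by exact: ltW.
have A0 : (0 <= normA2 D th eps delta u)%E.
  apply: stripint_ge0 => w y _ _.
  by rewrite !addr_ge0// mulr_ge0 ?powR_ge0 ?sqr_ge0// mulr_ge0 ?sqr_ge0.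
have B0 : (0 <= normB2 D th eps delta v)%E.
  apply: stripint_ge0 => w y _ _.
  by rewrite !addr_ge0// mulr_ge0 ?powR_ge0 ?sqr_ge0// mulr_ge0 ?sqr_ge0.
have T0 : (0 <= outflow_trace D th eps delta u)%E.
  apply: integral_ge0 => y _; rewrite lee_fin.
  by rewrite mulr_ge0 ?powR_ge0// mulr_ge0 ?sqr_ge0.
have [a aE] := ge0_EFin A0 finA.
have [b bE] := ge0_EFin B0 finB.
have [p pE] := ge0_EFin (nn P delta) finP.
have [x xE] := ge0_EFin (nn f (2 + delta)) finf.
have [z zE] := ge0_EFin (nn g (2 + delta)) fing.
have hA := normA2_ge th delta c_gt0 eps_gt0 cu; rewrite aE -EFinM in hA.
have hM := norm_fg_ge delta c_gt0 eps_gt0 cf cg; rewrite xE zE -EFinM -EFinD in hM.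
have hBE := normB2E D th delta eps_gt0 cv.
have hPE := normP2E D th eps delta P.
(* Finite bound for the density that multiplies the cutoff parameter; its value does not appear in
   the resulting estimate. *)
have hC1 : (stripint 0 th c (fun w y => (rho y * (P w y ^+ 2 + dy u w y ^+ 2)
   + rho y * ((Defs.rad D eps y * dy v w y + s * v w y) ^+ 2 + (s * dw v w y) ^+ 2
     + (s * v w y) ^+ 2))%R) <= (p + c^-1 * a + b)%:E)%E.
  have rp w y : c < y -> ptc (fun _ y => rho y) w y.
    by move=> cy; exact: powR_rad_ptc (ltW cy).
  have c1 : cont_strip 0 th c (fun w y => rho y * P w y ^+ 2).
    move=> w y _ cy; have p1 := rp w y cy.
    have p2 : ptc (fun w y => P w y) w y by exact: Ck_ptc cP.
    have h : ptc (fun w y => rho y * P w y ^+ 2) w y by ptcs.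
    exact: h.
  have c2 : cont_strip 0 th c (fun w y => rho y * dy u w y ^+ 2).
    move=> w y _ cy; have p1 := rp w y cy.
    have p2 : ptc (fun w y => dy u w y) w y by exact: Ck_ptc (Ck_dy cu).
    have h : ptc (fun w y => rho y * dy u w y ^+ 2) w y by ptcs.
    exact: h.
  have c3 : cont_strip 0 th c (fun w y => rho y * ((Defs.rad D eps y * dy v w y + s * v w y) ^+ 2
      + (s * dw v w y) ^+ 2 + (s * v w y) ^+ 2)).
    move=> w y wI cy; have p1 := rp w y cy.
    have [[_ [? ? ? _ _] _ _ ?] _] := fields_ptc wI cy.
    have h : ptc (fun w y => rho y * ((Defs.rad D eps y * dy v w y + s * v w y) ^+ 2
      + (s * dw v w y) ^+ 2 + (s * v w y) ^+ 2)) w y by ptcs.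
    exact: h.
  have g1 w y : 0 < w < th -> c < y -> 0 <= rho y * P w y ^+ 2.
    by move=> _ _; rewrite mulr_ge0 ?powR_ge0 ?sqr_ge0.
  have g2 w y : 0 < w < th -> c < y -> 0 <= rho y * dy u w y ^+ 2.
    by move=> _ _; rewrite mulr_ge0 ?powR_ge0 ?sqr_ge0.
  have g3 w y : 0 < w < th -> c < y -> 0 <= rho y * ((Defs.rad D eps y * dy v w y + s * v w y) ^+ 2
      + (s * dw v w y) ^+ 2 + (s * v w y) ^+ 2).
    by move=> _ _; rewrite mulr_ge0 ?powR_ge0// !addr_ge0 ?sqr_ge0.
  have c12 : cont_strip 0 th c (fun w y => rho y * P w y ^+ 2 + rho y * dy u w y ^+ 2).
    move=> w y wI cy.
    apply: (@ptcD _ (fun w y => rho y * P w y ^+ 2) (fun w y => rho y * dy u w y ^+ 2)).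
      exact: c1.
    exact: c2.
  have g12 w y : 0 < w < th -> c < y -> 0 <= rho y * P w y ^+ 2 + rho y * dy u w y ^+ 2.
    by move=> wI cy; rewrite addr_ge0 ?g1 ?g2.
  have := stripintD c12 c3 g12 g3; rewrite (stripintD c1 c2 g1 g2) -hPE -hBE pE bE => E.
  apply: (@le_trans _ _ (p%:E + (c^-1 * a)%:E + b%:E)%E); last by rewrite -!EFinD.
  have -> : (fun w y => rho y * (P w y ^+ 2 + dy u w y ^+ 2)
    + rho y * ((Defs.rad D eps y * dy v w y + s * v w y) ^+ 2 + (s * dw v w y) ^+ 2
     + (s * v w y) ^+ 2)) = (fun w y => rho y * P w y ^+ 2 + rho y * dy u w y ^+ 2
    + rho y * ((Defs.rad D eps y * dy v w y + s * v w y) ^+ 2 + (s * dw v w y) ^+ 2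
     + (s * v w y) ^+ 2)).
    by apply/funext => w; apply/funext => y; rewrite mulrDr.
  by rewrite E; apply: leeD (lexx _); exact: leeD (lexx _) hA.
have [eB eT] := est _ _ _ hA hC1 hM.
rewrite -hBE bE in eB.
have hTE := outflow_traceE th delta c_gt0 eps_gt0 u.
rewrite -hTE in eT.
(* Finiteness of the trace is itself a consequence of the estimate. *)
have [t tE] := ge0_EFin T0 (le_lt_trans eT (ltry _)).
rewrite aE bE pE xE zE tE -!EFinM -!EFinD lee_fin.
rewrite aE lee_fin in A0; rewrite bE lee_fin in B0.
have := nn P delta; rewrite pE lee_fin => p0.
have := nn f (2 + delta); rewrite xE lee_fin => x0.
have := nn g (2 + delta); rewrite zE lee_fin => z0.
rewrite lee_fin in eB; rewrite tE lee_fin in eT.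
rewrite -/s /estimate_const.
have [F0 q0] := @estimate_factors_ge0 _ (bigK k) (bigK_ge0 k_ge1).
set F := 2%:R * (12%:R * _ * _) in eB eT F0 *; set q := bigK k / _ in eT q0 *.
have ci : 0 <= c^-1 by rewrite invr_ge0 ltW.
have sb := mulr_ge0 (addr_ge0 (ltW th_gt0) (ltW s_gt0)) B0.
have dp := mulr_ge0 (sqr_ge0 (1 - delta)) p0.
have ez := mulr_ge0 e0 z0.
exact: le_trans (lerD eB eT) (final_sum F0 q0 ci A0 sb dp x0 ez).
Qed.
End LinearizedEstimate.

(** * Constants of the outer flow and positivity of the shear flow *)

Section OuterConstants.
Context {R : realType}.
Variables (D : profile_data R) (Theta : R) (up : R -> R -> R).
Hypotheses (hD : outer_data D) (hup : prandtl0 D Theta up).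
Let c : R := Defs.R0 D.
Implicit Types (r y : R).

(** [f + M / t] is nonincreasing, since its derivative is [f' - M / t^2]. *)
Lemma inv_sq_decay_le (f f' : R -> R) (M r : R) : 0 < c ->
  (forall t, c <= t -> is_derive t 1 f (f' t)) ->
  (forall t, c <= t -> t ^+ 2 * `|f' t| <= M) -> c <= r -> f r <= f c + M / c.
Proof.
move=> c0 df fM cr.
have M0 : 0 <= M by apply: le_trans (fM c (lexx _)); rewrite mulr_ge0// sqr_ge0.
have t0 (t : R) : c <= t -> 0 < t by exact: lt_le_trans.
have dF (t : R) : c <= t -> is_derive t 1 (fun t => f t + M / t) (f' t - M / t ^+ 2).
  move=> ct; have d := df t ct; have d' : is_derive t 1 (fun t => f t) _ := d.
  eapply is_derive_eq; first by dvs; rewrite gt_eqF// t0.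
  by field; rewrite gt_eqF// t0.
pose F (t : R) := f t + M / t.
have h1 (t : R) : t \in `]c, r[%R -> is_derive t 1 F (f' t - M / t ^+ 2).
  by rewrite in_itv/= => /andP[/ltW ct _]; exact: dF.
have h2 : {within `[c, r], continuous F}.
  apply: continuous_in_subspaceT => t /set_mem /=; rewrite in_itv/= => /andP[ct _].
  exact: dv_cont (dF t ct).
have [x] := MVT_segment cr h1 h2.
rewrite /F in_itv/= => /andP[cx _] E.
have h : f r + M / r - (f c + M / c) <= 0.
  rewrite E mulr_le0_ge0 ?subr_ge0// subr_le0.
  by apply: (le_trans (ler_norm _)); apply: ge_pos_poly; [exact: t0|exact: fM].
have Mr : 0 <= M / r by rewrite divr_ge0// ltW// t0.
by move: h Mr; move: (f r) (M / r) (f c + M / c) => x1 x2 x3 *; lra.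
Qed.

Lemma outer_bounds : exists Mb, [/\ 1 <= Mb,
  forall r, c <= r -> `|u_b1 D r| <= Mb /\ `|r * derive1 (u_b1 D) r| <= Mb,
  forall r, c <= r -> [/\ u_e0 D r <= Mb, `|r * derive1 (u_e0 D) r| <= Mb &
    `|r ^+ 2 * derive1n 2 (u_e0 D) r| <= Mb] &
  forall r, c <= r -> `|derive1 (u_e0 D) r| <= Mb].
Proof.
have [[c0 _ sue _ due] [_ _ [_ dub1] _]] := hD.
have [N1 [N11 hN1]] := exp_decay_bounds c0 dub1 3.
have [N2 [N21 hN2]] := exp_decay_bounds (h := fun n => derive1n n.+1 (u_e0 D)) c0
  (fun n => due n.+1 isT) 4.
pose Mb := Num.max N1 (Num.max N2 (`|u_e0 D c| + N2 / c)).
have [m1 m2 m3] : [/\ N1 <= Mb, N2 <= Mb & `|u_e0 D c| + N2 / c <= Mb].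
  by rewrite /Mb; split; rewrite !le_max lexx ?orbT.
exists Mb; split; first exact: le_trans m1.
- move=> r cr; have r0 : 0 <= r by exact: le_trans (ltW c0) cr.
  split; apply: le_trans m1.
    by have := hN1 0%N 0%N r isT isT cr; rewrite expr0 mul1r.
  by have := hN1 1%N 1%N r isT isT cr; rewrite expr1 normrM (ger0_norm r0).
- move=> r cr; have r0 : 0 <= r by exact: le_trans (ltW c0) cr.
  split.
  + apply: le_trans m3; apply: (@le_trans _ _ (u_e0 D c + N2 / c)).
      apply: (@inv_sq_decay_le _ (derive1 (u_e0 D))) => // t ct.
        exact: (smooth1_dv 0 t sue).
      exact: (hN2 0%N 2%N t isT isT ct).
    by rewrite lerD2r ler_norm.
  + apply: le_trans m2.
    by have := hN2 0%N 1%N r isT isT cr; rewrite expr1 normrM (ger0_norm r0).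
  + apply: le_trans m2.
    by have := hN2 1%N 2%N r isT isT cr; rewrite normrM ger0_norm ?exprn_ge0.
- move=> r cr; apply: le_trans m2.
  by have := hN2 0%N 0%N r isT isT cr; rewrite expr0 mul1r.
Qed.

(* Where [up 0] is not small one has [y] bounded and [u_e0] is close to [u_e];
   elsewhere the lower bound on [u_e0] suffices. *)
Lemma shear0_lower : exists q A : R, [/\ 0 < q, 0 < A &
  forall eps, Num.sqrt eps * A <= 1 -> forall y, c <= y -> q <= shear0 D up eps y].
Proof.
have aux1 (x1 x2 x3 x4 x5 : R) : x4 <= x2 + x1 -> - (x5 / 2%:R) <= x3 - x2 ->
  x5 <= x4 -> x5 / 2%:R <= x3 + x1 by move=> *; lra.
have aux2 (x1 x3 x4 x5 : R) : x4 <= x3 -> - (x5 / 2%:R) <= x1 -> x5 <= x4 ->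
  x5 / 2%:R <= x3 + x1 by move=> *; lra.
have [[c0 _ sue [m0 m00 hm0] _] [_ [m1 m10 hm1] _ _]] := hD.
have [_ _ _ _ up0] := hup.
have [Mb [Mb1 _ _ hMb]] := outer_bounds.
have [M [M1 hM]] := prandtl0_bounds hup.
pose q := Num.min m0 m1.
have q0 : 0 < q by rewrite lt_min m00.
have qm0 : q <= m0 by rewrite /q ge_min lexx.
have qm1 : q <= m1 by rewrite /q ge_min lexx orbT.
have M0 : 0 < M by exact: lt_le_trans M1.
have Mb0 : 0 < Mb by exact: lt_le_trans Mb1.
(* If [Mb s y > q / 2] then [M / y < 2 M Mb s / q], and the condition on [s A] makes this at most
   [q / 2]. *)
exists (q / 2%:R), (4%:R * M * Mb / q ^+ 2); split.
- by rewrite divr_gt0.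
- by rewrite divr_gt0 ?exprn_gt0// !mulr_gt0.
move=> eps hs y cy; set s := Num.sqrt eps in hs *.
have s0 : 0 <= s by exact: sqrtr_ge0.
have y0 : 0 < y by exact: lt_le_trans cy.
have cr : c <= Defs.rad D eps y by rewrite /Defs.rad -/s -/c lerDl mulr_ge0// subr_ge0.
have h1 : `|u_e0 D (Defs.rad D eps y) - u_e0 D c| <= Mb * (s * y).
  apply: (@le_trans _ _ (Mb * (Defs.rad D eps y - c))).
    apply: (dv_lip cr (f' := derive1 (u_e0 D))) => t /andP[ct _]; last exact: hMb.
    exact: (smooth1_dv 0 t sue).
  rewrite ler_wpM2l ?(ltW Mb0)// /Defs.rad -/s -/c addrC addKr ler_wpM2l// gerBl.
  exact: ltW.
have h2 : `|up 0 y| <= M / y.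
  apply: (ge_pos_poly (n := 1) y0).
  exact: (hM 0%N 0%N 1%N 0 y isT isT isT cy).
have h3 : m1 <= u_e0 D c + up 0 y by rewrite (up0 y cy); exact: hm1.
have h4 := hm0 _ cr.
rewrite /shear0; set e := u_e0 D (Defs.rad D eps y) in h1 h4 *.
have [small|large] := leP (Mb * (s * y)) (q / 2%:R).
  have := le_trans h1 small; rewrite ler_norml => /andP[h5 _].
  exact: aux1 h3 h5 qm1.
have h5 : M / y <= q / 2%:R.
  rewrite ler_pdivrMr//.
  have a1 : q ^+ 2 / (4%:R * M) * M = q / 2%:R * (q / 2%:R).
    by field; rewrite gt_eqF.
  have a2 : s * Mb <= q ^+ 2 / (4%:R * M).
    rewrite ler_pdivlMr ?mulr_gt0//.
    move: hs; rewrite mulrA ler_pdivrMr ?exprn_gt0// mul1r => hs.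
    by apply: le_trans hs; rewrite le_eqVlt; apply/orP; left; apply/eqP; ring.
  have a3 : q / 2%:R * (q / 2%:R) < (q / 2%:R * y) * (s * Mb).
    have -> : q / 2%:R * y * (s * Mb) = q / 2%:R * (Mb * (s * y)) by ring.
    by rewrite ltr_pM2l// divr_gt0.
  have q20 : 0 <= q / 2%:R * y by rewrite mulr_ge0 ?(ltW y0)// divr_ge0// ltW.
  have a4 := lt_le_trans a3 (ler_wpM2l q20 a2).
  rewrite -a1 [X in X < _]mulrC ltr_pM2r in a4; last first.
    by rewrite divr_gt0 ?exprn_gt0// mulr_gt0.
  exact: ltW.
have := le_trans h2 h5; rewrite ler_norml => /andP[h6 _].
exact: aux2 h4 h6 qm0.
Qed.
End OuterConstants.

Lemma estimate_const_gt0 {R : realType} (k c : R) : 1 <= k -> 0 < c -> 0 < estimate_const k c.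
Proof.
move=> k1 c0; have K1 : 1 <= bigK k by have := @bigK_ge _ 1 0 k k1 isT isT; rewrite mul1r.
have K0 : 0 < bigK k by exact: lt_le_trans K1.
have d0 : 0 < k_diss (bigK k) by apply: lt_le_trans (k_diss_gt0 K1).
rewrite /estimate_const; apply: mulr_gt0; last by rewrite addr_gt0// invr_gt0.
apply: mulr_gt0; last by rewrite addr_gt0// divr_gt0.
by rewrite !mulr_gt0 ?exprn_gt0// addr_gt0// ?exprn_gt0// mulr_gt0// exprn_gt0.
Qed.

Lemma le_sum5 {R : realType} (x1 x2 x3 x4 x5 : R) :
  1 <= x1 -> 0 <= x2 -> 0 <= x3 -> 0 <= x4 -> 0 <= x5 ->
  exists2 k, 1 <= k & [/\ x1 <= k, x2 <= k, x3 <= k, x4 <= k & x5 <= k].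
Proof.
by move=> *; exists (x1 + x2 + x3 + x4 + x5); first lra; split; lra.
Qed.

Theorem theorem1p13 (R : realType) (D : profile_data R) (Theta : R)
    (up : R -> R -> R) (hD : outer_data D) (hTheta : 0 < Theta)
    (hup : prandtl0 D Theta up) (hV : lateral_data D Theta up) :
  exists C thetamax : R, [/\ 0 < C, 0 < thetamax, thetamax <= Theta &
  forall theta0 : R, 0 < theta0 -> theta0 < thetamax ->
  exists2 epsmax : R, 0 < epsmax &
  forall eps : R, 0 < eps -> eps <= 1 -> eps < epsmax ->
  forall ve : R -> R -> R, euler1 D up theta0 eps ve ->
  forall u v P f g : R -> R -> R,
    linearized D (u_s D up ve eps) (v_s D up ve eps) theta0 eps u v P f g ->
  forall delta : R, 0 <= delta <= 1 ->
    finite_norms D theta0 eps delta u v P f g ->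
    (normB2 D theta0 eps delta v + outflow_trace D theta0 eps delta u
     <= C%:E * (normA2 D theta0 eps delta u
                + (theta0 + Num.sqrt eps)%:E * normB2 D theta0 eps delta v
                + ((1 - delta) ^+ 2)%:E * normL2 D theta0 eps delta P
                + normL2 D theta0 eps (2 + delta) f
                + eps%:E * normL2 D theta0 eps (2 + delta) g))%E].
Proof.
have [M [M1 hM]] := prandtl0_bounds hup.
have [k0 [Cv [t1 [k01 t10 t1T t11 [hka heul]]]]] := euler1_bounds hD hTheta hup hV.
have [Mb [Mb1 hub hue _]] := outer_bounds hD.
have [q [A [q0 A0 hq]]] := shear0_lower hD hup.
have [[c0 _ sue [m0 m00 hm0] _] [_ _ [sub1 _] _]] := hD.
have [sup _ _ _ _] := hup.
pose c := Defs.R0 D; rewrite -/c in c0 hm0.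
have M0 : 0 <= M by exact: le_trans ler01 M1.
have Mb0 : 0 <= Mb by exact: le_trans ler01 Mb1.
have Mc0 : 0 <= M / c by rewrite divr_ge0// ltW.
(* [k], and with it the constant of the theorem, is fixed before the angle: it involves the uniform
   [Cv] but not the angle-dependent [Ce] introduced below. *)
have [||||| k k1 [hk1 hk2 hk3 hk4 hk5]] :=
  @le_sum5 _ (Mb + M + 1) q^-1 c^-1 (M / c + `|Cv|) (M + M / c / c + 1).
- by rewrite lerDr addr_ge0.
- by rewrite invr_ge0 ltW.
- by rewrite invr_ge0 ltW.
- by rewrite addr_ge0.
- by rewrite !addr_ge0// !divr_ge0// ltW.
have hk4' : M / c + Cv <= k by apply: le_trans hk4; rewrite lerD2l ler_norm.
have K1 : 1 <= bigK k by have := @bigK_ge _ 1 0 k k1 isT isT; rewrite mul1r.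
exists (estimate_const k c), (Num.min t1 (th_max (bigK k))); split.
- exact: estimate_const_gt0.
- by rewrite lt_min t10 th_max_gt0.
- by rewrite ge_min t1T.
move=> th th0; rewrite lt_min => /andP[tht1 thmax].
have th1 : th <= 1 by apply: le_trans t11; exact: ltW.
have [Ce hCe] := heul th th0 tht1.
(* A common majorant of the two coefficients of [s] in [hs1] and [hs2]; absolute values spare the
   signs of [Cv] and [Ce]. *)
pose Z := 1 + Mb + 4%:R * `|Ce| + (1 + k0) * (`|Cv| / c).
have k00 : 0 <= k0 by exact: le_trans ler01 k01.
have Vc0 : 0 <= `|Cv| / c by rewrite divr_ge0// ltW.
have Z0 : 0 < Z.
  have a1 : 0 <= 4%:R * `|Ce| by rewrite mulr_ge0.
  have a2 : 0 <= (1 + k0) * (`|Cv| / c) by rewrite mulr_ge0// addr_ge0.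
  by rewrite /Z ltr_wpDr// ltr_wpDr// ltr_wpDr.
have auxZ (a b e x m n y : R) : a <= b -> 0 <= b -> x <= n -> 0 <= n -> 0 <= e ->
    m + (a + x) <= 1 + m + 4%:R * n + (1 + e) * b /\
    (y <= e * b -> m + (4%:R * x + y) <= 1 + m + 4%:R * n + (1 + e) * b).
  move=> ab b0 xn n0 e0; have eb := mulr_ge0 e0 b0.
  have -> : (1 + e) * b = b + e * b by rewrite mulrDl mul1r.
  by move: (e * b) eb => z z0; split=> *; lra.
have CvV : Cv / c <= `|Cv| / c by rewrite ler_wpM2r ?ler_norm// invr_ge0 ltW.
have [Z1 Z2'] := auxZ _ _ _ _ Mb _ (k0 * (Cv / c)) CvV Vc0 (ler_norm Ce) (normr_ge0 Ce) k00.
have Z2 := Z2' (ler_wpM2l k00 CvV).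
(* Three requirements on [sqrt eps]: at most [th], at most [th] after multiplication by the
   corrector bounds [Z], and small enough for the lower bound on the shear flow. *)
pose smax := Num.min th (Num.min (th / Z) A^-1).
have smax0 : 0 < smax by rewrite !lt_min th0 divr_gt0//= invr_gt0.
exists (smax ^+ 2); first exact: exprn_gt0.
move=> eps eps0 eps1 epsm ve hE u v P f g lin delta hdelta fin.
pose s := Num.sqrt eps.
have s0 : 0 <= s by exact: sqrtr_ge0.
have sm : s < smax.
  rewrite -(@ltr_pXn2r _ 2)// ?nnegrE//; last exact: ltW.
  by rewrite sqr_sqrtr// ltW.
have [s_th sZ sA] : [/\ s <= th, s * Z <= th & s * A <= 1].
  move: sm; rewrite !lt_min => /and3P[a1 a2 a3]; split; first exact: ltW.
    by rewrite -ler_pdivlMr// ltW.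
  by rewrite -ler_pdivlMr// mul1r ltW.
have hs1 : s * (Mb + (Cv / c + Ce)) <= th by apply: le_trans sZ; exact: ler_wpM2l.
have hs2 : s * (Mb + (4%:R * Ce + k0 * (Cv / c))) <= th.
  by apply: le_trans sZ; exact: ler_wpM2l.
have hM2 (j : nat) (w y : R) : (j < 7)%N -> c <= y -> y ^+ 2 * `|iter j dw up w y| <= M.
  by move=> j7 cy; exact: (hM j 0%N 2%N w y j7 isT isT cy).
have ue0 r : c <= r -> 0 < u_e0 D r by move=> cr; exact: lt_le_trans m00 (hm0 r cr).
have hprof := @shear_profile_bounds _ D up ve th eps M c0 eps0 sue sub1 sup hM2 hE k k0 Cv Ce Mb q
  th0 th1 ue0 hka (hCe eps ve eps0 eps1 hE) hub hue hM M1 q0 (hq eps sA)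
  hk1 hk2 hk3 hk4' hk5 s_th hs1 hs2.
have hptc := @shear_ptc _ D up ve th eps M c0 sue sub1 sup hM2 hE.
have ceq := @cont_strip_eq _ D th.
have U0 y : c <= y -> 0 < shear0 D up eps y by move=> cy; exact: lt_le_trans q0 (hq eps sA y cy).
apply: (@linearized_estimate _ D th eps delta k (shear0 D up eps) (shear1 D up eps)
  (shear2 D up eps) (u_s D up ve eps) (v_s D up ve eps) u v P f g c0 eps0 th0 k1 hdelta
  (shear0_dv eps sue sup) (shear1_dv eps sue sup) (@shear2_cont _ D up eps sue sup)
  U0 hprof (ltW thmax) _ _ _ _ _ _ lin fin).
- apply: (ceq (u_s D up ve eps)) => // w y /andP[w0 _] cy.
  by have [[]] := hptc w y w0 cy.
- apply: (ceq (us_w D up ve eps)) => w y /andP[w0 _] cy; first exact: (u_s_dw sup hE).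
  by have [[]] := hptc w y w0 cy.
- apply: (ceq (us_y D up ve eps)) => w y /andP[w0 _] cy; first exact: (u_s_dy sue sub1 sup hE).
  by have [[]] := hptc w y w0 cy.
- apply: (ceq (v_s D up ve eps)) => // w y /andP[w0 _] cy.
  by have [_ []] := hptc w y w0 cy.
- apply: (ceq (vs_w D up ve eps)) => w y /andP[w0 _] cy.
    exact: (v_s_dw c0 sup hM2 hE _ (ltW cy)).
  by have [_ []] := hptc w y w0 cy.
- apply: (ceq (vs_y D up ve eps)) => w y /andP[w0 _] cy.
    exact: (v_s_dy c0 sup hM2 hE _ cy).
  by have [_ []] := hptc w y w0 cy.
Qed.
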